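(* Let $\mathcal U$ be a compact $d$-dimensional Riemannian manifold. Let $H^r(\mathcal U)$ denote the Sobolev space of real-valued functions on $\mathcal U$ whose first $r$ weak derivatives are in $L^2(\mathcal U)$, and assume $2r>d$. Then $H^r(\mathcal U)$ is a reproducing kernel Hilbert space, and the eigenvalues $\tau_1\ge\tau_2\ge\cdots$ of its reproducing kernel satisfy $\tau_k\asymp k^{-2r/d}$.
   Context: Manifolds are second countable and Hausdorff, and every point has a neighbourhood homeomorphic to an open subset of $\mathbb R^d$ (so there is no boundary). $L^2(\mathcal U)$ is taken with respect to the Riemannian volume measure. $H^r(\mathcal U)$ carries its usual Sobolev Hilbert space structure; each element is identified with the unique continuous representative of its equivalence class. The eigenvalues of a kernel $K$ are the eigenvalues (in non-increasing order, with multiplicity) of the integral operator $f\mapsto\int_{\mathcal U}K(\cdot,s)f(s)\,ds$ on $L^2(\mathcal U)$. The notation $a_k\asymp b_k$ means that $a_k/b_k$ is bounded above and bounded below away from $0$ for all large $k$. *)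

(* Defs.v *)
From HB Require Import structures.
From mathcomp Require Import all_boot all_order all_algebra.
From mathcomp Require Import all_classical all_reals all_analysis.
Import Order.TTheory GRing.Theory Num.Theory.
Import numFieldNormedType.Exports.

Set Implicit Arguments.
Unset Strict Implicit.
Unset Printing Implicit Defensive.

Local Open Scope classical_set_scope.
Local Open Scope ring_scope.

Notation borel T := (g_sigma_algebraType (@open T)).

Section EuclideanSpace.
Context {R : realType}.

(* Built by slicing along the first coordinate, exactly as [product_measure1];
   on Borel sets it is the d-fold product of [lebesgue_measure]. Outside the
   Borel sets the value is meaningless and never used. *)
Fixpoint lebesgue_rV (d : nat) : set (borel 'rV[R]_d) -> \bar R :=
  match d with
  | 0 => fun A => \d_(0 : borel 'rV[R]_0) A
  | d'.+1 => fun A => (\int[@lebesgue_measure R]_t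
      lebesgue_rV [set x : 'rV[R]_d' | A (row_mx (const_mx t : 'rV[R]_1) x)])%E
  end.

Variable d : nat.
Implicit Types (V : set 'rV[R]_d) (f u w psi : 'rV[R]_d -> R).

Definition partial (i : 'I_d) f : 'rV[R]_d -> R :=
  fun x => 'D_(delta_mx 0 i) f x.

(* C^infty on the open set V: all iterated partial derivatives exist and are
   continuous at every point of V. *)
Definition smooth_on V f : Prop :=
  forall (s : seq 'I_d) (x : 'rV[R]_d), V x ->
    {for x, continuous (foldr partial f s)} /\
    (forall i, derivable (foldr partial f s) x (delta_mx 0 i)).

Definition test_function V psi : Prop :=
  smooth_on setT psi /\
  exists C : set 'rV[R]_d,
    [/\ compact C, C `<=` V & forall x, ~ C x -> psi x = 0].

Definition locally_integrable_on V f : Prop :=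
  forall C : set 'rV[R]_d, compact C -> C `<=` V ->
    (@lebesgue_rV d).-integrable C (EFin \o f).

Definition weak_partial V (k : 'I_d) u w : Prop :=
  [/\ locally_integrable_on V u, locally_integrable_on V w &
    forall psi, test_function V psi ->
      fine (\int[@lebesgue_rV d]_(x in V) (u x * partial k psi x)%:E)%E =
      - fine (\int[@lebesgue_rV d]_(x in V) (w x * psi x)%:E)%E].

End EuclideanSpace.

Section RiemannianManifold.
Variables (R : realType) (U : ptopologicalType) (d : nat).

(* [cinv] is only meaningful on the open set [cmap @` cdom]. *)
Record chart := Chart {
  cdom : set U;
  cmap : U -> 'rV[R]_d;
  cinv : 'rV[R]_d -> U;
  cdom_open : open cdom;
  ccod_open : open (cmap @` cdom);
  cmapK : forall p, cdom p -> cinv (cmap p) = p;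
  cmap_continuous : forall p, cdom p -> {for p, continuous cmap};
  cinv_continuous : forall x, (cmap @` cdom) x -> {for x, continuous cinv}
}.

Definition ccod (c : chart) : set 'rV[R]_d := cmap c @` cdom c.

Definition transition (c1 c2 : chart) (x : 'rV[R]_d) : 'rV[R]_d :=
  cmap c2 (cinv c1 x).

(* [metric c x] is the Gram matrix of the coordinate vector fields of c at the
   point of coordinates x. With the library's convention for row vectors,
   [jacobian f x i j] is the i-th partial derivative of the j-th component
   of f. *)
Record riemannian_manifold := RiemannianManifold {
  manifold_hausdorff : hausdorff_space U;
  manifold_second_countable : @second_countable U;
  atlas : set chart;
  atlas_cover : forall p : U, exists2 c, atlas c & cdom c p;
  atlas_smooth : forall c1 c2, atlas c1 -> atlas c2 -> forall j,
    smooth_on (cmap c1 @` (cdom c1 `&` cdom c2))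
              (fun x => transition c1 c2 x 0 j);
  metric : chart -> 'rV[R]_d -> 'M[R]_d;
  metric_smooth : forall c, atlas c -> forall i j,
    smooth_on (ccod c) (fun x => metric c x i j);
  metric_sym : forall c x, atlas c -> ccod c x ->
    (metric c x)^T = metric c x;
  metric_posdef : forall c x, atlas c -> ccod c x ->
    forall v : 'rV[R]_d, v != 0 -> 0 < (v *m metric c x *m v^T) 0 0;
  metric_change : forall c1 c2, atlas c1 -> atlas c2 ->
    forall p, cdom c1 p -> cdom c2 p ->
    let J := jacobian (transition c1 c2) (cmap c1 p) in
    metric c1 (cmap c1 p) = J *m metric c2 (cmap c2 p) *m J^T
}.

Variable M : riemannian_manifold.

(* As U is second countable, this determines vol on all Borel sets. *)
Definition is_riemannian_volume (vol : set (borel U) -> \bar R) : Prop :=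
  forall c, atlas M c -> forall A : set (borel U),
    measurable A -> A `<=` cdom c ->
    vol A = (\int[@lebesgue_rV R d]_(x in cmap c @` A)
               (Num.sqrt (\det (metric M c x)))%:E)%E.

Definition chart_at (p : U) : chart := s2val (cid2 (atlas_cover M p)).

(* The component of index l of the Levi-Civita derivative of the i-th
   coordinate vector field along the k-th one, in the chart c. *)
Definition christoffel (c : chart) (k i l : 'I_d) (x : 'rV[R]_d) : R :=
  2^-1 * \sum_(m < d) invmx (metric M c x) l m *
    (partial k (fun y => metric M c y m i) x
     + partial i (fun y => metric M c y m k) x
     - partial m (fun y => metric M c y k i) x).

(* A sequence of covariant tensor fields, one of each order: [T c I x] is the
   component of multi-index I, in the chart c and at the point of coordinates x,
   of the field of order [size I]. *)
Definition covariant_tensors := chart -> seq 'I_d -> 'rV[R]_d -> R.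
Implicit Types T S : covariant_tensors.

Definition tensorial (r : nat) T : Prop :=
  forall c1 c2, atlas M c1 -> atlas M c2 ->
  forall p, cdom c1 p -> cdom c2 p ->
  forall j, (j <= r)%N -> forall I : j.-tuple 'I_d,
    T c1 I (cmap c1 p) =
    \sum_(J : j.-tuple 'I_d)
      (\prod_(m < j) jacobian (transition c1 c2) (cmap c1 p)
                       (tnth I m) (tnth J m)) * T c2 J (cmap c2 p).

(* T consists, up to order r, of the iterated weak covariant derivatives
   nabla^j u of u, where the new index comes first:
     (nabla T)_{k I} = d_k T_I - sum_m sum_l Gamma^l_{k I_m} T_{I[m := l]}. *)
Definition weak_derivatives (r : nat) (u : U -> R) T : Prop :=
  [/\ tensorial r T,
      forall c, atlas M c -> forall p, cdom c p -> T c [::] (cmap c p) = u p &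
      forall c, atlas M c -> forall (I : seq 'I_d), (size I < r)%N ->
      forall k : 'I_d,
        weak_partial (ccod c) k (T c I)
          (fun x => T c (k :: I) x +
             \sum_(m < size I) \sum_(l < d)
               christoffel c k (nth k I m) l x * T c (set_nth k I m l) x)].

(* The pointwise inner product of the fields of order j of T and S induced by
   the metric; for tensorial T and S it does not depend on the chart. *)
Definition tensor_dot (j : nat) T S (p : U) : R :=
  let c := chart_at p in
  let x := cmap c p in
  \sum_(I : j.-tuple 'I_d) \sum_(J : j.-tuple 'I_d)
    (\prod_(m < j) invmx (metric M c x) (tnth I m) (tnth J m)) *
    T c I x * S c J x.

Variable vol : {measure set (borel U) -> \bar R}.

Definition sobolev (r : nat) : set (U -> R) :=
  [set u | exists2 T, weak_derivatives r u T &
     forall j, (j <= r)%N -> vol.-integrable setT (EFin \o tensor_dot j T T)].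

(* The weak derivatives are determined almost everywhere by u. *)
Definition nabla (r : nat) (u : U -> R) : covariant_tensors :=
  xget (fun _ _ _ => 0) [set T | weak_derivatives r u T].

Definition sobolev_dot (r : nat) (u v : U -> R) : R :=
  \sum_(j < r.+1)
    fine (\int[vol]_p (tensor_dot j (nabla r u) (nabla r v) p)%:E)%E.

Definition sobolev_continuous (r : nat) : set (U -> R) :=
  sobolev r `&` [set f | continuous f].

End RiemannianManifold.

Section ReproducingKernel.
Variables (R : realType) (X : Type).
Variables (H : set (X -> R)) (dot : (X -> R) -> (X -> R) -> R).

Definition is_inner_product_space : Prop :=
  [/\ H (fun=> 0),
      forall (a : R) f g, H f -> H g -> H (fun x => a * f x + g x),
      forall f g, H f -> H g -> dot f g = dot g f,
      forall (a : R) f g h, H f -> H g -> H h ->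
        dot (fun x => a * f x + g x) h = a * dot f h + dot g h &
      forall f, H f -> 0 <= dot f f /\ (dot f f = 0 -> f = fun=> 0)].

Definition rkhs_dist (f g : X -> R) : R :=
  Num.sqrt (dot (fun x => f x - g x) (fun x => f x - g x)).

Definition is_complete : Prop :=
  forall f_ : nat -> X -> R, (forall n, H (f_ n)) ->
    (forall e : R, 0 < e -> exists N, forall m n,
       (N <= m)%N -> (N <= n)%N -> rkhs_dist (f_ m) (f_ n) < e) ->
    exists2 f, H f & rkhs_dist (f_ n) f @[n --> \oo] --> (0 : R).

Definition is_rkhs : Prop :=
  [/\ is_inner_product_space, is_complete &
      forall x, exists C : R, forall f, H f -> `|f x| <= C * Num.sqrt (dot f f)].

Definition is_reproducing_kernel (K : X -> X -> R) : Prop :=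
  forall s, H (K ^~ s) /\ forall f, H f -> dot f (K ^~ s) = f s.

End ReproducingKernel.

Section Eigenvalues.
Variables (R : realType) (dsp : measure_display) (X : measurableType dsp).
Variables (mu : {measure set X -> \bar R}) (K : X -> X -> R).

Definition integral_operator (f : X -> R) (x : X) : R :=
  fine (\int[mu]_s (K x s * f s)%:E)%E.

Definition eigenspace (lambda : R) : set (X -> R) :=
  [set f | f \in Lfun mu 2%:E /\
     {ae mu, forall x, integral_operator f x = lambda * f x}].

(* The eigenspace of lambda, in L^2, has dimension at least n. *)
Definition multiplicity_ge (lambda : R) (n : nat) : Prop :=
  exists2 f : 'I_n -> X -> R, forall i, eigenspace lambda (f i) &
    forall a : 'I_n -> R,
      {ae mu, forall x, \sum_(i < n) a i * f i x = 0} -> forall i, a i = 0.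

(* tau lists all the eigenvalues in non-increasing order: every real number
   occurs in tau as often as its multiplicity as an eigenvalue. *)
Definition is_eigenvalue_sequence (tau : nat -> R) : Prop :=
  (forall k, tau k.+1 <= tau k) /\
  forall lambda n, multiplicity_ge lambda n <->
    exists2 k_ : 'I_n -> nat, injective k_ & forall i, tau (k_ i) = lambda.

End Eigenvalues.

Definition asymp (R : realType) (a b : nat -> R) : Prop :=
  exists c C : R, 0 < c /\ \forall k \near \oo, c <= a k / b k <= C.

(* Main.v *)
(** In finitely many charts, cut a Sobolev function off and expand it in products
    of sines and cosines.  Iterated integration by parts bounds the sum of
    (1 + |k|)^(2r) |c_k|^2 over the coefficients c_k by the square of the Sobolev
    norm; as 2r > d, the series converges uniformly.  This gives the continuous
    representatives and the bounded point evaluations.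

    The integral operator of the reproducing kernel is the adjoint of the
    inclusion of H^r into L^2, so its eigenvalues are the successive maxima of
    |f|_{L^2}^2 / |f|_{H^r}^2 on the orthogonal complements of the previous
    maximizers; zero is not among them because smooth bumps are dense in L^2.
    Keeping the terms with k_i <= N leaves O(N^d) functionals that determine f up
    to a relative L^2 error O(N^(-2r)), which bounds the eigenvalues from above.
    In one chart, N^d bumps of width about 1/N with disjoint supports have quotient
    at least c N^(-2r), which bounds them from below. *)

Require Import Defs.
From HB Require Import structures.
From mathcomp Require Import all_boot all_order all_algebra.
From mathcomp Require Import all_classical all_reals all_analysis.
From mathcomp Require Import measurable_realfun ring lra zify.
Import Order.TTheory GRing.Theory Num.Theory.
Import numFieldNormedType.Exports.
Set Implicit Arguments.
Unset Strict Implicit.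
Unset Printing Implicit Defensive.
Local Open Scope classical_set_scope.
Local Open Scope ring_scope.

(** * Borel sets and Lebesgue measure in dimension d *)

(** The derivatives are tensor fields given by components in every chart; their tensor law holds at
    every point, their differential equations only weakly. Hence three obstacles. Smooth functions
    lie in the space because the inhomogeneous term in the change of the Christoffel symbols cancels
    the derivative of the Jacobian; the symmetry of second derivatives needed there comes from
    testing against explicit bumps. For completeness, limits must be tensorial everywhere, so they
    are taken exactly where a chart-independent bound holds. And integration by parts must leave
    only components of order at most r, with compactly supported smooth coefficients.

    No partition of unity is used: patches of a quarter of the size of the Fourier boxes still cover
    the manifold, and there the cut-off is bounded below, so one divides by it.

    The condition 2r > d enters through max_i (k_i + 1)^(2r) >= prod_i (k_i + 1)^(2r/d), which
    dominates the inverse weights by a product of convergent series.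

    Maximizers exist because the low coefficients of the upper bound also make the L^2 form compact:
    along an ultrafilter they oscillate little on a bounded sequence. *)

Lemma le_of_eq {disp : Order.disp_t} {T : porderType disp} (x y : T) : x = y -> (x <= y)%O.
Proof. by move=> ->. Qed.

Section Borel.
Context {R : realType}.

Lemma open_borel (T : ptopologicalType) (A : set T) :
  open A -> measurable (A : set (borel T)).
Proof. by move=> oA; exact: sub_sigma_algebra. Qed.

Lemma closed_borel (T : ptopologicalType) (A : set T) :
  closed A -> measurable (A : set (borel T)).
Proof.
move=> cA; rewrite -(setCK A); apply: measurableC; apply: open_borel.
exact: closed_openC.
Qed.

Lemma continuous_open_preimage (T T' : topologicalType) (D : set T) (f : T -> T')
    (B : set T') : open D -> (forall x, D x -> {for x, continuous f}) ->
  open B -> open (D `&` f @^-1` B).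
Proof.
move=> oD cf oB; rewrite openE => x [Dx Bfx].
apply: filterI; first exact: open_nbhs_nbhs.
by apply: (cf x Dx); exact: open_nbhs_nbhs.
Qed.

Lemma borel_continuous (T T' : ptopologicalType) (D : set T) (f : T -> T') :
  open D -> (forall x, D x -> {for x, continuous f}) ->
  measurable_fun (D : set (borel T)) (f : borel T -> borel T').
Proof.
move=> oD cf; apply: measurability => // _ [B oB <-].
by apply: open_borel; exact: continuous_open_preimage.
Qed.

Lemma borel_real_continuous (T : ptopologicalType) (D : set T) (f : T -> R) :
  open D -> (forall x, D x -> {for x, continuous f}) ->
  measurable_fun (D : set (borel T)) f.
Proof.
move=> oD cf; apply: measurability.
  exact: RGenOpens.measurableE.
move=> _ [B [a [b ->]] <-].
by apply: open_borel; apply: continuous_open_preimage => //; exact: interval_open.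
Qed.

Lemma borel_real_continuous_sub (T : ptopologicalType) (V D : set T) (f : T -> R) :
  open V -> (forall x, V x -> {for x, continuous f}) -> measurable (D : set (borel T)) ->
  D `<=` V -> measurable_fun (D : set (borel T)) f.
Proof.
move=> oV cf mD DV; apply: (@measurable_funS _ _ _ _ (V : set (borel T))) => //; first exact: open_borel.
exact: borel_real_continuous.
Qed.

Lemma continuous_coord d (i : 'I_d) : continuous (fun x : 'rV[R]_d => x 0 i).
Proof. exact: coord_continuous. Qed.

Lemma borel_measurable_coord d (i : 'I_d) (D : set (borel 'rV[R]_d)) :
  measurable D -> measurable_fun D (fun x : borel 'rV[R]_d => (x : 'rV[R]_d) 0 i).
Proof.
move=> mD; apply: (@measurable_funS _ _ _ _ setT) => //.
apply: borel_real_continuous; first exact: openT.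
by move=> x _; exact: continuous_coord.
Qed.

Lemma rV_norm_lt d (x : 'rV[R]_d) (e : R) : 0 < e ->
  `|x| < e <-> forall i, `|x 0 i| < e.
Proof.
move=> e0; rewrite {1}/Num.Def.normr/= mx_normrE; split=> [h i|h].
  by move/bigmax_ltP: h => [_ /(_ (0, i) isT)].
by apply/bigmax_ltP; split => // -[a i] _ /=; rewrite ord1.
Qed.

Lemma rV_norm_le d (x : 'rV[R]_d) (e : R) : 0 <= e ->
  `|x| <= e <-> forall i, `|x 0 i| <= e.
Proof.
move=> e0; rewrite {1}/Num.Def.normr/= mx_normrE; split=> [h i|h].
  by move/bigmax_leP: h => [_ /(_ (0, i) isT)].
by apply/bigmax_leP; split => // -[a i] _ /=; rewrite ord1.
Qed.

Lemma rV_coord_le d (x : 'rV[R]_d) i : `|x 0 i| <= `|x|.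
Proof. by have [/(_ (lexx _))] := rV_norm_le x (normr_ge0 x). Qed.

Lemma rV_ballP d (x y : 'rV[R]_d) (e : R) : 0 < e ->
  ball x e y <-> forall i, `|x 0 i - y 0 i| < e.
Proof.
move=> e0; rewrite mx_norm_ball /=.
by rewrite rV_norm_lt//; split => h i; have := h i; rewrite !mxE.
Qed.

Definition rat_box d (q : 'rV[rat]_d) (n : nat) : set 'rV[R]_d :=
  [set x | forall i, `|x 0 i - ratr (q 0 i)| < n.+1%:R^-1].

Definition rat_cbox d (q : 'rV[rat]_d) (n : nat) : set 'rV[R]_d :=
  [set x | forall i, `|x 0 i - ratr (q 0 i)| <= n.+1%:R^-1].

(** The union is countable, and requiring the closed box in A lets statements proved for closed
    rectangles pass to open sets, as in [du_bois_reymond_bump]. *)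
Lemma open_rat_box d (A : set 'rV[R]_d) : open A ->
  A = \bigcup_(qn : 'rV[rat]_d * nat)
        [set x | rat_box qn.1 qn.2 x /\ rat_cbox qn.1 qn.2 `<=` A].
Proof.
move=> oA; apply/seteqP; split=> [x Ax|x [q _ []]]; last by move=> xq; apply=> i; exact: ltW.
move: oA; rewrite openE => /(_ _ Ax) /nbhs_ballP[e /= e0 eA].
have [n ne] : exists n, n.+1%:R^-1 *+ 2 < e.
  have e2 : 0 < e / 2 by lra.
  have [n _ /(_ n (leqnn n)) hn] := near_infty_natSinv_lt (PosNum e2).
  have {}hn : n.+1%:R^-1 < e / 2 := hn.
  by exists n; rewrite mulr2n; move: hn; set t := n.+1%:R^-1 => hn; lra.
have n0 : 0 < n.+1%:R^-1 :> R by rewrite invr_gt0.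
have q_ i : exists q : rat, `|x 0 i - ratr q| < n.+1%:R^-1.
  have [q []] := @dense_rat R (ball (x 0 i) n.+1%:R^-1)
    (ex_intro _ _ (ballxx _ n0)) (ball_open _ _).
  by move=> h [p _ pq]; exists p; rewrite pq; exact: h.
pose q := \row_i projT1 (cid (q_ i)).
have qE i : `|x 0 i - ratr (q 0 i)| < n.+1%:R^-1.
  by rewrite mxE; case: cid.
exists (q, n) => //=; split=> // y yq; apply: eA.
apply/(rV_ballP _ _ e0) => i.
rewrite (_ : x 0 i - y 0 i = (x 0 i - ratr (q 0 i)) - (y 0 i - ratr (q 0 i))); last by ring.
rewrite (le_lt_trans (ler_normB _ _))//; move: (qE i) (yq i) ne; rewrite mulr2n.
by set t := n.+1%:R^-1; lra.
Qed.

Lemma measurable_rV disp (T : measurableType disp) (D : set T) d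
    (f : T -> borel 'rV[R]_d) : measurable D ->
  (forall i, measurable_fun D (fun z => (f z : 'rV[R]_d) 0 i)) ->
  measurable_fun D f.
Proof.
move=> mD mf; apply: measurability => // _ [B oB <-].
rewrite (open_rat_box oB) setI_bigcupr.
apply: countable_bigcupT_measurable; first exact: countableP.
move=> [q n] /=.
have [h|h] := pselect (rat_cbox q n `<=` B); last first.
  rewrite (_ : _ `&` _ = set0)//; apply/seteqP; split=> // x [_ []] //.
rewrite (_ : _ `&` _ = \bigcap_i
  (D `&` (fun z => (f z : 'rV[R]_d) 0 i) @^-1` (ball (ratr (q 0 i) : R) n.+1%:R^-1))
  `&` D); last first.
  apply/seteqP; split=> x.
    move=> [Dx [xq _]]; split => // i _; split => //=.
    by rewrite /ball/= distrC; exact: xq.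
  move=> [H Dx]; split => //=; split => // i.
  by have [_] := H i I; rewrite distrC.
apply: measurableI => //; apply: fin_bigcap_measurable; first exact: finite_finset.
move=> i _; apply: mf => //; by apply: open_measurable; apply: ball_open; rewrite invr_gt0.
Qed.

End Borel.

Section LebesgueRV.
Context {R : realType}.

Definition rowcons d (tx : measurableTypeR R * borel 'rV[R]_d) : borel 'rV[R]_d.+1 :=
  row_mx (const_mx tx.1 : 'rV[R]_1) (tx.2 : 'rV[R]_d).

Lemma rowconsE d (t : R) (x : 'rV[R]_d) i : (rowcons (t, x) : 'rV[R]_d.+1) 0 i =
  if unlift ord0 i is Some j then x 0 j else t.
Proof.
rewrite mxE; case: splitP => j /= ij.
  by rewrite mxE (_ : i = ord0) ?unlift_none//; apply: val_inj; rewrite /= ij; case: (j) => -[].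
have -> : i = lift ord0 j by apply: val_inj.
by rewrite liftK.
Qed.

Lemma measurable_rowcons d : measurable_fun setT (@rowcons d).
Proof.
apply: measurable_rV => // i.
case: (unliftP ord0 i) => [j|] ij.
  rewrite (_ : (fun _ => _) = (fun x : borel 'rV[R]_d => x 0 j) \o snd).
    by apply: measurableT_comp => //; exact: borel_measurable_coord.
  by apply/funext => -[t x]; rewrite rowconsE ij liftK.
rewrite (_ : (fun _ => _) = fst)//.
by apply/funext => -[t x]; rewrite rowconsE ij unlift_none.
Qed.

Definition rect d (A : 'I_d -> set R) : set (borel 'rV[R]_d) :=
  [set x | forall i, A i ((x : 'rV[R]_d) 0 i)].

Lemma measurable_rect d (A : 'I_d -> set R) : (forall i, measurable (A i)) ->
  measurable (rect A : set (borel 'rV[R]_d)).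
Proof.
move=> mA; rewrite (_ : rect A = \bigcap_i
   (fun x : borel 'rV[R]_d => x 0 i) @^-1` A i); last first.
  by apply/seteqP; split => x h i; [move=> _; exact: h|exact: h].
apply: fin_bigcap_measurable; first exact: finite_finset.
move=> i _; rewrite -[X in measurable X]setTI.
exact: borel_measurable_coord.
Qed.

Lemma rowcons_rect d (A : 'I_d.+1 -> set R) :
  @rowcons d @^-1` rect A = A ord0 `*` rect (A \o lift ord0).
Proof.
apply/seteqP; split => -[t x] /=.
  move=> h; split; first by have := h ord0; rewrite rowconsE unlift_none.
  by move=> j; have := h (lift ord0 j); rewrite rowconsE liftK.
move=> [h0 h] i; rewrite rowconsE.
by case: (unliftP ord0 i) => [j|] -> //; exact: h.
Qed.

Lemma lebesgue_rVS d (m : {sigma_finite_measure set (borel 'rV[R]_d) -> \bar R}) :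
  (m : set _ -> _) = @lebesgue_rV R d -> @lebesgue_rV R d.+1 =
  pushforward (@lebesgue_measure R \x m)%E (@rowcons d).
Proof.
move=> mE; apply/funext => A /=; rewrite -mE.
apply: eq_integral => t _ /=; congr (m _).
by apply/seteqP; split => x /=; rewrite /xsection /= inE.
Qed.

(** The fixpoint is only a set function. The induction carries a sigma-finite measure equal to it,
    because the next product requires sigma-finiteness, and this in turn comes from the value on
    cubes. *)
Lemma lebesgue_rV_measure d :
  exists2 m : {sigma_finite_measure set (borel 'rV[R]_d) -> \bar R},
  (m : set _ -> _) = @lebesgue_rV R d & forall A : 'I_d -> set R,
   (forall i, measurable (A i)) -> m (rect A) = (\prod_i lebesgue_measure (A i))%E.
Proof.
elim: d => [|d [m mE mrect]].
  exists (\d_(0 : borel 'rV[R]_0)) => // A mA; rewrite big_ord0 /= /dirac indicE.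
  by rewrite mem_set// => -[].
have mrow := @measurable_rowcons d.
pose m' : {measure set (borel 'rV[R]_d.+1) -> \bar R} :=
  measure_function_pushforward__canonical__measure_function_Measure
    (product_measure1 (@lebesgue_measure R) m) mrow.
have rectE A : (forall i, measurable (A i)) -> m' (rect A) = (\prod_i lebesgue_measure (A i))%E.
  move=> mA; rewrite /= /pushforward rowcons_rect product_measure1E; last 2 first.
  - exact: mA.
  - by apply: measurable_rect => i; exact: mA.
  rewrite mrect; first by rewrite big_ord_recl.
  by move=> i; exact: mA.
have sf : sigma_finite setT m'.
  exists (fun n => rect (fun=> `[- n%:R, n%:R]%classic)).
    apply/esym/seteqP; split => // x _.
    exists (Num.truncn `|x : 'rV[R]_d.+1|).+1 => // i /=; rewrite in_itv/= -ler_norml.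
    apply: le_trans (ltW (truncnS_gt _)).
    exact: rV_coord_le.
  move=> n; split; first by apply: measurable_rect => i; exact: measurable_itv.
  rewrite rectE//.
  rewrite -ge0_fin_numE; last by apply: prode_ge0 => *; exact: measure_ge0.
  elim/big_ind : _ => // [|i _]; first exact: fin_numM.
  by rewrite lebesgue_measure_itv/=; case: ifP.
pose sfM := Measure_isSigmaFinite.Build _ _ _ m' sf.
pose m2 : {sigma_finite_measure set _ -> \bar R} := HB.pack (m' : set _ -> \bar R) sfM m'.
exists m2; first by rewrite (lebesgue_rVS mE).
exact: rectE.
Qed.

Let lebesgue_rV_sfm d := sval (cid2 (lebesgue_rV_measure d)).
Let lebesgue_rV_sfmE d : (lebesgue_rV_sfm d : set _ -> _) = @lebesgue_rV R d.
Proof. by rewrite /lebesgue_rV_sfm; case: cid2. Qed.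

Let lebesgue_rV0 d : @lebesgue_rV R d set0 = 0%E.
Proof. by rewrite -lebesgue_rV_sfmE. Qed.
Let lebesgue_rV_ge0 d A : (0 <= @lebesgue_rV R d A)%E.
Proof. by rewrite -lebesgue_rV_sfmE; exact: measure_ge0. Qed.
Let lebesgue_rV_sigma_additive d : semi_sigma_additive (@lebesgue_rV R d).
Proof. by rewrite -lebesgue_rV_sfmE; exact: measure_semi_sigma_additive. Qed.
HB.instance Definition _ d := isMeasure.Build _ _ _ (@lebesgue_rV R d)
  (lebesgue_rV0 d) (@lebesgue_rV_ge0 d) (@lebesgue_rV_sigma_additive d).

Let lebesgue_rV_sigma_finite d : sigma_finite setT (@lebesgue_rV R d).
Proof. by rewrite -lebesgue_rV_sfmE; exact: sigma_finiteT. Qed.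
HB.instance Definition _ d := Measure_isSigmaFinite.Build _ _ _ (@lebesgue_rV R d)
  (lebesgue_rV_sigma_finite d).

Lemma lebesgue_rV_rect d (A : 'I_d -> set R) : (forall i, measurable (A i)) ->
  lebesgue_rV (rect A : set (borel 'rV[R]_d)) = (\prod_i lebesgue_measure (A i))%E.
Proof. by have [m <-] := lebesgue_rV_measure d; exact. Qed.

Local Notation lam := (@lebesgue_measure R).

Lemma lebesgue_rV_pushforward d : @lebesgue_rV R d.+1 =
  pushforward (lam \x @lebesgue_rV R d)%E (@rowcons d).
Proof. exact: lebesgue_rVS. Qed.

Section fubini.
Variables (d : nat) (f : borel 'rV[R]_d.+1 -> \bar R).
Hypothesis fi : (@lebesgue_rV R d.+1).-integrable setT f.

Lemma integrable_rowcons :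
  (lam \x @lebesgue_rV R d)%E.-integrable setT (f \o @rowcons d).
Proof.
have mf := measurable_int _ fi.
apply/integrableP; split.
  by apply: measurableT_comp => //; exact: measurable_rowcons.
have /integrableP[_] := fi; rewrite lebesgue_rV_pushforward.
rewrite (ge0_integral_pushforward (@measurable_rowcons d))//.
exact: measurableT_comp.
Qed.

Let lebesgue_rV_prod :
  (\int[@lebesgue_rV R d.+1]_z f z = \int[lam \x @lebesgue_rV R d]_z f (rowcons z))%E.
Proof.
rewrite lebesgue_rV_pushforward (integral_pushforward (@measurable_rowcons d))//.
  exact: measurable_int fi.
exact: integrable_rowcons.
Qed.

Lemma lebesgue_rV_fubini1 : (\int[@lebesgue_rV R d.+1]_z f z =
  \int[lam]_t \int[@lebesgue_rV R d]_x f (rowcons (t, x)))%E.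
Proof. by rewrite lebesgue_rV_prod -integral12_prod_meas1//; exact: integrable_rowcons. Qed.

Lemma lebesgue_rV_fubini2 : (\int[@lebesgue_rV R d.+1]_z f z =
  \int[@lebesgue_rV R d]_x \int[lam]_t f (rowcons (t, x)))%E.
Proof. by rewrite lebesgue_rV_prod -integral21_prod_meas1//; exact: integrable_rowcons. Qed.

End fubini.

End LebesgueRV.

(** Common source of the Cauchy-Schwarz inequalities for integrals, sums and forms below, and of the
    variational step in [riesz]. *)
Lemma discriminant_le (R : realType) (a b c : R) : 0 <= a ->
  (forall t, 0 <= a * t ^+ 2 + b * t *+ 2 + c) -> b ^+ 2 <= a * c.
Proof.
move=> age0 h.
have [a0|a0] := eqVneq a 0.
  rewrite a0 mul0r; have [->|b0] := eqVneq b 0; first by rewrite expr0n.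
  (* For a = 0 this t gives the value -1, so b has to vanish. *)
  have := h (- (c + 1) / (2 * b)); rewrite a0 mul0r add0r.
  have -> : b * (- (c + 1) / (2 * b)) *+ 2 + c = -1 by field.
  lra.
have := h (- b / a).
have -> : a * (- b / a) ^+ 2 + b * (- b / a) *+ 2 + c = (a * c - b ^+ 2) / a by field.
by rewrite pmulr_lge0 ?invr_gt0 ?subr_ge0// lt_neqAle eq_sym a0.
Qed.

(** * Square-integrable functions *)

Section L2.
Context disp (T : measurableType disp) (R : realType).
Variable (mu : {measure set T -> \bar R}).
Implicit Types (D C : set T) (f g : T -> R).

Lemma Rint_supp D C f : C `<=` D -> (forall x, ~ C x -> f x = 0) ->
  \int[mu]_(x in D) f x = \int[mu]_(x in C) f x.
Proof.
move=> CD f0; rewrite Rintegral_mkcond [RHS]Rintegral_mkcond; congr Rintegral.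
apply/funext => x; rewrite !patchE; case: ifPn => xD; case: ifPn => xC //.
  by rewrite f0; move/negP : xC; rewrite inE.
by move/negP: xD; case; move: xC; rewrite !inE; exact: CD.
Qed.

Lemma integrable_supp D C f : measurable D -> measurable C -> C `<=` D ->
  (forall x, ~ C x -> f x = 0) -> mu.-integrable C (EFin \o f) ->
  mu.-integrable D (EFin \o f).
Proof.
move=> mD mC CD f0 fi; rewrite (integrable_mkcond _ mD).
rewrite (integrable_mkcond _ mC) in fi; apply: eq_integrable fi => // x _.
rewrite !patchE; case: ifPn => xC; case: ifPn => xD //=.
  by move/negP: xD; case; move: xC; rewrite !inE; exact: CD.
by rewrite f0; move/negP : xC; rewrite inE.
Qed.

Lemma integrable_bounded_mul D f g M : measurable D -> measurable_fun D g ->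
  (forall x, D x -> `|g x| <= M) ->
  mu.-integrable D (EFin \o f) -> mu.-integrable D (EFin \o (fun x => g x * f x)).
Proof.
move=> mD mg gM fi.
have := integrableMr mD mg _ fi; apply.
exists M; split; first exact: num_real.
by move=> y My x /= Dx; apply: le_trans (ltW My); exact: gM.
Qed.

Lemma RintegrableD D f g : measurable D -> mu.-integrable D (EFin \o f) ->
  mu.-integrable D (EFin \o g) -> mu.-integrable D (EFin \o (fun x => f x + g x)).
Proof.
by move=> mD fi gi; apply: eq_integrable (integrableD mD fi gi) => // x _ /=.
Qed.

Lemma RintegrableZ D (k : R) f : measurable D -> mu.-integrable D (EFin \o f) ->
  mu.-integrable D (EFin \o (fun x => k * f x)).
Proof.
by move=> mD fi; apply: eq_integrable (integrableZl mD k fi) => // x _ /=.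
Qed.

Lemma RintegrableB D f g : measurable D -> mu.-integrable D (EFin \o f) ->
  mu.-integrable D (EFin \o g) -> mu.-integrable D (EFin \o (fun x => f x - g x)).
Proof.
by move=> mD fi gi; apply: eq_integrable (integrableB mD fi gi) => // x _ /=.
Qed.

Lemma Rintegrable0 D : mu.-integrable D (EFin \o (fun=> 0 : R)).
Proof. exact: integrable0. Qed.

Lemma Rintegral_axpy D (k : R) f g h : measurable D -> mu.-integrable D (EFin \o f) ->
  mu.-integrable D (EFin \o g) -> (forall x, h x = k * f x + g x) ->
  \int[mu]_(x in D) h x = k * (\int[mu]_(x in D) f x) + \int[mu]_(x in D) g x.
Proof.
move=> mD fi gi hE; rewrite -(RintegralZl k mD fi) -(RintegralD mD (RintegrableZ k mD fi) gi).
by apply: eq_Rintegral => x _; exact: hE.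
Qed.

Lemma Rintegrable_sum D I (r : seq I) (P : pred I) (F : I -> T -> R) : measurable D ->
  (forall i, P i -> mu.-integrable D (EFin \o F i)) ->
  mu.-integrable D (EFin \o (fun x => \sum_(i <- r | P i) F i x)).
Proof.
move=> mD Fi; elim: r => [|i r IH].
  by apply: eq_integrable (Rintegrable0 D) => // x _ /=; rewrite big_nil.
have [Pi|Pi] := boolP (P i).
  apply: eq_integrable (RintegrableD mD (Fi _ Pi) IH) => // x _ /=.
  by rewrite big_cons Pi.
by apply: eq_integrable IH => // x _ /=; rewrite big_cons (negbTE Pi).
Qed.

Lemma Rintegral_sum D I (r : seq I) (P : pred I) (F : I -> T -> R) : measurable D ->
  (forall i, P i -> mu.-integrable D (EFin \o F i)) ->
  \int[mu]_(x in D) (\sum_(i <- r | P i) F i x) =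
  \sum_(i <- r | P i) \int[mu]_(x in D) F i x.
Proof.
move=> mD Fi; elim: r => [|i r IH].
  rewrite big_nil.
  rewrite (@Rint_supp D set0)//; last by move=> x _; rewrite big_nil.
  by rewrite !Rintegral_set0.
rewrite big_cons; have [Pi|Pi] := boolP (P i); rewrite -IH.
  rewrite -RintegralD//; [|exact: Fi|exact: Rintegrable_sum].
  by apply: eq_Rintegral => x _; rewrite big_cons Pi.
by apply: eq_Rintegral => x _; rewrite big_cons (negbTE Pi).
Qed.

(** Measurability of f is a separate clause, since that of f^2 does not imply it. *)
Definition sqint D f := measurable_fun D f /\
  mu.-integrable D (EFin \o (fun x => f x ^+ 2)).

Lemma sqintM D f g : measurable D -> sqint D f -> sqint D g ->
  mu.-integrable D (EFin \o (fun x => f x * g x)).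
Proof.
move=> mD [mf fi] [mg gi].
pose q x := f x ^+ 2 + g x ^+ 2.
have qi : mu.-integrable D (EFin \o q) by exact: RintegrableD.
apply: (le_integrable mD _ _ qi).
- by apply/measurable_EFinP; exact: measurable_funM.
- move=> x _ /=; rewrite lee_fin [leRHS]ger0_norm /q ?addr_ge0 ?sqr_ge0//.
  by rewrite ler_norml; have := sqr_ge0 (f x - g x); have := sqr_ge0 (f x + g x); nra.
Qed.

Lemma sqintZ D (k : R) f : measurable D -> sqint D f -> sqint D (fun x => k * f x).
Proof.
move=> mD [mf fi]; split; first exact: measurable_funM.
have := integrableZl mD (k ^+ 2) fi; apply: eq_integrable => // x _ /=.
by rewrite exprMn.
Qed.

Lemma sqintD D f g : measurable D -> sqint D f -> sqint D g ->
  sqint D (fun x => f x + g x).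
Proof.
move=> mD sf sg; have fg := sqintM mD sf sg.
have [[mf fi] [mg gi]] := (sf, sg); split; first exact: measurable_funD.
have := integrableD mD (integrableD mD fi gi) (integrableZl mD 2 fg).
by apply: eq_integrable => // x _ /=; rewrite -!EFinD; congr (_%:E); ring.
Qed.

Lemma cauchy_schwarz_int D f g : measurable D -> sqint D f -> sqint D g ->
  (\int[mu]_(x in D) (f x * g x)) ^+ 2 <=
  (\int[mu]_(x in D) (f x ^+ 2)) * \int[mu]_(x in D) (g x ^+ 2).
Proof.
move=> mD sf sg; apply: discriminant_le => [|t].
  by apply: Rintegral_ge0 => x _; exact: sqr_ge0.
have fg := sqintM mD sf sg; have [_ fi] := sf; have [_ gi] := sg.
have -> : (\int[mu]_(x in D) (f x ^+ 2)) * t ^+ 2 +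
   (\int[mu]_(x in D) (f x * g x)) * t *+ 2 + \int[mu]_(x in D) (g x ^+ 2) =
   \int[mu]_(x in D) ((t * f x + g x) ^+ 2).
  transitivity (\int[mu]_(x in D) (t ^+ 2 * (f x ^+ 2) + (t * 2) * (f x * g x) + g x ^+ 2)).
    rewrite !RintegralD// ?RintegralZl//; first by ring.
    - exact: (integrableZl mD (t ^+ 2) fi).
    - exact: (integrableZl mD (t * 2) fg).
    - apply: (integrableD mD (integrableZl mD (t ^+ 2) fi) (integrableZl mD (t * 2) fg)).
  by apply: eq_Rintegral => x _; ring.
by apply: Rintegral_ge0 => x _; exact: sqr_ge0.
Qed.

End L2.

Arguments Rint_supp {disp T R mu D C f}.
Arguments integrable_supp {disp T R mu D C f}.

Section RectVanish.
Context {R : realType} (d : nat).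
Local Notation E := (borel 'rV[R]_d).
Local Notation L := (@lebesgue_rV R d).

Definition open_rect (a b : 'I_d -> R) : set E :=
  rect (fun i => `]a i, b i[%classic).

Lemma open_rectI (a b a' b' : 'I_d -> R) : open_rect a b `&` open_rect a' b' =
  open_rect (fun i => Num.max (a i) (a' i)) (fun i => Num.min (b i) (b' i)).
Proof.
apply/seteqP; split => x /=.
  move=> [h h'] i; have := h i; have := h' i; rewrite /= !in_itv/= gt_max lt_min.
  by move=> /andP[-> ->] /andP[-> ->].
move=> h; split=> i; have := h i; rewrite /= !in_itv/= gt_max lt_min;
  by move=> /andP[/andP[h1 h2] /andP[h3 h4]]; apply/andP; split.
Qed.

Lemma measurable_open_rect a b : measurable (open_rect a b : set E).
Proof. by apply: measurable_rect => i; exact: measurable_itv. Qed.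

Lemma open_rect_lty a b : (L (open_rect a b) < +oo)%E.
Proof.
rewrite lebesgue_rV_rect; last by move=> j; exact: measurable_itv.
rewrite -ge0_fin_numE; last by apply: prode_ge0 => *; exact: measure_ge0.
elim/big_ind : _ => // [|j _]; first exact: fin_numM.
by rewrite lebesgue_measure_itv/=; case: ifP.
Qed.

Lemma open_open_rect a b : open (open_rect a b : set 'rV[R]_d).
Proof.
rewrite openE => x xab; rewrite /=.
have : \forall y \near x, forall i, `]a i, b i[%classic ((y : 'rV[R]_d) 0 i).
  apply: (@filter_forall _ _ (fun i => [set y : 'rV[R]_d | `]a i, b i[%classic (y 0 i)]) (nbhs x)) => i.
  have := @continuous_coord R d i x `]a i, b i[%classic; apply.
  by apply: open_nbhs_nbhs; split; [exact: interval_open|exact: xab].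
by apply: filterS => y; exact.
Qed.

(** Open rectangles are stable under intersection, so [dynkin_induction] applies to this
    generator. *)
Lemma borel_rV_open_rect : (measurable : set (set E)) =
  <<s [set A | exists a b, A = open_rect a b] >>.
Proof.
apply/seteqP; split.
  apply: smallest_sub; first exact: smallest_sigma_algebra.
  move=> A oA; rewrite (open_rat_box oA).
  apply: (@countable_bigcupT_measurable _
    (g_sigma_algebraType [set A | exists a b, A = open_rect a b])).
    exact: countableP.
  move=> [q n] /=; have [h|h] := pselect (rat_cbox q n `<=` A); last first.
    have -> : [set x : E | rat_box q n x /\ rat_cbox q n `<=` A] = set0.
      by apply/seteqP; split=> // x [].
    exact: measurable0.
  rewrite (_ : mkset _ = open_rect (fun i => ratr (q 0 i) - n.+1%:R^-1)
     (fun i => ratr (q 0 i) + n.+1%:R^-1)).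
    by apply: sub_sigma_algebra; eexists; eexists.
  apply/seteqP; split=> x /=.
    by move=> [xq _] i /=; rewrite in_itv/= -ltr_distl; exact: xq.
  by move=> xq; split => // i; have := xq i; rewrite /= in_itv/= -ltr_distl.
apply: smallest_sub; first exact: sigma_algebra_measurable.
by move=> _ [a [b ->]]; exact: measurable_open_rect.
Qed.

(** The sets over which h integrates to 0 form a Dynkin system; the support condition makes the
    whole space one of them. *)
Lemma ae0_open_rect (h : E -> R) (M : R) : L.-integrable setT (EFin \o h) ->
  (forall x, ~ open_rect (fun=> - M) (fun=> M) x -> h x = 0) ->
  (forall a b, \int[L]_(x in open_rect a b) h x = 0) ->
  {ae L, forall x, h x = 0}.
Proof.
move=> hi h0 hr.
pose P (A : set E) := (\int[L]_(x in A) (h x)%:E = 0)%E.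
have fn A : measurable A -> (\int[L]_(x in A) (h x)%:E)%E \is a fin_num.
  by move=> mA; apply: integrable_fin_num => //; exact: integrableS hi.
have PR A : measurable A -> \int[L]_(x in A) h x = 0 -> P A.
  by move=> mA; rewrite /Rintegral /P => A0; rewrite -(fineK (fn _ mA)) A0.
have PT : P setT.
  apply: PR => //; rewrite (Rint_supp (C := open_rect (fun=> - M) (fun=> M)))//.
have PA A : measurable A -> P A.
  rewrite borel_rV_open_rect; apply: dynkin_induction => //.
  - exact: borel_rV_open_rect.
  - move=> _ _ [a [b ->]] [a' [b' ->]]; rewrite open_rectI.
    by eexists; eexists.
  - by move=> _ [a [b ->]]; apply: PR; [exact: measurable_open_rect|exact: hr].
  - move=> S mS PS; move: PT; rewrite /P -(setUv S) integral_setU//=.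
    + by rewrite PS add0e.
    + exact: measurableC.
    + by rewrite setUv; exact: measurable_int hi.
    + by rewrite disj_set2E setICr.
  - move=> F mF tF PF; rewrite /P integral_bigcup//.
      by apply: eseries0 => i _ _; exact: PF.
    by apply: integrableS hi => //; exact: bigcup_measurable.
have := @integral_ae_eq _ E R L setT measurableT (cst 0)%E (EFin \o h) hi
  (measurable_cst _) (fun A _ mA => etrans (PA A mA) (esym (integral0 _ _))).
by apply: filterS => x /(_ I) /= [].
Qed.

End RectVanish.

Section IntegralProduct.
Context {R : realType}.
Local Notation lam := (@lebesgue_measure R).

Lemma integrable_rV_of_prod d (f : borel 'rV[R]_d.+1 -> \bar R) :
  measurable_fun setT f ->
  (\int[lam]_t \int[@lebesgue_rV R d]_x `|f (rowcons (t, x))| < +oo)%E ->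
  (@lebesgue_rV R d.+1).-integrable setT f.
Proof.
move=> mf fi; rewrite lebesgue_rV_pushforward.
apply: (integrable_pushforward (@measurable_rowcons R d)) => //.
apply/integrable12ltyP => //; apply: measurableT_comp => //.
exact: measurable_rowcons.
Qed.

Lemma integral_rV_prod d (phi : 'I_d -> R -> R) :
  (forall i, measurable_fun setT (phi i)) ->
  (forall i, lam.-integrable setT (EFin \o phi i)) ->
  let f := fun x : borel 'rV[R]_d => \prod_i phi i ((x : 'rV[R]_d) 0 i) in
  (@lebesgue_rV R d).-integrable setT (EFin \o f) /\
  (\int[@lebesgue_rV R d]_x (f x)%:E = (\prod_i \int[lam]_t phi i t)%:E)%E.
Proof.
elim: d phi => [|d IH] phi mphi phii f.
  have fE x : f x = 1 by rewrite /f big_ord0.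
  have mf : measurable_fun setT (EFin \o f).
    by rewrite (_ : EFin \o f = cst 1%E)//; apply/funext => x /=; rewrite fE.
  split.
    apply/integrableP; split => //=.
    under eq_integral do rewrite fE.
    by rewrite integral_dirac//= ltry.
  under eq_integral do rewrite fE.
  by rewrite integral_dirac//= diracT mul1e big_ord0.
pose psi i := phi (lift ord0 i).
have [gi gE] := IH psi (fun i => mphi _) (fun i => phii _).
set g := (fun x : borel 'rV[R]_d => _) in gi gE.
have fE t x : f (rowcons (t, x)) = phi ord0 t * g x.
  rewrite /f big_ord_recl rowconsE unlift_none; congr (_ * _).
  by apply: eq_bigr => i _; rewrite rowconsE liftK.
have mf : measurable_fun setT f.
  apply: measurable_prod => i _; apply: measurableT_comp; first exact: mphi.
  exact: borel_measurable_coord.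
have fi : (@lebesgue_rV R d.+1).-integrable setT (EFin \o f).
  apply: integrable_rV_of_prod; first exact/measurable_EFinP.
  under eq_integral => t _.
    under eq_integral => x _ do rewrite /= fE normrM EFinM.
    rewrite ge0_integralZl//; last first.
      by apply/measurable_EFinP; apply: measurableT_comp => //; apply/measurable_EFinP; exact: measurable_int gi.
    over.
  rewrite ge0_integralZr//; last 2 first.
  - by apply/measurable_EFinP; apply: measurableT_comp => //; exact: mphi.
  - exact: integral_ge0.
  apply: lte_mul_pinfty.
  - exact: integral_ge0.
  - rewrite ge0_fin_numE; last exact: integral_ge0.
    by have /integrableP[] := phii ord0.
  - by have /integrableP[] := gi.
split => //; rewrite lebesgue_rV_fubini1//=.
under eq_integral => t _.
  under eq_integral => x _ do rewrite fE EFinM.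
  rewrite integralZl// gE; over.
rewrite (integralZr measurableT (phii ord0)) [in RHS]big_ord_recl EFinM; congr (_ * _)%E.
rewrite fineK//.
exact: (integrable_fin_num measurableT (phii ord0)).
Qed.

Definition upd d (x : 'rV[R]_d) (i : 'I_d) (s : R) : 'rV[R]_d :=
  \row_j (if j == i then s else x 0 j).

(** The idea is to integrate first in direction i. As [lebesgue_rV] splits off the first coordinate,
    the induction descends until i is that coordinate; there the two integrals are exchanged. *)
Lemma integral_slice0 d (g : borel 'rV[R]_d -> R) (i : 'I_d) (B M : R) :
  measurable_fun setT g -> (forall x, `|g x| <= B) ->
  (forall x, ~ open_rect (fun=> - M) (fun=> M) x -> g x = 0) ->
  (forall x : 'rV[R]_d, \int[lam]_s (g (upd x i s))%:E = 0)%E ->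
  (\int[@lebesgue_rV R d]_x (g x)%:E = 0)%E.
Proof.
elim: d g i => [|d IH] g i; first by case: i.
move=> mg gB g0 gi.
have bd : (@lebesgue_rV R d.+1).-integrable setT (EFin \o g).
  apply: (integrable_supp (C := open_rect (fun=> - M) (fun=> M))) => //.
    exact: measurable_open_rect.
  apply: measurable_bounded_integrable.
  - exact: measurable_open_rect.
  - exact: open_rect_lty.
  - exact: measurable_funTS.
  - by exists B; split; [exact: num_real|move=> y By x _ /=; apply: le_trans (ltW By)].
case: (unliftP ord0 i) => [j|] ij.
  rewrite lebesgue_rV_fubini1//= -[RHS](integral0 lam setT).
  apply: eq_integral => t _.
  apply: IH.
  - apply: measurableT_comp => //.
    exact: (measurableT_comp (@measurable_rowcons R d) (measurable_pair1 _)).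
  - by move=> x; exact: gB.
  - move=> x nx; apply: g0 => h; apply: nx => k; have := h (lift ord0 k).
    by rewrite rowconsE liftK.
  - move=> x; rewrite -(gi (rowcons (t, x))); apply: eq_integral => s _.
    congr (g _)%:E; apply/rowP => k; rewrite rowconsE [RHS]mxE.
    case: (unliftP ord0 k) => [l|] kl.
      by rewrite kl mxE ij rowconsE liftK.
    by rewrite kl rowconsE unlift_none ij; case: eqP.
rewrite lebesgue_rV_fubini2//= -[RHS](integral0 (@lebesgue_rV R d) setT).
apply: eq_integral => x _; rewrite -(gi (rowcons (0, x))).
apply: eq_integral => s _; congr (g _)%:E; apply/rowP => k; rewrite rowconsE [RHS]mxE ij.
case: (unliftP ord0 k) => [l|] kl; last by rewrite kl.
by rewrite kl rowconsE liftK.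
Qed.

End IntegralProduct.

(** * Smooth functions and smooth bumps *)

Section SmoothCalculus.
Context {R : realType} {d : nat}.
Local Notation E := 'rV[R]_d.
Implicit Types (V : set E) (f g : E -> R).

Definition basis_vec (i : 'I_d) : E := delta_mx 0 i.
Local Notation e_ := basis_vec.

Lemma is_derive_line f (y : E) (i : 'I_d) (t : R) : derivable f (y + t *: e_ i) (e_ i) ->
  is_derive t (1 : R) (fun s : R => f (y + s *: e_ i)) (partial i f (y + t *: e_ i)).
Proof.
move=> df.
have eqf : (fun h : R => h^-1 *: (f (y + (h *: 1 + t) *: e_ i) - f (y + t *: e_ i)))
   = (fun h : R => h^-1 *: (f (h *: e_ i + (y + t *: e_ i)) - f (y + t *: e_ i))).
  apply/funext => h; congr (_ *: (f _ - _)).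
  by rewrite [h *: 1]mulr1 scalerDl addrCA.
by apply: DeriveDef; rewrite /derivable/derive/partial/derive eqf.
Qed.

(** The bound |c| <= |s| covers both signs of s, as the truncation argument of [partial_increment]
    requires. *)
Lemma line_MVT f (y : E) (i : 'I_d) (s : R) :
  (forall c, `|c| <= `|s| -> derivable f (y + c *: e_ i) (e_ i)) ->
  exists2 c, `|c| <= `|s| & f (y + s *: e_ i) - f y = s * partial i f (y + c *: e_ i).
Proof.
move=> df; pose g := fun t : R => f (y + t *: e_ i).
have gd t : `|t| <= `|s| -> is_derive t (1 : R) g (partial i f (y + t *: e_ i)).
  by move=> ts; apply: is_derive_line; exact: df.
have gc (a b : R) : (forall t, t \in `[a, b] -> `|t| <= `|s|) -> {within `[a, b], continuous g}.
  move=> h; apply: derivable_within_continuous => t tab.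
  by have [] := gd t (h _ tab).
have g0 : g 0 = f y by rewrite /g scale0r addr0.
have [s0|s0] := leP 0 s.
  have h t : t \in `[0, s] -> `|t| <= `|s|.
    by rewrite in_itv/= => /andP[t0 ts]; rewrite !ger0_norm.
  have [|c cs] := @MVT_segment R g (fun t => partial i f (y + t *: e_ i)) 0 s s0 _ (gc _ _ h).
    by move=> t ts; apply: gd; apply: h; move: ts; rewrite !in_itv/= => /andP[/ltW-> /ltW->].
  by rewrite g0 subr0 mulrC => H; exists c => //; exact: h.
have h t : t \in `[s, 0] -> `|t| <= `|s|.
  by rewrite in_itv/= => /andP[t0 ts]; rewrite ler0_norm// ltr0_norm// lerN2.
have [|c cs] := @MVT_segment R g (fun t => partial i f (y + t *: e_ i)) s 0 (ltW s0) _ (gc _ _ h).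
  by move=> t ts; apply: gd; apply: h; move: ts; rewrite !in_itv/= => /andP[/ltW-> /ltW->].
rewrite sub0r => H; exists c; first exact: h.
by rewrite -/(g s); lra.
Qed.

Definition gradmap (a : 'I_d -> R) (h : E) : R := \sum_i h 0 i * a i.

Lemma gradmap_is_linear a : linear (gradmap a : E -> R^o).
Proof.
move=> k u v; rewrite scaler_sumr -big_split; apply: eq_bigr => i _.
by rewrite !mxE mulrDl; congr (_ + _); rewrite -mulrA.
Qed.
HB.instance Definition _ a := GRing.isLinear.Build R E R^o _ (gradmap a) (gradmap_is_linear a).

Lemma gradmap_continuous a : continuous (gradmap a : E -> R^o).
Proof.
move=> x; apply/(@cvgrPdist_lt R R^o E (nbhs (x : E)) _) => e e0.
pose S := \sum_i `|a i| + 1.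
have S0 : 0 < S by rewrite ltr_wpDl// sumr_ge0.
have : \forall y \near x, `|x - y| < e / S.
  by apply/nbhs_ballP; exists (e / S) => //=; rewrite ?divr_gt0// => y; rewrite mx_norm_ball.
apply: filterS => y xy; rewrite -sumrB.
have -> : \sum_i (x 0 i * a i - y 0 i * a i) = \sum_i ((x - y) 0 i * a i).
  by apply: eq_bigr => i _; rewrite !mxE mulrBl.
apply: le_lt_trans (ler_norm_sum _ _ _) _.
apply: (@le_lt_trans _ _ (`|x - y| * \sum_i `|a i|)).
  rewrite mulr_sumr; apply: ler_sum => i _; rewrite normrM ler_wpM2r//.
  rewrite [leRHS]/Num.Def.normr/= mx_normrE.
  exact: (le_bigmax _ (fun i : 'I_1 * 'I_d => `|(x - y) i.1 i.2|) (0, i)).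
have : `|x - y| * S < e by rewrite -ltr_pdivlMr.
by apply: le_lt_trans; rewrite ler_wpM2l// lerDl.
Qed.

Definition grad f (x : E) (i : 'I_d) : R := partial i f x.

Lemma open_ball_sub V x : open V -> V x -> exists2 e : R, 0 < e & ball x e `<=` V.
Proof. by rewrite openE => oV /oV /nbhs_ballP[e /= e0 eV]; exists e. Qed.

Lemma mx_coord_le (x : E) i : `|x 0 i| <= `|x|.
Proof.
rewrite [leRHS]/Num.Def.normr/= mx_normrE.
exact: (le_bigmax _ (fun i : 'I_1 * 'I_d => `|x i.1 i.2|) (0, i)).
Qed.

(** Corners of the path from 0 to h that runs parallel to the axes; the increments of f telescope
    along it. *)
Definition trunc_rV (h : E) (k : nat) : E := \row_i (if (i < k)%N then h 0 i else 0).

Lemma trunc_rV_norm (h : E) k (i : 'I_d) (c : R) : `|c| <= `|h 0 i| -> (k <= i)%N ->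
  `|trunc_rV h k + c *: e_ i| <= `|h|.
Proof.
move=> ch ki; rewrite [leLHS]/Num.Def.normr/= mx_normrE.
apply: bigmax_le => // -[a j] _ /=; rewrite ord1 !mxE.
have [->|ji] := eqVneq j i.
  by rewrite ltnNge ki add0r mulr1 (le_trans ch)// mx_coord_le.
by rewrite mulr0 addr0; case: ifP => _; rewrite ?normr0// mx_coord_le.
Qed.

(** The mean value theorem on each edge of the path produces a partial derivative at some x + y with
    |y| <= |h|, which is within eps of its value at x. *)
Lemma partial_increment f x (h : E) (delta eps : R) :
  (forall y, `|y| <= delta -> forall i, derivable f (x + y) (e_ i)) ->
  (forall y, `|y| <= delta -> forall i, `|partial i f (x + y) - partial i f x| <= eps) ->
  `|h| <= delta ->
  `|f (x + h) - f x - gradmap (grad f x) h| <= eps * \sum_i `|h 0 i|.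
Proof.
move=> df dc hd.
suff H k : (k <= d)%N -> `|f (x + trunc_rV h k) - f x -
   \sum_(i < d | (i < k)%N) h 0 i * partial i f x| <= eps * \sum_(i < d | (i < k)%N) `|h 0 i|.
  have := H d (leqnn d).
  rewrite (_ : trunc_rV h d = h); last by apply/rowP => i; rewrite mxE ltn_ord.
  have bT F : \sum_(i < d | (i < d)%N) F i = \sum_i F i by apply: eq_bigl => i; rewrite ltn_ord.
  by rewrite !bT.
elim: k => [_|k IH kd].
  rewrite !big_pred0// mulr0 subr0.
  rewrite (_ : trunc_rV h 0 = 0); last by apply/rowP => i; rewrite !mxE.
  by rewrite addr0 subrr normr0.
pose i0 := Ordinal kd.
have tk : trunc_rV h k.+1 = trunc_rV h k + h 0 i0 *: e_ i0.
  apply/rowP => j; rewrite !mxE ltnS leq_eqVlt.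
  have -> : (j == i0) = (nat_of_ord j == k) by [].
  case: eqP => [jk|_] /=; last by rewrite mulr0 addr0.
  by rewrite jk ltnn add0r mulr1; congr (h 0 _); apply: val_inj.
have [c ch] : exists2 c, `|c| <= `|h 0 i0| &
    f (x + trunc_rV h k + h 0 i0 *: e_ i0) - f (x + trunc_rV h k) =
    h 0 i0 * partial i0 f (x + trunc_rV h k + c *: e_ i0).
  apply: line_MVT => c ch; rewrite -addrA; apply: df.
  by apply: le_trans hd; exact: trunc_rV_norm.
rewrite -[x + _ + h 0 i0 *: _]addrA -tk -[x + _ + c *: _]addrA => H.
have big1 F : \sum_(i < d | (i < k.+1)%N) F i = \sum_(i < d | (i < k)%N) F i + F i0 :> R.
  rewrite (bigD1 i0)//= addrC; congr (_ + _); apply: eq_bigl => j.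
  by rewrite [(j < k)%N]ltn_neqAle andbC.
rewrite !big1 mulrDr.
have := IH (ltnW kd); set A := \sum_(_ < d | _) _; set B := \sum_(_ < d | _) _ => IH'.
have -> : f (x + trunc_rV h k.+1) - f x - (A + h 0 i0 * partial i0 f x) =
  (f (x + trunc_rV h k) - f x - A) +
  h 0 i0 * (partial i0 f (x + (trunc_rV h k + c *: e_ i0)) - partial i0 f x).
  by rewrite mulrBr -H; ring.
apply: le_trans (ler_normD _ _) _; apply: lerD => //.
rewrite normrM mulrC ler_wpM2r//; apply: dc.
by apply: le_trans hd; exact: trunc_rV_norm.
Qed.

Lemma differentiable_C1 V f x : open V -> V x ->
  (forall y, V y -> forall i, derivable f y (e_ i)) ->
  (forall i, {for x, continuous (partial i f)}) ->
  differentiable f x /\ 'd f x = gradmap (grad f x) :> (E -> R).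
Proof.
move=> oV Vx df cf.
have key : f \o shift x = cst (f x) + (gradmap (grad f x)) +o_ (0 : E) id.
  apply/eqaddoP => _ /posnumP[e].
  (* Dividing by d + 1 absorbs the sum over the d coordinates of h. *)
  have near1 : \forall y \near x, V y /\ forall i, `|partial i f x - partial i f y| < e%:num / d.+1%:R.
    apply: filterI; first exact: open_nbhs_nbhs.
    apply: (@filter_forall _ _ (fun i => [set y | `|partial i f x - partial i f y| < e%:num / d.+1%:R]) (nbhs x)) => i.
    by have /cvgrPdist_lt := cf i; apply.
  have /nbhs_ballP[del /= del0 delP] := near1.
  have : \forall h \near (0 : E), `|h| < del / 2.
    apply/nbhs_ballP; exists (del / 2); rewrite //= ?divr_gt0// => y.
    by rewrite mx_norm_ball /= sub0r normrN.
  apply: filterS => h hd /=.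
  have ballh y : `|y| <= del / 2 -> ball x del (x + y).
    move=> yd; rewrite mx_norm_ball /= opprD addrA subrr sub0r normrN.
    by apply: le_lt_trans yd _; lra.
  have := @partial_increment f x h (del / 2) (e%:num / d.+1%:R).
  move=> H; rewrite (_ : (f \o shift x - _) h = f (x + h) - (f x + gradmap (grad f x) h)); last by rewrite [x + h]addrC.
  have {}H : `|f (x + h) - f x - gradmap (grad f x) h| <= e%:num / d.+1%:R * \sum_i `|h 0 i|.
    apply: H => [y yd i|y yd i|]; last exact: ltW.
      by apply: df; have [] := delP _ (ballh _ yd).
    by rewrite distrC ltW; have [_] := delP _ (ballh _ yd); exact.
  rewrite opprD addrA; apply: le_trans H _.
  apply: (@le_trans _ _ (e%:num / d.+1%:R * (d%:R * `|h|))).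
    apply: ler_wpM2l; first exact: ltW.
    have -> : d%:R * `|h| = \sum_(i < d) `|h| by rewrite sumr_const card_ord mulr_natl.
    by apply: ler_sum => i _; exact: mx_coord_le.
  rewrite mulrA ler_wpM2r// -mulrA ler_piMr// mulrC ler_pdivrMr// mul1r ler_nat//.
have cg := @gradmap_continuous (grad f x).
have dE := diff_unique cg key.
split => //; apply/diff_locallyP; rewrite dE; split => //.
Qed.

Lemma partial_near f g x i : (\near x, f x = g x) -> partial i f x = partial i g x.
Proof. by move=> fg; exact: near_eq_derive. Qed.

Lemma near_open_eq V f g x : open V -> V x -> (forall y, V y -> f y = g y) ->
  \near x, f x = g x.
Proof. by move=> oV Vx fg; apply: filterS (open_nbhs_nbhs (conj oV Vx)) => y; exact: fg. Qed.

Lemma continuous_near_eq f g x : (\near x, f x = g x) ->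
  {for x, continuous f} -> {for x, continuous g}.
Proof.
move=> fg cf; have fgx : f x = g x := nbhs_singleton fg.
suff : g @ x --> g x by [].
by rewrite -fgx; apply: cvg_trans (near_eq_cvg fg) cf.
Qed.

(** Coinduction principle for [smooth_on]: a class of continuous, partially differentiable functions
    that is stable under partial derivatives consists of smooth functions. Stability is asked only
    up to equality on V, where alone the values matter. *)
Lemma smooth_coind V (A : set (E -> R)) : open V ->
  (forall f, A f -> forall x, V x -> {for x, continuous f} /\
     forall i, derivable f x (e_ i)) ->
  (forall f, A f -> forall i, exists2 g, A g & forall x, V x -> partial i f x = g x) ->
  forall f, A f -> smooth_on V f.
Proof.
move=> oV A1 A2 f Af s.
have [g Ag fg] : exists2 g, A g & forall x, V x -> foldr (@partial R d) f s x = g x.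
  elim: s => [|i s [g Ag fg]] /=; first by exists f.
  have [g' Ag' gg'] := A2 g Ag i; exists g' => // x Vx.
  by rewrite -gg'//; apply: partial_near; exact: near_open_eq oV Vx fg.
move=> x Vx; have [cg dg] := A1 g Ag x Vx.
have gf : \near x, g x = foldr (@partial R d) f s x.
  by apply: near_open_eq oV Vx _ => y Vy; rewrite fg.
by split=> [|i]; [exact: continuous_near_eq gf cg|exact: near_eq_derivable gf (dg i)].
Qed.

Lemma smooth_continuous V f x : smooth_on V f -> V x -> {for x, continuous f}.
Proof. by move=> sf Vx; have [] := sf [::] x Vx. Qed.

Lemma smooth_derivable V f x i : smooth_on V f -> V x -> derivable f x (e_ i).
Proof. by move=> sf Vx; have [_] := sf [::] x Vx; exact. Qed.

Lemma smooth_partial V f i : smooth_on V f -> smooth_on V (partial i f).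
Proof. by move=> sf s; have := sf (rcons s i); rewrite foldr_rcons. Qed.

Lemma smooth_sub V W f : W `<=` V -> smooth_on V f -> smooth_on W f.
Proof. by move=> WV sf s x Wx; exact: sf (WV _ Wx). Qed.

Lemma smooth_eq V f g : open V -> (forall x, V x -> f x = g x) ->
  smooth_on V f -> smooth_on V g.
Proof.
move=> oV fg sf.
apply: (@smooth_coind V [set g | exists2 f, smooth_on V f & forall x, V x -> f x = g x]) => //; last by exists f.
  move=> k [h sh hk] x Vx; have hk' := near_open_eq oV Vx hk.
  split=> [|i]; first exact: (continuous_near_eq hk' (smooth_continuous sh Vx)).
  by apply: (near_eq_derivable hk'); exact: smooth_derivable sh Vx.
move=> h [k sk kh] i; exists (partial i k).
  by exists (partial i k); [exact: smooth_partial|by []].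
by move=> x Vx; apply: partial_near; apply: near_open_eq oV Vx _ => y Vy; rewrite kh.
Qed.

Lemma smooth_union V W f : smooth_on V f -> smooth_on W f -> smooth_on (V `|` W) f.
Proof. by move=> sV sW s x [Vx|Wx]; [exact: sV|exact: sW]. Qed.

Lemma partial_cst k i : partial i (fun=> k) = (fun=> 0) :> (E -> R).
Proof. by apply/funext => x; rewrite /partial derive_cst. Qed.

Lemma smooth_cst V k : open V -> smooth_on V (fun=> k).
Proof.
move=> oV; apply: (@smooth_coind V [set f | exists k, f = fun=> k]) => //; last by exists k.
  by move=> _ [c ->] x Vx; split=> [|i]; [exact: cst_continuous|exact: derivable_cst].
by move=> _ [c ->] i; exists (fun=> 0) => [|x _]; [exists 0|rewrite partial_cst].
Qed.

Lemma partialD f g x i : derivable f x (e_ i) -> derivable g x (e_ i) ->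
  partial i (fun y => f y + g y) x = partial i f x + partial i g x.
Proof. exact: deriveD. Qed.

Lemma partialM f g x i : derivable f x (e_ i) -> derivable g x (e_ i) ->
  partial i (fun y => f y * g y) x = f x * partial i g x + g x * partial i f x.
Proof. exact: deriveM. Qed.

Lemma smooth_differentiable V f x : open V -> smooth_on V f -> V x ->
  differentiable f x /\ 'd f x = gradmap (grad f x) :> (E -> R).
Proof.
move=> oV sf Vx; apply: (differentiable_C1 oV) => // [y Vy i|i].
  exact: smooth_derivable sf Vy.
by apply: smooth_continuous Vx; exact: smooth_partial.
Qed.

End SmoothCalculus.

Notation e_ := basis_vec.

Section SmoothComp.
Context {R : realType}.

Lemma differentiable_rV (W : normedModType R) d' (phi : W -> 'rV[R]_d') (x : W) :
  (forall j, differentiable (fun y => phi y 0 j) x) -> differentiable phi x.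
Proof.
move=> h.
have -> : phi = (fun y => \sum_j (phi y 0 j *: (delta_mx 0 j : 'rV[R]_d'))).
  by apply/funext => y; rewrite [LHS]row_sum_delta.
have -> : (fun y => \sum_j phi y 0 j *: (delta_mx 0 j : 'rV[R]_d')) =
   \sum_j (fun y => phi y 0 j *: (delta_mx 0 j : 'rV[R]_d')).
  by apply/funext => y; rewrite fct_sumE.
apply: differentiable_sum => j.
exact: differentiableZl; exact: h.
Qed.

Lemma chain_rule d d' (W : set 'rV[R]_d') (V : set 'rV[R]_d) (g : 'rV[R]_d' -> R)
    (phi : 'rV[R]_d -> 'rV[R]_d') (x : 'rV[R]_d) (i : 'I_d) :
  open V -> open W -> smooth_on W g -> (forall j, smooth_on V (fun y => phi y 0 j)) ->
  V x -> W (phi x) ->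
  differentiable (g \o phi) x /\
  partial i (g \o phi) x = \sum_j partial i (fun y => phi y 0 j) x * partial j g (phi x).
Proof.
move=> oV oW sg sphi Vx Wx.
have dphi : differentiable phi x.
  by apply: differentiable_rV => j; have [] := smooth_differentiable oV (sphi j) Vx.
have [dg dgE] := smooth_differentiable oW sg Wx.
have dc := differentiable_comp dphi dg; split => //.
rewrite /partial deriveE// diff_comp//= dgE; apply: eq_bigr => j _.
congr (_ * _); rewrite -deriveE// derive_mx ?mxE//.
exact: diff_derivable.
Qed.

(** Partial derivatives of products, inverses and composites mix all these operations, so smoothness
    is proved for all of them at once: this class is stable under partial derivatives up to equality
    on V and serves in [smooth_coind]. *)
Inductive smooth_alg d (V : set 'rV[R]_d) : ('rV[R]_d -> R) -> Prop :=
| smooth_alg_base f : smooth_on V f -> smooth_alg V f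
| smooth_algD f g : smooth_alg V f -> smooth_alg V g -> smooth_alg V (fun x => f x + g x)
| smooth_algM f g : smooth_alg V f -> smooth_alg V g -> smooth_alg V (fun x => f x * g x)
| smooth_algV f : smooth_alg V f -> (forall x, V x -> f x != 0) -> smooth_alg V (fun x => (f x)^-1)
| smooth_alg_comp d' (W : set 'rV[R]_d') (g : 'rV[R]_d' -> R) (phi : 'rV[R]_d -> 'rV[R]_d') : open W -> smooth_on W g ->
    (forall j, smooth_on V (fun y => phi y 0 j)) -> (forall x, V x -> W (phi x)) ->
    smooth_alg V (g \o phi).

Lemma smooth_alg_ok d (V : set 'rV[R]_d) f x : open V -> smooth_alg V f -> V x ->
  {for x, continuous f} /\ forall i, derivable f x (e_ i).
Proof.
move=> oV; elim=> {f} [f sf|f g _ IHf _ IHg|f g _ IHf _ IHg|f _ IHf f0|d' W g phi oW sg sphi VW] Vx.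
- by split=> [|i]; [exact: smooth_continuous sf Vx|exact: smooth_derivable sf Vx].
- have [cf df] := IHf Vx; have [cg dg] := IHg Vx.
  by split=> [|i]; [exact: continuousD|exact: derivableD].
- have [cf df] := IHf Vx; have [cg dg] := IHg Vx.
  by split=> [|i]; [exact: continuousM|exact: derivableM].
- have [cf df] := IHf Vx; split=> [|i]; first exact: (continuousV (f0 _ Vx)).
  by apply: derivableV => //; exact: f0.
- have dc i := (chain_rule i oV oW sg sphi Vx (VW _ Vx)).1.
  split=> [|i]; last by apply: diff_derivable; exact: dc.
  have c1 : {for x, continuous phi}.
    apply: differentiable_continuous; apply: differentiable_rV => j.
    by have [] := smooth_differentiable oV (sphi j) Vx.
  exact: continuous_comp c1 (smooth_continuous sg (VW _ Vx)).
Qed.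

Lemma smooth_alg_sum d (V : set 'rV[R]_d) I (r : seq I) (P : pred I) F : open V ->
  (forall i, P i -> smooth_alg V (F i)) -> smooth_alg V (fun x => \sum_(i <- r | P i) F i x).
Proof.
move=> oV h; elim: r => [|i r IH].
  rewrite (_ : (fun _ => _) = fun=> 0).
    by apply: smooth_alg_base; exact: smooth_cst.
  by apply/funext => x; rewrite big_nil.
have [Pi|Pi] := boolP (P i).
  rewrite (_ : (fun _ => _) = (fun x => F i x + \sum_(i <- r | P i) F i x)).
    by apply: smooth_algD => //; exact: h.
  by apply/funext => x; rewrite big_cons Pi.
rewrite (_ : (fun _ => _) = (fun x => \sum_(i <- r | P i) F i x)) //.
by apply/funext => x; rewrite big_cons (negbTE Pi).
Qed.

Lemma smooth_algP d (V : set 'rV[R]_d) f : open V -> smooth_alg V f -> smooth_on V f.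
Proof.
move=> oV; move: f; apply: (smooth_coind oV) => f sf; first by move=> x; exact: smooth_alg_ok.
move=> i; elim: sf => {f} [f sf|f g sf [f' sf' ff'] sg [g' sg' gg']|f g sf [f' sf' ff'] sg [g' sg' gg']|f sf [f' sf' ff'] f0|d' W g phi oW sg sphi VW].
- by exists (partial i f) => //; apply: smooth_alg_base; exact: smooth_partial.
- exists (fun x => f' x + g' x); first exact: smooth_algD.
  move=> x Vx; have [_ df] := smooth_alg_ok oV sf Vx; have [_ dg] := smooth_alg_ok oV sg Vx.
  by rewrite partialD// ff'// gg'.
- exists (fun x => f x * g' x + g x * f' x).
    by apply: smooth_algD; exact: smooth_algM.
  move=> x Vx; have [_ df] := smooth_alg_ok oV sf Vx; have [_ dg] := smooth_alg_ok oV sg Vx.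
  by rewrite partialM// ff'// gg'.
- exists (fun x => -1 * ((f x)^-1 * (f x)^-1 * f' x)).
    apply: smooth_algM; first by apply: smooth_alg_base; exact: smooth_cst.
    by apply: smooth_algM => //; apply: smooth_algM; exact: smooth_algV.
  move=> x Vx; have [_ df] := smooth_alg_ok oV sf Vx.
  rewrite /partial (deriveV (f0 _ Vx) (df i)).
  rewrite -ff'// -[LHS]/(- (f x) ^- 2 * partial i f x).
  by rewrite mulN1r mulNr invfM.
- exists (fun x => \sum_j partial i (fun y => phi y 0 j) x * partial j g (phi x)).
    apply: smooth_alg_sum => // j _; apply: smooth_algM.
      by apply: smooth_alg_base; exact: smooth_partial.
    exact: (@smooth_alg_comp _ _ d' W (partial j g) phi oW (smooth_partial j sg) sphi VW).
  by move=> x Vx; have [_] := chain_rule i oV oW sg sphi Vx (VW _ Vx).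
Qed.

Lemma smoothD d (V : set 'rV[R]_d) f g : open V -> smooth_on V f -> smooth_on V g ->
  smooth_on V (fun x => f x + g x).
Proof.
move=> oV sf sg; apply: (smooth_algP oV).
exact: (smooth_algD (smooth_alg_base sf) (smooth_alg_base sg)).
Qed.

Lemma smoothM d (V : set 'rV[R]_d) f g : open V -> smooth_on V f -> smooth_on V g ->
  smooth_on V (fun x => f x * g x).
Proof.
move=> oV sf sg; apply: (smooth_algP oV).
exact: (smooth_algM (smooth_alg_base sf) (smooth_alg_base sg)).
Qed.

Lemma smoothZ d (V : set 'rV[R]_d) k f : open V -> smooth_on V f ->
  smooth_on V (fun x => k * f x).
Proof. by move=> oV sf; exact: (smoothM oV (smooth_cst k oV) sf). Qed.

Lemma smooth_inv d (V : set 'rV[R]_d) f : open V -> smooth_on V f ->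
  (forall x, V x -> f x != 0) -> smooth_on V (fun x => (f x)^-1).
Proof.
move=> oV sf f0; apply: (smooth_algP oV).
exact: (smooth_algV (smooth_alg_base sf) f0).
Qed.

Lemma smooth_comp d d' (V : set 'rV[R]_d) (W : set 'rV[R]_d') (g : 'rV[R]_d' -> R)
    (phi : 'rV[R]_d -> 'rV[R]_d') : open V -> open W -> smooth_on W g ->
  (forall j, smooth_on V (fun y => phi y 0 j)) -> (forall x, V x -> W (phi x)) ->
  smooth_on V (g \o phi).
Proof.
move=> oV oW sg sphi VW; apply: (smooth_algP oV).
exact: smooth_alg_comp oW sg sphi VW.
Qed.

Lemma smooth_sum d (V : set 'rV[R]_d) I (r : seq I) (P : pred I) F : open V ->
  (forall i, P i -> smooth_on V (F i)) -> smooth_on V (fun x => \sum_(i <- r | P i) F i x).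
Proof.
move=> oV h; apply: (smooth_algP oV); apply: (smooth_alg_sum _ oV) => i Pi.
exact: (smooth_alg_base (h i Pi)).
Qed.

Lemma smooth_prod d (V : set 'rV[R]_d) I (r : seq I) (P : pred I) F : open V ->
  (forall i, P i -> smooth_on V (F i)) -> smooth_on V (fun x => \prod_(i <- r | P i) F i x).
Proof.
move=> oV h; elim: r => [|i r IH].
  rewrite (_ : (fun _ => _) = fun=> 1); first exact: smooth_cst.
  by apply/funext => x; rewrite big_nil.
have [Pi|Pi] := boolP (P i).
  rewrite (_ : (fun _ => _) = (fun x => F i x * \prod_(i <- r | P i) F i x)).
    exact: (smoothM oV (h i Pi) IH).
  by apply/funext => x; rewrite big_cons Pi.
rewrite (_ : (fun _ => _) = (fun x => \prod_(i <- r | P i) F i x)); first exact: IH.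
by apply/funext => x; rewrite big_cons (negbTE Pi).
Qed.

End SmoothComp.

(** * Test functions and integration by parts *)

Section TestFunctions.
Context {R : realType} {d : nat}.
Local Notation E := 'rV[R]_d.
Local Notation L := (@lebesgue_rV R d).
Local Notation lam := (@lebesgue_measure R).
Implicit Types (V : set E) (f g psi : E -> R).
Opaque smooth_on.

Lemma rV_hausdorff : hausdorff_space E.
Proof. exact: norm_hausdorff. Qed.

Lemma compact_borel (C : set E) : compact C -> measurable (C : set (borel E)).
Proof. by move=> cC; apply: closed_borel; apply: compact_closed => //; exact: rV_hausdorff. Qed.

(** f is smooth only on V, but the product vanishes off a compact C in V, and V together with the
    complement of C covers the space. *)
Lemma test_functionM V f psi : open V -> smooth_on V f -> test_function V psi ->
  test_function V (fun x => f x * psi x).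
Proof.
move=> oV sf [spsi [C [cC CV psi0]]]; split; last first.
  by exists C; split => // x Cx; rewrite psi0 ?mulr0.
have oC : open (~` C) by apply: closed_openC; apply: compact_closed => //; exact: rV_hausdorff.
apply: (@smooth_sub _ _ (V `|` ~` C)).
  by move=> x _; have [Cx|Cx] := pselect (C x); [left; exact: CV|right].
apply: smooth_union.
  by apply: (smoothM oV sf); exact: smooth_sub spsi.
apply: (@smooth_eq _ _ _ (fun=> 0)) => //; last exact: smooth_cst.
by move=> x Cx; rewrite psi0 ?mulr0.
Qed.

Lemma test_functionZ V k f : test_function V f -> test_function V (fun x => k * f x).
Proof.
move=> [sf [C [cC CV f0]]]; split; last by exists C; split => // x Cx; rewrite f0 ?mulr0.
exact: (smoothZ k openT sf).
Qed.

Lemma partial_out0 f (C : set E) i x : compact C -> (forall x, ~ C x -> f x = 0) ->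
  ~ C x -> partial i f x = 0.
Proof.
move=> cC f0 Cx.
have oC : open (~` C) by apply: closed_openC; apply: compact_closed => //; exact: rV_hausdorff.
rewrite (@partial_near _ _ f (fun=> 0)) ?partial_cst//.
by apply: (near_open_eq oC Cx) => y; exact: f0.
Qed.

Lemma test_function_partial V i f : test_function V f -> test_function V (partial i f).
Proof.
move=> [sf [C [cC CV f0]]]; split; first exact: smooth_partial.
by exists C; split => // x Cx; exact: partial_out0 f0 Cx.
Qed.

Lemma test_function_continuous V f : test_function V f -> continuous f.
Proof. by move=> [sf _] x; exact: (smooth_continuous sf). Qed.

Lemma test_function_sub V W f : V `<=` W -> test_function V f -> test_function W f.
Proof. by move=> VW [sf [C [cC CV f0]]]; split => //; exists C; split => // x /CV/VW. Qed.

Lemma compact_rect_bound (C : set E) : compact C ->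
  exists2 M : R, 0 < M & C `<=` open_rect (fun=> - M) (fun=> M).
Proof.
move=> /compact_bounded[M [_ hM]]; exists (`|M| + 1); first by rewrite ltr_pwDr.
move=> x Cx i; rewrite /= in_itv/= -ltr_norml.
apply: le_lt_trans (rV_coord_le _ _) _.
have /hM/(_ x Cx)/= : M < `|M| + 2^-1 by have := ler_norm M; lra.
by move=> h; apply: le_lt_trans h _; lra.
Qed.

Lemma test_function_bounded V f : test_function V f ->
  exists2 B : R, 0 <= B & forall x, `|f x| <= B.
Proof.
move=> tf; have cf := test_function_continuous tf.
have [_ [C [cC CV f0]]] := tf.
have /compact_bounded[M [_ hM]] : compact (f @` C).
  by apply: continuous_compact => //; exact: continuous_subspaceT.
exists (`|M| + 1); first by rewrite addr_ge0.
move=> x; have [Cx|Cx] := pselect (C x); last by rewrite f0// normr0.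
by apply: hM; [have := ler_norm M; lra|exists x].
Qed.

Lemma test_function_measurable V f : test_function V f ->
  measurable_fun setT (f : borel E -> R).
Proof.
by move=> tf; apply: (@borel_real_continuous R E setT f openT) => x _; exact: test_function_continuous tf x.
Qed.

Lemma compact_lty (C : set E) : compact C -> (L C < +oo)%E.
Proof.
move=> cC; have [M M0 CM] := compact_rect_bound cC.
apply: le_lt_trans (open_rect_lty (fun=> - M) (fun=> M)).
by apply: le_measure => //; rewrite inE; [exact: compact_borel|exact: measurable_open_rect].
Qed.

(** On each line in direction i the fundamental theorem of calculus gives the difference of two
    values of psi outside its support. *)
Lemma integral_partial0 V psi i : test_function V psi -> \int[L]_x partial i psi x = 0.
Proof.
move=> tp; have tpi := test_function_partial i tp.
have [B B0 hB] := test_function_bounded tpi.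
have [spsi [C [cC CV psi0]]] := tp.
have [M M0 CM] := compact_rect_bound cC.
rewrite /Rintegral (@integral_slice0 R d _ i B M)//.
- exact: test_function_measurable tpi.
- by move=> x nx; apply: partial_out0 cC psi0 _ => /CM.
move=> x.
pose F s := psi (upd x i s).
have updE s : upd x i s = upd x i 0 + s *: e_ i.
  apply/rowP => j; rewrite !mxE eqxx /=; case: eqP => _.
    by rewrite mulr1 add0r.
  by rewrite mulr0 addr0.
have dF (s : R) : is_derive s (1 : R) F (partial i psi (upd x i s)).
  rewrite /F (_ : (fun s => _) = (fun s => psi (upd x i 0 + s *: e_ i))); last first.
    by apply/funext => t; rewrite updE.
  rewrite (updE s); apply: is_derive_line; exact: (smooth_derivable spsi I).
have F0 s : M <= `|s| -> F s = 0.
  move=> Ms; apply: psi0 => /CM /(_ i); rewrite /= in_itv/= mxE eqxx -ltr_norml.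
  by rewrite ltNge Ms.
have dF0 s : M <= `|s| -> partial i psi (upd x i s) = 0.
  move=> Ms; apply: partial_out0 cC psi0 _ => /CM /(_ i).
  by rewrite /= in_itv/= mxE eqxx -ltr_norml ltNge Ms.
have M2 : - M < M by lra.
have cF : continuous F by move=> s; apply/differentiable_continuous/derivable1_diffP; have [] := dF s.
have cdF : continuous (fun s => partial i psi (upd x i s)).
  move=> s; apply: (@continuous_comp _ _ _ (upd x i) (partial i psi)); last first.
    exact: test_function_continuous tpi _.
  apply: differentiable_continuous; apply: differentiable_rV => j.
  rewrite (_ : (fun y => _) = (fun y => if j == i then y else x 0 j)); last by apply/funext => y; rewrite mxE.
  by case: eqP.
transitivity (\int[lam]_(s in `[(- M)%R, M]) (partial i psi (upd x i s))%:E)%E.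
  rewrite integral_mkcond [RHS]integral_mkcond; apply: eq_integral => s _.
  rewrite !patchE in_setT; case: ifPn => // /negP h; rewrite dF0//.
  apply: contrapT => hs; apply: h; rewrite inE /= in_itv/= -ler_norml.
  by move/negP: hs; rewrite -ltNge => /ltW.
rewrite (@continuous_FTC2 R (fun s => partial i psi (upd x i s)) F)//.
- by rewrite ?F0 ?subee// ?normrN ger0_norm// ltW.
- exact: continuous_subspaceT.
- split=> [s _||]; first by have [] := dF s.
    by apply: cvg_at_right_filter; exact: cF.
  by apply: cvg_at_left_filter; exact: cF.
- by move=> s _; rewrite derive1E; have [_ ->] := dF s.
Qed.

Lemma test_function_integrable V f : test_function V f -> L.-integrable setT (EFin \o f).
Proof.
move=> tf; have [B B0 hB] := test_function_bounded tf.
have [_ [C [cC CV f0]]] := tf; have mC := compact_borel cC.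
apply: (integrable_supp (C := C : set (borel E))) => //.
apply: measurable_bounded_integrable => //; first exact: compact_lty.
  by apply: measurable_funTS; exact: test_function_measurable tf.
by exists B; split; [exact: num_real|move=> y By x _ /=; apply: le_trans (ltW By)].
Qed.

Lemma rV_integration_by_parts V f psi i : open V -> smooth_on V f -> test_function V psi ->
  \int[L]_(x in V) (f x * partial i psi x) = - \int[L]_(x in V) (partial i f x * psi x).
Proof.
move=> oV sf tp; have t1 := test_functionM oV sf (test_function_partial i tp).
have t2 := test_functionM oV (smooth_partial i sf) tp.
have t3 := test_functionM oV sf tp.
have [spsi [C [cC CV psi0]]] := tp.
have VE g : (forall x, ~ C x -> g x = 0) -> \int[L]_(x in V) g x = \int[L]_x g x.
  by move=> g0; rewrite (Rint_supp (C := (V : set (borel E))) (D := setT)) // => x Vx; apply: g0 => /CV.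
rewrite !VE; last 2 first.
- by move=> x Cx; rewrite psi0 ?mulr0.
- by move=> x Cx; rewrite (partial_out0 i cC psi0 Cx) mulr0.
apply/eqP; rewrite -subr_eq0 opprK -RintegralD//; last 2 first.
- exact: test_function_integrable t1.
- exact: test_function_integrable t2.
suff key : forall x : E, f x * partial i psi x + partial i f x * psi x =
    partial i (fun y => f y * psi y) x.
  by rewrite -(integral_partial0 i t3); apply/eqP/eq_Rintegral => x _; exact: key.
move=> x; have [Cx|Cx] := pselect (C x).
  rewrite (partialM (smooth_derivable sf (CV _ Cx)) (smooth_derivable spsi I)).
  by congr (_ + _); rewrite mulrC.
rewrite psi0// (partial_out0 i cC psi0 Cx) !mulr0 addr0.
by rewrite (@partial_out0 _ C)// => y Cy; rewrite psi0// mulr0.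
Qed.

End TestFunctions.

Section Tower.
Context {R : realType}.

(** A function of one variable comes together with all its derivatives, so that smoothness and
    iterated partials of [F 0 (x 0 i)] are explicit. *)
Definition tower (F : nat -> R -> R) := forall n t, is_derive t (1 : R) (F n) (F n.+1 t).

Lemma tower_shift F n : tower F -> tower (fun k => F (n + k)%N).
Proof. by move=> tF k t; rewrite addnS; exact: tF. Qed.

Lemma tower_continuous F n : tower F -> continuous (F n).
Proof. by move=> tF t; apply/differentiable_continuous/derivable1_diffP; have [] := tF n t. Qed.

Lemma tower_affine F a b : tower F -> tower (fun n t => a ^+ n * F n (a * t + b)).
Proof.
move=> tF n t; have h1 : is_derive t 1 (fun t : R => a * t + b) a.
  have d1 : is_derive t 1 (a *: (id : R -> R)) (a *: 1) := is_deriveZ a (is_derive_id t 1).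
  have d2 : is_derive t 1 (cst b) 0 := is_derive_cst b t 1.
  have := is_deriveD d1 d2; rewrite addr0 [a *: 1]mulr1.
  by rewrite (_ : a *: id + cst b = fun t0 : R => a * t0 + b).
have h2 := @is_derive1_comp R (F n) (fun t : R => a * t + b) t _ _ (tF n (a * t + b)) h1.
have h3 := is_deriveZ (a ^+ n) h2.
rewrite (_ : a ^+ n.+1 * _ = a ^+ n *: (F n.+1 (a * t + b) * a)); first exact: h3.
by rewrite /GRing.scale/= exprSr; ring.
Qed.

Context {d : nat}.
Local Notation E := 'rV[R]_d.

Lemma partial_tower F n (i j : 'I_d) (x : E) : tower F ->
  derivable (fun y : E => F n (y 0 i)) x (e_ j) /\
  partial j (fun y : E => F n (y 0 i)) x = if j == i then F n.+1 (x 0 i) else 0.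
Proof.
move=> tF; have := tF n (x 0 i).
have eqf : (fun h : R => h^-1 *: (F n ((h *: (e_ j : E) + x) 0 i) - F n (x 0 i))) =
  (fun h : R => h^-1 *: (F n (h *: ((j == i)%:R) + x 0 i) - F n (x 0 i))).
  by apply/funext => h; rewrite !mxE eq_sym.
case: (eqVneq j i) => [_|ji] in eqf * => /= Fd.
  by have [d1 d2] := Fd; rewrite /derivable/partial/derive eqf.
have eq0 : (fun h : R => h^-1 *: (F n (h *: (false%:R) + x 0 i) - F n (x 0 i))) = fun=> 0.
  by apply/funext => h; rewrite scaler0 add0r subrr scaler0.
rewrite /derivable/partial/derive eqf eq0; split; first exact: is_cvg_cst.
exact: lim_cst.
Qed.

Lemma smooth_tower F (i : 'I_d) : tower F -> smooth_on [set: E] (fun x : E => F 0%N (x 0 i)).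
Proof.
move=> tF; pose A := [set f : E -> R | exists n, exists c, f = fun x : E => c * F n (x 0 i)].
have cA : forall n c, smooth_on [set: E] (fun x : E => c * F n (x 0 i)).
  move=> n c; apply: (@smooth_coind _ _ _ A openT); last by exists n, c.
    move=> _ [k [b ->]] x _; split=> [|j].
      apply: (continuousM (@cst_continuous _ _ b _ )).
      apply: continuous_comp.
        exact: continuous_coord.
      exact: tower_continuous.
    by apply: derivableM; [exact: derivable_cst|have [] := partial_tower k i j x tF].
  move=> _ [k [b ->]] j; exists (fun x => (if j == i then b else 0) * F k.+1 (x 0 i)).
    by exists k.+1, (if j == i then b else 0).
  move=> x _; have [d1 d2] := partial_tower k i j x tF.
  rewrite (partialM (@derivable_cst _ _ _ b x _) d1) partial_cst mulr0 addr0 d2.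
  by case: eqP; rewrite ?mulr0 ?mul0r.
apply: (smooth_eq openT _ (cA 0%N 1)) => x _; by rewrite mul1r.
Qed.

End Tower.

(** * The flat function exp(-1/t) and its derivatives *)

Section FlatExp.
Context {R : realType}.

(** The polynomial factor makes the class closed under differentiation; p = 1 is the standard flat
    function. *)
Definition flat_exp (p : {poly R}) (t : R) : R :=
  if 0 < t then p.[t^-1] * expR (- t^-1) else 0.

(** The derivative of p(1/t) exp(-1/t) is t^-2 (p - p')(1/t) exp(-1/t). *)
Definition flat_next (p : {poly R}) : {poly R} := 'X^2 * (p - p^`()).

Lemma horner_bound (p : {poly R}) (s : R) : 1 <= s ->
  `|p.[s]| <= (\sum_(i < size p) `|p`_i|) * s ^+ size p.
Proof.
move=> s1; rewrite horner_coef mulr_suml; apply: le_trans (ler_norm_sum _ _ _) _.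
apply: ler_sum => i _; rewrite normrM ler_wpM2l// ger0_norm ?exprn_ge0//; last by lra.
by apply: ler_weXn2l => //; exact: ltnW.
Qed.

(** With m + 1 = size p + 2, the term s^(m+1)/(m+1)! of the exponential series beats p and leaves
    s^-2; at s = 1/h this makes the difference quotient at 0 of order h. *)
Lemma horner_exp_bound (p : {poly R}) : exists2 C : R, 0 <= C &
  forall s, 1 <= s -> `|p.[s] * expR (- s)| <= C / s ^+ 2.
Proof.
pose m := (size p).+1; pose c := \sum_(i < size p) `|p`_i|.
exists (c * m.+1`!%:R); first by rewrite mulr_ge0// sumr_ge0.
move=> s s1; have s0 : 0 < s by lra.
rewrite normrM (ger0_norm (expR_ge0 _)) expRN.
have e1 : s ^+ m.+1 / m.+1`!%:R <= expR s.
  by apply: le_trans (expR_ge1Dxn m (ltW s0)); rewrite lerDr.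
have f0 : 0 < m.+1`!%:R :> R by rewrite ltr0n fact_gt0.
rewrite ler_pdivrMr ?expR_gt0//.
apply: le_trans (horner_bound p s1) _; rewrite -/c.
have c0 : 0 <= c by apply: sumr_ge0.
apply: le_trans (_ : c * m.+1`!%:R / s ^+ 2 * (s ^+ m.+1 / m.+1`!%:R) <= _); last first.
  by rewrite ler_wpM2l// divr_ge0 ?mulr_ge0 ?exprn_ge0// ltW.
have -> : s ^+ m.+1 = s ^+ 2 * s ^+ size p by rewrite -exprD.
by apply: le_of_eq; field; rewrite ?gt_eqF ?gt_eqF.
Qed.

Lemma flat_exp_derive (p : {poly R}) (t : R) :
  is_derive t (1 : R) (flat_exp p) (flat_exp (flat_next p) t).
Proof.
have [t0|t0|t0] := ltrgtP t 0.
- rewrite /flat_exp ltNge (ltW t0)/=.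
  have d0 : is_derive t 1 (cst (0 : R)) 0 := is_derive_cst 0 t 1.
  apply: near_eq_is_derive d0.
  near=> u; have u0 : u < 0 by near: u; exact: lt_nbhsl.
  by rewrite ltNge ltW.
- have hi : is_derive t 1 (fun u : R => u^-1) (- t ^- 2).
    have tn : t != 0 by rewrite gt_eqF.
    have di : derivable (id : R -> R) t 1 by exact: derivable_id.
    split; first exact: derivableV.
    by rewrite (deriveV (f := id) tn di) derive_id /GRing.scale/= mulr1.
  have hp := @is_derive1_comp R (horner p) (fun u : R => u^-1) t _ _ (is_derive_poly p _) hi.
  have he := @is_derive1_comp R expR (fun u : R => - u^-1) t _ _ (is_derive_expR _) (is_deriveN hi).
  have hm := is_deriveM hp he.
  apply: near_eq_is_derive.
    near=> u; have u0 : 0 < u by near: u; exact: lt_nbhsr.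
    by rewrite /flat_exp u0.
  set l := (X in is_derive _ _ _ X) in hm.
  suff -> : flat_exp (flat_next p) t = l by exact: hm.
  rewrite /l /flat_exp t0 hornerM hornerXn hornerD hornerN /GRing.scale/= exprVn.
  by ring.
rewrite t0; have -> : flat_exp (flat_next p) 0 = 0 by rewrite /flat_exp ltxx.
have [C C0 hC] := horner_exp_bound p.
(* The quotient is at most C h for small h > 0 and vanishes for h < 0. *)
have cv : (h^-1 *: (flat_exp p (h *: 1 + 0) - flat_exp p 0)) @[h --> (0)^'] --> 0.
  apply/cvgrPdist_lt => e e0.
  near=> h.
  rewrite sub0r normrN addr0 [h *: 1]mulr1 {2}/flat_exp ltxx subr0 /flat_exp.
  case: ifP => [h0|_]; last by rewrite scaler0 normr0.
  have h1 : 1 <= h^-1.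
    rewrite invf_ge1// ltW//; near: h; apply: nbhs_dnbhs; exact: lt_nbhsl.
  rewrite normrM (ger0_norm (ltW _)) ?invr_gt0//.
  apply: le_lt_trans (_ : h^-1 * (C / h^-1 ^+ 2) < e); first by rewrite ler_wpM2l ?hC// invr_ge0 ltW.
  have -> : h^-1 * (C / h^-1 ^+ 2) = C * h by field; rewrite gt_eqF.
  apply: le_lt_trans (_ : (C + 1) * h < e); first by rewrite ler_pM2r// lerDl.
  rewrite mulrC -ltr_pdivlMr; last by lra.
  near: h; apply: nbhs_dnbhs; apply: lt_nbhsl; rewrite divr_gt0; lra.
split; first by apply/cvg_ex; exists 0.
exact: cvg_lim.
Unshelve. all: by end_near. Qed.

Definition flat_tower (n : nat) : R -> R := flat_exp (iter n flat_next 1%:P).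

Lemma tower_flat : tower flat_tower.
Proof. by move=> n t; exact: flat_exp_derive. Qed.

Lemma flat_towerE t : flat_tower 0 t = if 0 < t then expR (- t^-1) else 0.
Proof. by rewrite /flat_tower /flat_exp/= hornerC mul1r. Qed.

Lemma flat_tower_ge0 t : 0 <= flat_tower 0 t.
Proof. by rewrite flat_towerE; case: ifP => // _; exact: expR_ge0. Qed.

Lemma flat_tower_le1 t : flat_tower 0 t <= 1.
Proof.
rewrite flat_towerE; case: ifP => // t0.
by rewrite -expR0 ler_expR oppr_le0 invr_ge0 ltW.
Qed.

Lemma flat_tower_gt0 t : 0 < t -> 0 < flat_tower 0 t.
Proof. by move=> t0; rewrite flat_towerE t0 expR_gt0. Qed.

Lemma flat_tower_le0 t : t <= 0 -> flat_tower 0 t = 0.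
Proof. by move=> t0; rewrite flat_towerE ltNge t0. Qed.

Lemma flat_tower_mono s t : s <= t -> flat_tower 0 s <= flat_tower 0 t.
Proof.
move=> st; rewrite !flat_towerE; case: ifPn => s0; last first.
  by case: ifP => // _; exact: expR_ge0.
rewrite (lt_le_trans s0 st) ler_expR lerN2 lef_pV2//.
exact: lt_le_trans s0 st.
Qed.

End FlatExp.

Lemma ae_imp disp (T : measurableType disp) (R : realType)
    (mu : {measure set T -> \bar R}) (P Q : T -> Prop) :
  (forall x, P x -> Q x) -> {ae mu, forall x, P x} -> {ae mu, forall x, Q x}.
Proof. by move=> PQ; apply: filterS. Qed.

Lemma ae_imp2 disp (T : measurableType disp) (R : realType)
    (mu : {measure set T -> \bar R}) (P Q S : T -> Prop) :
  (forall x, P x -> Q x -> S x) -> {ae mu, forall x, P x} -> {ae mu, forall x, Q x} ->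
  {ae mu, forall x, S x}.
Proof. by move=> h; apply: filterS2. Qed.

(** * The du Bois-Reymond lemma *)

Section DuBoisReymond.
Context {R : realType} {d : nat}.
Local Notation E := 'rV[R]_d.
Local Notation L := (@lebesgue_rV R d).
Implicit Types (V : set E) (a b : 'I_d -> R).
Opaque smooth_on.

Definition closed_rect a b : set E := [set x | forall i, a i <= x 0 i <= b i].

Lemma compact_closed_rect a b : compact (closed_rect a b).
Proof.
have := @rV_compact R d (fun i => `[a i, b i]%classic) (fun i => @segment_compact _ _ _).
by congr compact; apply/seteqP; split => x h i; have := h i; rewrite in_itv.
Qed.

Lemma open_rect_closed a b : open_rect a b `<=` closed_rect a b.
Proof. by move=> x h i; have := h i; rewrite /= => /andP[/ltW-> /ltW->]. Qed.

(* Smooth, positive exactly on the open rectangle, and increasing with [n] to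
   its indicator function. *)
Definition rect_bump (n : R) a b (x : E) : R :=
  \prod_i (flat_tower 0 (n * x 0 i + - (n * a i)) * flat_tower 0 (- n * x 0 i + n * b i)).

Lemma rect_bump_smooth n a b : smooth_on setT (rect_bump n a b).
Proof.
apply: (smooth_prod _ openT) => i _; apply: (smoothM openT).
  apply: smooth_eq openT _ (smooth_tower i (tower_affine n (- (n * a i)) tower_flat)) => x _.
  by rewrite mul1r.
apply: smooth_eq openT _ (smooth_tower i (tower_affine (- n) (n * b i) tower_flat)) => x _.
by rewrite mul1r.
Qed.

Lemma rect_bump_ge0 n a b x : 0 <= rect_bump n a b x.
Proof. by apply: prodr_ge0 => i _; rewrite mulr_ge0// flat_tower_ge0. Qed.

Lemma rect_bump_le1 n a b x : rect_bump n a b x <= 1.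
Proof.
suff /andP[] : 0 <= rect_bump n a b x <= 1 by [].
rewrite /rect_bump; elim/big_ind : _ => [|u v /andP[u0 u1] /andP[v0 v1]|i _].
- by rewrite ler01 lexx.
- by rewrite mulr_ge0//= mulr_ile1.
- by rewrite mulr_ge0 ?flat_tower_ge0//= mulr_ile1 ?flat_tower_ge0 ?flat_tower_le1.
Qed.

Lemma rect_bump_gt0 n a b x : 0 < n -> open_rect a b x -> 0 < rect_bump n a b x.
Proof.
move=> n0 xab; apply: prodr_gt0 => i _; have := xab i; rewrite /= => /andP[ax xb].
rewrite mulr_gt0// flat_tower_gt0//; first by rewrite -mulrBr mulr_gt0// subr_gt0.
by rewrite mulNr addrC -mulrBr mulr_gt0// subr_gt0.
Qed.

Lemma rect_bump_out n a b x : 0 <= n -> ~ open_rect a b x -> rect_bump n a b x = 0.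
Proof.
move=> n0 /existsNP[i]; rewrite /= => /negP; rewrite negb_and -!leNgt => h.
rewrite /rect_bump (bigD1 i)//=; apply/eqP; rewrite !mulf_eq0; apply/orP; left; apply/orP.
case/orP: h => h; [left|right]; apply/eqP; apply: flat_tower_le0.
  by rewrite -mulrBr mulr_ge0_le0// subr_le0.
by rewrite mulNr addrC -mulrBr mulr_ge0_le0// subr_le0.
Qed.

Lemma rect_bump_test V n a b : 0 <= n -> closed_rect a b `<=` V ->
  test_function V (rect_bump n a b).
Proof.
move=> n0 abV; split; first exact: rect_bump_smooth.
exists (closed_rect a b); split => //; first exact: compact_closed_rect.
by move=> x xab; apply: rect_bump_out => // /open_rect_closed.
Qed.

Lemma flat_tower_cvg1 (s : R) : 0 < s -> flat_tower 0 (n.+1%:R * s) @[n --> \oo] --> (1 : R).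
Proof.
move=> s0; have h : - (n.+1%:R * s)^-1 @[n --> \oo] --> 0.
  rewrite -oppr0; apply: cvgN.
  under eq_fun do rewrite invfM.
  rewrite -(mul0r s^-1); apply: cvgM; last exact: cvg_cst.
  exact: cvg_harmonic.
have H := cvg_comp _ _ h (@continuous_expR R 0); rewrite expR0 in H.
apply: cvg_trans H; apply: near_eq_cvg; apply: nearW => n /=.
by rewrite flat_towerE mulr_gt0.
Qed.

Lemma rect_bump_cvg a b x :
  rect_bump n.+1%:R a b x @[n --> \oo] --> (\1_(open_rect a b) x : R).
Proof.
rewrite indicE; have [xab|xab] := pselect (open_rect a b x); last first.
  rewrite memNset//; apply: cvg_near_cst; apply: nearW => n.
  exact: rect_bump_out.
rewrite mem_set//= -[1%:R](_ : \prod_(i < d) (1 * 1) = 1); last first.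
  by rewrite big1// => i _; rewrite mulr1.
have mc : continuous (fun x : R * R => x.1 * x.2) := @mul_continuous R.
rewrite /rect_bump; apply: (cvg_big mc).
move=> i _; have := xab i; rewrite /= => /andP[ax xb].
apply: cvgM.
  under eq_fun do rewrite -mulrBr.
  by apply: flat_tower_cvg1; rewrite subr_gt0.
under eq_fun do rewrite mulNr addrC -mulrBr.
by apply: flat_tower_cvg1; rewrite subr_gt0.
Qed.

(** Only the bumps serve as test functions: in the proof of [schwarz] their mixed derivatives are
    already known to commute, while those of general test functions are not. *)
Lemma du_bois_reymond_bump V (w : E -> R) : open V -> locally_integrable_on V w ->
  (forall n a b, closed_rect a b `<=` V ->
     \int[L]_(x in V) (w x * rect_bump n.+1%:R a b x) = 0) ->
  {ae L, forall x, V x -> w x = 0}.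
Proof.
move=> oV wi w0.
(* Dominated convergence: the bumps are bounded by 1 and converge to the indicator of the open
   rectangle. *)
have zero a b : closed_rect a b `<=` V -> \int[L]_(x in open_rect a b) w x = 0.
  move=> abV.
  have mC : measurable (closed_rect a b : set (borel E)) by apply: compact_borel; exact: compact_closed_rect.
  have wiC : L.-integrable (closed_rect a b) (EFin \o w) by apply: wi => //; exact: compact_closed_rect.
  have mw : measurable_fun (closed_rect a b : set (borel E)) w by apply/measurable_EFinP; exact: measurable_int wiC.
  have mn n : measurable_fun (closed_rect a b : set (borel E)) (rect_bump n.+1%:R a b).
    by apply: measurable_funTS; apply: test_function_measurable; exact: (@rect_bump_test setT).
  have h1 n : measurable_fun (closed_rect a b : set (borel E)) (fun x => (w x * rect_bump n.+1%:R a b x)%:E).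
    by apply/measurable_EFinP; apply: measurable_funM => //; exact: mn.
  have h2 : measurable_fun (closed_rect a b : set (borel E)) (fun x => (w x * \1_(open_rect a b) x)%:E).
    apply/measurable_EFinP; apply: measurable_funM => //.
    by apply: measurable_indic; exact: measurable_open_rect.
  have h3 : {ae L, forall x, closed_rect a b x -> (w x * rect_bump n.+1%:R a b x)%:E @[n --> \oo] --> (w x * \1_(open_rect a b) x)%:E}.
    apply: aeW => x _; apply: cvg_EFin; first exact: nearW.
    by apply: cvgM; [exact: cvg_cst|exact: rect_bump_cvg].
  have h4 : L.-integrable (closed_rect a b) (fun x => `|(w x)%:E|)%E by exact: integrable_abse.
  have h5 : {ae L, forall x n, closed_rect a b x -> (`|(w x * rect_bump n.+1%:R a b x)%:E| <= `|(w x)%:E|)%E}.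
    apply: aeW => x n _; rewrite lee_fin normrM ler_piMr//.
    by rewrite ger0_norm ?rect_bump_ge0// rect_bump_le1.
  have [_ _] := dominated_convergence mC h1 h2 h3 h4 h5.
  have n0 n : (\int[L]_(x in closed_rect a b) (w x * rect_bump n.+1%:R a b x)%:E = 0)%E.
    have := w0 n a b abV.
    rewrite (Rint_supp (C := (closed_rect a b)) (D := (V : set (borel E)))) //; last first.
      by move=> x xab; rewrite rect_bump_out ?mulr0// => /open_rect_closed.
    rewrite /Rintegral => h; rewrite -[LHS]fineK ?h//.
    apply: integrable_fin_num => //.
    apply: eq_integrable (integrable_bounded_mul (M := 1) mC (mn n) _ wiC) => //.
      by move=> x _ /=; rewrite mulrC.
    by move=> x _; rewrite ger0_norm ?rect_bump_ge0// rect_bump_le1.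
  under eq_fun do rewrite n0.
  move=> /cvg_lim; rewrite lim_cst// => /(_ (@ereal_hausdorff R)) h.
  rewrite /Rintegral integral_mkcond.
  rewrite (_ : integral _ _ _ = 0%E)// h [RHS]integral_mkcond; apply: eq_integral => x _.
  rewrite !patchE indicE; case: ifPn => xab; last by case: ifP => _ //; rewrite mulr0.
  by rewrite mulr1 mem_set//; apply: open_rect_closed; rewrite inE in xab.
suff H (qn : 'rV[rat]_d * nat) : {ae L, forall x, (rat_box qn.1 qn.2 x /\ rat_cbox qn.1 qn.2 `<=` V) -> w x = 0}.
  have : {ae L, forall x, forall k : nat, forall qn, unpickle k = Some qn -> (rat_box qn.1 qn.2 x /\ rat_cbox qn.1 qn.2 `<=` V) -> w x = 0}.
    apply/ae_foralln => k; case: (unpickle k) => [qn|]; last exact: aeW.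
    by apply: ae_imp (H qn) => x hx qn' [<-].
  apply: ae_imp => x hx Vx; move: (Vx); rewrite {1}(open_rat_box oV) => -[qn _ h].
  exact: (hx (pickle qn) qn (pickleK qn) h).
have [h|h] := pselect (rat_cbox qn.1 qn.2 `<=` V); last by apply: aeW => x [].
pose a i : R := ratr (qn.1 0 i) - qn.2.+1%:R^-1; pose b i : R := ratr (qn.1 0 i) + qn.2.+1%:R^-1.
have abV : closed_rect a b `<=` V.
  by move=> x xab; apply: h => i; rewrite ler_distl; exact: xab.
have boxE x : rat_box qn.1 qn.2 x -> open_rect a b x.
  by move=> hx i; rewrite /= in_itv/= -ltr_distl; exact: hx.
have mC : measurable (closed_rect a b : set (borel E)) by apply: compact_borel; exact: compact_closed_rect.
have wiC : L.-integrable (closed_rect a b) (EFin \o w) by apply: wi => //; exact: compact_closed_rect.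
have mab := measurable_open_rect a b.
(* Extended by 0 from one box to the whole space, w meets the hypotheses of [ae0_open_rect];
   intersections of rectangles with the box stay inside V. *)
pose hh := w \_ (open_rect a b).
have [M M0 hM] := compact_rect_bound (@compact_closed_rect a b).
have hi : L.-integrable setT (EFin \o hh).
  have := integrableS mC mab (@open_rect_closed a b) wiC.
  by rewrite integrable_mkcond// restrict_EFin.
have : {ae L, forall x, hh x = 0}.
  apply: (ae0_open_rect (M := M) hi).
    move=> x nx; rewrite /hh patchE; case: ifPn => // xab; case: nx; apply: hM.
    by apply: open_rect_closed; rewrite inE in xab.
  move=> a' b'; rewrite -Rintegral_mkcondr setIC open_rectI; apply: zero => x hx.
  by apply: abV => i; have := hx i; rewrite ge_max le_min => /andP[/andP[-> _] /andP[-> _]].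
apply: filterS => x hx [xab _]; move: hx.
by rewrite /hh patchE mem_set//; exact: boxE.
Qed.

Lemma du_bois_reymond V (w : E -> R) : open V -> locally_integrable_on V w ->
  (forall psi, test_function V psi -> \int[L]_(x in V) (w x * psi x) = 0) ->
  {ae L, forall x, V x -> w x = 0}.
Proof.
by move=> oV wi w0; apply: du_bois_reymond_bump => // n a b abV; apply: w0; exact: rect_bump_test.
Qed.

(** Nonempty open sets contain a cube, hence have positive measure. *)
Lemma ae_open_nonempty (P : E -> Prop) V x : {ae L, forall x, P x} -> open V -> V x ->
  exists2 y, V y & P y.
Proof.
move=> aeP oV Vx; apply: contrapT => h.
have [e e0 eV] := open_ball_sub oV Vx.
pose a i := x 0 i - e; pose b i := x 0 i + e.
have abV : open_rect a b `<=` V.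
  move=> y hy; apply: eV; apply/(rV_ballP _ _ e0) => i; have := hy i.
  by rewrite /= in_itv/= -ltr_distl distrC.
have [N [mN N0 PN]] := aeP.
have : (L (open_rect a b) <= L N)%E.
  apply: le_measure; rewrite ?inE//; first exact: measurable_open_rect.
  by move=> y /abV Vy; apply: PN => Py; apply: h; exists y.
rewrite N0 lebesgue_rV_rect; last by move=> j; exact: measurable_itv.
apply/negP; rewrite -ltNge.
have -> : (\prod_i lebesgue_measure (`]a i, b i[%classic : set R) = \prod_(i < d) ((2 * e)%R)%:E)%E.
  apply: eq_bigr => i _; rewrite lebesgue_measure_itv/= lte_fin /a /b ifT; last by lra.
  by rewrite -EFinB; congr (_%:E); ring.
by rewrite prodEFin; apply: prodr_gt0 => i _; lra.
Qed.

Lemma ae_continuous_eq0 V (f : E -> R) : open V -> (forall x, V x -> {for x, continuous f}) ->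
  {ae L, forall x, V x -> f x = 0} -> forall x, V x -> f x = 0.
Proof.
move=> oV cf aef x Vx; apply: contrapT => /eqP fx.
have oW : open (V `&` f @^-1` [set t | t != 0]).
  by apply: continuous_open_preimage => //; exact: open_neq.
have [y [Vy /= /eqP fy] h] := ae_open_nonempty aef oW (conj Vx fx).
by apply: fy; exact: h.
Qed.

End DuBoisReymond.

(** * Symmetry of second derivatives *)

Section Schwarz.
Context {R : realType} {d : nat}.
Local Notation E := 'rV[R]_d.
Local Notation L := (@lebesgue_rV R d).
Implicit Types (V : set E) (f g : E -> R).
Opaque smooth_on partial Rintegral.

(** This property is stable under products and clear for functions of one coordinate, hence holds
    for the bumps: the seed for [schwarz]. *)
Let sym f := smooth_on setT f /\
  forall i j x, partial i (partial j f) x = partial j (partial i f) x.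

Let symM f g : sym f -> sym g -> sym (fun x => f x * g x).
Proof.
move=> [sf hf] [sg hg]; split; first exact: smoothM openT sf sg.
have pM k : partial k (fun x => f x * g x) = (fun x => f x * partial k g x + g x * partial k f x).
  by apply/funext => x; exact: (partialM (smooth_derivable sf I) (smooth_derivable sg I)).
have ppM k l x : partial k (partial l (fun x => f x * g x)) x =
   f x * partial k (partial l g) x + partial l g x * partial k f x +
   (g x * partial k (partial l f) x + partial l f x * partial k g x).
  rewrite pM.
  have s1 := smooth_partial l sg; have s2 := smooth_partial l sf.
  rewrite (partialD (smooth_derivable (smoothM openT sf s1) I) (smooth_derivable (smoothM openT sg s2) I)).
  rewrite (partialM (smooth_derivable sf I) (smooth_derivable s1 I)).
  by rewrite (partialM (smooth_derivable sg I) (smooth_derivable s2 I)).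
move=> i j x; rewrite ppM ppM hf hg.
move: (partial i f x) (partial j f x) (partial i g x) (partial j g x) (f x) (g x)
  (partial j (partial i f) x) (partial j (partial i g) x) => a b c e u v w z.
by ring.
Qed.

Let sym_tower F (k : 'I_d) : tower F -> sym (fun x : E => F 0%N (x 0 k)).
Proof.
move=> tF; split; first exact: smooth_tower.
have p1 n j : partial j (fun x : E => F n (x 0 k)) = (fun x : E => if j == k then F n.+1 (x 0 k) else 0).
  by apply/funext => x; have [_ ->] := partial_tower n k j x tF.
move=> i j x; rewrite !p1.
case: (eqVneq j k) => [->|jk]; case: (eqVneq i k) => [->|ik]; rewrite ?p1 ?(negbTE ik) ?(negbTE jk) ?partial_cst//.
Qed.

Let sym_bump n a b : sym (rect_bump n a b).
Proof.
rewrite /rect_bump; elim: (index_enum _) => [|i r IH].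
  rewrite (_ : (fun _ => _) = fun=> 1); last by apply/funext => x; rewrite big_nil.
  by split => [|i j x]; [exact: smooth_cst _ openT|rewrite !partial_cst].
have h1 := sym_tower i (tower_affine n (- (n * a i)) tower_flat).
have h2 := sym_tower i (tower_affine (- n) (n * b i) tower_flat).
have := symM (symM h1 h2) IH.
congr sym; apply/funext => x; rewrite big_cons; congr (_ * _).
by rewrite !mul1r.
Qed.

Lemma continuous_locally_integrable V f : open V -> (forall x, V x -> {for x, continuous f}) ->
  locally_integrable_on V f.
Proof.
move=> oV cf C cC CV.
have mC := compact_borel cC.
have mf : measurable_fun (C : set (borel E)) f := borel_real_continuous_sub oV cf mC CV.
have /compact_bounded[M [_ hM]] : compact (f @` C).
  apply: continuous_compact => //; apply: continuous_in_subspaceT => x.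
  by rewrite inE => /CV; exact: cf.
apply: measurable_bounded_integrable => //; first exact: compact_lty.
exists (M + 1); split; first exact: num_real.
by move=> y My x Cx /=; apply: hM; [lra|exists x].
Qed.

(** Two integrations by parts move both mixed derivatives of f onto a bump, where they commute; du
    Bois-Reymond and continuity then compare the derivatives themselves. *)
Lemma schwarz V f i j x : open V -> smooth_on V f -> V x ->
  partial i (partial j f) x = partial j (partial i f) x.
Proof.
move=> oV sf Vx; apply/eqP; rewrite -subr_eq0; apply/eqP.
have sij := smooth_partial i (smooth_partial j sf).
have sji := smooth_partial j (smooth_partial i sf).
pose D := fun y => partial i (partial j f) y + -1 * partial j (partial i f) y.
have sD : smooth_on V D by exact: (smoothD oV sij (smoothZ (-1) oV sji)).
suff : D x = 0 by rewrite /D mulN1r.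
apply: (@ae_continuous_eq0 _ _ V D) => //; first by move=> y Vy; exact: smooth_continuous sD Vy.
apply: du_bois_reymond_bump => //.
  by apply: continuous_locally_integrable => // y Vy; exact: smooth_continuous sD Vy.
move=> n a b abV; have tb : test_function V (rect_bump n.+1%:R a b) by exact: rect_bump_test.
set psi := rect_bump _ _ _ in tb *.
have key k l : \int[L]_(y in V) (partial k (partial l f) y * psi y) =
    \int[L]_(y in V) (f y * partial l (partial k psi) y).
  apply/eqP; rewrite -eqr_opp; apply/eqP.
  rewrite -(rV_integration_by_parts k oV (smooth_partial l sf) tb).
  by rewrite (rV_integration_by_parts l oV sf (test_function_partial k tb)) opprK.
have mV : measurable (V : set (borel E)) by exact: open_borel.
have ti g : smooth_on V g -> L.-integrable V (EFin \o (fun y => g y * psi y)).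
  move=> sg; apply: (integrableS measurableT mV) => //.
  exact: test_function_integrable (test_functionM oV sg tb).
transitivity (\int[L]_(y in V) (partial i (partial j f) y * psi y - partial j (partial i f) y * psi y)).
  by apply: eq_Rintegral => y _; rewrite mulrDl -mulrA mulN1r.
rewrite RintegralB//; [|exact: ti|exact: ti].
have pE : partial j (partial i psi) = partial i (partial j psi).
  by apply/funext => y; have [_ h] := sym_bump n.+1%:R a b; exact: h.
have k1 := key i j; have k2 := key j i; rewrite pE in k1.
by apply/eqP; rewrite subr_eq0; apply/eqP; exact: (etrans k1 (esym k2)).
Qed.

End Schwarz.

(** * Trigonometric series *)

Section Bessel.
Context disp (T : measurableType disp) (R : realType).
Variable (mu : {measure set T -> \bar R}).
Variables (D : set T) (I : eqType) (e : I -> T -> R) (kappa : R).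
Hypotheses (mD : measurable D) (kappa0 : 0 < kappa).
Hypothesis se : forall k, sqint mu D (e k).
Hypothesis orth : forall k l, \int[mu]_(x in D) (e k x * e l x) = kappa * (k == l)%:R.

(** Induction on s: subtracting the projection of F on e_k keeps the other coefficients and lowers
    the squared norm by c^2 / kappa. *)
Lemma bessel (F : T -> R) (s : seq I) : uniq s -> sqint mu D F ->
  \sum_(k <- s) (\int[mu]_(x in D) (F x * e k x)) ^+ 2 <=
  kappa * \int[mu]_(x in D) (F x ^+ 2).
Proof.
elim: s F => [|k s IH] F.
  move=> _ _; rewrite big_nil; apply: mulr_ge0; first exact: ltW.
  by apply: Rintegral_ge0 => x _; exact: sqr_ge0.
move=> /= /andP[ks us] sF; rewrite big_cons.
set c := \int[mu]_(x in D) (F x * e k x).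
pose F' x := - (kappa^-1 * c) * e k x + F x.
have sF' : sqint mu D F' by apply: (sqintD mD (sqintZ _ mD (se k)) sF).
have iFF := sF.2; have iFe l := sqintM mD sF (se l); have iee l := sqintM mD (se k) (se l).
have h1 l : \int[mu]_(x in D) (F' x * e l x) =
    - (kappa^-1 * c) * (kappa * (k == l)%:R) + \int[mu]_(x in D) (F x * e l x).
  by rewrite -orth; apply: (Rintegral_axpy mD (iee l) (iFe l)) => x; rewrite mulrDl mulrA.
have h2 : \int[mu]_(x in D) (F' x ^+ 2) = \int[mu]_(x in D) (F x ^+ 2) - kappa^-1 * c ^+ 2.
  have i1 := sqintM mD sF' (se k); have i2 := RintegrableZ (- (kappa^-1 * c)) mD (iFe k).
  rewrite (Rintegral_axpy (k := - (kappa^-1 * c)) (h := fun x => F' x ^+ 2) mD i1 (RintegrableD mD i2 iFF)) => [|x].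
    rewrite h1 (Rintegral_axpy mD (iFe k) iFF (fun=> erefl)) eqxx mulr1 -/c.
    have k0 : kappa != 0 by rewrite gt_eqF.
    by field.
  by rewrite /F'; ring.
have := IH F' us sF'.
have -> : \sum_(l <- s) (\int[mu]_(x in D) (F' x * e l x)) ^+ 2 =
    \sum_(l <- s) (\int[mu]_(x in D) (F x * e l x)) ^+ 2.
  rewrite big_seq [RHS]big_seq; apply: eq_bigr => l ls; rewrite h1.
  have -> : (k == l) = false by apply/negP => /eqP kl; move: ks; rewrite kl ls.
  by rewrite !mulr0 add0r.
rewrite h2 mulrBr mulVKf ?gt_eqF// => h.
by rewrite -lerBrDl.
Qed.

End Bessel.

Section Trig.
Context {R : realType}.
Local Notation lam := (@lebesgue_measure R).
Variable rho : R.
Hypothesis rho0 : 0 < rho.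

(** Boxes have side 2 rho, so the lowest frequency is 2 pi / (2 rho). *)
Definition freq : R := pi / rho.

Lemma freq_rho : freq * rho = pi.
Proof. by rewrite divfK// gt_eqF. Qed.

Lemma freq_gt0 : 0 < freq. Proof. by rewrite divr_gt0// pi_gt0. Qed.

Definition cos_tower (n : nat) (t : R) : R := cos (t + n%:R * (pi / 2)).

Lemma tower_cos : tower cos_tower.
Proof.
move=> n t; rewrite /cos_tower.
have -> : cos (t + n.+1%:R * (pi / 2)) = - sin (t + n%:R * (pi / 2)).
  by rewrite -cosDpihalf -natr1 mulrDl mul1r addrA.
have h : is_derive t 1 (fun t : R => t + n%:R * (pi / 2)) 1.
  by apply: is_derive_eq; rewrite addr0.
by apply: is_derive_eq; rewrite mulr1.
Qed.

Lemma cosD_int (k : int) (t : R) : cos (t + k%:~R * (pi *+ 2)) = cos t.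
Proof.
case: k => n; first by rewrite -[RHS](periodicn (@cosD2pi R) n) mulr_natl.
rewrite -[LHS](periodicn (@cosD2pi R) n.+1) mulNr mulr_natl.
by rewrite -addrA addNr addr0.
Qed.

Lemma sinD_int (k : int) (t : R) : sin (t + k%:~R * (pi *+ 2)) = sin t.
Proof. by rewrite -!cosBpihalf addrAC cosD_int. Qed.

Lemma integral_cos (k : int) (b lo : R) : k != 0 ->
  (\int[lam]_(t in `]lo, (lo + rho *+ 2)%R[) (cos (k%:~R * freq * t + b))%:E = 0)%E.
Proof.
move=> k0; pose al := k%:~R * freq.
have al0 : al != 0 by rewrite mulf_neq0 ?intr_eq0// gt_eqF// freq_gt0.
pose F t := al^-1 * sin (al * t + b).
have dF t : is_derive t (1 : R) F (cos (al * t + b)).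
  have h := tower_affine al (b - pi / 2) tower_cos 0%N t.
  have := is_deriveZ al^-1 h; rewrite /cos_tower mul1r => hd.
  have e1 : F = al^-1 *: (fun t : R => al ^+ 0 * cos (al * t + (b - pi / 2) + 0%:R * (pi / 2))).
    apply/funext => s; rewrite /F; change (al^-1 * sin (al * s + b) = al^-1 * (al ^+ 0 * cos (al * s + (b - pi / 2) + 0%:R * (pi / 2)))).
    by rewrite mul1r mul0r addr0 addrA cosBpihalf.
  rewrite e1; apply: is_derive_eq.
  change (al^-1 * (al * cos (al * t + (b - pi / 2) + pi / 2)) = cos (al * t + b)).
  by rewrite mulKf//; congr cos; rewrite addrA subrK.
have cF : continuous F by move=> s; apply/differentiable_continuous/derivable1_diffP; have [] := dF s.
have cc : continuous (fun t : R => cos (al * t + b)).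
  move=> t; apply: continuous_comp; last exact: continuous_cos.
  by apply: continuousD; [apply: continuousM; [exact: cvg_cst|exact: cvg_id]|exact: cvg_cst].
have lt1 : lo < lo + rho *+ 2 by rewrite ltrDl pmulrn_lgt0.
rewrite integral_itv_bndo_bndc; last first.
  by apply/measurable_EFinP; apply: measurable_funTS; exact: continuous_measurable_fun.
rewrite integral_itv_obnd_cbnd; last first.
  by apply/measurable_EFinP; apply: measurable_funTS; exact: continuous_measurable_fun.
rewrite (@continuous_FTC2 R _ F)//.
- have -> : F (lo + rho *+ 2) = F lo; last by rewrite subee.
  rewrite /F -(sinD_int k (al * lo + b)); congr (_ * sin _).
  have e : k%:~R * (pi *+ 2) = al * (rho *+ 2) by rewrite -[pi]freq_rho /al; ring.
  by rewrite e; ring.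
- exact: continuous_subspaceT.
- split=> [s _||]; first by have [] := dF s.
    by apply: cvg_at_right_filter; exact: cF.
  by apply: cvg_at_left_filter; exact: cF.
- by move=> s _; rewrite derive1E; have [_ ->] := dF s.
Qed.

(* For m > 0, the indices 2m-1 and 2m are the sine and the cosine of frequency m. *)
Definition trig (lo : R) (n : nat) (tau t : R) : R :=
  if n == 0%N then (Num.sqrt 2)^-1
  else cos ((uphalf n)%:R * freq * (t - lo) - (odd n)%:R * (pi / 2) + tau).

(** What [tau] is for: each derivative multiplies by the frequency and adds pi/2 to the phase, so
    derivatives stay in an orthogonal family of the same kind. For n = 0 the factor [uphalf 0] kills
    them. *)
Lemma trig_tower lo n tau : tower (fun j t =>
  ((uphalf n)%:R * freq) ^+ j * trig lo n (tau + j%:R * (pi / 2)) t).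
Proof.
have [->|n0] := eqVneq n 0%N.
  move=> j t; rewrite /trig /= mul0r.
  by rewrite [X in is_derive _ _ _ X]mulrC exprS mul0r mulr0; exact: is_derive_cst.
pose m := (uphalf n)%:R * freq; pose b := - m * lo - (odd n)%:R * (pi / 2) + tau.
have := tower_affine m b tower_cos; congr tower; apply/funext => j; apply/funext => t.
rewrite /trig (negbTE n0); congr (_ * cos _); rewrite /b -/m.
by rewrite mulNr; ring.
Qed.

Lemma trig_continuous lo n tau : continuous (trig lo n tau).
Proof.
have -> : trig lo n tau =
    (fun t => ((uphalf n)%:R * freq) ^+ 0 * trig lo n (tau + 0%:R * (pi / 2)) t).
  by apply/funext => t; rewrite mul1r mul0r addr0.
exact: (@tower_continuous _ _ 0%N (trig_tower lo n tau)).
Qed.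

Lemma trig_measurable lo n tau : measurable_fun setT (trig lo n tau).
Proof. exact: continuous_measurable_fun (@trig_continuous lo n tau). Qed.

Lemma trig_le1 lo n tau t : `|trig lo n tau t| <= 1.
Proof.
rewrite /trig; case: ifP => _; last exact: cos_max.
rewrite ger0_norm ?sqrtr_ge0// invf_le1 ?sqrtr_gt0//.
by rewrite -[leLHS]sqrtr1 ler_sqrt// ler1n.
Qed.

Lemma cos_mul (x y : R) : cos x * cos y = 2^-1 * (cos (x - y) + cos (x + y)).
Proof. by rewrite cosB cosD; field. Qed.

Lemma integrable_bounded_itv (f : R -> R) (a b B : R) : measurable_fun setT f ->
  (forall t, `|f t| <= B) -> lam.-integrable `]a, b[ (EFin \o f).
Proof.
move=> mf hf; apply: measurable_bounded_integrable => //.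
- have e := @lebesgue_measure_itv R `]a, b[%R; rewrite [X in (X < _)%E]e.
  by case: ifP => _ //=; rewrite ltry.
- exact: measurable_funTS.
- exists B; split; first exact: num_real.
  by move=> x Bx y _; apply: le_trans (hf y) (ltW Bx).
Qed.

Lemma integral_trig lo n n' tau :
  \int[lam]_(t in `]lo, lo + rho *+ 2[) (trig lo n tau t * trig lo n' tau t) =
  rho * (n == n')%:R.
Proof.
have len : lam `]lo, (lo + rho *+ 2)%R[%classic = (rho *+ 2)%:E.
  rewrite lebesgue_measure_itv/= lte_fin ltrDl pmulrn_lgt0// rho0.
  by rewrite -EFinB addrAC subrr add0r.
have icst c : \int[lam]_(t in `]lo, lo + rho *+ 2[) c = c * (rho *+ 2).
  by rewrite Rintegral_cst//; congr (_ * _); have := congr1 fine len.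
have icos (k : int) b : k != 0 ->
    \int[lam]_(t in `]lo, lo + rho *+ 2[) cos (k%:~R * freq * t + b) = 0.
  by move=> k0; rewrite /Rintegral integral_cos.
have icosZ (k : int) b c : k != 0 ->
    \int[lam]_(t in `]lo, lo + rho *+ 2[) (c * cos (k%:~R * freq * t + b)) = 0.
  move=> k0; rewrite RintegralZl// ?icos ?mulr0//.
  apply: integrable_bounded_itv; last by move=> t; exact: cos_max.
  apply: continuous_measurable_fun => t; apply: continuous_comp; last exact: continuous_cos.
  by apply: continuousD; [apply: continuousM; [exact: cvg_cst|exact: cvg_id]|exact: cvg_cst].
pose ph n := - ((uphalf n)%:R * freq * lo) - (odd n)%:R * (pi / 2) + tau.
have trigE m t : m != 0%N -> trig lo m tau t = cos ((uphalf m)%:Z%:~R * freq * t + ph m).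
  by move=> m0; rewrite /trig (negbTE m0) /ph; congr cos; rewrite -pmulrn; ring.
have uph m : m != 0%N -> (uphalf m)%:Z != 0 by case: m => [|[]].
have [->|n0] := eqVneq n 0%N; have [->|n'0] := eqVneq n' 0%N.
- have h (x : R) : 2^-1 * (x *+ 2) = x by rewrite -[x *+ 2]mulr_natl mulKf.
  by rewrite /trig /= icst mulr1 -invfM -expr2 sqr_sqrtr.
- rewrite mulr0.
  rewrite -(icosZ (uphalf n')%:Z (ph n') (Num.sqrt 2)^-1 (uph _ n'0)); congr fine.
  by apply: eq_integral => t _; rewrite (trigE n' t n'0).
- rewrite (negbTE n0) mulr0.
  rewrite -(icosZ (uphalf n)%:Z (ph n) (Num.sqrt 2)^-1 (uph _ n0)); congr fine.
  by apply: eq_integral => t _; rewrite (trigE n t n0) mulrC.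
pose k1 : int := (uphalf n)%:Z - (uphalf n')%:Z; pose k2 : int := (uphalf n)%:Z + (uphalf n')%:Z.
have u0 : (0 < uphalf n)%N by case: (n) n0 => [|[|m]].
have k20 : k2 != 0 by rewrite -lt0n addn_gt0 u0.
have prodE t : trig lo n tau t * trig lo n' tau t =
   2^-1 * cos (k1%:~R * freq * t + (ph n - ph n')) + 2^-1 * cos (k2%:~R * freq * t + (ph n + ph n')).
  rewrite !trigE// cos_mul mulrDr; congr (_ * cos _ + _ * cos _).
    by rewrite rmorphB; ring.
  by rewrite /=; ring.
have mcos (k : int) b : measurable_fun setT (fun t : R => 2^-1 * cos (k%:~R * freq * t + b)).
  apply: measurable_funM => //; apply: continuous_measurable_fun => t.
  apply: continuous_comp; last exact: continuous_cos.
  by apply: continuousD; [apply: continuousM; [exact: cvg_cst|exact: cvg_id]|exact: cvg_cst].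
have bcos (k : int) b t : `|2^-1 * cos (k%:~R * freq * t + b)| <= 1.
  rewrite normrM ger0_norm ?invr_ge0//; apply: (@le_trans _ _ (2^-1 * 1)).
    by rewrite ler_wpM2l ?invr_ge0// cos_max.
  by rewrite mulr1 invf_le1// ler1n.
have -> : (fun t => trig lo n tau t * trig lo n' tau t) = (fun t =>
   2^-1 * cos (k1%:~R * freq * t + (ph n - ph n')) + 2^-1 * cos (k2%:~R * freq * t + (ph n + ph n'))).
  by apply/funext => t; exact: prodE.
rewrite RintegralD//; first last.
- by apply: integrable_bounded_itv => //; exact: bcos.
- by apply: integrable_bounded_itv => //; exact: bcos.
rewrite (icosZ k2)// addr0.
have [nn|nn] := eqVneq n n'.
  rewrite /k1 nn !subrr.
  have -> : (fun t : R => 2^-1 * cos (0%:~R * freq * t + 0)) = (fun=> 2^-1).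
    by apply/funext => t; rewrite !mul0r addr0 cos0 mulr1.
  by rewrite icst mulr1 -[rho *+ 2]mulr_natl mulKf.
(* Equal frequencies with distinct indices are a sine and a cosine, whose phases differ by pi/2. *)
rewrite mulr0; have [k10|k10] := eqVneq k1 0; last exact: icosZ.
have un : uphalf n = uphalf n' by move/eqP: k10; rewrite subr_eq0 => /eqP[].
have -> : (fun t : R => 2^-1 * cos (k1%:~R * freq * t + (ph n - ph n'))) = (fun=> 0).
  apply/funext => t; rewrite k10 !mul0r add0r /ph un.
  have -> : cos (- ((uphalf n')%:R * freq * lo) - (odd n)%:R * (pi / 2) + tau -
     (- ((uphalf n')%:R * freq * lo) - (odd n')%:R * (pi / 2) + tau)) =
     cos (((odd n')%:R - (odd n)%:R) * (pi / 2)).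
    by congr cos; ring.
  have : odd n != odd n'.
    apply: contra_neq nn => oo; have := odd_double_half n; have := odd_double_half n'.
    rewrite !uphalf_half in un; rewrite oo in un; move/addnI: un => ->.
    by rewrite oo => -> .
  case: (odd n); case: (odd n') => // _.
    by rewrite sub0r mulN1r cosN cos_pihalf mulr0.
  by rewrite subr0 mul1r cos_pihalf mulr0.
by rewrite icst mul0r.
Qed.

End Trig.

Section TrigBasis.
Context {R : realType} {d : nat}.
Local Notation E := 'rV[R]_d.
Local Notation L := (@lebesgue_rV R d).
Local Notation lam := (@lebesgue_measure R).
Variables (rho : R) (a : 'I_d -> R).
Hypothesis rho0 : 0 < rho.
Opaque Rintegral.

Definition box : set (borel E) := open_rect a (fun i => a i + rho *+ 2).

Lemma measurable_box : measurable box. Proof. exact: measurable_open_rect. Qed.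

Lemma box_lty : (L box < +oo)%E. Proof. exact: open_rect_lty. Qed.

Lemma integrable_box (f : E -> R) (K : R) : measurable_fun setT (f : borel E -> R) ->
  (forall x, `|f x| <= K) -> L.-integrable box (EFin \o f).
Proof.
move=> mf hf; apply: measurable_bounded_integrable; [exact: measurable_box|exact: box_lty| |].
  exact: measurable_funTS.
exists K; split; first exact: num_real.
by move=> x Kx y _; apply: le_trans (hf y) (ltW Kx).
Qed.

Definition etrig (tau : 'I_d -> R) (k : 'I_d -> nat) (x : E) : R :=
  \prod_i trig rho (a i) (k i) (tau i) (x 0 i).

Lemma measurable_prod_coord (F : 'I_d -> R -> R) : (forall i, measurable_fun setT (F i)) ->
  measurable_fun setT (fun x : borel E => \prod_i F i ((x : E) 0 i)).
Proof.
move=> mF; apply: measurable_prod => i _.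
by apply: measurableT_comp => //; exact: borel_measurable_coord.
Qed.

Lemma prod_le1 (F : 'I_d -> R) : (forall i, `|F i| <= 1) -> `|\prod_i F i| <= 1.
Proof.
move=> h; rewrite normr_prod; apply: prodr_ile1 => i _.
by rewrite normr_ge0 h.
Qed.

Lemma etrig_measurable tau k : measurable_fun setT (etrig tau k : borel E -> R).
Proof. by apply: (measurable_prod_coord (F := fun i => trig rho (a i) (k i) (tau i))) => i; exact: trig_measurable. Qed.

Lemma etrig_le1 tau k x : `|etrig tau k x| <= 1.
Proof. by apply: prod_le1 => i; exact: trig_le1. Qed.

Lemma etrig_sqint tau k : sqint L box (etrig tau k).
Proof.
split; first exact: measurable_funTS (etrig_measurable tau k).
apply: (@integrable_box _ 1); first by apply: measurable_funX; exact: etrig_measurable.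
by move=> x; rewrite normrX expr_le1// etrig_le1.
Qed.

Lemma etrig_orth tau (k l : {ffun 'I_d -> nat}) :
  \int[L]_(x in box) (etrig tau k x * etrig tau l x) = rho ^+ d * (k == l)%:R.
Proof.
pose ph i t := trig rho (a i) (k i) (tau i) t * trig rho (a i) (l i) (tau i) t *
   \1_(`]a i, (a i + rho *+ 2)[%classic) t.
have mph i : measurable_fun setT (ph i).
  by apply: measurable_funM; [apply: measurable_funM; exact: trig_measurable|exact: measurable_indic].
have iph0 i : lam.-integrable `]a i, (a i + rho *+ 2)[
    (EFin \o (fun t => trig rho (a i) (k i) (tau i) t * trig rho (a i) (l i) (tau i) t)).
  apply: (@integrable_bounded_itv _ _ _ _ 1).
    by apply: measurable_funM; exact: trig_measurable.
  by move=> t; rewrite normrM mulr_ile1// trig_le1.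
have eph i : EFin \o ph i = (EFin \o (fun t => trig rho (a i) (k i) (tau i) t *
    trig rho (a i) (l i) (tau i) t)) \_ `]a i, (a i + rho *+ 2)[%classic.
  by apply/funext => t; rewrite patchE /= /ph indicE; case: ifP => _; rewrite ?mulr1 ?mulr0.
have iph i : lam.-integrable setT (EFin \o ph i).
  by rewrite eph; apply/integrable_restrict => //; rewrite setTI; exact: iph0.
have [_ h] := integral_rV_prod mph iph.
have -> : \int[L]_(x in box) (etrig tau k x * etrig tau l x) =
    \int[L]_x (\prod_i ph i ((x : E) 0 i)).
  congr fine; rewrite integral_mkcond; apply: eq_integral => x _; rewrite patchE.
  rewrite -big_split /ph; case: ifPn => xB.
    congr EFin; apply: eq_bigr => i _; rewrite indicE.
    by move: xB; rewrite inE => /(_ i) hi; rewrite mem_set ?mulr1.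
  have [i hi] : exists i, ~ `]a i, (a i + rho *+ 2)[%classic (x 0 i).
    by apply/existsNP => hx; move/negP: xB; apply; rewrite inE.
  by rewrite (bigD1 i)//= indicE memNset// mulr0 mul0r.
have -> : \int[L]_x (\prod_i ph i ((x : E) 0 i)) = \prod_i \int[lam]_t ph i t.
  exact: (etrans (congr1 fine h)).
rewrite (eq_bigr (fun i => rho * (k i == l i)%:R)); last first.
  move=> i _; rewrite -(integral_trig rho0 (a i) (k i) (l i) (tau i)).
  congr fine; rewrite [RHS]integral_mkcond -eph.
  exact: eq_integral.
rewrite big_split prodr_const card_ord; congr (_ * _).
have [->|kl] := eqVneq k l; first by rewrite big1// => i _; rewrite eqxx.
have [i ki] : exists i, k i != l i.
  apply/existsP; rewrite -negb_forall; apply: contra kl => /forallP h'.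
  by apply/eqP/ffunP => i; apply/eqP; exact: h'.
by rewrite (bigD1 i)//= (negbTE ki) mul0r.
Qed.

(** * From trigonometric polynomials to indicators of rectangles *)

Section Annihilator.
Variable h : E -> R.
Hypothesis ih : L.-integrable box (EFin \o h).

Definition cosprod (m : 'I_d -> int) (al : 'I_d -> R) (x : E) : R :=
  \prod_i cos ((m i)%:~R * freq rho * x 0 i + al i).

Definition bounded1 (Phi : E -> R) :=
  measurable_fun setT (Phi : borel E -> R) /\ forall x, `|Phi x| <= 1.

(** All frequencies and phases are included so that the property survives multiplication of Phi by
    cosines; with linear combinations and bounded limits this reaches the indicators of
    rectangles. *)
Definition annih (Phi : E -> R) :=
  forall m al, \int[L]_(x in box) (h x * (Phi x * cosprod m al x)) = 0.

Lemma bounded1M Phi Psi : bounded1 Phi -> bounded1 Psi -> bounded1 (fun x => Phi x * Psi x).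
Proof.
move=> [m1 h1] [m2 h2]; split; first exact: measurable_funM.
by move=> x; rewrite normrM mulr_ile1.
Qed.

Lemma cos_affine_measurable (al be : R) : measurable_fun setT (fun t : R => cos (al * t + be)).
Proof.
apply: continuous_measurable_fun => t; apply: continuous_comp; last exact: continuous_cos.
by apply: continuousD; [apply: continuousM; [exact: cvg_cst|exact: cvg_id]|exact: cvg_cst].
Qed.

Lemma bounded1_cosprod m al : bounded1 (cosprod m al).
Proof.
split; last by move=> x; apply: prod_le1 => i; exact: cos_max.
by apply: (measurable_prod_coord (F := fun i t => cos ((m i)%:~R * freq rho * t + al i))) => i; exact: cos_affine_measurable.
Qed.

Lemma bounded1_integrable Phi : bounded1 Phi ->
  L.-integrable box (EFin \o (fun x => h x * Phi x)).
Proof.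
move=> [mP hP].
have := @integrable_bounded_mul _ _ _ L box h Phi 1 measurable_box (measurable_funTS mP)
  (fun x _ => hP x) ih.
by apply: eq_integrable; [exact: measurable_box|move=> x _ /=; rewrite mulrC].
Qed.

Lemma Rintegral_comb0 s t Phi Psi Xi : bounded1 Phi -> bounded1 Psi ->
  \int[L]_(x in box) (h x * Phi x) = 0 -> \int[L]_(x in box) (h x * Psi x) = 0 ->
  (forall x, Xi x = s * Phi x + t * Psi x) -> \int[L]_(x in box) (h x * Xi x) = 0.
Proof.
move=> /bounded1_integrable iP /bounded1_integrable iQ P0 Q0 hXi; have mB := measurable_box.
rewrite (Rintegral_axpy (k := s) mB iP (RintegrableZ t mB iQ)) => [|x]; last by rewrite hXi; ring.
by rewrite P0 mulr0 add0r; apply: (etrans (RintegralZl t mB iQ)); rewrite Q0 mulr0.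
Qed.

Lemma annih_lin s t Phi Psi Xi : bounded1 Phi -> bounded1 Psi ->
  (forall x, Xi x = s * Phi x + t * Psi x) -> annih Phi -> annih Psi -> annih Xi.
Proof.
move=> bP bQ hXi aP aQ m al; have bc := bounded1_cosprod m al.
apply: (Rintegral_comb0 (bounded1M bP bc) (bounded1M bQ bc) (aP m al) (aQ m al)) => x.
by rewrite hXi mulrDl !mulrA.
Qed.

Lemma bounded1_cos i be : bounded1 (fun x => cos (freq rho * x 0 i + be)).
Proof.
split; last by move=> x; exact: cos_max.
apply: (@measurableT_comp _ _ _ _ _ _ (fun t : R => cos (freq rho * t + be))).
  exact: cos_affine_measurable.
exact: borel_measurable_coord.
Qed.

Lemma annih_cos Phi i be : bounded1 Phi -> annih Phi ->
  annih (fun x => Phi x * cos (freq rho * x 0 i + be)).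
Proof.
move=> bP aP m al.
pose mp (s : int) j := if j == i then m j + s else m j.
pose ap s j := if j == i then al j + s else al j.
have e x : Phi x * cos (freq rho * x 0 i + be) * cosprod m al x =
    2^-1 * (Phi x * cosprod (mp (-1)) (ap (- be)) x) + 2^-1 * (Phi x * cosprod (mp 1) (ap be) x).
  rewrite -mulrA; suff -> : cos (freq rho * x 0 i + be) * cosprod m al x =
      2^-1 * (cosprod (mp (-1)) (ap (- be)) x + cosprod (mp 1) (ap be) x) by ring.
  rewrite /cosprod (bigD1 i)//= [in RHS](bigD1 i)//= [X in _ = _ * (_ + X)](bigD1 i)//=.
  have rest s u : \prod_(j < d | j != i) cos ((mp s j)%:~R * freq rho * x 0 j + ap u j) =
      \prod_(j < d | j != i) cos ((m j)%:~R * freq rho * x 0 j + al j).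
    by apply: eq_bigr => j /negbTE ji; rewrite /mp /ap ji.
  rewrite !rest /mp /ap eqxx -mulrDl [LHS]mulrA [RHS]mulrA; congr (_ * _).
  rewrite mulrC cos_mul; congr (_ * (cos _ + cos _)).
    by move: (freq rho) => w; ring.
  by move: (freq rho) => w; ring.
have b s u := bounded1M bP (bounded1_cosprod (mp s) (ap u)).
exact: Rintegral_comb0.
Qed.

(** A trigonometric polynomial with values in [0, 1], below 1/2 exactly where the cosine is
    negative; [step_cvg] turns it into an indicator. *)
Let half i be (x : E) := (1 + cos (freq rho * x 0 i + be)) / 2.

Let half01 i be x : 0 <= half i be x <= 1.
Proof.
have := cos_geN1 (freq rho * x 0 i + be); have := cos_le1 (freq rho * x 0 i + be).
by rewrite /half => *; apply/andP; split; lra.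
Qed.

Let half_measurable i be : measurable_fun setT (half i be : borel E -> R).
Proof.
apply: measurable_funM => //; apply: measurable_funD => //.
by have [] := bounded1_cos i be.
Qed.

Let bounded1_half i be : bounded1 (half i be).
Proof.
split; first exact: half_measurable.
by move=> x; have /andP[h0 h1] := half01 i be x; rewrite ger0_norm.
Qed.

Let bounded1_pow i be n : bounded1 (fun x => half i be x ^+ n).
Proof.
split; first exact: measurable_funX.
by move=> x; rewrite normrX exprn_ile1; have [] := bounded1_half i be.
Qed.

Let annih_pow Phi i be n : bounded1 Phi -> annih Phi -> annih (fun x => Phi x * half i be x ^+ n).
Proof.
move=> bP aP; elim: n => [|n IH].
  by have -> : (fun x => Phi x * half i be x ^+ 0) = Phi by apply/funext => x; rewrite mulr1.
have b1 := bounded1M bP (bounded1_pow i be n).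
apply: (annih_lin (s := 2^-1) (t := 2^-1) b1 (bounded1M b1 (bounded1_cos i be)) _ IH).
  by move=> x; rewrite exprS /half; move: (_ ^+ n) => y; field.
exact: annih_cos.
Qed.

Let bounded1_compl i be n N : bounded1 (fun x => (1 - half i be x ^+ n) ^+ N).
Proof.
split; first by apply: measurable_funX; apply: measurable_funB => //; exact: measurable_funX.
move=> x; have /andP[h0 h1] := half01 i be x.
have /andP[y0 y1] : 0 <= half i be x ^+ n <= 1 by rewrite exprn_ge0// exprn_ile1.
by rewrite normrX exprn_ile1// ler_norml; apply/andP; split; lra.
Qed.

Let annih_compl Phi i be n N : bounded1 Phi -> annih Phi ->
  annih (fun x => Phi x * (1 - half i be x ^+ n) ^+ N).
Proof.
move=> bP aP; elim: N => [|N IH].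
  by have -> : (fun x => Phi x * (1 - half i be x ^+ n) ^+ 0) = Phi by apply/funext => x; rewrite mulr1.
have b1 := bounded1M bP (bounded1_compl i be n N).
apply: (annih_lin (s := 1) (t := -1) b1 (bounded1M b1 (bounded1_pow i be n)) _ IH).
  by move=> x; rewrite exprS; ring.
exact: annih_pow.
Qed.

Lemma annih_limit (Phi : (E -> R)^nat) Psi : (forall n, bounded1 (Phi n)) -> bounded1 Psi ->
  (forall n, annih (Phi n)) -> (forall x, Phi n x @[n --> \oo] --> Psi x) -> annih Psi.
Proof.
move=> bP bQ aP cP m al; have bc := bounded1_cosprod m al.
have mB := measurable_box.
have i1 n := bounded1_integrable (bounded1M (bP n) bc).
have i2 := bounded1_integrable (bounded1M bQ bc).
have c1 : {ae L, forall x, box x -> (h x * (Phi n x * cosprod m al x))%:E @[n --> \oo] -->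
    (h x * (Psi x * cosprod m al x))%:E}.
  apply: aeW => x _; apply: cvg_EFin; first exact: nearW.
  apply: cvgM; first exact: cvg_cst.
  by apply: cvgM; [exact: cP|exact: cvg_cst].
have c2 : {ae L, forall x n, box x -> (`|(h x * (Phi n x * cosprod m al x))%:E| <= `|(h x)%:E|)%E}.
  apply: aeW => x n _; rewrite lee_fin normrM ler_piMr//.
  by have [_] := bounded1M (bP n) bc; exact.
have [_ _] := dominated_convergence mB (fun n => measurable_int _ (i1 n)) (measurable_int _ i2) c1 (integrable_abse ih) c2.
have n0 n : (\int[L]_(x in box) (h x * (Phi n x * cosprod m al x))%:E = 0)%E.
  have := aP n m al => hn; rewrite -[LHS]fineK; last exact: (integrable_fin_num mB (i1 n)).
  by congr EFin.
move=> hc; have : (\int[L]_(x in box) (h x * (Psi x * cosprod m al x))%:E = 0)%E.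
  apply/esym; move: hc; rewrite (_ : (fun _ => _) = cst 0%E); last by apply/funext => n; exact: n0.
  by move=> /cvg_lim; rewrite lim_cst// => /(_ (@ereal_hausdorff R)).
exact: congr1.
Qed.

Lemma bernoulli (y : R) n : -1 <= y -> 1 + n%:R * y <= (1 + y) ^+ n.
Proof.
move=> y1; elim: n => [|n IH]; first by rewrite mul0r addr0.
rewrite exprS; apply: (@le_trans _ _ ((1 + y) * (1 + n%:R * y))).
  by rewrite -natr1; have := ler0n R n; nra.
by rewrite ler_wpM2l; lra.
Qed.

(* As in the classical proof of the Stone-Weierstrass theorem. *)
Lemma step_cvg (p : R) : 0 <= p <= 1 ->
  (1 - p ^+ (2 * n)) ^+ (n.+1 * 4 ^ n) @[n --> \oo] --> ((p < 2^-1)%R%:R : R).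
Proof.
move=> /andP[p0 p1]; pose q := p * 2; have q0 : 0 <= q by rewrite mulr_ge0.
(* The factor 4^n puts the threshold at p = 1/2, because K n times p^(2n) is (n + 1) (2p)^(2n); the
   factor n + 1 settles p = 1/2 itself. *)
pose K n := (n.+1 * 4 ^ n)%N; pose y n := p ^+ (2 * n).
have y01 n : 0 <= y n <= 1 by rewrite exprn_ge0// exprn_ile1.
have Ky n : (K n)%:R * y n = n.+1%:R * (q ^+ n) ^+ 2.
  have e4 : (4%:R : R) ^+ n = 2%:R ^+ (n * 2) by rewrite mulnC exprM -[2%:R ^+ 2]natrX.
  rewrite /K /y /q natrM natrX e4 -[(p * 2) ^+ n ^+ 2]exprM exprMn [(2 * n)%N]mulnC.
  by rewrite -mulrA [_ * p ^+ _]mulrC.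
case: ltP => hp /=.
  have q1 : q < 1 by rewrite /q; lra.
  have sumq n : n.+1%:R * q ^+ n <= (1 - q)^-1.
    have : n.+1%:R * q ^+ n * (1 - q) <= 1 - q ^+ n.+1.
      elim: n => [|n IH]; first by rewrite expr0 expr1; lra.
      have qn1 : q ^+ n.+1 <= 1 by rewrite exprn_ile1// ltW.
      have h1 : 0 <= (1 - q) * (1 - q ^+ n.+1) by rewrite mulr_ge0// subr_ge0// ltW.
      have := ler_wpM2l q0 IH; move: h1; rewrite !exprS -[n.+2%:R]natr1.
      move: (n.+1%:R) (q ^+ n) => N z h1 h2; nra.
    have : 0 <= q ^+ n.+1 by rewrite exprn_ge0.
    move=> h1 h2; rewrite -[X in _ <= X]mul1r ler_pdivlMr ?subr_gt0//.
    by apply: (le_trans h2); rewrite gerBl.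
  apply/cvgrPdist_le => e e0.
  have := @cvg_geometric R (1 - q)^-1 q; rewrite ger0_norm// => /(_ q1)/cvgrPdist_le/(_ e e0).
  apply: filterS => n; rewrite sub0r normrN /geometric /= => hn.
  have /andP[y0 y1] := y01 n.
  have b1 : 1 - (K n)%:R * y n <= (1 - y n) ^+ K n by have := @bernoulli (- y n) (K n); rewrite mulrN; apply; lra.
  have b2 : (1 - y n) ^+ K n <= 1 by rewrite exprn_ile1//; lra.
  rewrite -/(y n) -/(K n) ger0_norm; last by rewrite subr_ge0.
  apply: (@le_trans _ _ ((K n)%:R * y n)); first by rewrite lerBlDr addrC -lerBlDr.
  apply: le_trans hn; apply: le_trans (ler_norm _).
  rewrite Ky expr2 mulrA ler_wpM2r ?exprn_ge0//.
have q1 : 1 <= q by rewrite /q; lra.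
apply/cvgrPdist_le => e e0; have := @cvg_harmonic R => /cvgrPdist_le/(_ e e0).
apply: filterS => n; rewrite !sub0r !normrN => hn.
have /andP[y0 y1] := y01 n; rewrite -/y -/K.
have b0 : 0 <= (1 - y n) ^+ K n by rewrite exprn_ge0//; lra.
rewrite ger0_norm//; apply: le_trans hn; rewrite ger0_norm /harmonic ?invr_ge0//.
rewrite -[X in _ <= X]mul1r ler_pdivlMr ?ltr0n//.
apply: (@le_trans _ _ ((1 - y n) ^+ K n * (1 + y n) ^+ K n)).
  rewrite ler_wpM2l//; apply: le_trans (bernoulli _ _); last by lra.
  rewrite Ky; have : 1 <= (q ^+ n) ^+ 2 by rewrite exprn_ege1// exprn_ege1.
  by have := ler0n R n.+1; nra.
rewrite -exprMn exprn_ile1; nra.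
Qed.

Lemma annih_step Phi i be : bounded1 Phi -> annih Phi ->
  annih (fun x => Phi x * (cos (freq rho * x 0 i + be) < 0)%R%:R) /\
  bounded1 (fun x => Phi x * (cos (freq rho * x 0 i + be) < 0)%R%:R).
Proof.
move=> bP aP.
have bS : bounded1 (fun x : E => (cos (freq rho * x 0 i + be) < 0)%R%:R).
  split; last by move=> x; case: (_ < _); rewrite ?normr1 ?normr0.
  have [mc _] := bounded1_cos i be.
  have mb : measurable_fun setT (fun x : borel E => cos (freq rho * (x : E) 0 i + be) < 0) by exact: measurable_fun_ltr.
  apply: (@measurableT_comp _ _ _ _ _ _ (fun b : bool => b%:R : R)) => //.
split; last exact: bounded1M.
apply: (@annih_limit (fun n x => Phi x * (1 - half i be x ^+ (2 * n)) ^+ (n.+1 * 4 ^ n))).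
- by move=> n; exact: bounded1M.
- exact: bounded1M.
- by move=> n; exact: annih_compl.
- move=> x; apply: cvgM; first exact: cvg_cst.
  have -> : (cos (freq rho * x 0 i + be) < 0) = (half i be x < 2^-1).
    by rewrite /half; apply/idP/idP => ?; lra.
  exact: step_cvg.
Qed.

End Annihilator.

End TrigBasis.

Section TrigComplete.
Context {R : realType} {d : nat}.
Local Notation E := 'rV[R]_d.
Local Notation L := (@lebesgue_rV R d).
Variables (rho : R) (a : 'I_d -> R).
Hypothesis rho0 : 0 < rho.
Opaque Rintegral.
Local Notation w := (freq rho).
Local Notation box := (box rho a).

(** The middle half of the box in each direction: the rectangles that [arc_interval] can cut out by
    half-period arcs lie here. *)
Definition inner_box : set (borel E) :=
  open_rect (fun i => a i + rho / 2) (fun i => a i + rho / 2 + rho).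

Lemma inner_box_sub : inner_box `<=` box.
Proof.
move=> x hx i; have := hx i; rewrite /= !in_itv/= => /andP[h1 h2].
by apply/andP; split; lra.
Qed.

(** Any phase is a combination of the sine and the cosine, so orthogonality to [etrig] with tau = 0
    suffices for [annih1]. *)
Lemma cos_trig (m : int) (al lo : R) : exists z : (R * nat) * (R * nat), forall t,
  cos (m%:~R * w * t + al) = z.1.1 * trig rho lo z.1.2 0 t + z.2.1 * trig rho lo z.2.2 0 t.
Proof.
have main (n : nat) (ga) : exists z : (R * nat) * (R * nat), forall t,
    cos (n%:R * w * t + ga) = z.1.1 * trig rho lo z.1.2 0 t + z.2.1 * trig rho lo z.2.2 0 t.
  case: n => [|n].
    exists ((Num.sqrt 2 * cos ga, 0%N), (0, 0%N)) => t.
    rewrite !mul0r add0r addr0 mulrAC mulfV ?mul1r//.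
  pose ga' := n.+1%:R * w * lo + ga.
  exists ((cos ga', n.+1.*2), (- sin ga', n.*2.+1)) => t.
  rewrite /trig /= uphalf_double half_double odd_double mul0r subr0 !addr0 mul1r.
  rewrite cosBpihalf mulNr [cos ga' * _]mulrC [sin ga' * _]mulrC -cosD; congr cos.
  by rewrite /ga'; ring.
case: m => n; first by have [z hz] := main n al; exists z => t; rewrite -hz.
have [z hz] := main n.+1 (- al); exists z => t.
by rewrite -hz -cosN; congr cos; ring.
Qed.

Section Unique.
Variable h : E -> R.
Hypothesis ih : L.-integrable box (EFin \o h).
Hypothesis h0 : forall k : {ffun 'I_d -> nat},
  \int[L]_(x in box) (h x * etrig rho a (fun=> 0) k x) = 0.

Let bounded1_etrig k : bounded1 (etrig rho a (fun=> 0) k).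
Proof. by split; [exact: etrig_measurable|move=> x; exact: etrig_le1]. Qed.

Lemma annih1 : annih rho a h (fun=> 1).
Proof.
move=> m al; pose z i := sval (cid (cos_trig (m i) (al i) (a i))).
have hz i t : cos ((m i)%:~R * w * t + al i) =
    (z i).1.1 * trig rho (a i) (z i).1.2 0 t + (z i).2.1 * trig rho (a i) (z i).2.2 0 t.
  by rewrite /z; case: cid => z' hz'; exact: hz'.
pose zb i (b : bool) := if b then (z i).1 else (z i).2.
pose kf (f : {ffun 'I_d -> bool}) : {ffun 'I_d -> nat} := [ffun i => (zb i (f i)).2].
(* The product over the coordinates is expanded: f chooses one of the two terms of [cos_trig] in
   each. *)
have e x : cosprod rho m al x = \sum_(f : {ffun 'I_d -> bool})
    (\prod_i (zb i (f i)).1) * etrig rho a (fun=> 0) (kf f) x.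
  rewrite /cosprod (eq_bigr (fun i => \sum_b (zb i b).1 * trig rho (a i) (zb i b).2 0 (x 0 i))).
    rewrite bigA_distr_bigA; apply: eq_bigr => f _; rewrite big_split; congr (_ * _).
    by apply: eq_bigr => i _; rewrite ffunE.
  by move=> i _; rewrite big_bool.
have mB := @measurable_box R d rho a.
have ik k := bounded1_integrable ih (bounded1_etrig k).
have -> : (fun x => h x * (1 * cosprod rho m al x)) = (fun x => \sum_(f : {ffun 'I_d -> bool})
   (\prod_i (zb i (f i)).1) * (h x * etrig rho a (fun=> 0) (kf f) x)).
  by apply/funext => x; rewrite mul1r e mulr_sumr; apply: eq_bigr => f _; rewrite mulrCA.
apply: (etrans (Rintegral_sum _ mB _)).
  by move=> f _; exact: RintegrableZ.
by rewrite big1// => f _; apply: (etrans (RintegralZl _ mB (ik _))); rewrite h0 mulr0.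
Qed.

Lemma sin_np (t : R) : - pi <= t <= 0 -> sin t <= 0.
Proof. by move=> ht; rewrite -oppr_ge0 -sinN; apply: sin_ge0_pi; lra. Qed.

(** The two cosines are negative on the arcs (c, c + rho) and (e - rho, e) modulo 2 rho. The bounds
    on c and e keep their periodic translates from meeting inside the box, so only (c, e)
    remains. *)
Lemma arc_interval (lo c e t : R) : lo + rho / 2 <= c -> c < e -> e <= lo + rho / 2 + rho ->
  lo < t < lo + rho *+ 2 ->
  (cos (w * t + (pi / 2 - w * c)) < 0) && (cos (w * t + (- (pi / 2) - w * e)) < 0) = (c < t < e).
Proof.
move=> hc ce he /andP[t1 t2].
have w0 := freq_gt0 rho0; have wr := freq_rho rho0.
have -> : cos (w * t + (pi / 2 - w * c)) = - sin (w * (t - c)).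
  by rewrite -cosDpihalf; congr cos; ring.
have -> : cos (w * t + (- (pi / 2) - w * e)) = sin (w * (t - e)).
  by rewrite -cosBpihalf; congr cos; ring.
have pos u : 0 < u < rho -> 0 < sin (w * u).
  by move=> /andP[u1 u2]; apply: sin_gt0_pi; rewrite mulr_gt0//= -wr ltr_pM2l.
have npos u : - rho <= u <= 0 -> sin (w * u) <= 0.
  move=> /andP[u1 u2]; apply: sin_np; rewrite -wr -mulrN ler_pM2l// u1/=.
  by rewrite pmulr_rle0.
have big u : rho < u < rho *+ 2 -> sin (w * u) < 0.
  move=> /andP[u1 u2]; rewrite -[w * u](subrK pi) sinDpi oppr_lt0 -wr -mulrBr.
  by apply: pos; lra.
case: (ltP c t) => ct /=; last first.
  have [u|u] := leP (- rho) (t - c).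
    by have := npos (t - c); rewrite u subr_le0 ct => /(_ isT) hs; rewrite oppr_lt0 ltNge hs.
  have := big (e - t); rewrite -[e - t]opprB mulrN sinN oppr_lt0 => hb.
  by rewrite [X in _ && X]ltNge ltW ?andbF//; apply: hb; lra.
case: (ltP t e) => te.
  rewrite oppr_lt0 pos; last by lra.
  by rewrite -oppr_gt0 -sinN -mulrN; apply: pos; lra.
have [u|u] := leP (t - e) rho.
  have hs : 0 <= sin (w * (t - e)).
    by rewrite -oppr_le0 -sinN -mulrN; apply: npos; lra.
  by rewrite [X in _ && X]ltNge hs andbF.
have hb := big (t - c).
by rewrite oppr_lt0 [X in X && _]ltNge ltW//; apply: hb; lra.
Qed.

Lemma annih_rect (c e : 'I_d -> R) : (forall i, a i + rho / 2 <= c i) ->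
  (forall i, c i < e i) -> (forall i, e i <= a i + rho / 2 + rho) ->
  \int[L]_(x in open_rect c e) h x = 0.
Proof.
move=> hc ce he.
pose st i (x : E) : R := (cos (w * x 0 i + (pi / 2 - w * c i)) < 0)%R%:R *
   (cos (w * x 0 i + (- (pi / 2) - w * e i)) < 0)%R%:R.
have hs (s : seq 'I_d) : bounded1 (fun x => \prod_(i <- s) st i x) /\
    annih rho a h (fun x => \prod_(i <- s) st i x).
  elim: s => [|i s [b1 a1]].
    have -> : (fun x => \prod_(i <- [::]) st i x) = (fun=> 1) by apply/funext => x; rewrite big_nil.
    split; last exact: annih1.
    by split => // x; rewrite normr1.
  have -> : (fun x => \prod_(j <- i :: s) st j x) = (fun x => \prod_(j <- s) st j x *
     (cos (w * x 0 i + (pi / 2 - w * c i)) < 0)%R%:R * (cos (w * x 0 i + (- (pi / 2) - w * e i)) < 0)%R%:R).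
    by apply/funext => x; rewrite big_cons mulrC mulrA.
  have [a2 b2] := annih_step ih i (pi / 2 - w * c i) b1 a1.
  by have [a3 b3] := annih_step ih i (- (pi / 2) - w * e i) b2 a2.
have [_ aP] := hs (index_enum 'I_d); have := aP (fun=> 0) (fun=> 0).
have rB : open_rect c e `<=` box.
  move=> x hx i; have := hx i; rewrite /= !in_itv/= => /andP[h1 h2].
  have := hc i; have := he i => *; apply/andP; split; lra.
have -> : \int[L]_(x in box) (h x * ((\prod_(i <- index_enum 'I_d) st i x) * cosprod rho (fun=> 0) (fun=> 0) x)) =
   \int[L]_(x in open_rect c e) h x; last by [].
congr fine; rewrite integral_mkcond [RHS]integral_mkcond; apply: eq_integral => x _.
rewrite !patchE; case: ifPn => xB; last first.
  by rewrite memNset// => /rB xr; move/negP: xB; apply; rewrite inE.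
have -> : cosprod rho (fun=> 0) (fun=> 0) x = 1.
  by rewrite /cosprod big1// => i _; rewrite !mul0r add0r cos0.
rewrite mulr1; move: xB; rewrite inE => xB.
have sti i : st i x = (c i < x 0 i < e i)%R%:R.
  rewrite /st -natrM mulnb; congr (_ %:R); congr nat_of_bool.
  by apply: arc_interval; have := xB i; rewrite /=.
case: ifPn => xr.
  rewrite big1 ?mulr1// => i _; rewrite sti.
  by move: xr; rewrite inE => /(_ i); rewrite /= in_itv/= => ->.
have [i hi] : exists i, ~ (c i < x 0 i < e i).
  apply/existsNP => hx; move/negP: xr; apply; rewrite inE => i /=.
  by rewrite in_itv/=; exact: hx.
by rewrite (bigD1 i)//= sti; move/negP/negbTE: hi => ->; rewrite mul0r mulr0.
Qed.

Lemma trig_unique : {ae L, forall x, inner_box x -> h x = 0}.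
Proof.
pose h' x : R := if x \in inner_box then h x else 0.
have mI : measurable inner_box by exact: measurable_open_rect.
have ih' : L.-integrable setT (EFin \o h').
  apply: (@integrable_supp _ _ _ L setT inner_box) => //.
    by move=> x nx; rewrite /h' memNset.
  have := integrableS (@measurable_box R d rho a) mI inner_box_sub ih.
  by apply: eq_integrable => // x xI /=; rewrite /h' xI.
pose K := 1 + \sum_i (`|a i| + rho * 2).
have hK i : `|a i| + rho * 2 < K.
  rewrite /K (bigD1 i)//= addrCA -[X in X < _]addr0 ltrD2l ltr_pwDl//.
  by apply: sumr_ge0 => j _; rewrite addr_ge0// mulr_ge0// ltW.
suff : {ae L, forall x, h' x = 0}.
  by apply: ae_imp => x + xI; rewrite /h' mem_set.
apply: (ae0_open_rect (M := K)) => //.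
  move=> x nx; rewrite /h' memNset// => xI; apply: nx => i /=.
  have := inner_box_sub xI i; rewrite /= !in_itv/= => /andP[h1 h2].
  have := hK i; have := ler_norm (a i); have := ler_norm (- a i); rewrite normrN.
  by move=> *; apply/andP; split; lra.
move=> c e.
have -> : \int[L]_(x in open_rect c e) h' x = \int[L]_(x in open_rect c e `&` inner_box) h x.
  congr fine; rewrite [RHS]integral_mkcondr; apply: eq_integral => x _.
  by rewrite patchE /h'; case: ifP.
rewrite open_rectI.
set c' := fun i => _; set e' := fun i => _.
have [ce|] := pselect (forall i, c' i < e' i).
  apply: annih_rect => // i; first by rewrite le_max lexx orbT.
  by rewrite ge_min lexx orbT.
move=> /existsNP[i /negP]; rewrite -leNgt => hi.
rewrite (_ : open_rect c' e' = set0); first by apply: (@etrans _ _ (fine 0%E)) => //; congr fine; exact: integral_set0.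
apply/seteqP; split => // x /(_ i); rewrite /= => /andP[h1 h2].
by have := lt_trans h1 h2; rewrite ltNge hi.
Qed.

End Unique.

Lemma etrig_smooth tau k : smooth_on setT (etrig rho a tau k).
Proof.
apply: (smooth_prod _ openT) => i _; have := smooth_tower i (trig_tower rho (a i) (k i) (tau i)).
apply: smooth_eq; first exact: openT.
by move=> x _; rewrite mul1r mul0r addr0.
Qed.

(** * Uniformly convergent trigonometric series *)

Section Series.
Variable v : E -> R.
Hypothesis sv : sqint L box v.
Hypothesis v0 : forall x, ~ inner_box x -> v x = 0.
Local Notation coef k := (\int[L]_(x in box) (v x * etrig rho a (fun=> 0) k x)).
Variables (W : {ffun 'I_d -> nat} -> R) (A S : R).
Hypothesis W0 : forall k, 0 < W k.
Hypothesis hA : forall s : seq {ffun 'I_d -> nat}, uniq s -> \sum_(k <- s) W k * (coef k) ^+ 2 <= A.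
Hypothesis hS : forall s : seq {ffun 'I_d -> nat}, uniq s -> \sum_(k <- s) (W k)^-1 <= S.

Lemma seq_cauchy_schwarz (I : Type) (s : seq I) (x y : I -> R) :
  (\sum_(i <- s) x i * y i) ^+ 2 <= (\sum_(i <- s) x i ^+ 2) * (\sum_(i <- s) y i ^+ 2).
Proof.
apply: discriminant_le => [|t]; first by apply: sumr_ge0 => i _; exact: sqr_ge0.
have -> : (\sum_(i <- s) x i ^+ 2) * t ^+ 2 + (\sum_(i <- s) x i * y i) * t *+ 2 + \sum_(i <- s) y i ^+ 2 =
   \sum_(i <- s) (x i * t + y i) ^+ 2.
  rewrite mulr_suml mulr_suml -sumrMnl -!big_split; apply: eq_bigr => i _ /=; ring.
by apply: sumr_ge0 => i _; exact: sqr_ge0.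
Qed.

(** Cauchy-Schwarz against the weights: the source of uniform convergence. *)
Lemma sum_coef (s : seq {ffun 'I_d -> nat}) : uniq s -> \sum_(k <- s) `|coef k| <= Num.sqrt (A * S).
Proof.
move=> us; rewrite -[leLHS]ger0_norm; last exact: sumr_ge0.
rewrite -sqrtr_sqr; apply: ler_wsqrtr.
have -> : \sum_(k <- s) `|coef k| = \sum_(k <- s) (Num.sqrt (W k) * `|coef k|) * Num.sqrt (W k)^-1.
  apply: eq_bigr => k _; rewrite mulrAC -sqrtrM ?mulfV ?sqrtr1 ?mul1r//; first by rewrite gt_eqF.
  exact: ltW.
apply: le_trans (seq_cauchy_schwarz _ _ _) _; apply: ler_pM.
- by apply: sumr_ge0 => k _; exact: sqr_ge0.
- by apply: sumr_ge0 => k _; exact: sqr_ge0.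
- apply: le_trans (hA us); apply: ler_sum => k _.
  by rewrite exprMn sqr_sqrtr ?(ltW (W0 k))// -normrX ger0_norm ?sqr_ge0.
- apply: le_trans (hS us); apply: ler_sum => k _.
  by rewrite sqr_sqrtr// invr_ge0 ltW.
Qed.

(** The multi-indices are enumerated through [pickle_inv], with zero terms at numbers that code no
    index, so that the series is an ordinary sequence. *)
Let cn (n : nat) : R := if @pickle_inv {ffun 'I_d -> nat} n is Some k then coef k else 0.
Let en (n : nat) (x : E) : R :=
  if @pickle_inv {ffun 'I_d -> nat} n is Some k then etrig rho a (fun=> 0) k x else 0.
Let sn (N : nat) := pmap (@pickle_inv {ffun 'I_d -> nat}) (iota 0 N).

Let usn N : uniq (sn N).
Proof. by apply: (pmap_uniq (@pickle_invK _)); exact: iota_uniq. Qed.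

Let sumn N (F : {ffun 'I_d -> nat} -> R) :
  \sum_(n < N) (if @pickle_inv {ffun 'I_d -> nat} n is Some k then F k else 0) = \sum_(k <- sn N) F k.
Proof.
rewrite /sn -(big_mkord xpredT (fun n => if @pickle_inv {ffun 'I_d -> nat} n is Some k then F k else 0)).
rewrite /index_iota subn0; elim: (iota 0 N) => [|n s IH]; first by rewrite !big_nil.
by rewrite big_cons IH /=; case: pickle_inv => [k|] /=; rewrite ?big_cons// add0r.
Qed.

Let ka : R := (rho ^+ d)^-1.
Let ka0 : 0 < ka. Proof. by rewrite invr_gt0 exprn_gt0. Qed.

Let gN N x := ka * \sum_(n < N) cn n * en n x.
Let AN N := \sum_(n < N) `|cn n|.

Let AN_sum N : AN N = \sum_(k <- sn N) `|coef k|.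
Proof.
rewrite -sumn; apply: eq_bigr => n _; rewrite /cn; case: pickle_inv => //.
by rewrite normr0.
Qed.

Let AN_le N : AN N <= Num.sqrt (A * S).
Proof. by rewrite AN_sum; exact: sum_coef. Qed.

Let AN_nd : {homo AN : m n / (m <= n)%N >-> m <= n}.
Proof.
apply/nondecreasing_seqP => n; rewrite /AN big_ord_recr lerDl; exact: normr_ge0.
Qed.

Let AN_cvg : cvgn AN.
Proof.
apply: nondecreasing_is_cvgn; first exact: AN_nd.
by exists (Num.sqrt (A * S)) => _ [n _ <-]; exact: AN_le.
Qed.

Let en_le1 n x : `|en n x| <= 1.
Proof. by rewrite /en; case: pickle_inv => [k|]; rewrite ?normr0//; exact: etrig_le1. Qed.

Let gN_dist m n x : (m <= n)%N -> `|gN n x - gN m x| <= ka * (AN n - AN m).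
Proof.
elim: n => [|n IH]; first by rewrite leqn0 => /eqP ->; rewrite !subrr normr0 mulr0.
rewrite leq_eqVlt => /orP[/eqP <-|]; first by rewrite !subrr normr0 mulr0.
move/IH => h.
have -> : gN n.+1 x - gN m x = (gN n x - gN m x) + ka * (cn n * en n x).
  by rewrite /gN big_ord_recr /=; ring.
have -> : ka * (AN n.+1 - AN m) = ka * (AN n - AN m) + ka * `|cn n|.
  by rewrite /AN big_ord_recr /=; ring.
apply: le_trans (ler_normD _ _) _; apply: lerD => //.
by rewrite normrM (gtr0_norm ka0) ler_wpM2l ?(ltW ka0)// normrM ler_piMr.
Qed.

Let gN_cvg x : cvgn (gN ^~ x).
Proof.
pose u n := cn n * en n x.
have cs : cvgn (series u).
  apply: normed_cvg.
  have -> : [normed series u] = (fun N => \sum_(i < N) `|u i|).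
    by apply/funext => N; rewrite /normed_series_of /series /= big_mkord.
  apply: nondecreasing_is_cvgn.
    apply/nondecreasing_seqP => n; rewrite big_ord_recr/= lerDl; exact: normr_ge0.
  exists (Num.sqrt (A * S)) => _ [n _ <-]; apply: le_trans (AN_le n).
  apply: ler_sum => i _.
  by rewrite normrM ler_piMr.
have -> : gN ^~ x = (fun N => ka * series u N).
  by apply/funext => N; rewrite seriesEnat /= big_mkord.
by apply: is_cvgM => //; exact: is_cvg_cst.
Qed.

Let g x := limn (gN ^~ x).
Let dN N := ka * (limn AN - AN N).

Let g_dist N x : `|g x - gN N x| <= dN N.
Proof.
have c1 : `|gN n x - gN N x| @[n --> \oo] --> `|g x - gN N x|.
  by apply: cvg_norm; apply: cvgB; [exact: gN_cvg|exact: cvg_cst].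
have c2 : ka * (AN n - AN N) @[n --> \oo] --> dN N.
  by apply: cvgM; [exact: cvg_cst|apply: cvgB; [exact: AN_cvg|exact: cvg_cst]].
rewrite -(cvg_lim (@Rhausdorff R) c1) -(cvg_lim (@Rhausdorff R) c2).
apply: ler_lim; [by apply/cvg_ex; eexists; exact: c1|by apply/cvg_ex; eexists; exact: c2|].
by exists N => // n /= Nn; exact: gN_dist.
Qed.

Let dN_cvg : dN N @[N --> \oo] --> 0.
Proof.
have -> : 0 = ka * (limn AN - limn AN) by rewrite subrr mulr0.
by apply: cvgM; [exact: cvg_cst|apply: cvgB; [exact: cvg_cst|exact: AN_cvg]].
Qed.

Let en_continuous n : continuous (en n).
Proof.
rewrite /en; case: pickle_inv => [k|]; last exact: cst_continuous.
by move=> x; exact: (smooth_continuous (etrig_smooth _ _)).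
Qed.

Let gN_continuous N : continuous (gN N).
Proof.
elim: N => [|N IH] x.
  have -> : gN 0 = fun=> 0 by apply/funext => y; rewrite /gN big_ord0 mulr0.
  exact: cst_continuous.
have -> : gN N.+1 = fun x => gN N x + ka * (cn N * en N x).
  by apply/funext => y; rewrite /gN big_ord_recr mulrDr.
apply: continuousD; first exact: IH.
apply: continuousM; first exact: cst_continuous.
by apply: continuousM; [exact: cst_continuous|exact: en_continuous].
Qed.

Let g_continuous : continuous g.
Proof.
move=> x; have FF : Filter (nbhs (x : E)) := nbhs_filter x.
apply/cvgrPdist_le => e e0.
have e3 : 0 < e / 3 by rewrite divr_gt0.
have := dN_cvg => /cvgrPdist_le/(_ _ e3)[N _ /(_ N (leqnn N))].
rewrite sub0r normrN => hN; have dNe : dN N <= e / 3 by apply: le_trans (ler_norm _) hN.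
have := @gN_continuous N x => /cvgrPdist_le/(_ _ e3); apply: filterS => y hy.
have -> : g x - g y = (g x - gN N x) + (gN N x - gN N y) - (g y - gN N y) by ring.
have h1 := le_trans (g_dist N x) dNe; have h2 := le_trans (g_dist N y) dNe.
apply: le_trans (ler_normB _ _) _; apply: le_trans (lerD (ler_normD _ _) (lexx _)) _.
by move: h1 h2 hy; lra.
Qed.

(** The sum g has the coefficients of v, so [trig_unique] identifies them on the inner box. The last
    clause is the half of Parseval's identity that Bessel's inequality does not give. *)
Lemma trig_series : exists g : E -> R, [/\ continuous g,
  forall x, `|g x| <= (rho ^+ d)^-1 * Num.sqrt (A * S),
  {ae L, forall x, inner_box x -> v x = g x} &
  forall B, (forall s : seq {ffun 'I_d -> nat}, uniq s -> \sum_(k <- s) (coef k) ^+ 2 <= B) ->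
    \int[L]_(x in box) (v x ^+ 2) <= (rho ^+ d)^-1 * B].
Proof.
have gb x : `|g x| <= ka * Num.sqrt (A * S).
  have := g_dist 0 x; rewrite /gN big_ord0 mulr0 subr0 /dN /AN big_ord0 subr0 => h.
  apply: (le_trans h); rewrite ler_wpM2l ?(ltW ka0)//.
  by apply: limr_le => //; apply: nearW => n; exact: AN_le.
have mB := @measurable_box R d rho a.
have mg : measurable_fun setT (g : borel E -> R).
  by apply: (@borel_real_continuous R _ setT g); [exact: openT|move=> x _; exact: g_continuous].
have mgN N : measurable_fun setT (gN N : borel E -> R).
  by apply: (@borel_real_continuous R _ setT (gN N)); [exact: openT|move=> x _; exact: gN_continuous].
have men n : measurable_fun setT (en n : borel E -> R).
  by apply: (@borel_real_continuous R _ setT (en n)); [exact: openT|move=> x _; exact: en_continuous].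
have sbd f K : measurable_fun setT (f : borel E -> R) -> (forall x, `|f x| <= K) -> sqint L box f.
  move=> mf hf; split; first exact: measurable_funTS.
  apply: (@integrable_box _ _ _ _ _ (K ^+ 2)); first exact: measurable_funX.
  by move=> x; rewrite normrX; have := hf x; have := normr_ge0 (f x); nra.
have sg : sqint L box g by exact: sbd mg gb.
have gNb N x : `|gN N x| <= ka * Num.sqrt (A * S) + dN N.
  have -> : gN N x = g x - (g x - gN N x) by ring.
  by apply: le_trans (ler_normB _ _) _; rewrite lerD.
have sgN N : sqint L box (gN N) by exact: sbd (mgN N) (gNb N).
have se k := etrig_sqint rho a (fun=> 0) k.
have smul f : sqint L box f -> L.-integrable box (EFin \o f).
  move=> sf; have s1 : sqint L box (fun=> 1) by apply: (@sbd _ 1) => // x; rewrite normr1.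
  by have := sqintM mB sf s1; apply: eq_integrable => // x _ /=; rewrite mulr1.
have limE (f : E -> R) : sqint L box f ->
   \int[L]_(x in box) (gN N x * f x) @[N --> \oo] --> \int[L]_(x in box) (g x * f x).
  move=> sf; apply/cvgrPdist_le => e e0.
  have iaf : L.-integrable box (EFin \o (fun x => `|f x|)) by exact: integrable_abse (smul _ sf).
  set I := \int[L]_(x in box) `|f x|.
  have I0 : 0 <= I by apply: Rintegral_ge0.
  have e1 : 0 < e / (1 + I) by rewrite divr_gt0// ltr_pwDl.
  have := dN_cvg => /cvgrPdist_le/(_ _ e1); apply: filterS => N; rewrite sub0r normrN => hN.
  have ig := sqintM mB sg sf; have igN := sqintM mB (sgN N) sf.
  have eB : \int[L]_(x in box) (g x * f x) - \int[L]_(x in box) (gN N x * f x) =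
     \int[L]_(x in box) ((g x - gN N x) * f x).
    have -> : (fun x => (g x - gN N x) * f x) = (fun x => g x * f x - gN N x * f x).
      by apply/funext => x; rewrite mulrBl.
    by have := RintegralB mB ig igN => h; apply: esym; apply: (etrans h).
  rewrite eB.
  have igg : L.-integrable box (EFin \o (fun x => (g x - gN N x) * f x)).
    have := RintegrableB mB ig igN; apply: eq_integrable => // x _ /=.
    by rewrite mulrBl.
  apply: le_trans (le_normr_Rintegral mB igg) _.
  apply: (@le_trans _ _ (\int[L]_(x in box) (dN N * `|f x|))).
    apply: le_Rintegral => //; first exact: integrable_abse igg.
      exact: RintegrableZ.
    by move=> x _; rewrite normrM ler_wpM2r.
  have h := RintegralZl (dN N) mB iaf.
  apply: (@le_trans _ _ (dN N * I)); first by rewrite -h.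
  apply: (@le_trans _ _ (e / (1 + I) * I)).
    by rewrite ler_wpM2r//; apply: le_trans (ler_norm _) hN.
  by rewrite mulrAC ler_pdivrMr ?ltr_pwDl// ler_wpM2l ?(ltW e0)// lerDr.
have gNint f N : sqint L box f -> \int[L]_(x in box) (gN N x * f x) =
    ka * \sum_(k <- sn N) coef k * \int[L]_(x in box) (etrig rho a (fun=> 0) k x * f x).
  move=> sf.
  have -> : (fun x => gN N x * f x) = (fun x => ka * \sum_(k <- sn N) coef k * (etrig rho a (fun=> 0) k x * f x)).
    apply/funext => x; rewrite /gN -mulrA; congr (_ * _); rewrite mulr_suml.
    rewrite -(sumn N (fun k => coef k * (etrig rho a (fun=> 0) k x * f x))); apply: eq_bigr => n _.
    by rewrite /cn /en; case: pickle_inv => [k|]; rewrite ?mulrA// !mul0r.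
  have i1 k : L.-integrable box (EFin \o (fun x => coef k * (etrig rho a (fun=> 0) k x * f x))).
    exact: (RintegrableZ _ mB (sqintM mB (se k) sf)).
  have i2 := Rintegrable_sum (sn N) mB (fun k (_ : xpredT k) => i1 k).
  apply: (etrans (RintegralZl ka mB i2)); congr (_ * _).
  apply: (etrans (Rintegral_sum (sn N) mB (fun k (_ : xpredT k) => i1 k))).
  by apply: eq_bigr => k _; have := RintegralZl (coef k) mB (sqintM mB (se k) sf); apply: etrans.
have gcoef (k : {ffun 'I_d -> nat}) : \int[L]_(x in box) (g x * etrig rho a (fun=> 0) k x) = coef k.
  have := limE _ (se k) => /cvg_lim => <- //; apply: cvg_lim => //.
  (* Once N exceeds the code of k, the partial sum contains the term k and its k-th coefficient no
     longer changes. *)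
  apply: cvg_near_cst; exists (pickle k).+1 => // N /= hN.
  rewrite gNint//.
  have ks : k \in sn N.
    by rewrite /sn mem_pmap; apply/mapP; exists (pickle k); rewrite ?mem_iota ?add0n// pickleK_inv.
  rewrite (bigD1_seq k)//= big1 ?addr0; last first.
    by move=> l /negbTE lk; rewrite etrig_orth// lk !mulr0.
  rewrite etrig_orth// eqxx mulr1 /ka mulrCA mulVf ?mulr1// gt_eqF// exprn_gt0//.
pose h x := v x - g x.
have ih : L.-integrable box (EFin \o h) by apply: RintegrableB => //; exact: smul.
have h0 (k : {ffun 'I_d -> nat}) : \int[L]_(x in box) (h x * etrig rho a (fun=> 0) k x) = 0.
  have -> : (fun x => h x * etrig rho a (fun=> 0) k x) =
     (fun x => v x * etrig rho a (fun=> 0) k x - g x * etrig rho a (fun=> 0) k x).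
    by apply/funext => x; rewrite mulrBl.
  apply: (etrans (RintegralB mB (sqintM mB sv (se k)) (sqintM mB sg (se k)))).
  by rewrite gcoef subrr.
have vg : {ae L, forall x, inner_box x -> v x = g x}.
  by apply: ae_imp (trig_unique ih h0) => x hx xI; apply/eqP; rewrite -subr_eq0; apply/eqP; exact: hx.
exists g; split => //.
move=> B hB.
(* g and v may differ outside the inner box, but v vanishes there, so v^2 = g v almost
   everywhere. *)
have -> : \int[L]_(x in box) (v x ^+ 2) = \int[L]_(x in box) (g x * v x).
  congr fine; apply: (@ae_eq_integral _ _ _ L box (fun x => (g x * v x)%:E) (fun x => (v x ^+ 2)%:E) mB).
  - by apply/measurable_EFinP; apply: measurable_funX; have [] := sv.
  - by apply/measurable_EFinP; apply: measurable_funM; [exact: measurable_funTS|have [] := sv].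
  - apply: ae_imp vg => x hx _; congr EFin.
    have [xI|xI] := pselect (inner_box x); first by rewrite {1}expr2 {1}hx.
    by rewrite v0// mulr0 expr0n.
have := limE _ sv => /cvg_lim => <- //.
apply: limr_le; first by apply/cvg_ex; eexists; exact: limE.
apply: nearW => N; rewrite gNint// ler_wpM2l ?(ltW ka0)//.
apply: le_trans (hB (sn N) (usn N)); apply: le_of_eq.
apply: eq_bigr => k _; rewrite expr2; congr (_ * _); congr fine.
by apply: eq_integral => x _; rewrite mulrC.
Qed.

End Series.

End TrigComplete.

(** * Summability of the inverse weights *)

Section Summability.
Context {R : realType}.

(** Condensation: the block of length 2^m that starts at j = 2^m - 1 contributes at most 2^m
    (2^m)^(-th) = q^m. *)
Lemma pseries_bound (th : R) : 1 < th ->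
  exists2 C : R, 0 < C & forall n, \sum_(j < n) j.+1%:R `^ (- th) <= C.
Proof.
move=> th1; pose q : R := 2 `^ (1 - th).
have q0 : 0 < q by rewrite powR_gt0.
have q1 : q < 1.
  have th0 : 0 < th - 1 by rewrite subr_gt0.
  have : 1 `^ (th - 1) < 2 `^ (th - 1) by apply: gt0_ltr_powR; rewrite ?nnegrE// ltr1n.
  by rewrite powR1 => h; rewrite /q -opprB powRN invf_lt1.
exists (1 - q)^-1; first by rewrite invr_gt0 subr_gt0.
have dy m : \sum_(0 <= j < (2 ^ m).-1) j.+1%:R `^ (- th) <= \sum_(0 <= i < m) q ^+ i.
  elim: m => [|m IH]; first by rewrite !big_geq.
  rewrite big_nat_recr//= (@big_cat_nat _ _ _ (2 ^ m).-1)//=; last first.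
    by rewrite expnS -!subn1 leq_sub2r// mul2n -addnn leq_addl.
  apply: lerD => //; apply: (@le_trans _ _ (\sum_((2 ^ m).-1 <= i < (2 ^ m.+1).-1) ((2 ^ m)%:R `^ (- th)))).
    rewrite big_nat [leRHS]big_nat; apply: ler_sum => j /andP[j1 _].
    rewrite !powRN lef_pV2 ?posrE ?expn_gt0//.
    rewrite ge0_ler_powR ?nnegrE ?ler0n//; first by rewrite ltW// (lt_trans ltr01).
    rewrite ler_nat; case: (2 ^ m)%N j1 => // k /=; exact.
  rewrite sumr_const_nat (_ : ((2 ^ m.+1).-1 - (2 ^ m).-1 = 2 ^ m)%N); last first.
    by rewrite expnS; have : (0 < 2 ^ m)%N by [rewrite expn_gt0]; lia.
  have e2 : (2 ^ m)%:R = (2 : R) `^ m%:R by rewrite natrX powR_mulrn.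
  set X := _ `^ (- th); rewrite -[X *+ _]mulr_natl /X e2 -powRrM -powRD; last by rewrite pnatr_eq0 implybT.
  by rewrite -powR_mulrn ?powR_ge0// -powRrM; apply: le_of_eq; congr (_ `^ _); ring.
move=> n; apply: (@le_trans _ _ (\sum_(0 <= j < (2 ^ n).-1) j.+1%:R `^ (- th))).
  rewrite -(big_mkord xpredT (fun j => j.+1%:R `^ (- th))).
  rewrite [leRHS](@big_cat_nat _ _ _ n)//=; last first.
    by have := ltn_expl n (isT : (1 < 2)%N); case: (2 ^ n)%N => // k /=.
  by rewrite lerDl; apply: sumr_ge0 => i _; exact: powR_ge0.
apply: (le_trans (dy n)).
have : \sum_(0 <= i < n) q ^+ i * (1 - q) <= 1.
  have -> : \sum_(0 <= i < n) q ^+ i * (1 - q) = 1 - q ^+ n.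
    elim: n => [|n IH]; first by rewrite big_geq// subrr.
    by rewrite big_nat_recr//= IH exprSr; ring.
  by rewrite gerBl exprn_ge0// ltW.
by rewrite -mulr_suml -ler_pdivlMr ?subr_gt0// div1r.
Qed.

(** The finitely many indices lie in a cube {0,...,M-1}^d, over which the sum of products
    factors. *)
Lemma sum_prod_uniq d (s : seq {ffun 'I_d -> nat}) (f : nat -> R) : uniq s ->
  (forall j, 0 <= f j) -> exists M : nat,
  \sum_(k <- s) \prod_i f (k i) <= \prod_(i < d) \sum_(j < M) f j.
Proof.
move=> us f0; pose M := (\max_(k <- s) \max_i k i)%N.
have hM k i : k \in s -> (k i < M.+1)%N.
  move=> ks; rewrite ltnS; apply: (@leq_trans (\max_i k i)).
    exact: leq_bigmax_cond.
  exact: leq_bigmax_seq.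
exists M.+1; rewrite bigA_distr_bigA.
pose t (k : {ffun 'I_d -> nat}) : {ffun 'I_d -> 'I_M.+1} := [ffun i => inord (k i)].
have tE k i : k \in s -> t k i = k i :> nat.
  by move=> ks; rewrite ffunE inordK//; exact: hM.
have ut : uniq (map t s).
  rewrite map_inj_in_uniq// => k l ks ls tkl; apply/ffunP => i.
  by rewrite -(tE k i ks) tkl tE.
have -> : \sum_(k <- s) \prod_i f (k i) = \sum_(k <- map t s) \prod_i f (k i).
  rewrite big_map big_seq [RHS]big_seq; apply: eq_bigr => k ks.
  by apply: eq_bigr => i _; rewrite tE.
rewrite big_uniq//= [leRHS](bigID (mem (map t s)))/= lerDl.
by apply: sumr_ge0 => k _; apply: prodr_ge0.
Qed.

Lemma expr_add_le (x y : R) n : 0 <= x -> 0 <= y ->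
  (x + y) ^+ n <= 2 ^+ n * (x ^+ n + y ^+ n).
Proof.
wlog xy : x y / x <= y.
  move=> h x0 y0; case: (leP x y) => [xy|/ltW yx]; first exact: h.
  by rewrite addrC [x ^+ n + _]addrC; exact: h.
move=> x0 y0; apply: (@le_trans _ _ ((2 * y) ^+ n)).
  by rewrite lerXn2r ?nnegrE; lra.
by rewrite exprMn ler_wpM2l ?exprn_ge0// lerDr exprn_ge0.
Qed.

Variables (d r : nat) (w : R).
Hypotheses (d_gt0 : (0 < d)%N) (rd : (d < 2 * r)%N) (w0 : 0 < w).

Definition weight (k : {ffun 'I_d -> nat}) : R :=
  1 + \sum_i ((uphalf (k i))%:R * w) ^+ (2 * r).

Lemma weight_ge1 k : 1 <= weight k.
Proof.
by rewrite lerDl; apply: sumr_ge0 => i _; rewrite exprn_ge0// mulr_ge0// ltW.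
Qed.

Lemma weight_coord (k : {ffun 'I_d -> nat}) i : ((uphalf (k i))%:R * w) ^+ (2 * r) <= weight k.
Proof.
rewrite /weight (bigD1 i)//= addrCA lerDl addr_ge0//.
by apply: sumr_ge0 => j _; rewrite exprn_ge0// mulr_ge0// ltW.
Qed.

(** As k_i + 1 <= 1 + 2 [uphalf (k i)], a power of k_i + 1 is controlled by 1 plus the same power of
    the frequency. *)
Lemma weight_lower : exists2 c : R, 0 < c & forall (k : {ffun 'I_d -> nat}) i,
  c * (k i).+1%:R ^+ (2 * r) <= weight k.
Proof.
pose D : R := 2 ^+ (2 * r) * (1 + (2 / w) ^+ (2 * r)).
have D0 : 0 < D by rewrite mulr_gt0 ?exprn_gt0// ltr_pwDl// exprn_ge0// divr_ge0// ltW.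
exists (D^-1 / 2); first by rewrite divr_gt0// invr_gt0.
move=> k i; pose x := (uphalf (k i))%:R * w.
have x0 : 0 <= x by rewrite mulr_ge0// ltW.
have h1 : (k i).+1%:R <= 1 + (2 / w) * x.
  rewrite mulrA mulrAC divfK ?gt_eqF// -natr1 addrC lerD2l -natrM ler_nat mul2n.
  rewrite uphalf_half -{1}(odd_double_half (k i)).
  by case: (odd _).
have h2 : (k i).+1%:R ^+ (2 * r) <= D * (1 + x ^+ (2 * r)).
  apply: (@le_trans _ _ ((1 + (2 / w) * x) ^+ (2 * r))).
    by rewrite lerXn2r ?nnegrE// addr_ge0// mulr_ge0// divr_ge0// ltW.
  apply: le_trans (expr_add_le _ _ _) _ => //; first by rewrite mulr_ge0// divr_ge0// ltW.
  rewrite -[X in _ <= X]mulrA ler_wpM2l ?exprn_ge0// expr1n exprMn.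
  have := exprn_ge0 (2 * r) x0.
  have : 0 <= (2 / w) ^+ (2 * r) by rewrite exprn_ge0// divr_ge0// ltW.
  by move: ((2 / w) ^+ _) (x ^+ _) => u v *; nra.
have h3 : 1 + x ^+ (2 * r) <= 2 * weight k.
  by have := weight_ge1 k; have := weight_coord k i; rewrite -/x; lra.
rewrite mulrAC ler_pdivrMr// mulrC -ler_pdivlMr ?invr_gt0// invrK.
by apply: (le_trans h2); rewrite mulrC ler_pM2r// [weight k * 2]mulrC.
Qed.

(** The largest k_i controls the product: prod (k_i + 1)^(2r/d) <= max (k_i + 1)^(2r), and the
    exponent 2r/d exceeds 1. *)
Lemma weight_summable : exists2 S : R, 0 < S & forall s : seq {ffun 'I_d -> nat}, uniq s ->
  \sum_(k <- s) (weight k)^-1 <= S.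
Proof.
have [c c0 hc] := weight_lower.
pose th : R := (2 * r)%:R / d%:R.
have dR : 0 < d%:R :> R by rewrite ltr0n.
have th1 : 1 < th by rewrite ltr_pdivlMr// mul1r ltr_nat.
have [C C0 hC] := pseries_bound th1.
exists (c^-1 * C ^+ d); first by rewrite mulr_gt0 ?invr_gt0 ?exprn_gt0.
move=> s us.
have hk (k : {ffun 'I_d -> nat}) : (weight k)^-1 <= c^-1 * \prod_i ((k i).+1%:R `^ (- th)).
  have [i0 _ hi] := @arg_maxnP _ (Ordinal d_gt0) xpredT k isT.
  have -> : \prod_i ((k i).+1%:R `^ (- th)) = (\prod_i ((k i).+1%:R `^ th))^-1.
    by rewrite -prodfV; apply: eq_bigr => i _; rewrite powRN.
  rewrite -invfM lef_pV2 ?posrE ?mulr_gt0 ?(lt_le_trans ltr01 (weight_ge1 k))//; last first.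
    by apply: prodr_gt0 => i _; rewrite powR_gt0.
  apply: le_trans (hc k i0); rewrite ler_pM2l//.
  apply: (@le_trans _ _ (\prod_(i < d) ((k i0).+1%:R `^ th))).
    apply: ler_prod => i _; rewrite powR_ge0/= ge0_ler_powR ?nnegrE ?ler0n//.
      by rewrite ltW// (lt_trans ltr01).
    by rewrite ler_nat; exact: hi.
  rewrite prodr_const card_ord -powR_mulrn ?powR_ge0// -powRrM -powR_mulrn//.
  by rewrite divfK// gt_eqF.
apply: (@le_trans _ _ (c^-1 * \sum_(k <- s) \prod_i ((k i).+1%:R `^ (- th)))).
  by rewrite mulr_sumr; apply: ler_sum => k _; exact: hk.
rewrite ler_pM2l ?invr_gt0//.
have [M hM] := @sum_prod_uniq d s (fun j => j.+1%:R `^ (- th)) us (fun j => powR_ge0 _ _).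
apply: (le_trans hM); rewrite prodr_const card_ord lerXn2r ?nnegrE ?(ltW C0)//.
by apply: sumr_ge0 => j _; exact: powR_ge0.
Qed.

End Summability.

Section IterPartial.
Context {R : realType} {d : nat}.
Local Notation E := 'rV[R]_d.
Opaque smooth_on.

Lemma partial_const_line (P : E -> R) i x : (forall y h, P (y + h *: e_ i) = P y) ->
  derivable P x (e_ i) /\ partial i P x = 0.
Proof.
move=> hP; have e : (fun h : R => h^-1 *: ((P \o shift x) (h *: e_ i) - P x)) = fun=> 0.
  apply/funext => h; have -> : (P \o shift x) (h *: e_ i) = P x.
    by rewrite -[RHS](hP x h) [x + _]addrC.
  by rewrite subrr scaler0.
split; first by rewrite /derivable e; exact: is_cvg_cst.
by rewrite /partial /derive e lim_cst.
Qed.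

Lemma iter_partial_tower (P : E -> R) (F : nat -> R -> R) i m : tower F ->
  (forall y h, P (y + h *: e_ i) = P y) ->
  iter m (partial i) (fun x => P x * F 0%N (x 0 i)) = (fun x => P x * F m (x 0 i)).
Proof.
move=> tF hP; elim: m => [//|m IH]; rewrite iterS IH; apply/funext => x.
have [d1 p1] := partial_const_line x hP; have [d2 p2] := partial_tower m i i x tF.
by rewrite (partialM d1 d2) p1 p2 eqxx mulr0 addr0.
Qed.

(** The initial phase -m pi/2 in direction i is chosen so that m derivatives end at phase 0. *)
Lemma iter_partial_etrig (rho : R) (a : 'I_d -> R) (k : 'I_d -> nat) i m :
  iter m (partial i) (etrig rho a (fun j => if j == i then - (m%:R * (pi / 2)) else 0) k) =
  (fun x => ((uphalf (k i))%:R * freq rho) ^+ m * etrig rho a (fun=> 0) k x).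
Proof.
set tau := fun j => _.
pose P (x : E) := \prod_(j < d | j != i) trig rho (a j) (k j) 0 (x 0 j).
pose F n t := ((uphalf (k i))%:R * freq rho) ^+ n *
  trig rho (a i) (k i) (- (m%:R * (pi / 2)) + n%:R * (pi / 2)) t.
have tF : tower F by exact: trig_tower.
have -> : etrig rho a tau k = (fun x => P x * F 0%N (x 0 i)).
  apply/funext => x; rewrite /etrig (bigD1 i)//= mulrC /F /tau eqxx mul1r mul0r addr0.
  by congr (_ * _); apply: eq_bigr => j /negbTE ->.
rewrite iter_partial_tower//.
  apply/funext => x; rewrite /F addNr mulrCA; congr (_ * _).
  by rewrite /etrig (bigD1 i)//= mulrC.
move=> y h; apply: eq_bigr => j /negbTE ji; rewrite !mxE ji.
by rewrite mulr0 addr0.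
Qed.

End IterPartial.

(** * Tensor algebra *)

Section PullCorr.
Context {R : comRingType} {d : nat}.
Implicit Types (A : 'I_d -> 'I_d -> R) (I : seq 'I_d) (S T : seq 'I_d -> R)
  (G : 'I_d -> 'I_d -> R).

(** Components of a covariant tensor in another frame, by recursion on the multi-index, so that the
    Leibniz rule and the correction terms follow the same recursion. [pull_tuple] gives the usual
    sum. *)
Fixpoint pull A I S : R :=
  if I is i :: I' then \sum_a A i a * pull A I' (fun J => S (a :: J)) else S [::].

(* [G i l] stands for [Gamma^l_{k i}], with k fixed. *)
Fixpoint corr G I T : R :=
  if I is i :: I' then
    \sum_l G i l * T (l :: I') + corr G I' (fun J => T (i :: J))
  else 0.

Lemma eq_pull A I S S' : (forall J, size J = size I -> S J = S' J) -> pull A I S = pull A I S'.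
Proof.
elim: I S S' => [|i I IH] S S' h /=; first exact: h.
by apply: eq_bigr => a _; congr (_ * _); apply: IH => J sJ; rewrite h//= sJ.
Qed.

Lemma eq_corr G I T T' : (forall J, size J = size I -> T J = T' J) -> corr G I T = corr G I T'.
Proof.
elim: I T T' => [|i I IH] T T' h //=; congr (_ + _).
  by apply: eq_bigr => a _; rewrite h.
by apply: IH => J sJ; rewrite h//= sJ.
Qed.

Lemma pull_sum A I n (c : 'I_n -> R) (S : 'I_n -> seq 'I_d -> R) :
  pull A I (fun J => \sum_i c i * S i J) = \sum_i c i * pull A I (S i).
Proof.
elim: I S => [|k I IH] S //=.
transitivity (\sum_a \sum_i A k a * (c i * pull A I (fun J => S i (a :: J)))).
  by apply: eq_bigr => a _; rewrite IH mulr_sumr.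
rewrite exchange_big; apply: eq_bigr => i _; rewrite mulr_sumr.
by apply: eq_bigr => a _; rewrite mulrCA.
Qed.

Lemma pullD A I S S' : pull A I (fun J => S J + S' J) = pull A I S + pull A I S'.
Proof.
elim: I S S' => [|k I IH] S S' //=; rewrite -big_split; apply: eq_bigr => a _ /=.
by rewrite IH mulrDr.
Qed.

Lemma corr_sum G I n (c : 'I_n -> R) (T : 'I_n -> seq 'I_d -> R) :
  corr G I (fun J => \sum_i c i * T i J) = \sum_i c i * corr G I (T i).
Proof.
elim: I T => [|k I IH] T /=; first by rewrite big1// => i _; rewrite mulr0.
rewrite IH; under [RHS]eq_bigr do rewrite mulrDr; rewrite big_split; congr (_ + _).
transitivity (\sum_l \sum_i G k l * (c i * T i (l :: I))).
  by apply: eq_bigr => a _; rewrite mulr_sumr.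
rewrite exchange_big; apply: eq_bigr => i _; rewrite mulr_sumr.
by apply: eq_bigr => a _; rewrite mulrCA.
Qed.

(* The part of the derivative of [pull A I S] in which the derivative [H] of A appears. *)
Fixpoint dpull A (H : 'I_d -> 'I_d -> R) I S : R :=
  if I is i :: I' then
    \sum_a H i a * pull A I' (fun J => S (a :: J)) +
    \sum_a A i a * dpull A H I' (fun J => S (a :: J))
  else 0.

(** The hypothesis is the law of change of the Christoffel symbols with k fixed. Its inhomogeneous
    part H yields exactly the part of the derivative of the pull-back that cancels in [cov_pull]. *)
Lemma corr_pull A (H : 'I_d -> 'I_d -> R) G (A1 : 'I_d -> R)
    (G' : 'I_d -> 'I_d -> 'I_d -> R) I S :
  (forall i a, \sum_l G i l * A l a =
     H i a + \sum_b \sum_c A1 b * A i c * G' b c a) ->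
  corr G I (fun J => pull A J S) =
  dpull A H I S + \sum_b A1 b * pull A I (fun K => corr (G' b) K S).
Proof.
move=> hG; elim: I S => [|i I IH] S /=.
  by rewrite add0r big1// => b _; rewrite mulr0.
rewrite corr_sum; under [X in _ + X]eq_bigr do rewrite IH mulrDr.
have -> : \sum_l G i l * (\sum_a A l a * pull A I (fun J => S (a :: J))) =
   \sum_a (\sum_l G i l * A l a) * pull A I (fun J => S (a :: J)).
  under eq_bigr do rewrite mulr_sumr; rewrite exchange_big.
  by apply: eq_bigr => a _; rewrite mulr_suml; apply: eq_bigr => l _; rewrite mulrA.
have -> : \sum_a (\sum_l G i l * A l a) * pull A I (fun J => S (a :: J)) =
   \sum_a H i a * pull A I (fun J => S (a :: J)) +
   \sum_a (\sum_b \sum_c A1 b * A i c * G' b c a) * pull A I (fun J => S (a :: J)).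
  by rewrite -big_split; apply: eq_bigr => a _; rewrite hG mulrDl.
rewrite !big_split/= -!addrA; congr (_ + _).
rewrite addrCA; congr (_ + _).
have -> : \sum_b A1 b * (\sum_c A i c * pull A I (fun J => corr (G' b) (c :: J) S)) =
  \sum_b A1 b * (\sum_c A i c * pull A I (fun J => \sum_l G' b c l * S (l :: J))) +
  \sum_b A1 b * (\sum_c A i c * pull A I (fun J => corr (G' b) J (fun K => S (c :: K)))).
  rewrite -big_split; apply: eq_bigr => b _ /=; rewrite -mulrDr -big_split; congr (_ * _).
  by apply: eq_bigr => c _ /=; rewrite -mulrDr -pullD.
congr (_ + _).
  under eq_bigr do rewrite mulr_suml; rewrite exchange_big; apply: eq_bigr => b _.
  rewrite mulr_sumr; under eq_bigr do rewrite mulr_suml; rewrite exchange_big.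
  apply: eq_bigr => c _; rewrite pull_sum !mulr_sumr; apply: eq_bigr => a _.
  by rewrite !mulrA.
under eq_bigr do rewrite mulr_sumr; rewrite exchange_big; apply: eq_bigr => b _.
by rewrite mulr_sumr; apply: eq_bigr => c _; rewrite mulrCA.
Qed.

Lemma sum_tupleS n (F : n.+1.-tuple 'I_d -> R) :
  \sum_(J : n.+1.-tuple 'I_d) F J = \sum_a \sum_(J : n.-tuple 'I_d) F [tuple of a :: J].
Proof.
rewrite pair_big.
rewrite (reindex (fun p : 'I_d * n.-tuple 'I_d => [tuple of p.1 :: p.2])) //=.
exists (fun t => (thead t, [tuple of behead t])) => [[a J]|t] _ /=.
  by congr (_, _); apply: val_inj.
by rewrite -tuple_eta.
Qed.

Lemma pull_tuple A n (I : n.-tuple 'I_d) S :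
  pull A I S = \sum_(J : n.-tuple 'I_d) (\prod_(m < n) A (tnth I m) (tnth J m)) * S J.
Proof.
elim: n I S => [|n IH] I S.
  rewrite tuple0 (big_pred1 [tuple]) => [|J]; last by apply/esym/eqP; exact: tuple0.
  by rewrite big_ord0 mul1r.
case/tupleP: I => i I; rewrite sum_tupleS /=; apply: eq_bigr => a _.
rewrite IH mulr_sumr; apply: eq_bigr => J _.
rewrite big_ord_recl mulrA; congr (_ * _ * _).
by apply: eq_bigr => m _; rewrite !tnthS.
Qed.

Lemma corr_nth (k : 'I_d) G I T :
  corr G I T = \sum_(m < size I) \sum_l G (nth k I m) l * T (set_nth k I m l).
Proof.
elim: I T => [|i I IH] T /=; first by rewrite big_ord0.
by rewrite big_ord_recl IH.
Qed.

End PullCorr.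

(** * Algebra of the change of Christoffel symbols *)

Section ChristoffelAlgebra.
Variables (R : comUnitRingType) (d : nat).
Variables (J G' : 'M[R]_d) (H : 'I_d -> 'I_d -> 'I_d -> R) (D : 'I_d -> 'I_d -> 'I_d -> R).
Hypothesis Hsym : forall k i a, H k i a = H i k a.
Hypothesis Gsym : forall a b, G' a b = G' b a.

(* [H k i a] = d_k J_ia and [D c a b] = d_c G'_ab; [dG k m i] is then the
   derivative d_k G_mi of G = J G' J^T. *)
Let dG k m i := \sum_a \sum_b (H k m a * J i b * G' a b + J m a * H k i b * G' a b +
   J m a * J i b * \sum_c J k c * D c a b).

(** In this combination the terms with second derivatives cancel by the symmetry of H, except the
    two that contain [H k i]. *)
Lemma christoffel_lower k i m :
  dG k m i + dG i m k - dG m k i =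
  \sum_a J m a * ((\sum_b G' a b * H k i b) *+ 2 +
     \sum_b \sum_c J k b * J i c * (D b a c + D c a b - D a b c)).
Proof.
pose B (u v : 'I_d -> R) := \sum_a \sum_b u a * v b * G' a b.
pose T (k m i : 'I_d) := \sum_a \sum_b J m a * J i b * \sum_c J k c * D c a b.
have BC u v : B u v = B v u.
  rewrite /B exchange_big; apply: eq_bigr => a _; apply: eq_bigr => b _.
  by rewrite Gsym; ring.
have dGE k' m' i' : dG k' m' i' = B (H k' m') (J i') + B (J m') (H k' i') + T k' m' i'.
  rewrite -!big_split; apply: eq_bigr => a _ /=.
  by rewrite -!big_split.
have -> : dG k m i + dG i m k - dG m k i = B (J m) (H k i) *+ 2 + (T k m i + T i m k - T m k i).
  rewrite !dGE.
  have -> : H m k = H k m by apply/funext => a; rewrite Hsym.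
  have -> : H m i = H i m by apply/funext => a; rewrite Hsym.
  have -> : H i k = H k i by apply/funext => a; rewrite Hsym.
  by rewrite (BC (H i m)) ; ring.
under [RHS]eq_bigr do rewrite mulrDr; rewrite big_split; congr (_ + _).
  rewrite -sumrMnl; apply: eq_bigr => a _; rewrite mulrnAr mulr_sumr; congr (_ *+ _).
  by apply: eq_bigr => b _; rewrite mulrAC -mulrA.
have T1 : T k m i = \sum_a J m a * \sum_b \sum_c J k b * J i c * D b a c.
  apply: eq_bigr => a _; rewrite exchange_big mulr_sumr; apply: eq_bigr => b _ /=.
  by rewrite !mulr_sumr; apply: eq_bigr => c _; ring.
have T2 : T i m k = \sum_a J m a * \sum_b \sum_c J k b * J i c * D c a b.
  apply: eq_bigr => a _; rewrite mulr_sumr; apply: eq_bigr => b _.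
  by rewrite !mulr_sumr; apply: eq_bigr => c _; ring.
have T3 : T m k i = \sum_a J m a * \sum_b \sum_c J k b * J i c * D a b c.
  transitivity (\sum_b \sum_c \sum_a J m a * (J k b * J i c * D a b c)).
    apply: eq_bigr => b _; apply: eq_bigr => c _.
    by rewrite mulr_sumr; apply: eq_bigr => a _; ring.
  under eq_bigr do rewrite exchange_big; rewrite exchange_big; apply: eq_bigr => a _.
  by rewrite mulr_sumr; apply: eq_bigr => b _; rewrite mulr_sumr.
rewrite T1 T2 T3 -big_split -sumrB; apply: eq_bigr => a _ /=.
rewrite -mulrDr -mulrBr; congr (_ * _).
rewrite -big_split -sumrB; apply: eq_bigr => b _ /=.
by rewrite -big_split -sumrB; apply: eq_bigr => c _ /=; ring.
Qed.

Hypothesis uJ : J \in unitmx.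
Hypothesis uG : G' \in unitmx.

(** Both sides carry twice the Christoffel symbols, so that no division by 2 occurs.
    [christoffel_lower] is multiplied by the inverse of J G' J^T, and J^T (J G' J^T)^-1 J =
    G'^-1. *)
Lemma christoffel_change k i a :
  \sum_l (\sum_m invmx (J *m G' *m J^T) l m * (dG k m i + dG i m k - dG m k i)) * J l a =
  (H k i a) *+ 2 + \sum_b \sum_c J k b * J i c *
     (\sum_m invmx G' a m * (D b m c + D c m b - D m b c)).
Proof.
pose Z a := (\sum_b G' a b * H k i b) *+ 2 +
     \sum_b \sum_c J k b * J i c * (D b a c + D c a b - D a b c).
pose A m := dG k m i + dG i m k - dG m k i.
pose zc := \col_a Z a; pose ac := \col_m A m.
have acE : ac = J *m zc.
  apply/colP => m; rewrite !mxE /A christoffel_lower; apply: eq_bigr => b _.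
  by rewrite mxE.
have -> : \sum_l (\sum_m invmx (J *m G' *m J^T) l m * A m) * J l a =
   (J^T *m (invmx (J *m G' *m J^T) *m ac)) a 0.
  rewrite mxE; apply: eq_bigr => l _; rewrite !mxE mulrC; congr (_ * _).
  by apply: eq_bigr => m _; rewrite mxE.
have uJT : J^T \in unitmx by rewrite unitmx_tr.
have -> : J^T *m (invmx (J *m G' *m J^T) *m ac) = invmx G' *m zc.
  have uW : J *m G' *m J^T \in unitmx by rewrite !unitmx_mul uJ uG.
  apply: (can_inj (mulKmx uG)); rewrite mulKVmx//.
  apply: (can_inj (mulKmx uJ)); rewrite -acE.
  by rewrite !mulmxA mulmxV// mul1mx.
have hz : zc = G' *m (\col_b H k i b) + G' *m (\col_b H k i b) + \col_m (\sum_b \sum_c J k b * J i c * (D b m c + D c m b - D m b c)).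
  apply/colP => m; rewrite !mxE; congr (_ + _).
  by rewrite mulr2n; congr (_ + _); apply: eq_bigr => b _; rewrite mxE.
rewrite hz 2!mulmxDr mulKmx// !mxE; congr (_ + _).
under eq_bigr do rewrite mxE mulr_sumr; rewrite exchange_big; apply: eq_bigr => b _.
under eq_bigr do rewrite mulr_sumr; rewrite exchange_big; apply: eq_bigr => c _.
by rewrite mulr_sumr; apply: eq_bigr => m _; rewrite mulrCA.
Qed.

End ChristoffelAlgebra.

Section Cholesky.
Context {R : realType}.

(** Induction through the Schur complement of the corner entry. The factor F supplies the
    orthonormal frame behind the positivity and the lower bounds of tensor norms. *)
Lemma cholesky n (A : 'M[R]_n) : A^T = A ->
  (forall v : 'rV[R]_n, v != 0 -> 0 < (v *m A *m v^T) 0 0) ->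
  exists2 F : 'M[R]_n, F \in unitmx & A = F *m F^T.
Proof.
elim: n A => [|n IH] A symA posA.
  by exists 1%:M; [exact: unitmx1|apply/matrixP => -[]].
change 'M[R]_(1 + n) in A.
have eA : A = block_mx (ulsubmx A) (ursubmx A) (dlsubmx A) (drsubmx A) by rewrite submxK.
set a := A 0 0; set b := ursubmx A; set C := drsubmx A.
have ua : ulsubmx A = a%:M.
  by rewrite [LHS]mx11_scalar !mxE; congr (A _ _)%:M; exact: val_inj.
have db : dlsubmx A = b^T by rewrite /b -[in RHS]symA -trmx_dlsub trmxK.
have sC : C^T = C by rewrite trmx_drsub symA.
rewrite ua db in eA.
have qA t (w : 'rV[R]_n) :
   (row_mx t%:M w *m A *m (row_mx t%:M w)^T) 0 0 =
   a * t ^+ 2 + (t * (b *m w^T) 0 0) *+ 2 + (w *m C *m w^T) 0 0.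
  rewrite eA mul_row_block tr_row_mx mul_row_col !mulmxDl tr_scalar_mx !mul_scalar_mx.
  rewrite !mul_mx_scalar -!scalemxAl.
  have -> : w *m b^T = ((b *m w^T) 0 0)%:M.
    rewrite [LHS]mx11_scalar !mxE; congr (_)%:M; apply: eq_bigr => j _.
    by rewrite !mxE mulrC.
  by rewrite !mxE !mulr1n; ring.
have a0 : 0 < a.
  have := posA (row_mx 1%:M 0); rewrite qA trmx0 mulmx0 mulmx0 !mxE mulr0 mul0rn !addr0 expr1n mulr1.
  apply; apply/eqP => /(congr1 (fun z : 'M[R]_(1, 1 + n) => lsubmx z)); rewrite row_mxKl => /matrixP/(_ 0 0)/eqP.
  by rewrite !mxE oner_eq0.
pose s := Num.sqrt a.
have s0 : 0 < s by rewrite sqrtr_gt0.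
have ss : s * s = a by rewrite -expr2 sqr_sqrtr// ltW.
pose C' := C - a^-1 *: (b^T *m b).
have [|v v0|F uF hF] := IH C'.
- by rewrite linearB linearZ /= trmx_mul trmxK sC.
(* This t minimizes the quadratic form at (t, v), and the minimum is the value of C' at v. *)
- pose t := - a^-1 * (b *m v^T) 0 0.
  have hv : row_mx t%:M v != 0.
    apply: contra v0 => /eqP/(congr1 rsubmx); rewrite row_mxKr => ->.
    by apply/eqP/rowP => i; rewrite !mxE.
  have := posA _ hv; rewrite qA; congr (_ < _).
  have e2 : (v *m (b^T *m b) *m v^T) 0 0 = (b *m v^T) 0 0 ^+ 2.
    have hvb : v *m b^T = b *m v^T.
      rewrite [LHS]mx11_scalar [RHS]mx11_scalar !mxE; congr (_)%:M; apply: eq_bigr => j _.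
      by rewrite !mxE mulrC.
    rewrite mulmxA hvb -mulmxA; move: (b *m v^T) => m.
    by rewrite [m]mx11_scalar -scalar_mxM !mxE.
  rewrite mulmxBr mulmxBl -scalemxAr -scalemxAl.
  have sub (X Y : 'M[R]_1) k : (X - k *: Y) 0 0 = X 0 0 - k * Y 0 0 by rewrite !mxE.
  apply: (etrans _ (esym (sub _ _ _))); rewrite e2.
  move: ((b *m v^T) 0 0) ((v *m C *m v^T) 0 0) @t hv => q w t hv.
  have aN : a != 0 by rewrite gt_eqF.
  by rewrite /t; field.
pose P : 'M[R]_(1 + n) := block_mx s%:M 0 (s^-1 *: b^T) F.
exists P.
  have dP : \det P = s * \det F.
    by apply: (etrans (det_lblock _ _ _)); rewrite det_scalar.
  by rewrite unitmxE dP unitrM unitfE gt_eqF//=.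
have PT : P^T = block_mx s%:M (s^-1 *: b) 0 F^T.
  by apply: (etrans (tr_block_mx _ _ _ _)); rewrite tr_scalar_mx trmx0 linearZ /= trmxK.
have sN : s != 0 by rewrite gt_eqF.
rewrite PT [LHS]eA; have := mulmx_block s%:M 0 (s^-1 *: b^T) F s%:M (s^-1 *: b) 0 F^T.
move=> hP; apply: etrans (esym hP).
rewrite !mulmx0 !mul0mx !addr0 -scalar_mxM ss !mul_scalar_mx mul_mx_scalar !scalerA mulfV// !scale1r.
congr block_mx; rewrite -scalemxAl -scalemxAr scalerA -invfM ss -hF.
by rewrite addrC subrK.
Qed.

End Cholesky.

Section TensorForm.
Context {R : realType} {d : nat}.
Implicit Types (A : 'M[R]_d) (T S : seq 'I_d -> R) (I J : seq 'I_d).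

(** The inner product of tensors of order n as a nested bilinear form, recursive so that positivity
    and invariance are inductions; [tform_tuple] relates it to the sum in [tensor_dot]. *)
Fixpoint tform A n T S : R :=
  if n is n'.+1 then
    \sum_a \sum_b A a b * tform A n' (fun J => T (a :: J)) (fun J => S (b :: J))
  else T [::] * S [::].

Lemma tform_tuple A n T S :
  \sum_(I : n.-tuple 'I_d) \sum_(J : n.-tuple 'I_d)
    (\prod_(m < n) A (tnth I m) (tnth J m)) * T I * S J = tform A n T S.
Proof.
have sum0 (F : 0.-tuple 'I_d -> R) : \sum_(J : 0.-tuple 'I_d) F J = F [tuple].
  rewrite (bigD1 [tuple])//= big1 ?addr0// => J; rewrite tuple0; by case/eqP.
elim: n T S => [|n IH] T S; first by rewrite !sum0 big_ord0 mul1r.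
rewrite sum_tupleS; apply: eq_bigr => a _.
under eq_bigr do rewrite sum_tupleS; rewrite exchange_big; apply: eq_bigr => b _.
transitivity (A a b * \sum_(I : n.-tuple 'I_d) \sum_(J : n.-tuple 'I_d)
    (\prod_(m < n) A (tnth I m) (tnth J m)) * T (a :: I) * S (b :: J)); last by rewrite (IH (fun J => T (a :: J)) (fun J => S (b :: J))).
rewrite mulr_sumr; apply: eq_bigr => I _; rewrite mulr_sumr; apply: eq_bigr => J _.
rewrite big_ord_recl !mulrA; congr (_ * _ * _ * _).
by apply: eq_bigr => m _; rewrite !tnthS.
Qed.

Lemma eq_tform A n T T' S S' : (forall I, size I = n -> T I = T' I) ->
  (forall I, size I = n -> S I = S' I) -> tform A n T S = tform A n T' S'.
Proof.
elim: n T T' S S' => [|n IH] T T' S S' hT hS /=; first by rewrite hT// hS.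
apply: eq_bigr => a _; apply: eq_bigr => b _; congr (_ * _).
by apply: IH => I sI; [apply: hT|apply: hS]; rewrite /= sI.
Qed.

Lemma tform_linl A n k T T' S :
  tform A n (fun J => k * T J + T' J) S = k * tform A n T S + tform A n T' S.
Proof.
elim: n T T' S => [|n IH] T T' S /=; first by ring.
rewrite mulr_sumr -big_split; apply: eq_bigr => a _ /=.
rewrite mulr_sumr -big_split; apply: eq_bigr => b _ /=.
by rewrite IH; ring.
Qed.

Lemma tform_suml A n m (c : 'I_m -> R) (T : 'I_m -> seq 'I_d -> R) S :
  tform A n (fun J => \sum_i c i * T i J) S = \sum_i c i * tform A n (T i) S.
Proof.
elim: m c T => [|m IH] c T.
  rewrite big_ord0; transitivity (tform A n (fun J => 0 * 0 + 0) S).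
    by apply: eq_tform => // I _; rewrite big_ord0 mul0r addr0.
  have := tform_linl A n 0 (fun=> 0) (fun=> 0) S.
  have := tform_linl A n 1 (fun=> 0) (fun=> 0) S.
  rewrite !mul1r add0r.
  lra.
rewrite big_ord_recl -IH -tform_linl; apply: eq_tform => // I _.
by rewrite big_ord_recl.
Qed.

Lemma tformC A n T S : A^T = A -> tform A n T S = tform A n S T.
Proof.
move=> sA; elim: n T S => [|n IH] T S /=; first by rewrite mulrC.
rewrite exchange_big; apply: eq_bigr => b _; apply: eq_bigr => a _.
by rewrite IH -{1}sA mxE.
Qed.

Let gram (B : 'M[R]_d) := B^T *m B.

Let gram_sym B : (gram B)^T = gram B.
Proof. by rewrite trmx_mul trmxK. Qed.

(** One index is expressed in the frame given by B, in which the form becomes a sum over equal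
    indices. *)
Lemma tform_gramS (B : 'M[R]_d) n T S : tform (B^T *m B) n.+1 T S =
  \sum_c tform (B^T *m B) n (fun J => \sum_a B c a * T (a :: J))
                            (fun J => \sum_a B c a * S (a :: J)).
Proof.
have sB := gram_sym B; rewrite /gram in sB.
transitivity (\sum_a \sum_b \sum_c B c a * (B c b *
   tform (B^T *m B) n (fun J => T (a :: J)) (fun J => S (b :: J)))).
  apply: eq_bigr => a _; apply: eq_bigr => b _; rewrite mxE mulr_suml.
  by apply: eq_bigr => c _; rewrite mxE mulrA.
under eq_bigr do rewrite exchange_big; rewrite exchange_big; apply: eq_bigr => c _ /=.
rewrite tform_suml; apply: eq_bigr => a _.
rewrite tformC// tform_suml mulr_sumr.
by apply: eq_bigr => b _; rewrite [tform _ _ _ (fun J => T _)]tformC.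
Qed.

Lemma tform_gram_ge0 (B : 'M[R]_d) n T : 0 <= tform (B^T *m B) n T T.
Proof.
elim: n T => [|n IH] T; first by rewrite sqr_ge0.
by rewrite tform_gramS; apply: sumr_ge0 => c _; exact: IH.
Qed.

Lemma sum_cauchy_schwarz n (x y : 'I_n -> R) :
  (\sum_i x i * y i) ^+ 2 <= (\sum_i x i ^+ 2) * (\sum_i y i ^+ 2).
Proof.
apply: discriminant_le => [|t]; first by apply: sumr_ge0 => i _; exact: sqr_ge0.
have -> : (\sum_i x i ^+ 2) * t ^+ 2 + (\sum_i x i * y i) * t *+ 2 + \sum_i y i ^+ 2 =
   \sum_i (x i * t + y i) ^+ 2.
  rewrite mulr_suml mulr_suml -sumrMnl -!big_split; apply: eq_bigr => i _ /=; ring.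
by apply: sumr_ge0 => i _; exact: sqr_ge0.
Qed.

(* With F the inverse of B, the square of T_(i :: I) is at most the i-th
   diagonal coefficient of F F^T times the sum over c of the squares of the
   (c :: I)-components of T in the frame given by B. *)
Lemma tform_gram_lower (F : 'M[R]_d) I T : F \in unitmx ->
  T I ^+ 2 <= (\prod_(i <- I) (F *m F^T) i i) * tform ((invmx F)^T *m invmx F) (size I) T T.
Proof.
move=> uF; elim: I T => [|i I IH] T; first by rewrite big_nil mul1r.
set B := invmx F; rewrite tform_gramS big_cons.
pose W c J := \sum_a B c a * T (a :: J).
have -> : T (i :: I) = \sum_c F i c * W c I.
  have h : F *m (B *m \col_a T (a :: I)) = \col_a T (a :: I) by rewrite mulKVmx.
  move/matrixP/(_ i 0): h; rewrite !mxE => <-; apply: eq_bigr => c _; rewrite mxE.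
  by congr (_ * _); apply: eq_bigr => a _; rewrite mxE.
apply: le_trans (sum_cauchy_schwarz _ _) _.
have -> : (F *m F^T) i i = \sum_c F i c ^+ 2.
  by rewrite mxE; apply: eq_bigr => c _; rewrite mxE.
rewrite -mulrA ler_wpM2l//; first by apply: sumr_ge0 => c _; exact: sqr_ge0.
by rewrite mulr_sumr; apply: ler_sum => c _; exact: IH.
Qed.

(** A change of frame turns A into J^T A J; with [metric_inv_change] this makes the inner product
    independent of the chart. *)
Lemma tform_pull A (J : 'M[R]_d) n T S :
  tform A n (fun I => pull (fun i a => J i a) I T) (fun I => pull (fun i a => J i a) I S) =
  tform (J^T *m A *m J) n T S.
Proof.
have linr m (c : 'I_m -> R) k T' (S' : 'I_m -> seq 'I_d -> R) :
   tform A k T' (fun J => \sum_i c i * S' i J) = \sum_i c i * tform A k T' (S' i).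
  elim: k T' S' => [|k IH] T' S' /=.
    by rewrite mulr_sumr; apply: eq_bigr => i _; rewrite mulrCA.
  under [RHS]eq_bigr do (rewrite mulr_sumr; under eq_bigr do rewrite mulr_sumr).
  rewrite [RHS]exchange_big; apply: eq_bigr => a _.
  rewrite [RHS]exchange_big; apply: eq_bigr => b _.
  rewrite IH mulr_sumr; apply: eq_bigr => i _; exact: mulrCA.
elim: n T S => [//|n IH] T S /=.
transitivity (\sum_a \sum_b \sum_e \sum_f (A a b * J a e * J b f) *
  tform (J^T *m A *m J) n (fun I => T (e :: I)) (fun I => S (f :: I))).
  apply: eq_bigr => a _; apply: eq_bigr => b _.
  rewrite tform_suml mulr_sumr.
  apply: eq_bigr => e _.
  rewrite linr.
  by rewrite !mulr_sumr; apply: eq_bigr => f _; rewrite IH !mulrA.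
rewrite (eq_bigr _ (fun a _ => exchange_big _ _ _ _ _ _)) exchange_big; apply: eq_bigr => e _ /=.
rewrite (eq_bigr _ (fun a _ => exchange_big _ _ _ _ _ _)) exchange_big; apply: eq_bigr => f _ /=.
rewrite exchange_big mxE mulr_suml; apply: eq_bigr => b _; rewrite mxE !mulr_suml.
by apply: eq_bigr => a _; rewrite mxE; ring.
Qed.

End TensorForm.

Section Transport.
Local Open Scope ereal_scope.
Context disp1 disp2 (T1 : measurableType disp1) (T2 : measurableType disp2) (R : realType).
Variables (m1 : {measure set T1 -> \bar R}) (m2 : {measure set T2 -> \bar R}).
Variables (D1 : set T1) (D2 : set T2) (phi : T1 -> T2) (t0 : T2).
Hypotheses (mD1 : measurable D1) (mD2 : measurable D2) (mphi : measurable_fun D1 phi).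
Hypothesis phiD : forall x, D1 x -> D2 (phi x).

(** The measure inequality says that the push-forward of the restricted m1 is at most C m2. The
    value t0 outside D1 makes phi a measurable map on all of T1. *)
Lemma transport_integral (C : R) (F : T2 -> \bar R) : (0 <= C)%R ->
  (forall A, measurable A -> m1 (D1 `&` phi @^-1` A) <= C%:E * m2 A) ->
  measurable_fun D2 F -> (forall y, D2 y -> 0 <= F y) ->
  \int[m1]_(x in D1) F (phi x) <= C%:E * \int[m2]_(y in D2) F y.
Proof.
move=> C0 mC mF F0.
pose psi x := if x \in D1 then phi x else t0.
have psiE x : D1 x -> psi x = phi x by move=> Dx; rewrite /psi mem_set.
have mpsi : measurable_fun setT psi.
  apply: measurable_fun_if => //.
  - apply: measurable_fun_bool; rewrite setTI.
    by rewrite (_ : _ @^-1` _ = D1)//; apply/seteqP; split => x /=; [by move=> /set_mem|move=> ?; exact: mem_set].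
  - by rewrite setTI (_ : _ @^-1` _ = D1)//; apply/seteqP; split => x /=; [by move=> /set_mem|move=> ?; exact: mem_set].
pose mr := mrestr m1 mD1.
pose Fr := F \_ D2.
have mFr : measurable_fun setT Fr by apply/(measurable_restrictT _ mD2).
have Fr0 y : 0 <= Fr y by apply: erestrict_ge0.
have -> : \int[m2]_(y in D2) F y = \int[m2]_(y in D2) Fr y.
  by apply: eq_integral => y Dy; rewrite /Fr patchE Dy.
have -> : \int[m1]_(x in D1) F (phi x) = \int[m1]_(x in D1) (Fr \o psi) x.
  apply: eq_integral => x; rewrite inE => Dx /=.
  by rewrite /Fr patchE psiE// mem_set//; exact: phiD.
have -> : \int[m1]_(x in D1) (Fr \o psi) x = \int[mr]_(x in D1) (Fr \o psi) x.
  apply: eq_measure_integral => A mA AD; apply/esym.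
  by change (m1 (A `&` D1) = m1 A); rewrite setIidl.
have mpD : measurable (psi @^-1` D2) by rewrite -[X in measurable X]setTI; exact: mpsi.
apply: (@le_trans _ _ (\int[mr]_(x in psi @^-1` D2) (Fr \o psi) x)).
  apply: ge0_subset_integral => //.
  - by apply: measurableT_comp; exact: measurable_funTS.
  - by move=> x _; exact: Fr0.
  - by move=> x Dx /=; rewrite psiE//; exact: phiD.
rewrite -ge0_integral_pushforward//; last exact: measurable_funTS.
apply: (@le_trans _ _ (\int[mscale (NngNum C0) m2]_(y in D2) Fr y)).
  apply: ge0_le_measure_integral => // S mS.
  apply: le_trans (mC S mS).
  change (m1 (psi @^-1` S `&` D1) <= m1 (D1 `&` phi @^-1` S)).
  rewrite (_ : psi @^-1` S `&` D1 = D1 `&` phi @^-1` S)//.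
  by apply/seteqP; split => x /= [h1 h2]; split => //; [rewrite -psiE|rewrite psiE].
rewrite ge0_integral_mscale//; exact: measurable_funTS.
Qed.

End Transport.

Section CompactBound.
Context {R : realType}.

Lemma compact_bound (T : topologicalType) (K : set T) (f : T -> R) : compact K ->
  (forall x, K x -> {for x, continuous f}) ->
  exists2 C : R, 0 < C & forall x, K x -> `|f x| <= C.
Proof.
move=> cK cf.
have /continuous_compact/(_ cK)/compact_bounded : {within K, continuous f}.
  by apply: continuous_in_subspaceT => x; rewrite inE; exact: cf.
move=> /ex_strict_bound_gt0[C C0 hC]; exists C => // x Kx.
by apply/ltW; apply: hC; exists x.
Qed.

Lemma compact_points (T : ptopologicalType) (W : T -> set T) : compact [set: T] ->
  (forall p, open (W p)) -> (forall p, W p p) ->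
  exists s : seq T, forall q, exists2 p, p \in s & W p q.
Proof.
rewrite compact_cover => cT oW Wp.
have [|D _ hD] := cT T setT W (fun i _ => oW i); first by move=> q _; exists q.
by exists (finmap.enum_fset D) => q; have [p pD Wq] := hD q I; exists p.
Qed.

End CompactBound.

Section FormBounds.
Context {R : realType} {d : nat}.
Local Notation E := 'rV[R]_d.

Lemma tform_le (A : 'M[R]_d) n (T S : seq 'I_d -> R) (a b B : R) : 0 <= B ->
  (forall i j, `|A i j| <= B) ->
  (forall I, size I = n -> `|T I| <= a) -> (forall I, size I = n -> `|S I| <= b) ->
  `|tform A n T S| <= (d%:R ^+ 2 * B) ^+ n * (a * b).
Proof.
move=> B0 hA; elim: n T S => [|n IH] T S hT hS.
  by rewrite mul1r normrM ler_pM// ?hT ?hS.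
rewrite exprS -mulrA.
have h i j : `|A i j * tform A n (fun J => T (i :: J)) (fun J => S (j :: J))| <=
    B * ((d%:R ^+ 2 * B) ^+ n * (a * b)).
  rewrite normrM ler_pM//; apply: IH => I sI; [apply: hT|apply: hS]; by rewrite /= sI.
apply: le_trans (ler_norm_sum _ _ _) _.
apply: (@le_trans _ _ (\sum_(i < d) \sum_(j < d) (B * ((d%:R ^+ 2 * B) ^+ n * (a * b))))).
  by apply: ler_sum => i _; apply: le_trans (ler_norm_sum _ _ _) _; apply: ler_sum => j _.
apply: le_of_eq.
have e y : \sum_(i < d) \sum_(j < d) y = d%:R ^+ 2 * y.
  by rewrite sumr_const sumr_const card_ord -[y *+ d]mulr_natl -[(_ * y) *+ d]mulr_natl mulrA.
by rewrite e mulrA.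
Qed.

Lemma measurable_tform disp (X : measurableType disp) (D : set X) (A : X -> 'M[R]_d) n
    (T S : seq 'I_d -> X -> R) :
  (forall i j, measurable_fun D (fun x => A x i j)) ->
  (forall I, size I = n -> measurable_fun D (T I)) ->
  (forall I, size I = n -> measurable_fun D (S I)) ->
  measurable_fun D (fun x => tform (A x) n (fun I => T I x) (fun I => S I x)).
Proof.
move=> mA; elim: n T S => [|n IH] T S mT mS /=.
  by apply: measurable_funM; [exact: mT|exact: mS].
apply: measurable_sum => i; apply: measurable_sum => j; apply: measurable_funM => //.
by apply: IH => I sI; [apply: mT|apply: mS]; rewrite /= sI.
Qed.

End FormBounds.

(** * Weak derivatives and dominated limits *)

Section LocInt.
Context {R : realType} {d : nat}.
Local Notation E := 'rV[R]_d.
Local Notation L := (@lebesgue_rV R d).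
Implicit Types (V : set E) (f g psi : E -> R).
Opaque smooth_on partial Rintegral.

Lemma locally_integrable_test V f psi : open V -> locally_integrable_on V f ->
  test_function V psi -> L.-integrable V (EFin \o (fun x => f x * psi x)).
Proof.
move=> oV lf tpsi; have [B B0 hB] := test_function_bounded tpsi.
have mpsi := test_function_measurable tpsi.
have [_ [C [cC CV hC]]] := tpsi.
have mC := compact_borel cC; have mV : measurable (V : set (borel E)) by exact: open_borel.
apply: (@integrable_supp _ _ _ _ (V : set (borel E)) C) => //.
  by move=> x nC; rewrite hC// mulr0.
have := @integrable_bounded_mul _ _ _ L C f psi B mC
  (measurable_funTS mpsi) (fun x _ => hB x) (lf C cC CV).
by apply: eq_integrable => // x _ /=; rewrite mulrC.
Qed.

Lemma locally_integrable_lin V k f g : locally_integrable_on V f ->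
  locally_integrable_on V g -> locally_integrable_on V (fun x => k * f x + g x).
Proof.
move=> lf lg C cC CV; have mC := compact_borel cC.
exact: (RintegrableD mC (RintegrableZ k mC (lf C cC CV)) (lg C cC CV)).
Qed.

Lemma locally_integrable_mul V (s : E -> R) f : (forall x : E, V x -> {for x, continuous s}) -> open V ->
  locally_integrable_on V f -> locally_integrable_on V (fun x => s x * f x).
Proof.
move=> cs oV lf C cC CV; have mC := compact_borel cC.
have [B B0 hB] := compact_bound cC (fun x Cx => cs x (CV x Cx)).
apply: (@integrable_bounded_mul _ _ _ L C f s B mC) => //.
  exact: borel_real_continuous_sub oV cs mC CV.
exact: lf.
Qed.

Lemma locally_integrable_sum V I (s : seq I) (P : pred I) (F : I -> E -> R) :
  (forall i, P i -> locally_integrable_on V (F i)) ->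
  locally_integrable_on V (fun x => \sum_(i <- s | P i) F i x).
Proof.
move=> lF C cC CV; apply: (Rintegrable_sum _ (compact_borel cC)) => i Pi.
exact: lF.
Qed.

Lemma Rintegral_lin V k f g psi : open V -> locally_integrable_on V f ->
  locally_integrable_on V g -> test_function V psi ->
  \int[L]_(x in V) ((k * f x + g x) * psi x) =
  k * (\int[L]_(x in V) (f x * psi x)) + \int[L]_(x in V) (g x * psi x).
Proof.
move=> oV lf lg tpsi; have mV : measurable (V : set (borel E)) by exact: open_borel.
have i1 := locally_integrable_test oV lf tpsi.
have i2 := locally_integrable_test oV lg tpsi.
by apply: (Rintegral_axpy mV i1 i2) => x; rewrite mulrDl mulrA.
Qed.

Lemma weak_partial_lin V i k f g f' g' : open V -> weak_partial V i f f' ->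
  weak_partial V i g g' ->
  weak_partial V i (fun x => k * f x + g x) (fun x => k * f' x + g' x).
Proof.
move=> oV [lf lf' ff'] [lg lg' gg']; split; [exact: locally_integrable_lin..|].
move=> psi tpsi; have tp := test_function_partial i tpsi.
apply: (etrans (Rintegral_lin k oV lf lg tp)).
apply: (etrans _ (congr1 -%R (esym (Rintegral_lin k oV lf' lg' tpsi)))).
have -> : \int[L]_(x in V) (f x * partial i psi x) = - \int[L]_(x in V) (f' x * psi x) by exact: ff'.
have -> : \int[L]_(x in V) (g x * partial i psi x) = - \int[L]_(x in V) (g' x * psi x) by exact: gg'.
by rewrite mulrN opprD.
Qed.

Lemma weak_partial_unique V i f g f' g' : open V -> weak_partial V i f f' ->
  weak_partial V i g g' -> {ae L, forall x, V x -> f x = g x} ->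
  {ae L, forall x, V x -> f' x = g' x}.
Proof.
move=> oV wf wg fg.
have [_ lh hh] := weak_partial_lin (-1) oV wf wg.
have mV : measurable (V : set (borel E)) by exact: open_borel.
suff dz : {ae L, forall x, V x -> -1 * f' x + g' x = 0}.
  by apply: ae_imp dz => x h Vx; have := h Vx; rewrite mulN1r addrC => /subr0_eq ->.
apply: (du_bois_reymond oV lh).
move=> psi tpsi; have tp := test_function_partial i tpsi.
have h1 := hh psi tpsi.
have [lf _ _] := wf; have [lg _ _] := wg.
apply/eqP; rewrite -oppr_eq0; apply/eqP.
apply: (etrans (esym h1)).
have lfg := locally_integrable_lin (-1) lf lg.
have ifg := locally_integrable_test oV lfg tp.
change (Rintegral L V (fun x => (-1 * f x + g x) * partial i psi x) = 0).
suff z : (\int[L]_(x in V) ((-1 * f x + g x) * partial i psi x)%:E = 0)%E by exact: (congr1 fine z).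
apply: (etrans (@ae_eq_integral _ _ _ L V (cst 0%E) (EFin \o (fun x => (-1 * f x + g x) * partial i psi x)) mV _ _ _)).
- exact: measurable_int _ ifg.
- exact: measurable_cst.
- by apply: ae_imp fg => x h Vx /=; rewrite (h Vx) mulN1r addNr mul0r.
- by rewrite integral0.
Qed.

End LocInt.

Lemma ae_forall_fin disp (T : measurableType disp) (R : realType)
    (mu : {measure set T -> \bar R}) (I : finType) (P : I -> T -> Prop) :
  (forall i, {ae mu, forall x, P i x}) -> {ae mu, forall x, forall i, P i x}.
Proof. by move=> h; apply: filter_forall. Qed.

Section DominatedLimits.
Context {R : realType} {d : nat}.
Local Notation E := 'rV[R]_d.
Local Notation L := (@lebesgue_rV R d).
Opaque smooth_on partial Rintegral.

Lemma compact_rects (V K : set E) : compact K -> open V -> K `<=` V ->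
  exists (n : nat) (a b : 'I_n -> 'I_d -> R), (forall i, closed_rect (a i) (b i) `<=` V) /\
   forall x, K x -> exists i, open_rect (a i) (b i) x.
Proof.
move=> cK oV KV.
have /choice[e he] : forall x : E, exists e : R, V x -> 0 < e /\
    closed_rect (fun i => x 0 i - e) (fun i => x 0 i + e) `<=` V.
  move=> x; have [Vx|nV] := pselect (V x); last by exists 0.
  have [e e0 eV] := open_ball_sub oV Vx.
  exists (e / 2) => _; split; first by rewrite divr_gt0.
  move=> y hy; apply: eV; apply/rV_ballP => // i.
  have := hy i; rewrite -ler_distlC => h; apply: (le_lt_trans h).
  by rewrite ltr_pdivrMr// ltr_pMr// ltr1n.
pose a (x : E) (i : 'I_d) := x 0 i - e x; pose b (x : E) (i : 'I_d) := x 0 i + e x.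
move: cK; rewrite compact_cover => cK.
have [|D DK hD] := cK E K (fun x => open_rect (a x) (b x)) (fun i _ => @open_open_rect _ _ (a i) (b i)).
  move=> x Kx; exists x => // i; have [e0 _] := he x (KV x Kx).
  by rewrite /= in_itv/=; apply/andP; split; rewrite ?ltrBlDr ltrDl.
pose s := finmap.enum_fset D.
exists (size s), (fun i => a (tnth (in_tuple s) i)), (fun i => b (tnth (in_tuple s) i)); split.
  move=> i; have := mem_tnth i (in_tuple s); set x := tnth _ _ => xs.
  by have := DK x xs; rewrite inE => /KV /he[].
move=> x /hD[y yD hy]; have : y \in s by exact: yD.
by move=> /seq_tnthP[i yi]; exists i; rewrite -yi.
Qed.

(** The mode of convergence under which weak derivatives pass to the limit: dominated almost
    everywhere on each compact set. *)
Definition dcvg (V : set E) (u_ : nat -> E -> R) (u : E -> R) : Prop :=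
  forall K : set E, compact K -> K `<=` V ->
    [/\ forall n, measurable_fun (K : set (borel E)) (u_ n : borel E -> R),
        measurable_fun (K : set (borel E)) (u : borel E -> R),
        {ae L, forall x, K x -> u_ n x @[n --> \oo] --> u x} &
        exists2 g : borel E -> R, L.-integrable K (EFin \o g) &
          {ae L, forall x, K x -> forall n, `|u_ n x| <= g x}].

Lemma dcvg_integrable V u_ u : dcvg V u_ u -> locally_integrable_on V u.
Proof.
move=> h K cK KV; have [mu_ mu cu [g ig bg]] := h K cK KV.
have mK := compact_borel cK.
have [] // := @dominated_convergence _ _ _ L K mK (fun n => EFin \o (u_ n))
  (EFin \o u) (EFin \o g).
- by move=> n; apply/measurable_EFinP.
- exact/measurable_EFinP.
- by apply: ae_imp cu => x hx Kx; apply: cvg_EFin; [exact: nearW|exact: hx].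
- by apply: ae_imp bg => x hx n Kx; rewrite lee_fin; exact: hx.
Qed.

Lemma dcvg_mul V u_ u (s : E -> R) : open V -> (forall x : E, V x -> {for x, continuous s}) ->
  dcvg V u_ u -> dcvg V (fun n x => s x * u_ n x) (fun x => s x * u x).
Proof.
move=> oV cs h K cK KV; have [mu_ mu cu [g ig bg]] := h K cK KV.
have mK := compact_borel cK.
have ms : measurable_fun (K : set (borel E)) s := borel_real_continuous_sub oV cs mK KV.
have [B B0 hB] := compact_bound cK (fun x Kx => cs x (KV x Kx)).
split.
- by move=> n; exact: measurable_funM.
- exact: measurable_funM.
- by apply: ae_imp cu => x hx Kx; apply: cvgM; [exact: cvg_cst|exact: hx].
- exists (fun x => B * g x); first exact: RintegrableZ.
  by apply: ae_imp bg => x hx Kx n; rewrite normrM ler_pM//; [exact: hB|exact: hx].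
Qed.

Lemma dcvg_add V u_ u v_ v : dcvg V u_ u -> dcvg V v_ v ->
  dcvg V (fun n x => u_ n x + v_ n x) (fun x => u x + v x).
Proof.
move=> hu hv K cK KV; have [mu_ mu cu [g ig bg]] := hu K cK KV.
have [mv_ mv cv [h ih bh]] := hv K cK KV; have mK := compact_borel cK.
split.
- by move=> n; exact: measurable_funD.
- exact: measurable_funD.
- by apply: ae_imp2 cu cv => x hx hy Kx; apply: cvgD; [exact: hx|exact: hy].
- exists (fun x => g x + h x); first exact: (@integrableD _ _ _ L K mK _ _ ig ih).
  by apply: ae_imp2 bg bh => x hx hy Kx n; rewrite (le_trans (ler_normD _ _))// lerD//; [exact: hx|exact: hy].
Qed.

Lemma dcvg_sum V (I : Type) (s : seq I) (u_ : I -> nat -> E -> R) (u : I -> E -> R) :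
  (forall i, dcvg V (u_ i) (u i)) ->
  dcvg V (fun n x => \sum_(i <- s) u_ i n x) (fun x => \sum_(i <- s) u i x).
Proof.
move=> h; elim: s => [|i s IH].
  rewrite (_ : (fun n x => _) = (fun=> fun=> 0)); last by apply/funext => n; apply/funext => x; rewrite big_nil.
  rewrite (_ : (fun x => \sum_(_ <- _) _) = (fun=> 0)); last by apply/funext => x; rewrite big_nil.
  move=> K cK KV; split => [n|||]; first exact: measurable_cst.
  - exact: measurable_cst.
  - by apply: aeW => x _; exact: cvg_cst.
  - exists (cst 0); first exact: integrable0.
    by apply: aeW => x _ n; rewrite normr0.
rewrite (_ : (fun n x => _) = (fun n x => u_ i n x + \sum_(j <- s) u_ j n x)); last first.
  by apply/funext => n; apply/funext => x; rewrite big_cons.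
rewrite (_ : (fun x => \sum_(_ <- _ :: _) _) = (fun x => u i x + \sum_(j <- s) u j x)); last first.
  by apply/funext => x; rewrite big_cons.
exact: dcvg_add.
Qed.

Lemma dcvg_test V u_ u psi : open V -> dcvg V u_ u -> test_function V psi ->
  \int[L]_(x in V) (u_ n x * psi x) @[n --> \oo] --> \int[L]_(x in V) (u x * psi x).
Proof.
move=> oV h tpsi; have [B B0 hB] := test_function_bounded tpsi.
have mpsi := test_function_measurable tpsi.
have [_ [C [cC CV hC]]] := tpsi.
have mC := compact_borel cC.
have [mu_ mu cu [g ig bg]] := h C cC CV.
have mpsiC : measurable_fun (C : set (borel E)) (psi) by exact: measurable_funTS.
have e (f : E -> R) : \int[L]_(x in V) (f x * psi x) = \int[L]_(x in C) (f x * psi x).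
  by apply: Rint_supp => // x nC; rewrite hC// mulr0.
under eq_fun do rewrite e.
rewrite e; apply: fine_cvg.
have [|||||i _ c] := @dominated_convergence _ _ _ L C mC
  (fun n => EFin \o (fun x => u_ n x * psi x))
  (EFin \o (fun x => u x * psi x)) (EFin \o (fun x => B * g x)).
- by move=> n; apply/measurable_EFinP; exact: measurable_funM.
- by apply/measurable_EFinP; exact: measurable_funM.
- by apply: ae_imp cu => x hx Kx; apply: cvg_EFin; [exact: nearW|apply: cvgM; [exact: hx|exact: cvg_cst]].
- exact: RintegrableZ.
- by apply: ae_imp bg => x hx n Kx; rewrite lee_fin normrM mulrC ler_pM//; exact: hx.
by rewrite fineK//; exact: integrable_fin_num.
Qed.

Lemma weak_partial_lim V k u_ u w_ w : open V -> (forall n, weak_partial V k (u_ n) (w_ n)) ->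
  dcvg V u_ u -> dcvg V w_ w -> weak_partial V k u w.
Proof.
move=> oV hw cu cw; split; [exact: dcvg_integrable cu|exact: dcvg_integrable cw|].
move=> psi tpsi; have tp := test_function_partial k tpsi.
have h1 := dcvg_test oV cu tp; have h2 := dcvg_test oV cw tpsi.
have h3 : \int[L]_(x in V) (u_ n x * partial k psi x) @[n --> \oo] --> - \int[L]_(x in V) (w x * psi x).
  rewrite (_ : (fun n => _) = (fun n => - \int[L]_(x in V) (w_ n x * psi x))); first exact: cvgN.
  by apply/funext => n; have [_ _ /(_ psi tpsi)] := hw n.
exact: cvg_unique _ h1 h3.
Qed.

(** The sum of all |h_n| is integrable by monotone convergence, hence finite almost everywhere, and
    its real part dominates. *)
Lemma summable_dom (K : set (borel E)) (h : nat -> borel E -> R) C : measurable K ->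
  (forall n, measurable_fun K (h n)) ->
  (forall n, (\int[L]_(x in K) `|h n x|%:E <= (C * 2^-1 ^+ n)%:E)%E) ->
  exists2 g : borel E -> R, L.-integrable K (EFin \o g) &
    {ae L, forall x, K x -> forall n, \sum_(i < n) `|h i x| <= g x}.
Proof.
move=> mK mh hKC.
pose G x := (\sum_(n <oo) `|h n x|%:E)%E.
have mna n : measurable_fun K (fun x => `|h n x|%:E).
  by apply/measurable_EFinP; exact: measurableT_comp.
have mG : measurable_fun K G by apply: ge0_emeasurable_sum.
have G0 x : (0 <= G x)%E by apply: nneseries_ge0.
have iG : L.-integrable K G.
  apply/integrableP; split => //.
  under eq_integral do rewrite gee0_abs//.
  rewrite integral_nneseries//.
  apply: (@le_lt_trans _ _ (C * 2)%:E); last exact: ltry.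
  have C0 : 0 <= C.
    have := hKC 0; rewrite mulr1 -lee_fin; apply: le_trans.
    by apply: integral_ge0 => x _; rewrite lee_fin.
  have geo n : \sum_(0 <= k < n) (2^-1 ^+ k : R) <= 2.
    suff -> : \sum_(0 <= k < n) (2^-1 ^+ k : R) = 2 - 2 * 2^-1 ^+ n by rewrite gerBl.
    elim: n => [|n IH]; first by rewrite big_nil; ring.
    by rewrite big_nat_recr//= IH exprSr; field.
  apply: lime_le; first by apply: is_cvg_nneseries => n _ _; apply: integral_ge0 => x _; rewrite lee_fin.
  apply: nearW => n; apply: le_trans.
    by apply: lee_sum => k _; exact: hKC.
  by rewrite sumEFin lee_fin -mulr_sumr ler_wpM2l.
exists (fine \o G).
  apply: (le_integrable mK _ _ iG).
    by apply/measurable_EFinP; apply: measurableT_comp.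
  by move=> x _ /=; have := G0 x; case: (G x) => [t||] //= _; rewrite ?leey.
have fG := integrable_ae mK iG.
apply: ae_imp fG => x hx Kx n; rewrite -lee_fin fineK; last exact: hx.
have := @nneseries_lim_ge R (fun n => `|h n x|%:E) xpredT 0 n (fun k _ _ => normr_ge0 (h k x)).
by rewrite sumEFin big_mkord; apply.
Qed.

Lemma bounded_series_cvg (a : nat -> R) B : (forall n, \sum_(i < n) `|a i| <= B) ->
  cvgn (fun n => \sum_(i < n) a i).
Proof.
move=> h; have e (b : nat -> R) : (fun n => \sum_(i < n) b i) = series b.
  by apply/funext => n; rewrite /series /= big_mkord.
rewrite e; apply: normed_cvg; rewrite -[X in cvgn X]e; apply: nondecreasing_is_cvgn.
  by apply/nondecreasing_seqP => n; rewrite big_ord_recr /= lerDl.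
by exists B => _ [n _ <-]; exact: h.
Qed.

Lemma measurable_bounded_sum (K : set (borel E)) (h : nat -> borel E -> R) : measurable K ->
  (forall n, measurable_fun K (h n)) ->
  measurable [set x | K x /\ exists B, forall n, \sum_(i < n) h i x <= B].
Proof.
move=> mK mh.
have -> : [set x | K x /\ exists B, forall n, \sum_(i < n) h i x <= B] =
    \bigcup_(k : nat) \bigcap_(n : nat) (K `&` (fun x => \sum_(i < n) h i x) @^-1` `]-oo, k%:R]).
  apply/seteqP; split => x.
    move=> [Kx [B hB]]; exists (Num.truncn `|B|).+1 => // n _; split => //.
    by rewrite /= in_itv/= (le_trans (hB n))// (le_trans (ler_norm _))// ltW// truncnS_gt.
  move=> [k _ hk]; have [Kx _] := hk 0%N Logic.I; split => //.
  by exists k%:R => n; have [_] := hk n Logic.I; rewrite /=.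
apply: bigcupT_measurable => k; apply: bigcapT_measurable => n.
have : measurable_fun K (fun x => \sum_(i < n) h i x) by apply: measurable_sum => i; exact: mh.
by apply.
Qed.

Lemma dcvg_series V (s0 : E -> R) (h : nat -> E -> R) (u : E -> R) : open V ->
  locally_integrable_on V s0 -> (forall n, locally_integrable_on V (h n)) ->
  (forall K : set E, compact K -> K `<=` V -> exists C : R, forall n,
     (\int[L]_(x in K) `|h n x|%:E <= (C * 2^-1 ^+ n)%:E)%E) ->
  (forall K : set E, compact K -> K `<=` V -> measurable_fun (K : set (borel E)) (u : borel E -> R)) ->
  (forall K : set E, compact K -> K `<=` V -> {ae L, forall x, K x ->
     s0 x + \sum_(i < n) h i x @[n --> \oo] --> u x}) ->
  dcvg V (fun n x => s0 x + \sum_(i < n) h i x) u.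
Proof.
move=> oV i0 ih hC mu cu K cK KV; have mK := compact_borel cK.
have mh n : measurable_fun (K : set (borel E)) (h n).
  by have := ih n K cK KV => /measurable_int/measurable_EFinP.
have ms : measurable_fun (K : set (borel E)) (s0).
  by have := i0 K cK KV => /measurable_int/measurable_EFinP.
have [C hKC] := hC K cK KV.
have [g ig bg] := summable_dom mK mh hKC.
split; [|exact: mu|exact: cu|].
- move=> n; apply: measurable_funD => //.
  by apply: measurable_sum => k; exact: mh.
- exists (fun x => `|s0 x| + g x).
    apply: (@integrableD _ _ _ L K mK (fun x => `|s0 x|%:E) (EFin \o g)) => //.
    exact: (integrable_abse (i0 K cK KV)).
  apply: ae_imp bg => x hx Kx n; apply: (le_trans (ler_normD _ _)); rewrite lerD2l.
  by apply: (le_trans (ler_norm_sum _ _ _)); exact: hx.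
Qed.

End DominatedLimits.

(** * Uniform derivative bounds for families of functions *)

Section BoundedFamilies.
Context {R : realType} {d : nat}.
Local Notation E := 'rV[R]_d.
Variables (J : Type) (la : J -> R).
Hypothesis la1 : forall j, 1 <= la j.
Variables (V K : set E).
Hypotheses (oV : open V) (KV : K `<=` V) (cK : compact K).
Opaque smooth_on partial.
Implicit Types (F G : J -> E -> R) (n m : nat).

(* A family whose derivatives of order k <= n are O(la ^ (m + k)) on K. *)
Fixpoint bfam n m F : Prop :=
  [/\ forall j, smooth_on V (F j),
      exists C : R, forall j x, K x -> `|F j x| <= C * la j ^+ m &
      if n is n'.+1 then forall i, bfam n' m.+1 (fun j => partial i (F j)) else True].

Lemma bfam_eq n m F G : (forall j x, V x -> F j x = G j x) -> bfam n m F -> bfam n m G.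
Proof.
elim: n m F G => [|n IH] m F G FG [sF [C hC] pF]; (split; [|exists C|]).
- by move=> j; exact: (smooth_eq oV (FG j)).
- by move=> j x Kx; rewrite -FG; [exact: hC|exact: KV].
- exact: Logic.I.
- by move=> j; exact: (smooth_eq oV (FG j)).
- by move=> j x Kx; rewrite -FG; [exact: hC|exact: KV].
- move=> i; apply: IH (pF i) => j x Vx; apply: partial_near.
  exact: near_open_eq oV Vx (FG j).
Qed.

Let la_weaken m (C : R) j : C * la j ^+ m <= `|C| * la j ^+ m.+1.
Proof.
have l0 : 0 <= la j by apply: le_trans (la1 j).
apply: (le_trans (ler_wpM2r (exprn_ge0 m l0) (ler_norm C))).
by rewrite ler_wpM2l// ler_weXn2l.
Qed.

Lemma bfam_weaken n m F : bfam n m F -> bfam n m.+1 F.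
Proof.
elim: n m F => [|n IH] m F [sF [C hC] pF]; (split; [exact: sF|exists (`|C|)|]).
- by move=> j x Kx; exact: le_trans (hC j x Kx) (la_weaken _ _ _).
- exact: Logic.I.
- by move=> j x Kx; exact: le_trans (hC j x Kx) (la_weaken _ _ _).
- by move=> i; apply: IH; exact: pF.
Qed.

Lemma bfam_lower n m F : bfam n.+1 m F -> bfam n m F.
Proof.
elim: n m F => [|n IH] m F [sF bF pF]; (split; [exact: sF|exact: bF|]).
  exact: Logic.I.
by move=> i; apply: IH; exact: pF.
Qed.

Lemma bfamD n m F G : bfam n m F -> bfam n m G -> bfam n m (fun j x => F j x + G j x).
Proof.
elim: n m F G => [|n IH] m F G [sF [C hC] pF] [sG [D hD] pG].
  split; [by move=> j; exact: smoothD| |exact: Logic.I].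
  exists (C + D) => j x Kx; rewrite mulrDl; apply: (le_trans (ler_normD _ _)).
  by apply: lerD; [exact: hC|exact: hD].
split; first by move=> j; exact: smoothD.
  exists (C + D) => j x Kx; rewrite mulrDl; apply: (le_trans (ler_normD _ _)).
  by apply: lerD; [exact: hC|exact: hD].
move=> i; apply: bfam_eq (IH _ _ _ (pF i) (pG i)) => j x Vx.
apply/esym; apply: partialD; first exact: smooth_derivable.
exact: smooth_derivable.
Qed.

Lemma bfamM n m m' F G : bfam n m F -> bfam n m' G -> bfam n (m + m') (fun j x => F j x * G j x).
Proof.
have b F0 G0 m1 m2 : (exists C : R, forall j x, K x -> `|F0 j x| <= C * la j ^+ m1) ->
    (exists C : R, forall j x, K x -> `|G0 j x| <= C * la j ^+ m2) ->
    exists C : R, forall j x, K x -> `|F0 j x * G0 j x| <= C * la j ^+ (m1 + m2).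
  move=> [C hC] [D hD]; exists (C * D) => j x Kx.
  by rewrite exprD mulrACA normrM ler_pM//; [exact: hC|exact: hD].
elim: n m m' F G => [|n IH] m m' F G bF bG.
  case: (bF) (bG) => sF cF _ [sG cG _]; split; [|exact: b|exact: Logic.I].
  by move=> j; exact: smoothM.
have lF := bfam_lower bF; have lG := bfam_lower bG.
case: (bF) (bG) => sF cF pF [sG cG pG]; split; last first.
- move=> i; have h1 := IH _ _ _ _ lF (pG i); have h2 := IH _ _ _ _ lG (pF i).
  rewrite addnS in h1; rewrite addnC in h2.
  apply: bfam_eq (bfamD h1 h2) => j x Vx; apply/esym; apply: partialM.
    exact: smooth_derivable.
  exact: smooth_derivable.
- exact: b.
- by move=> j; exact: smoothM.
Qed.

Lemma bfam_fixed n (g : E -> R) : smooth_on V g -> bfam n 0 (fun=> g).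
Proof.
have b (g0 : E -> R) m : smooth_on V g0 -> exists C : R, forall (j : J) x, K x -> `|g0 x| <= C * la j ^+ m.
  move=> sg; have [C C0 hC] := compact_bound cK (fun x Kx => smooth_continuous sg (KV Kx)).
  exists C => j x Kx; apply: (le_trans (hC x Kx)).
  by rewrite ler_peMr ?(ltW C0)// exprn_ege1.
elim: n g => [|n IH] g sg; (split; [by move=> _; exact: sg|exact: b|]).
  exact: Logic.I.
by move=> i; apply: bfam_weaken; apply: IH; exact: smooth_partial.
Qed.

Lemma bfam0 n m : bfam n m (fun=> fun=> 0).
Proof.
elim: m => [|m IH]; last exact: bfam_weaken.
by apply: bfam_fixed; exact: smooth_cst.
Qed.

Lemma bfam_sum n m (I : Type) (s : seq I) (F : I -> J -> E -> R) :
  (forall i, bfam n m (F i)) -> bfam n m (fun j x => \sum_(i <- s) F i j x).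
Proof.
move=> h; elim: s => [|i s IH].
  by apply: bfam_eq (bfam0 n m) => j x _; rewrite big_nil.
by apply: bfam_eq (bfamD (h i) IH) => j x _; rewrite big_cons.
Qed.

Lemma bfam_prod n (I : Type) (s : seq I) (F : I -> J -> E -> R) :
  (forall i, bfam n 0 (F i)) -> bfam n 0 (fun j x => \prod_(i <- s) F i j x).
Proof.
move=> h; elim: s => [|i s IH].
  by apply: bfam_eq (bfam_fixed n (smooth_cst 1 oV)) => j x _; rewrite big_nil.
by apply: bfam_eq (bfamM (h i) IH) => j x _; rewrite big_cons.
Qed.

Lemma bfam_corr n m (G : 'I_d -> 'I_d -> E -> R) I (S : seq 'I_d -> J -> E -> R) :
  (forall i a, smooth_on V (G i a)) -> (forall J, size J = size I -> bfam n m (S J)) ->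
  bfam n m (fun j x => corr (fun i a => G i a x) I (fun J => S J j x)).
Proof.
move=> sG; elim: I S => [|i I IH] S sS.
  exact: bfam0.
apply: bfamD; last by apply: IH => J' sJ; apply: sS; rewrite /= sJ.
apply: bfam_sum => a; have := bfamM (bfam_fixed n (sG i a)) (sS (a :: I) erefl).
by rewrite add0n.
Qed.

(** For t <= 1 the exponential decay wins; for t > 1 the polynomial is evaluated in [0, 1]. *)
Lemma flat_tower_bounded k : exists C : R, forall t, `|@flat_tower R k t| <= C.
Proof.
rewrite /flat_tower; set p := iter _ _ _.
have [C C0 hC] := horner_exp_bound p.
exists (C + \sum_(i < size p) `|p`_i|) => t; rewrite /flat_exp; case: ifPn => [t0|_]; last first.
  by rewrite normr0 addr_ge0// sumr_ge0.
have [t1|t1] := lerP t 1.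
  have s1 : 1 <= t^-1 by rewrite invf_ge1.
  apply: (le_trans (hC _ s1)); apply: (@le_trans _ _ C); last by rewrite lerDl sumr_ge0.
  by rewrite ler_pdivrMr ?exprn_gt0 ?invr_gt0// ler_peMr// exprn_ege1.
apply: (@le_trans _ _ (\sum_(i < size p) `|p`_i|)); last by rewrite lerDr.
have t10 : 0 <= t^-1 by rewrite invr_ge0 ltW.
have t11 : t^-1 <= 1 by rewrite invf_le1 ?lt_trans// ltW.
rewrite normrM [`|expR _|]ger0_norm ?expR_ge0//.
apply: (@le_trans _ _ (`|p.[t^-1]| * 1)).
  by rewrite ler_wpM2l// -expR0 ler_expR oppr_le0.
rewrite mulr1 horner_coef; apply: le_trans (ler_norm_sum _ _ _) _.
apply: ler_sum => i _; rewrite normrM -[leRHS]mulr1 ler_wpM2l//.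
by rewrite ger0_norm ?exprn_ge0// exprn_ile1.
Qed.

(** Slopes are at most la, so each derivative costs one factor la, and the derivatives of the flat
    function are bounded. *)
Lemma bfam_flat n (i : 'I_d) (s b : J -> R) : (forall j, `|s j| <= la j) ->
  bfam n 0 (fun j x => flat_tower 0 (s j * x 0 i + b j)).
Proof.
move=> sl.
have st j k : smooth_on V (fun x : E => s j ^+ k * flat_tower k (s j * x 0 i + b j)).
  apply: (@smooth_sub _ _ setT) => //.
  have := smooth_tower i (tower_shift k (tower_affine (s j) (b j) tower_flat)).
  by rewrite addn0.
have b0 k : exists C : R, forall j (x : E), K x -> `|s j ^+ k * flat_tower k (s j * x 0 i + b j)| <= C * la j ^+ k.
  have [C hC] := flat_tower_bounded k; exists C => j x _.
  by rewrite normrM normrX mulrC ler_pM ?exprn_ge0// lerXn2r ?nnegrE//; apply: le_trans (la1 j).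
suff h k : bfam n k (fun j x => s j ^+ k * flat_tower k (s j * x 0 i + b j)).
  by apply: bfam_eq (h 0) => j x _; rewrite mul1r.
elim: n k => [|n IH] k; (split; [by move=> j; exact: st|exact: b0|]).
  exact: Logic.I.
move=> i'; have e j x : partial i' (fun x : E => s j ^+ k * flat_tower k (s j * x 0 i + b j)) x =
    if i' == i then s j ^+ k.+1 * flat_tower k.+1 (s j * x 0 i + b j) else 0.
  have [_] := partial_tower 0 i i' x (tower_shift k (tower_affine (s j) (b j) tower_flat)).
  by rewrite addn0 addn1.
have [ii|ni] := eqVneq i' i.
  by apply: bfam_eq (IH k.+1) => j x _; rewrite e ii eqxx.
by apply: bfam_eq (bfam0 n k.+1) => j x _; rewrite e (negPf ni).
Qed.

End BoundedFamilies.

(** The supremum y is the limit along F: x_n lies above some t > y - e/4 on one large set and below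
    y + e/4 on another. *)
Lemma ultra_oscillation {R : realType} (F : set_system nat) (x : nat -> R) (B e : R) : UltraFilter F ->
  (forall n, `|x n| <= B) -> 0 < e ->
  exists2 A, F A & forall m n, A m -> A n -> `|x m - x n| < e.
Proof.
move=> uF xB e0.
pose Y := [set t : R | F [set n | t <= x n]].
have Y0 : has_sup Y.
  split.
    by exists (- B); rewrite /Y/=; apply: filterS filterT => n _ /=; have := xB n; rewrite ler_norml => /andP[].
  exists B => t Yt; have [n /= tn] := filter_ex Yt.
  by apply: le_trans tn _; have := xB n; rewrite ler_norml => /andP[].
pose y := sup Y; have e4 : 0 < e / 4 by rewrite divr_gt0.
have [t Yt ty] := sup_adherent e4 Y0.
have nY : ~ F [set n | y + e / 4 <= x n].
  by move=> h; have := sup_ubound Y0.2 h; rewrite leNgt ltrDl e4.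
have [//|h] := in_ultra_setVsetC [set n | y + e / 4 <= x n] uF.
exists ([set n | t <= x n] `&` ~` [set n | y + e / 4 <= x n]); first exact: filterI.
move=> m n [/= m1 /negP m2] [/= n1 /negP n2]; move: m2 n2 ty; rewrite -/y => m2 n2 ty.
by rewrite ltr_norml; apply/andP; split; lra.
Qed.

Lemma le_small {R : realType} (x K : R) : 0 <= K -> (forall e : R, 0 < e -> x <= e * K) -> x <= 0.
Proof.
move=> K0 h; rewrite leNgt; apply/negP => x0.
have K1 : 0 < 2 * (K + 1) by rewrite mulr_gt0// ltr_wpDl.
have := h _ (divr_gt0 x0 K1); rewrite mulrAC ler_pdivlMr// ler_pM2l; lra.
Qed.

(** * The eigenvalue problem of two quadratic forms on a Hilbert space *)

Section Forms.
Context {R : realType} {V : lmodType R}.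
Implicit Types (W : set V) (q : V -> V -> R) (f g h : V).

Definition linear_subspace W := W 0 /\ forall (k : R) f g, W f -> W g -> W (k *: f + g).

Definition psd_form W q := [/\ forall f g, W f -> W g -> q f g = q g f,
  forall (k : R) f g h, W f -> W g -> W h -> q (k *: f + g) h = k * q f h + q g h &
  forall f, W f -> 0 <= q f f].

Variables (W : set V).
Hypothesis sW : linear_subspace W.

Lemma subspace0 : W 0. Proof. by case: sW. Qed.
Lemma subspaceZ (k : R) f : W f -> W (k *: f).
Proof. by move=> Wf; rewrite -[_ *: _]addr0; case: sW => W0; apply. Qed.
Lemma subspaceD f g : W f -> W g -> W (f + g).
Proof. by move=> Wf Wg; rewrite -[f]scale1r; case: sW => _; apply. Qed.
Lemma subspaceN f : W f -> W (- f).
Proof. by move=> Wf; rewrite -scaleN1r; exact: subspaceZ. Qed.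
Lemma subspaceB f g : W f -> W g -> W (f - g).
Proof. by move=> Wf Wg; apply: subspaceD => //; exact: subspaceN. Qed.
Lemma subspace_sum (I : Type) (s : seq I) (a : I -> R) (u : I -> V) : (forall i, W (u i)) ->
  W (\sum_(i <- s) a i *: u i).
Proof.
by move=> Wu; elim/big_ind : _ => [|f g|i _]; [exact: subspace0|exact: subspaceD|exact: subspaceZ].
Qed.

Variable q : V -> V -> R.
Hypothesis fq : psd_form W q.

Lemma form_sym f g : W f -> W g -> q f g = q g f. Proof. by case: fq => h _ _; exact: h. Qed.
Lemma form_ge0 f : W f -> 0 <= q f f. Proof. by case: fq => _ _; exact. Qed.
Lemma form_lin k f g h : W f -> W g -> W h -> q (k *: f + g) h = k * q f h + q g h.
Proof. by case: fq => _ h' _; exact: h'. Qed.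
Lemma form_zerol h : W h -> q 0 h = 0.
Proof.
move=> Wh; have := form_lin 1 subspace0 subspace0 Wh; rewrite scale1r addr0 mul1r => /eqP.
by rewrite -subr_eq subrr => /eqP.
Qed.
Lemma form_scalel k f h : W f -> W h -> q (k *: f) h = k * q f h.
Proof. by move=> Wf Wh; rewrite -[_ *: _]addr0 form_lin ?form_zerol ?addr0//; exact: subspace0. Qed.
Lemma form_addl f g h : W f -> W g -> W h -> q (f + g) h = q f h + q g h.
Proof. by move=> Wf Wg Wh; rewrite -{1}[f]scale1r form_lin// mul1r. Qed.
Lemma form_subl f g h : W f -> W g -> W h -> q (f - g) h = q f h - q g h.
Proof.
move=> Wf Wg Wh; rewrite (form_addl Wf (subspaceN Wg) Wh) -[- g]scaleN1r.
by rewrite (form_scalel (-1) Wg Wh) mulN1r.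
Qed.
Lemma form_scaler k f h : W f -> W h -> q h (k *: f) = k * q h f.
Proof. by move=> Wf Wh; rewrite (form_sym Wh (subspaceZ k Wf)) (form_scalel k Wf Wh) form_sym. Qed.
Lemma form_addr f g h : W f -> W g -> W h -> q h (f + g) = q h f + q h g.
Proof.
move=> Wf Wg Wh; rewrite (form_sym Wh (subspaceD Wf Wg)) (form_addl Wf Wg Wh).
by rewrite (form_sym Wf Wh) (form_sym Wg Wh).
Qed.
Lemma form_subr f g h : W f -> W g -> W h -> q h (f - g) = q h f - q h g.
Proof.
move=> Wf Wg Wh; rewrite (form_sym Wh (subspaceB Wf Wg)) (form_subl Wf Wg Wh).
by rewrite (form_sym Wf Wh) (form_sym Wg Wh).
Qed.

Lemma form_suml (I : Type) (s : seq I) (a : I -> R) (u : I -> V) h : (forall i, W (u i)) -> W h ->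
  q (\sum_(i <- s) a i *: u i) h = \sum_(i <- s) a i * q (u i) h.
Proof.
move=> Wu Wh; elim: s => [|i s IH]; first by rewrite !big_nil form_zerol.
by rewrite !big_cons (form_lin _ (Wu i) (subspace_sum s a Wu) Wh) IH.
Qed.

Lemma form_sumr (I : Type) (s : seq I) (a : I -> R) (u : I -> V) h : (forall i, W (u i)) -> W h ->
  q h (\sum_(i <- s) a i *: u i) = \sum_(i <- s) a i * q h (u i).
Proof.
move=> Wu Wh; rewrite (form_sym Wh (subspace_sum s a Wu)) (form_suml s a Wu Wh).
by apply: eq_bigr => i _; rewrite form_sym.
Qed.

Lemma form_orth_sum (I : finType) (a : I -> R) (u : I -> V) : (forall i, W (u i)) ->
  (forall i k, i != k -> q (u i) (u k) = 0) ->
  q (\sum_i a i *: u i) (\sum_i a i *: u i) = \sum_i a i ^+ 2 * q (u i) (u i).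
Proof.
move=> Wu ou; have WS := subspace_sum (index_enum I) a Wu.
rewrite (form_suml _ _ Wu WS); apply: eq_bigr => i _.
rewrite (form_sumr _ _ Wu (Wu i)) (bigD1 i)//= big1 ?addr0; last by move=> k ki; rewrite ou ?mulr0// eq_sym.
by rewrite mulrA.
Qed.

Lemma form_sq k f g : W f -> W g ->
  q (k *: f + g) (k *: f + g) = q f f * k ^+ 2 + q f g * k *+ 2 + q g g.
Proof.
move=> Wf Wg; have Wkf := subspaceZ k Wf.
rewrite (form_addl Wkf Wg (subspaceD Wkf Wg)) (form_addr Wkf Wg Wkf) (form_addr Wkf Wg Wg).
rewrite (form_scalel k Wf Wkf) (form_scalel k Wf Wg) !form_scaler // [q g f](form_sym Wg Wf); ring.
Qed.

Lemma form_cauchy f g : W f -> W g -> q f g ^+ 2 <= q f f * q g g.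
Proof.
move=> Wf Wg; apply: discriminant_le => [|t]; first exact: form_ge0.
by rewrite -(form_sq t Wf Wg); apply: form_ge0; case: sW => _; apply.
Qed.

Lemma form_parallelogram f g : W f -> W g ->
  q (f - g) (f - g) + q (f + g) (f + g) = 2 * q f f + 2 * q g g.
Proof.
move=> Wf Wg; have h1 := form_sq 1 Wf Wg; have h2 := form_sq (-1) Wg Wf.
rewrite scale1r in h1; rewrite scaleN1r addrC in h2; rewrite h1 h2 (form_sym Wg Wf).
by move: (q f f) (q g g) (q f g) => x y z; ring.
Qed.

Lemma form_sub_le f g : W f -> W g -> q (f - g) (f - g) <= 2 * q f f + 2 * q g g.
Proof.
move=> Wf Wg; rewrite -(form_parallelogram Wf Wg) lerDl; exact: form_ge0 (subspaceD Wf Wg).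
Qed.

Lemma form_add_le f g : W f -> W g -> q (f + g) (f + g) <= 2 * q f f + 2 * q g g.
Proof.
move=> Wf Wg; rewrite -(form_parallelogram Wf Wg) lerDr; exact: form_ge0 (subspaceB Wf Wg).
Qed.

End Forms.

Lemma exists_combination {R : realType} (n m : nat) (A : 'I_m -> 'I_n -> R) : (n < m)%N ->
  exists2 a : 'I_m -> R, (exists i, a i != 0) & forall k, \sum_i a i * A i k = 0.
Proof.
move=> nm; pose Am : 'M[R]_(m, n) := \matrix_(i, k) A i k.
have : kermx Am != 0.
  rewrite kermx_eq0 neq_ltn; apply/orP; left.
  exact: leq_ltn_trans (rank_leq_col Am) nm.
move=> /rowV0Pn[v /sub_kermxP vA v0].
exists (fun i => v 0 i).
  by move: v0 => /rV0Pn[i vi]; exists i.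
move=> k; have := congr1 (fun B : 'rV[R]_n => B 0 k) vA.
by rewrite !mxE => h; rewrite -[RHS]h; apply: eq_bigr => i _; rewrite mxE.
Qed.

Section Hilbert.
Context {R : realType} {V : lmodType R}.
Variables (H : set V) (dot : V -> V -> R).
Hypotheses (sH : linear_subspace H) (fdot : psd_form H dot).
Hypothesis dot_eq0 : forall f, H f -> dot f f = 0 -> f = 0.
Hypothesis complete : forall f_ : nat -> V, (forall n, H (f_ n)) ->
  (forall e : R, 0 < e -> exists N, forall m n, (N <= m)%N -> (N <= n)%N ->
     dot (f_ m - f_ n) (f_ m - f_ n) <= e) ->
  exists2 f, H f & forall e : R, 0 < e -> exists N, forall n, (N <= n)%N ->
     dot (f_ n - f) (f_ n - f) <= e.
Implicit Types (f g h : V).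

(** The representing vector minimizes |f|^2 - 2 l(f); by the parallelogram law a minimizing sequence
    is Cauchy. *)
Lemma riesz (l : V -> R) (C : R) : 0 <= C ->
  (forall (k : R) f g, H f -> H g -> l (k *: f + g) = k * l f + l g) ->
  (forall f, H f -> l f ^+ 2 <= C * dot f f) ->
  exists2 g, H g & forall f, H f -> dot f g = l f.
Proof.
move=> C0 lL lC; have H0 := subspace0 sH.
pose J f := dot f f - 2 * l f.
have lZ k f : H f -> l (k *: f) = k * l f.
  move=> Hf; have l0 : l 0 = 0.
    have := lL 1 0 0 H0 H0; rewrite scale1r addr0 mul1r => /eqP.
    by rewrite -subr_eq subrr => /eqP.
  by rewrite -[_ *: _]addr0 (lL k f 0 Hf H0) l0 addr0.
have Jb f : H f -> - C <= J f.
  move=> Hf; have h := lC f Hf; have d0 := form_ge0 fdot Hf; rewrite /J.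
  move: (dot f f) (l f) h d0 => x y h x0.
  suff : 2 * y <= x + C by lra.
  have [y0|y0] := lerP 0 y; last by lra.
  have s := sqr_ge0 (x - C).
  by rewrite -(ler_pXn2r (_ : 0 < 2)%N) ?nnegrE ?mulr_ge0//; nra.
pose Y := [set J f | f in H].
have iY : has_inf Y by split; [exists (J 0), 0|exists (- C) => _ [f Hf <-]; exact: Jb].
pose m := inf Y.
have Jm f : H f -> m <= J f by move=> Hf; apply: (inf_lbound iY.2); exists f.
have /choice[f_ hf] : forall n : nat, exists f, H f /\ J f <= m + n.+1%:R^-1.
  move=> n; have n0 : 0 < n.+1%:R^-1 :> R by [].
  by have [_ [f Hf <-] /ltW h] := inf_adherent n0 iY; exists f.
have Hf n : H (f_ n) by have [] := hf n.
have Je n : J (f_ n) <= m + n.+1%:R^-1 by have [] := hf n.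
have par f g : H f -> H g -> dot (f - g) (f - g) <= 2 * (J f - m) + 2 * (J g - m).
  move=> Hf' Hg; have Hs := subspaceD sH Hf' Hg; have Hw := subspaceZ sH 2^-1 Hs.
  have := Jm _ Hw; rewrite /J (lZ _ _ Hs) (form_scalel sH fdot _ Hs Hw) (form_scaler sH fdot _ Hs Hs).
  have -> : l (f + g) = l f + l g by have := lL 1 f g Hf' Hg; rewrite scale1r mul1r.
  have := form_parallelogram sH fdot Hf' Hg.
  move: (dot (f - g) _) (dot (f + g) _) (dot f f) (dot g g) (l f) (l g) => a b c e x y.
  have -> : 2^-1 * (2^-1 * b) = b / 4 by field.
  have -> : 2 * (2^-1 * (x + y)) = x + y by field.
  lra.
have [|g Hg cg] := complete Hf.
  move=> e e0; exists (Num.truncn (4 / e)) => i k hi hk; apply: (le_trans (par _ _ (Hf i) (Hf k))).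
  have small n : (Num.truncn (4 / e) <= n)%N -> n.+1%:R^-1 <= e / 4.
    move=> hn; rewrite -[leRHS]invrK lef_pV2 ?posrE ?invr_gt0 ?divr_gt0// invf_div.
    apply: ltW; apply: lt_le_trans (truncnS_gt _) _; by rewrite ler_nat ltnS.
  move: (small _ hi) (small _ hk) (Je i) (Je k); move: (J (f_ i)) (J (f_ k)) (m) (i.+1%:R^-1) (k.+1%:R^-1) => x y z t w *; lra.
exists g => // h Hh.
(* The quadratic t -> J(t h + f_n) - m is nonnegative with value at most 1/(n+1) at t = 0; its
   discriminant bounds the defect of f_n against h. *)
have var n : (dot h (f_ n) - l h) ^+ 2 <= dot h h * n.+1%:R^-1.
  apply: discriminant_le => [|t]; first exact: (form_ge0 fdot Hh).
  have := Jm _ (subspaceD sH (subspaceZ sH t Hh) (Hf n)); have := Je n.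
  rewrite /J (form_sq sH fdot t Hh (Hf n)) (lL t h _ Hh (Hf n)).
  move: (dot h h) (dot h (f_ n)) (dot (f_ n) (f_ n)) (l h) (l (f_ n)) (n.+1%:R^-1) => a b c x y z.
  by move=> *; lra.
apply/eqP; rewrite -subr_eq0 -sqrf_eq0 eq_le sqr_ge0 andbT.
apply: (@le_small _ _ (4 * dot h h)); first by rewrite mulr_ge0// (form_ge0 fdot Hh).
move=> e e0; have [N hN] := cg e e0.
pose n := maxn N (Num.truncn e^-1).
have h1 := hN n (leq_maxl _ _).
have h2 : n.+1%:R^-1 <= e.
  rewrite -[leRHS]invrK lef_pV2 ?posrE ?invr_gt0//.
  by apply: ltW; apply: lt_le_trans (truncnS_gt _) _; rewrite ler_nat ltnS leq_maxr.
have Hd := subspaceB sH (Hf n) Hg.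
have h3 := form_cauchy sH fdot Hh Hd.
rewrite (form_subr sH fdot (Hf n) Hg Hh) in h3.
have h0 := form_ge0 fdot Hh; have := var n.
have h4 : dot h h * n.+1%:R^-1 <= dot h h * e by rewrite ler_wpM2l.
have h5 : dot h h * dot (f_ n - g) (f_ n - g) <= dot h h * e by rewrite ler_wpM2l.
move: h3 h4 h5; move: (dot h h * n.+1%:R^-1) (dot h h * dot (f_ n - g) _) => p q h3 h4 h5 h6.
have : p <= dot h h * e := h4.
have : (dot h g - l h) ^+ 2 <= 2 * (dot h (f_ n) - l h) ^+ 2 + 2 * (dot h (f_ n) - dot h g) ^+ 2.
  move: (dot h g) (l h) (dot h (f_ n)) => a b c; have := sqr_ge0 ((c - b) + (c - a)); nra.
lra.
Qed.

Lemma dot_normalize f : H f -> f <> 0 -> exists2 k : R, k != 0 & dot (k *: f) (k *: f) = 1.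
Proof.
move=> Hf f0; have d0 : 0 < dot f f.
  by rewrite lt_neqAle (form_ge0 fdot Hf) andbT; apply/eqP => h; apply: f0; exact: dot_eq0.
exists (Num.sqrt (dot f f))^-1; first by rewrite invr_eq0 sqrtr_eq0 -ltNge.
have Hk := subspaceZ sH (Num.sqrt (dot f f))^-1 Hf.
rewrite (form_scalel sH fdot _ Hf Hk) (form_scaler sH fdot _ Hf Hf) mulrA -expr2 exprVn sqr_sqrtr ?ltW//.
by rewrite mulVf// gt_eqF.
Qed.

Variable b : V -> V -> R.
Variable B : R.
Hypotheses (fb : psd_form H b) (b_le : forall f, H f -> b f f <= B * dot f f).
Hypothesis b_eq0 : forall f, H f -> b f f = 0 -> f = 0.
Definition bounded_functional (l : V -> R) :=
  (forall (k : R) f g, H f -> H g -> l (k *: f + g) = k * l f + l g) /\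
  exists C : R, forall f, H f -> l f ^+ 2 <= C * dot f f.
(** Up to e times [dot], finitely many bounded functionals control b: the form in which the Fourier
    estimates provide compactness. *)
Hypothesis approx : forall e : R, 0 < e -> exists (n : nat) (l : 'I_n -> V -> R) (C : R),
  [/\ 0 <= C, forall i, bounded_functional (l i) &
      forall f, H f -> b f f <= C * \sum_i l i f ^+ 2 + e * dot f f].

(* Along an ultrafilter the bounded functionals converge, so [b] of the
   differences of a bounded sequence is small on a large set of indices. *)
Lemma precompact (F : set_system nat) (f_ : nat -> V) (e : R) : UltraFilter F ->
  (forall n, H (f_ n) /\ dot (f_ n) (f_ n) = 1) -> 0 < e ->
  exists2 A, F A & forall m n, A m -> A n -> b (f_ m - f_ n) (f_ m - f_ n) <= e.
Proof.
move=> uF hf e0.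
have e8 : 0 < e / 8 by rewrite divr_gt0.
have [n [l [C [C0 lb bl]]]] := approx e8.
(* Chosen so that C n eta^2 <= e/2. The other half is e/8 times 4, the bound of the squared norm of
   a difference of unit vectors. *)
pose eta := Num.sqrt (e / (2 * (C * n%:R + 1))).
have Cn : 0 < C * n%:R + 1 by rewrite ltr_wpDl// mulr_ge0.
have eta0 : 0 < eta by rewrite sqrtr_gt0 divr_gt0// mulr_gt0.
have /choice[A hA] : forall i, exists A, F A /\ forall m m', A m -> A m' -> `|l i (f_ m) - l i (f_ m')| < eta.
  move=> i; have [lL [D hD]] := lb i.
  have bd m : `|l i (f_ m)| <= Num.sqrt D.
    have [Hm m1] := hf m; have := hD _ Hm; rewrite m1 mulr1 => h.
    by rewrite -sqrtr_sqr ler_wsqrtr.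
  by have [A FA h] := ultra_oscillation uF bd eta0; exists A.
exists [set m | forall i, A i m].
  by apply: filter_forall => i; have [] := hA i.
move=> m m' Am Am'; have [Hm m1] := hf m; have [Hm' m1'] := hf m'.
have Hd := subspaceB sH Hm Hm'.
apply: (le_trans (bl _ Hd)).
have h1 := form_sub_le sH fdot Hm Hm'; rewrite m1' in h1.
have h2 : \sum_i l i (f_ m - f_ m') ^+ 2 <= \sum_(i < n) eta ^+ 2.
  apply: ler_sum => i _; have [lL _] := lb i.
  have -> : l i (f_ m - f_ m') = l i (f_ m) - l i (f_ m').
    by rewrite addrC -scaleN1r (lL (-1) _ _ Hm' Hm) mulN1r addrC.
  have [_ /(_ m m' (Am i) (Am' i)) h] := hA i.
  rewrite -real_normK ?num_real// lerXn2r ?ltW//; exact: ltW.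
have h3 : C * \sum_i l i (f_ m - f_ m') ^+ 2 <= e / 2.
  apply: (le_trans (ler_wpM2l C0 h2)).
  rewrite sumr_const card_ord -[_ *+ n]mulr_natr sqr_sqrtr; last by rewrite ltW// divr_gt0// mulr_gt0.
  rewrite mulrCA mulrAC -mulrA; move: Cn; move: (C * n%:R) (mulr_ge0 C0 (ler0n R n)) => x x0 x1.
  rewrite ler_pM2l// ler_pdivrMr ?mulr_gt0//.
  by rewrite mulKf// lerDl.
have h4 : e / 8 * dot (f_ m - f_ m') (f_ m - f_ m') <= e / 8 * 4.
  by rewrite ler_wpM2l ?(ltW e8)//; lra.
apply: (le_trans (lerD h3 h4)); by apply: le_of_eq; field.
Qed.

(** With S the supremum of b on the unit sphere of W, the form q = S dot - b is positive on W and
    tends to 0 along a maximizing sequence. Since S dot = q + b and [precompact] controls b, a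
    subsequence is Cauchy for [dot]. *)
Lemma exists_maximizer (W : set V) f0 : linear_subspace W -> W `<=` H -> W f0 -> f0 <> 0 ->
  (forall (f_ : nat -> V) f, (forall n, W (f_ n)) -> H f -> (forall e : R, 0 < e -> exists n : nat,
      dot (f_ n - f) (f_ n - f) <= e) -> W f) ->
  exists e, [/\ W e, dot e e = 1 & forall f, W f -> b f f <= b e e * dot f f].
Proof.
move=> sW WH Wf0 f00 cW.
pose Y := [set b f f | f in [set f | W f /\ dot f f = 1]].
have sup_Y : has_sup Y.
  split.
    have [k k0 h] := dot_normalize (WH _ Wf0) f00.
    by exists (b (k *: f0) (k *: f0)), (k *: f0) => //; split => //; exact: subspaceZ.
  by exists B => _ [f [Wf d1] <-]; have := b_le (WH _ Wf); rewrite d1 mulr1.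
pose S := sup Y.
have bS f : W f -> b f f <= S * dot f f.
  move=> Wf; have [->|/eqP fn0] := eqVneq f 0.
    by rewrite (form_zerol sH fb (subspace0 sH)) (form_zerol sH fdot (subspace0 sH)) mulr0.
  have Hf := WH _ Wf; have [k k0 h] := dot_normalize Hf fn0.
  have Hk := subspaceZ sH k Hf.
  have : b (k *: f) (k *: f) <= S.
    by apply: (sup_ubound sup_Y.2); exists (k *: f) => //; split => //; exact: subspaceZ.
  move: h; rewrite (form_scalel sH fdot _ Hf Hk) (form_scaler sH fdot _ Hf Hf).
  rewrite (form_scalel sH fb _ Hf Hk) (form_scaler sH fb _ Hf Hf) !mulrA -expr2 => h1 h2.
  have k2 : 0 < k ^+ 2 by rewrite exprn_even_gt0.
  by rewrite -(ler_pM2l k2) mulrCA h1 mulr1.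
have S0 : 0 < S.
  have h := bS _ Wf0; have b0 : 0 < b f0 f0.
    rewrite lt_neqAle (form_ge0 fb (WH _ Wf0)) andbT eq_sym; apply/eqP => h'.
    by apply: f00; apply: b_eq0 => //; exact: WH.
  have := lt_le_trans b0 h; rewrite pmulr_lgt0//.
  rewrite lt_neqAle (form_ge0 fdot (WH _ Wf0)) andbT eq_sym; apply/eqP => h'.
  by apply: f00; apply: dot_eq0 => //; exact: WH.
pose q f g := S * dot f g - b f g.
have fq : psd_form W q.
  split.
  - by move=> f g /WH Hf /WH Hg; rewrite /q (form_sym fdot Hf Hg) (form_sym fb Hf Hg).
  - move=> k f g h /WH Hf /WH Hg /WH Hh.
    by rewrite /q (form_lin fdot k Hf Hg Hh) (form_lin fb k Hf Hg Hh); ring.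
  - by move=> f Wf; rewrite /q subr_ge0; exact: bS.
have /choice[f_ hf] : forall n : nat, exists f, [/\ W f, dot f f = 1 & q f f <= n.+1%:R^-1].
  move=> n; have n0 : 0 < n.+1%:R^-1 :> R by [].
  have [_ [f [Wf d1] <-] h] := sup_adherent n0 sup_Y; exists f; split => //.
  by rewrite /q d1 mulr1 lerBlDr addrC -lerBlDr ltW.
have Wf n : W (f_ n) by have [] := hf n.
have Hf n : H (f_ n) := WH _ (Wf n).
have d1 n : dot (f_ n) (f_ n) = 1 by have [] := hf n.
have qn n : q (f_ n) (f_ n) <= n.+1%:R^-1 by have [] := hf n.
have [F [uF subF]] := ultraFilterLemma (eventually_filter).
have /choice[A hA] : forall j : nat, exists A : set nat, F A /\ forall m n, A m -> A n ->
    b (f_ m - f_ n) (f_ m - f_ n) <= j.+1%:R^-1 /\ (j <= m)%N.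
  move=> j; have j0 : 0 < j.+1%:R^-1 :> R by [].
  have [A FA h] := precompact uF (fun n => conj (Hf n) (d1 n)) j0.
  exists (A `&` [set n | (j <= n)%N]); split.
    by apply: filterI => //; apply: subF; exact: nbhs_infty_ge.
  by move=> m n [Am jm] [An _]; split => //; exact: h.
(* Diagonal choice: the j-th term lies in the large sets of all levels up to j. *)
have /choice[phi hphi] : forall j : nat, exists n : nat, forall i : 'I_j.+1, A i n.
  move=> j; have : F [set n | forall i : 'I_j.+1, A i n].
    by apply: (@filter_forall _ _ (fun i : 'I_j.+1 => A i)) => i; have [] := hA i.
  by move=> /filter_ex[n hn]; exists n.
have phiA i j : (i <= j)%N -> A i (phi j) by move=> ij; exact: (hphi j (Ordinal (ij : (i < j.+1)%N))).
pose g_ j := f_ (phi j).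
have inv_le i j : (i <= j)%N -> j.+1%:R^-1 <= i.+1%:R^-1 :> R.
  by move=> ij; rewrite lef_pV2 ?posrE// ler_nat.
have qg i j : (i <= j)%N -> q (g_ j) (g_ j) <= i.+1%:R^-1.
  move=> ij; apply: (le_trans (qn _)); apply: inv_le.
  by have [_ /(_ _ _ (phiA i j ij) (phiA i j ij))[]] := hA i.
(* The constant is 1 + 4: one from b on [A i], four from q of a difference of two terms at which q
   is at most 1/(i+1). *)
have cau i j k : (i <= j)%N -> (i <= k)%N -> S * dot (g_ j - g_ k) (g_ j - g_ k) <= 5 * i.+1%:R^-1.
  move=> ij ik; have [_ /(_ _ _ (phiA i j ij) (phiA i k ik))[h1 _]] := hA i.
  have h2 := form_sub_le sW fq (Wf (phi j)) (Wf (phi k)); rewrite {1}/q in h2.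
  have h3 := qg i j ij; have h4 := qg i k ik.
  move: h1 h2 h3 h4; rewrite -/(g_ j) -/(g_ k).
  move: (S * dot _ _) (b _ _) (q _ _) (q _ _) (i.+1%:R^-1) => x y z t w *; lra.
have tr e : 0 < e -> exists i, 5 * i.+1%:R^-1 <= e :> R.
  move=> e0; exists (Num.truncn (5 / e)); rewrite -ler_pdivlMl// -[leRHS]invrK lef_pV2 ?posrE ?invr_gt0 ?mulr_gt0//.
  by rewrite invfM invrK ltW// truncnS_gt.
have [|g Hg cg] := complete (fun j => Hf (phi j)).
  move=> e e0; have [i hi] := tr _ (mulr_gt0 S0 e0); exists i => j k ij ik.
  by rewrite -(ler_pM2l S0); apply: le_trans hi; exact: cau.
have Wg : W g.
  apply: (cW g_ g) => [n|//|e e0]; first exact: Wf.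
  by have [N hN] := cg e e0; exists N; exact: hN.
have g1 : 1 <= 2 * dot g g.
  have h e : 0 < e -> 1 - 2 * dot g g <= e * 2.
    move=> e0; have [N hN] := cg e e0; have := hN N (leqnn _).
    have := form_add_le sH fdot (subspaceB sH (Hf (phi N)) Hg) Hg.
    rewrite subrK d1; lra.
  by have := le_small (_ : 0 <= 2) h; rewrite subr_le0; apply.
have gn0 : g <> 0.
  by move=> g0; move: g1; rewrite g0 (form_zerol sH fdot (subspace0 sH)) mulr0 ler10.
have q0 : q g g <= 0.
  apply: (@le_small _ _ (2 + 2 * S)); first by rewrite addr_ge0// mulr_ge0// ltW.
  move=> e e0; have [N hN] := cg e e0; have [i hi] := tr e e0.
  pose n := maxn N i; have h1 := hN n (leq_maxl _ _).
  have h2 := qg i n (leq_maxr _ _).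
  have Wd := subspaceB sW Wg (Wf (phi n)).
  have h3 := form_add_le sW fq Wd (Wf (phi n)); rewrite subrK in h3.
  have h4 : q (g - f_ (phi n)) (g - f_ (phi n)) <= S * e.
    have b0 := form_ge0 fb (WH _ Wd); rewrite /q.
    have Hd := subspaceB sH (Hf (phi n)) Hg.
    have e1 : dot (g - f_ (phi n)) (g - f_ (phi n)) = dot (f_ (phi n) - g) (f_ (phi n) - g).
      have -> : g - f_ (phi n) = -1 *: (f_ (phi n) - g) by rewrite scaleN1r opprB.
      rewrite (form_scalel sH fdot _ Hd (subspaceZ sH _ Hd)) (form_scaler sH fdot _ Hd Hd) mulrA.
      by rewrite mulrN1 opprK mul1r.
    rewrite e1; have : S * dot (f_ (phi n) - g) (f_ (phi n) - g) <= S * e by rewrite ler_pM2l.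
    by move: b0; move: (b _ _) (S * dot _ _) => *; lra.
  have i0 : 0 <= i.+1%:R^-1 :> R by rewrite invr_ge0.
  by move: h2 h3 h4 hi i0; rewrite -/g_; move: (q _ _) (q _ _) (q _ _) (i.+1%:R^-1) => *; lra.
have [k k0 h] := dot_normalize Hg gn0.
have Wk := subspaceZ sW k Wg; exists (k *: g); split => // f Wf'.
apply: (le_trans (bS f Wf')); have d0 := form_ge0 fdot (WH _ Wf'); rewrite ler_wpM2r//.
have qk : q (k *: g) (k *: g) <= 0.
  rewrite (form_scalel sW fq _ Wg Wk) (form_scaler sW fq _ Wg Wg) mulrA.
  by rewrite mulr_ge0_le0// sqr_ge0.
by move: qk; rewrite /q h mulr1 subr_le0.
Qed.

(** Keeps the orthogonal complement of finitely many vectors nonzero, so that the choice of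
    eigenvectors never stops. *)
Hypothesis infinite_dim : forall n : nat, exists u : 'I_n -> V, [/\ forall i, H (u i),
  forall i k, i != k -> dot (u i) (u k) = 0 & forall i, 0 < dot (u i) (u i)].

Definition orthogonal (s : seq V) : set V := [set f | H f /\ forall g, List.In g s -> dot f g = 0].

Definition maximizes (s : seq V) e := [/\ orthogonal s e, dot e e = 1 &
  forall f, orthogonal s f -> b f f <= b e e * dot f f].

Lemma subspace_orthogonal s : (forall g, List.In g s -> H g) -> linear_subspace (orthogonal s).
Proof.
move=> Hs; split.
  by split; [exact: subspace0|move=> g /Hs Hg; rewrite (form_zerol sH fdot Hg)].
move=> k f g [Hf of_] [Hg og]; split; first by case: sH => _; apply.
by move=> h sh; rewrite (form_lin fdot k Hf Hg (Hs h sh)) of_// og// mulr0 addr0.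
Qed.

Lemma orth_combination (n m : nat) (e : 'I_n -> V) (u : 'I_m -> V) : (n < m)%N ->
  (forall k, H (e k)) -> (forall i, H (u i)) ->
  exists2 a : 'I_m -> R, (exists i, a i != 0) & forall k, dot (\sum_i a i *: u i) (e k) = 0.
Proof.
move=> nm He Hu; have [a a0 ha] := exists_combination (fun i k => dot (u i) (e k)) nm.
exists a => // k; rewrite (form_suml sH fdot _ _ Hu (He k)); exact: ha.
Qed.

Lemma orth_sum_gt0 (I : finType) (a : I -> R) (u : I -> V) : (forall i, H (u i)) ->
  (forall i k, i != k -> dot (u i) (u k) = 0) -> (forall i, 0 < dot (u i) (u i)) ->
  (exists i, a i != 0) -> 0 < dot (\sum_i a i *: u i) (\sum_i a i *: u i).
Proof.
move=> Hu ou u0 [i ai]; rewrite (form_orth_sum sH fdot a Hu ou) (bigD1 i)//=.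
apply: ltr_pwDl; first by rewrite mulr_gt0// exprn_even_gt0.
by apply: sumr_ge0 => k _; rewrite mulr_ge0 ?sqr_ge0// ltW.
Qed.

(** Among [(size s).+1] orthogonal vectors some nonzero combination is orthogonal to s; closedness
    of the complement is Cauchy-Schwarz. *)
Lemma exists_maximizes s : (forall g, List.In g s -> H g) -> exists e, maximizes s e.
Proof.
move=> Hs; have sW := subspace_orthogonal Hs.
have [u [Hu ou u0]] := infinite_dim (size s).+1.
pose e (k : 'I_(size s)) := nth 0 s k.
have Hin (k : 'I_(size s)) : List.In (e k) s.
  rewrite /e; case: k => k /=; elim: s k {Hs sW u Hu ou u0 e} => [//|x s IH] [|k] /=; first by left.
  by rewrite ltnS => ks; right; exact: IH.
have [a a0 oa] := orth_combination (ltnSn _) (fun k => Hs _ (Hin k)) Hu.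
have p0 := orth_sum_gt0 Hu ou u0 a0.
have HS := subspace_sum sH (index_enum _) a Hu.
apply: (@exists_maximizer (orthogonal s) (\sum_i a i *: u i)) => //.
- by move=> f [].
- split => // g sg; suff [k ->] : exists k, g = e k by exact: oa.
  rewrite /e; elim: s g sg {Hs sW u Hu ou u0 e Hin a a0 oa p0 HS} => [//|x s IH] g /= [<-|sg].
    by exists ord0.
  by have [k ->] := IH g sg; exists (lift ord0 k).
- by move=> h; move: p0; rewrite h (form_zerol sH fdot (subspace0 sH)) ltxx.
- move=> f_ f Wf Hf hf; split => // g sg; have Hg := Hs g sg.
  apply/eqP; rewrite -sqrf_eq0 eq_le sqr_ge0 andbT.
  apply: le_small; first exact: (form_ge0 fdot Hg).
  move=> e' e0; have [n hn] := hf e' e0; have [Hn on] := Wf n.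
  have Hd := subspaceB sH Hn Hf.
  have := form_cauchy sH fdot Hd Hg; rewrite (form_subl sH fdot Hn Hf Hg) on// sub0r sqrrN => h.
  by apply: (le_trans h); rewrite ler_wpM2r// (form_ge0 fdot Hg).
Qed.

(** The default 0 is never reached on the lists that occur, by [eigen_maximizes]. *)
Definition eigen_choice s : V := xget 0 [set e | maximizes s e].
Fixpoint eigen_list n : seq V := if n is n'.+1 then eigen_choice (eigen_list n') :: eigen_list n' else [::].
Definition eigenvector n := eigen_choice (eigen_list n).
Definition eigenvalue_of n := b (eigenvector n) (eigenvector n).
Local Notation e := eigenvector.
Local Notation tau := eigenvalue_of.

Lemma eigen_list_in n g : List.In g (eigen_list n) <-> exists2 k, (k < n)%N & g = e k.
Proof.
elim: n g => [|n IH] g /=; first by split => // -[].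
split=> [[<-|/IH[k kn ->]]|[k]]; [by exists n|by exists k => //; exact: ltnW|].
rewrite ltnS leq_eqVlt => /orP[/eqP->|kn] ->; first by left.
by right; apply/IH; exists k.
Qed.

Lemma eigen_maximizes n : maximizes (eigen_list n) (e n).
Proof.
have [m] := ubnP n; elim: m n => [//|m IH] n nm.
have Hs g : List.In g (eigen_list n) -> H g.
  move=> /eigen_list_in[k kn ->]; have [[]] := IH k (leq_trans kn nm); exact.
exact: (xgetPex 0 (exists_maximizes Hs)).
Qed.

Lemma eigenvector_in n : H (e n). Proof. by have [[]] := eigen_maximizes n. Qed.
Lemma eigenvector_norm n : dot (e n) (e n) = 1. Proof. by have [] := eigen_maximizes n. Qed.

Lemma eigenvector_orth k n : k != n -> dot (e k) (e n) = 0.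
Proof.
have lt i j : (i < j)%N -> dot (e j) (e i) = 0.
  move=> ij; have [[_ h] _ _] := eigen_maximizes j; apply: h; apply/eigen_list_in; by exists i.
rewrite neq_ltn => /orP[kn|nk]; last exact: lt.
by rewrite (form_sym fdot (eigenvector_in k) (eigenvector_in n)); exact: lt.
Qed.

Lemma eigen_max n f : H f -> (forall k, (k < n)%N -> dot f (e k) = 0) -> b f f <= tau n * dot f f.
Proof.
move=> Hf of_; have [_ _ h] := eigen_maximizes n; apply: h; split => // g /eigen_list_in[k kn ->].
exact: of_.
Qed.

Lemma tau_mono k n : (k <= n)%N -> tau n <= tau k.
Proof.
move=> kn; have := @eigen_max k (e n) (eigenvector_in n); rewrite eigenvector_norm mulr1; apply.
by move=> i ik; rewrite eigenvector_orth// eq_sym neq_ltn (leq_trans ik kn).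
Qed.

(** On the complement of the earlier eigenvectors, tau_n dot - b is positive and vanishes at e_n, so
    by Cauchy-Schwarz e_n is in its kernel. On the earlier eigenvectors both sides vanish, by
    induction and symmetry. *)
Lemma eigen_relation n f : H f -> b (e n) f = tau n * dot (e n) f.
Proof.
have [m] := ubnP n; elim: m n f => [//|m IH] n f nm Hf; have Hn := eigenvector_in n.
pose W := orthogonal (eigen_list n).
have Hs g : List.In g (eigen_list n) -> H g by move=> /eigen_list_in[k _ ->]; exact: eigenvector_in.
have sW : linear_subspace W := subspace_orthogonal Hs.
have WH g : W g -> H g by case.
pose q f g := tau n * dot f g - b f g.
have fq : psd_form W q.
  split.
  - by move=> g h /WH Hg /WH Hh; rewrite /q (form_sym fdot Hg Hh) (form_sym fb Hg Hh).
  - move=> k g h w /WH Hg /WH Hh /WH Hw.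
    by rewrite /q (form_lin fdot k Hg Hh Hw) (form_lin fb k Hg Hh Hw); ring.
  - move=> g Wg; rewrite subr_ge0; have [_ _ h] := eigen_maximizes n; exact: h.
have We : W (e n) by have [] := eigen_maximizes n.
have orthog g : W g -> b (e n) g = tau n * dot (e n) g.
  move=> Wg; have := form_cauchy sW fq We Wg.
  rewrite {2}/q eigenvector_norm mulr1 subrr mul0r => h.
  have /eqP : q (e n) g ^+ 2 == 0 by rewrite eq_le h sqr_ge0.
  by move=> /eqP; rewrite sqrf_eq0 subr_eq0 => /eqP.
pose s := \sum_(i < n) dot f (e i) *: e i.
have Hsum : H s by apply: (subspace_sum sH) => i; exact: eigenvector_in.
have Wfs : W (f - s).
  split; first exact: subspaceB.
  move=> g /eigen_list_in[k kn ->]; have Hk := eigenvector_in k.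
  rewrite (form_subl sH fdot Hf Hsum Hk) (form_suml sH fdot _ _ (fun i : 'I_n => eigenvector_in i) Hk).
  rewrite (bigD1 (Ordinal kn))//= big1 ?addr0 ?eigenvector_norm ?mulr1 ?subrr// => i ik.
  by rewrite eigenvector_orth ?mulr0.
have bs : b (e n) s = 0.
  rewrite (form_sumr sH fb _ _ (fun i : 'I_n => eigenvector_in i) Hn) big1// => i _.
  have ni : (i < n)%N by []; have Hi := eigenvector_in i.
  rewrite (form_sym fb Hn Hi) (IH i _ (leq_trans ni nm) Hn) eigenvector_orth ?mulr0//.
  by rewrite neq_ltn ni.
have ds : dot (e n) s = 0.
  rewrite (form_sumr sH fdot _ _ (fun i : 'I_n => eigenvector_in i) Hn) big1// => i _.
  by rewrite eigenvector_orth ?mulr0// eq_sym neq_ltn ltn_ord.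
have := orthog _ Wfs; rewrite (form_subr sH fb Hf Hsum Hn) (form_subr sH fdot Hf Hsum Hn).
by rewrite bs ds !subr0.
Qed.

Lemma eigen_sum_b n (a : 'I_n -> R) :
  b (\sum_i a i *: e i) (\sum_i a i *: e i) = \sum_i a i ^+ 2 * tau i.
Proof.
rewrite (form_orth_sum sH fb)// => [i|i k ik]; first exact: eigenvector_in.
by rewrite eigen_relation ?eigenvector_orth ?mulr0//; exact: eigenvector_in.
Qed.

Lemma eigen_sum_dot n (a : 'I_n -> R) :
  dot (\sum_i a i *: e i) (\sum_i a i *: e i) = \sum_i a i ^+ 2.
Proof.
rewrite (form_orth_sum sH fdot)// => [|i|i k ik]; first by apply: eq_bigr => i _; rewrite eigenvector_norm mulr1.
  exact: eigenvector_in.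
exact: eigenvector_orth.
Qed.

(** Some nonzero combination of the first #|I| + 1 eigenvectors is annihilated by all l_i, and on
    their span b is at least [tau #|I|] times [dot]. *)
Lemma tau_upper (I : finType) (l : I -> V -> R) (C de : R) :
  (forall i (k : R) f g, H f -> H g -> l i (k *: f + g) = k * l i f + l i g) ->
  (forall f, H f -> b f f <= C * \sum_i l i f ^+ 2 + de * dot f f) -> tau #|I| <= de.
Proof.
move=> lL bl; set n := #|I|.
have lS i m (a : 'I_m -> R) : l i (\sum_k a k *: e k) = \sum_k a k * l i (e k).
  have l0 : l i 0 = 0.
    have := lL i 1 0 0 (subspace0 sH) (subspace0 sH); rewrite scale1r addr0 mul1r => /eqP.
    by rewrite -subr_eq subrr => /eqP.
  elim: (index_enum _) => [|k s IH]; first by rewrite !big_nil.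
  rewrite !big_cons lL ?IH//; first exact: eigenvector_in.
  by apply: (subspace_sum sH) => j; exact: eigenvector_in.
have [a [i0 ai0] ha] := exists_combination (fun (k : 'I_n.+1) (j : 'I_n) => l (enum_val j) (e k)) (ltnSn n).
pose f := \sum_k a k *: e k.
have Hf : H f by apply: (subspace_sum sH) => j; exact: eigenvector_in.
have z i : l i f = 0 by rewrite lS -(enum_rankK i); exact: ha.
have := bl f Hf; rewrite big1 ?mulr0 ?add0r; last by move=> i _; rewrite z expr0n.
rewrite eigen_sum_b eigen_sum_dot => h.
have A0 : 0 < \sum_k a k ^+ 2.
  rewrite (bigD1 i0)//= ltr_pwDl ?exprn_even_gt0// sumr_ge0// => k _; exact: sqr_ge0.
rewrite -(ler_pM2r A0); apply: le_trans h; rewrite mulr_sumr; apply: ler_sum => k _.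
by rewrite mulrC ler_wpM2l ?sqr_ge0// tau_mono// -ltnS.
Qed.

(** More than n vectors have a nonzero combination orthogonal to the first n eigenvectors; their
    orthogonality for both forms transfers the quotient bound to it. *)
Lemma tau_lower (n : nat) (I : finType) (u : I -> V) (de : R) : (n < #|I|)%N -> 
  (forall i, H (u i)) -> (forall i k, i != k -> dot (u i) (u k) = 0) ->
  (forall i k, i != k -> b (u i) (u k) = 0) -> (forall i, 0 < dot (u i) (u i)) ->
  (forall i, de * dot (u i) (u i) <= b (u i) (u i)) -> de <= tau n.
Proof.
move=> nI Hu od ob d0 bd; set m := #|I| in nI; pose v (i : 'I_m) := u (enum_val i).
have Hv i : H (v i) by exact: Hu.
have nv i k : i != k -> enum_val i != enum_val k :> I by apply: contra_neq; exact: enum_val_inj.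
have odv i k : i != k -> dot (v i) (v k) = 0 by move=> /nv; exact: od.
have obv i k : i != k -> b (v i) (v k) = 0 by move=> /nv; exact: ob.
have [a a0 oa] := orth_combination nI (fun k : 'I_n => eigenvector_in k) Hv.
have p0 := orth_sum_gt0 Hv odv (fun i => d0 _) a0.
pose f := \sum_i a i *: v i; have Hf : H f by exact: subspace_sum.
rewrite -(ler_pM2r p0); apply: le_trans (eigen_max Hf _); last by move=> k kn; exact: (oa (Ordinal kn)).
rewrite (form_orth_sum sH fdot _ Hv odv) (form_orth_sum sH fb _ Hv obv) mulr_sumr.
by apply: ler_sum => i _; rewrite mulrCA ler_wpM2l ?sqr_ge0//; exact: bd.
Qed.

Lemma tau_lim (de : R) : 0 < de -> exists n, tau n <= de.
Proof.
move=> de0; have [n [l [C [C0 lb bl]]]] := approx de0.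
exists #|'I_n|; apply: (@tau_upper _ l C) => // i; by have [] := lb i.
Qed.

(** The values of tau become arbitrarily small, so b vanishes on the complement of all
    eigenvectors. *)
Lemma orth_all_eq0 f : H f -> (forall k, dot f (e k) = 0) -> f = 0.
Proof.
move=> Hf of_; apply: b_eq0 => //; apply/eqP; rewrite eq_le (form_ge0 fb Hf) andbT.
apply: le_small; first exact: (form_ge0 fdot Hf).
move=> e' e0; have [n hn] := tau_lim e0.
by apply: (le_trans (eigen_max Hf (fun k _ => of_ k))); exact: (ler_wpM2r (form_ge0 fdot Hf) hn).
Qed.

(* An eigenspace is spanned by the eigenvectors [e k] with [tau k = la]. *)
Lemma eigen_multiplicity (la : R) n (g : 'I_n -> V) : 0 < la -> (forall i, H (g i)) ->
  (forall i h, H h -> b (g i) h = la * dot (g i) h) ->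
  (forall a : 'I_n -> R, \sum_i a i *: g i = 0 -> forall i, a i = 0) ->
  exists2 k_ : 'I_n -> nat, injective k_ & forall i, tau (k_ i) = la.
Proof.
move=> la0 Hg bg free_g.
have [N hN] := tau_lim (divr_gt0 la0 (ltr0n R 2)).
pose s := [seq k <- iota 0 N | tau k == la].
have us : uniq s by rewrite filter_uniq// iota_uniq.
have memS k : (k \in s) = (tau k == la).
  rewrite mem_filter mem_iota; case: eqVneq => //= tk.
  rewrite ltnNge; apply/negP => Nk; have := le_trans (tau_mono Nk) hN; rewrite tk.
  by rewrite leNgt ltr_pdivrMr// ltr_pMr// ltr1n.
have [ns|sn] := leqP n (size s).
  exists (fun i => nth 0%N s i).
    move=> i j /eqP; rewrite nth_uniq ?(leq_trans (ltn_ord _) ns)// => /eqP; exact: val_inj.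
  by move=> i; apply/eqP; rewrite -memS mem_nth// (leq_trans (ltn_ord _) ns).
exfalso.
(* With too many g_i, some combination is orthogonal to the eigenvectors for la. It is orthogonal to
   the others because their eigenvalues differ from la, hence it is 0. *)
have [a [i0 ai0] oa] := orth_combination sn (fun k : 'I_(size s) => eigenvector_in (nth 0%N s k)) Hg.
pose f := \sum_i a i *: g i.
have Hf : H f by exact: subspace_sum.
have f0 : f = 0.
  apply: orth_all_eq0 => // k; have Hk := eigenvector_in k.
  have [tk|tk] := eqVneq (tau k) la.
    have ks : k \in s by rewrite memS tk.
    have ik : (index k s < size s)%N by rewrite index_mem.
    by have := oa (Ordinal ik); rewrite nth_index.
  have h1 := eigen_relation k Hf.
  have h2 : b f (e k) = la * dot f (e k).
    rewrite (form_suml sH fb _ _ Hg Hk) (form_suml sH fdot _ _ Hg Hk) mulr_sumr.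
    by apply: eq_bigr => i _; rewrite bg// mulrCA.
  rewrite (form_sym fb Hk Hf) (form_sym fdot Hk Hf) h2 in h1.
  move/eqP: h1; rewrite -subr_eq0 -mulrBl mulf_eq0 subr_eq0 eq_sym (negPf tk) => /eqP; exact.
by move/eqP: ai0; apply; exact: free_g.
Qed.

End Hilbert.

Section L2Bounds.
Context disp (T : measurableType disp) (R : realType).
Variables (mu : {measure set T -> \bar R}) (D : set T).
Hypothesis mD : measurable D.
Opaque Rintegral.

Lemma sqint_bounded_mul (f g : T -> R) (K : R) : measurable_fun D g ->
  (forall x, D x -> `|g x| <= K) -> sqint mu D f ->
  sqint mu D (fun x => g x * f x) /\
  \int[mu]_(x in D) ((g x * f x) ^+ 2) <= K ^+ 2 * \int[mu]_(x in D) (f x ^+ 2).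
Proof.
move=> mg hg [mf if2].
have hgK x : D x -> g x ^+ 2 <= K ^+ 2.
  by move=> Dx; rewrite -[g x ^+ 2]ger0_norm ?sqr_ge0// normrX; have := hg x Dx; have := normr_ge0 (g x); nra.
have e : (fun x => (g x * f x) ^+ 2) = (fun x => g x ^+ 2 * f x ^+ 2).
  by apply/funext => x; rewrite exprMn.
have i2 : mu.-integrable D (EFin \o (fun x => g x ^+ 2 * f x ^+ 2)).
  apply: integrable_bounded_mul => //.
    exact: measurable_funX.
  by move=> x Dx; rewrite ger0_norm ?sqr_ge0//; exact: hgK.
split; first by split; [exact: measurable_funM|rewrite e].
rewrite e; have h := RintegralZl (K ^+ 2) mD if2.
apply: (@le_trans _ _ (\int[mu]_(x in D) (K ^+ 2 * f x ^+ 2))); last by rewrite h.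
apply: le_Rintegral => //; first exact: RintegrableZ.
by move=> x Dx; rewrite ler_wpM2r ?sqr_ge0//; exact: hgK.
Qed.

Lemma sqint_sum (K : finType) (f : K -> T -> R) (A : K -> R) (X : R) :
  (forall k, sqint mu D (f k) /\ \int[mu]_(x in D) (f k x ^+ 2) <= A k * X) ->
  sqint mu D (fun x => \sum_k f k x) /\
  \int[mu]_(x in D) ((\sum_k f k x) ^+ 2) <= #|K|%:R * (\sum_k A k) * X.
Proof.
move=> h; have i2 k := ((h k).1).2.
have hle x : (\sum_k f k x) ^+ 2 <= #|K|%:R * \sum_k f k x ^+ 2.
  have := seq_cauchy_schwarz (index_enum K) (fun=> 1) (fun k => f k x).
  under eq_bigr do rewrite mul1r; move=> hcs; apply: (le_trans hcs).
  by rewrite ?sumr_const ?expr1n// => k _; rewrite expr1n.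
have is2 := Rintegrable_sum (index_enum K) mD (fun k (_ : xpredT k) => i2 k).
have iN := RintegrableZ (#|K|%:R) mD is2.
have mS : measurable_fun D (fun x => \sum_k f k x).
  by apply: measurable_sum => k; have [[]] := h k.
have iS : mu.-integrable D (EFin \o (fun x => (\sum_k f k x) ^+ 2)).
  apply: le_integrable iN => //; first by apply/measurable_EFinP; exact: measurable_funX.
  move=> x Dx; rewrite lee_fin ger0_norm ?sqr_ge0// ger0_norm//.
  by rewrite mulr_ge0//; apply: sumr_ge0 => k _; exact: sqr_ge0.
split; first by split.
apply: (@le_trans _ _ (\int[mu]_(x in D) (#|K|%:R * \sum_k f k x ^+ 2))).
  by apply: le_Rintegral => // x Dx; exact: hle.
have h1 := RintegralZl (#|K|%:R) mD is2.
have h2 := Rintegral_sum (index_enum K) mD (fun k (_ : xpredT k) => i2 k).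
apply: le_trans; first by rewrite h1.
rewrite -mulrA ler_wpM2l// mulr_suml.
apply: le_trans; first by rewrite h2.
by apply: ler_sum => k _; have [] := h k.
Qed.

End L2Bounds.

Lemma integral_cover {R : realType} disp (T : measurableType disp) (mu : {measure set T -> \bar R}) (I : finType)
    (D : set T) (A : I -> set T) (f : T -> \bar R) : measurable D -> (forall i, measurable (A i)) ->
  (forall x, (0 <= f x)%E) -> measurable_fun D f -> (forall i, measurable_fun (A i) f) ->
  (forall x, D x -> exists i, A i x) ->
  (\int[mu]_(x in D) f x <= \sum_i \int[mu]_(x in A i) f x)%E.
Proof.
move=> mD mA f0 mf mfA DA; have F0 B x : (0 <= (f \_ B) x)%E by apply: erestrict_ge0.
rewrite [leLHS]integral_mkcond; under [leRHS]eq_bigr do rewrite integral_mkcond.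
have mfA' i : measurable_fun setT (f \_ (A i)) by apply/(measurable_restrictT _ (mA i)).
rewrite -ge0_integral_sum//; apply: ge0_le_integral => //.
- exact/(measurable_restrictT _ mD).
- exact: emeasurable_sum.
- move=> x _; rewrite {1}/patch; case: ifPn => [xD|_]; last exact: sume_ge0.
  have [i iq] := DA x (set_mem xD).
  by rewrite (bigD1 i)//= {1}/patch mem_set// leeDl//; apply: sume_ge0.
Qed.

Lemma cvgn_sum {R : realType} (I : Type) (s : seq I) (a : I -> nat -> R) (l : I -> R) :
  (forall i, a i n @[n --> \oo] --> l i) ->
  \sum_(i <- s) a i n @[n --> \oo] --> \sum_(i <- s) l i.
Proof.
move=> h; elim: s => [|i s IH].
  rewrite big_nil (_ : (fun n => _) = (fun=> 0)); first exact: cvg_cst.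
  by apply/funext => n; rewrite big_nil.
rewrite big_cons (_ : (fun n => _) = (fun n => a i n + \sum_(j <- s) a j n)); first exact: cvgD.
by apply/funext => n; rewrite big_cons.
Qed.

Lemma Lfun2P {R : realType} dsp (X : measurableType dsp) (mu : {measure set X -> \bar R}) (f : X -> R) :
  f \in Lfun mu 2%:E <-> sqint mu setT f.
Proof.
split=> [fL|[mf fi]].
  split; last by have := Lfun2_integrable_sqr fL.
  by have := sub_Lfun_mfun fL; rewrite inE.
rewrite inE; apply/andP; split; first by rewrite inE.
rewrite inE /finite_norm unlock; apply: poweR_lty.
have /integrableP[_] := fi; apply: le_lt_trans; apply: le_of_eq.
by apply: eq_integral => x _; rewrite /= powR_mulrn// normrX.
Qed.

Lemma floor_root (m d k : nat) : (0 < m)%N -> (0 < d)%N ->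
  exists N, (m * N ^ d <= k < m * N.+1 ^ d)%N.
Proof.
move=> m0 d0; have ex0 : exists n, (m * n ^ d <= k)%N by exists 0%N; rewrite exp0n// muln0.
have bd n : (m * n ^ d <= k)%N -> (n <= k)%N.
  apply: leq_trans; apply: (@leq_trans (n ^ d)); last by rewrite leq_pmull.
  by case: n => [//|n]; rewrite -{1}[n.+1]expn1 leq_pexp2l.
case: (ex_maxnP ex0 bd) => N hN maxN; exists N; rewrite hN ltnNge; apply/negP => h.
by have := maxN _ h; rewrite ltnn.
Qed.

Section RiemannianSobolev.
Context {R : realType} {U : ptopologicalType} {d : nat}.
Local Notation E := 'rV[R]_d.
Local Notation L := (@lebesgue_rV R d).
Variable M : riemannian_manifold R U d.
Variable vol : {measure set (borel U) -> \bar R}.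
Variable r : nat.
Hypotheses (d_gt0 : (0 < d)%N) (r_gt0 : (0 < r)%N) (rd : (d < 2 * r)%N).
Hypothesis compactU : compact [set: U].
Hypothesis volP : is_riemannian_volume M vol.
Local Notation wd := (weak_derivatives M r).
Local Notation sobolevC := (sobolev_continuous M vol r).
Local Notation sdot := (sobolev_dot M vol r).

(** * Charts and covariant derivatives *)

Section Charts.
Opaque smooth_on.
Implicit Types c : chart R U d.

Definition overlap c1 c2 : set E := cmap c1 @` (cdom c1 `&` cdom c2).

Lemma ccodP c x : ccod c x -> cdom c (cinv c x) /\ cmap c (cinv c x) = x.
Proof. by move=> [p cp <-]; rewrite cmapK. Qed.

Lemma ccod_cmap c p : cdom c p -> ccod c (cmap c p).
Proof. by move=> cp; exists p. Qed.

Lemma overlapP c1 c2 x : overlap c1 c2 x <-> ccod c1 x /\ cdom c2 (cinv c1 x).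
Proof.
split=> [[p [p1 p2] <-]|[/ccodP[x1 x2] h]]; first by rewrite cmapK//; split => //; exists p.
by exists (cinv c1 x).
Qed.

Lemma overlap_sub c1 c2 : overlap c1 c2 `<=` ccod c1.
Proof. by move=> x /overlapP[]. Qed.

Lemma open_overlap c1 c2 : open (overlap c1 c2).
Proof.
rewrite (_ : overlap c1 c2 = ccod c1 `&` cinv c1 @^-1` cdom c2); last first.
  by apply/seteqP; split => x /overlapP.
apply: continuous_open_preimage; first exact: ccod_open.
  by move=> x cx; exact: cinv_continuous.
exact: cdom_open.
Qed.

Lemma open_ccod c : open (ccod c).
Proof. exact: ccod_open. Qed.

Lemma transition_overlap c1 c2 x : overlap c1 c2 x -> overlap c2 c1 (transition c1 c2 x).
Proof.
move=> [p [p1 p2] <-]; rewrite /transition cmapK//.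
by exists p.
Qed.

Lemma transitionK c1 c2 x : overlap c1 c2 x -> transition c2 c1 (transition c1 c2 x) = x.
Proof. by move=> [p [p1 p2] <-]; rewrite /transition !cmapK. Qed.

Lemma transition_smooth c1 c2 j : atlas M c1 -> atlas M c2 ->
  smooth_on (overlap c1 c2) (fun x => transition c1 c2 x 0 j).
Proof. by move=> a1 a2; exact: (@atlas_smooth R U d M c1 c2 a1 a2 j). Qed.

Lemma jacobianE (V : set E) (phi : E -> E) x i j : open V ->
  (forall j, smooth_on V (fun y => phi y 0 j)) -> V x ->
  jacobian phi x i j = partial i (fun y => phi y 0 j) x.
Proof.
move=> oV sphi Vx.
have dphi : differentiable phi x.
  by apply: differentiable_rV => k; have [] := smooth_differentiable oV (sphi k) Vx.
have := deriveEjacobian (e_ i) dphi; rewrite derive_mx; last exact: diff_derivable.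
by move=> /rowP/(_ j); rewrite mxE -rowE mxE => <-.
Qed.

Opaque jacobian partial overlap.

Lemma transition_jacobianE c1 c2 x i j : atlas M c1 -> atlas M c2 -> overlap c1 c2 x ->
  jacobian (transition c1 c2) x i j = partial i (fun y => transition c1 c2 y 0 j) x.
Proof.
move=> a1 a2; apply: jacobianE; first exact: open_overlap.
by move=> k; exact: transition_smooth.
Qed.

Lemma partial_sum (V : set E) x k n (F : 'I_n -> E -> R) : open V -> V x ->
  (forall i, smooth_on V (F i)) ->
  partial k (fun y => \sum_i F i y) x = \sum_i partial k (F i) x.
Proof.
move=> oV Vx; elim: n F => [|n IH] F sF.
  rewrite big_ord0 (_ : (fun _ => _) = fun=> 0) ?partial_cst//.
  by apply/funext => y; rewrite big_ord0.
rewrite big_ord_recl -IH; last by move=> i; exact: sF.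
rewrite (_ : (fun _ => _) = (fun y => F ord0 y + \sum_i F (lift ord0 i) y)); last first.
  by apply/funext => y; rewrite big_ord_recl.
apply: (partialD (smooth_derivable (sF _) Vx)).
have sS : smooth_on V (fun y => \sum_i F (lift ord0 i) y).
  by apply: (smooth_sum _ oV) => i _; exact: sF.
exact: smooth_derivable sS Vx.
Qed.

Lemma transition_chain c1 c2 x i g : atlas M c1 -> atlas M c2 -> overlap c1 c2 x ->
  smooth_on (overlap c2 c1) g ->
  partial i (g \o transition c1 c2) x =
  \sum_j jacobian (transition c1 c2) x i j * partial j g (transition c1 c2 x).
Proof.
move=> a1 a2 ox sg.
have [_ ->] := chain_rule i (@open_overlap c1 c2) (@open_overlap c2 c1) sg
  (fun j => transition_smooth j a1 a2) ox (transition_overlap ox).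
by apply: eq_bigr => j _; rewrite transition_jacobianE.
Qed.

Lemma jacobian_mul c1 c2 x : atlas M c1 -> atlas M c2 -> overlap c1 c2 x ->
  jacobian (transition c1 c2) x *m jacobian (transition c2 c1) (transition c1 c2 x) = 1%:M.
Proof.
move=> a1 a2 ox; apply/matrixP => i k; rewrite !mxE.
have := transition_chain i a1 a2 ox (transition_smooth k a2 a1).
have -> : partial i ((fun y => transition c2 c1 y 0 k) \o transition c1 c2) x =
   partial i (fun y : E => y 0 k) x.
  apply: partial_near; apply: near_open_eq (@open_overlap c1 c2) ox _ => y oy /=.
  by rewrite transitionK.
(* The identity of one variable as a tower, which makes the coordinate functions accessible to
   [partial_tower]. *)
have tid : tower (fun n (t : R) => if n is n'.+1 then (if n' is 0 then 1 else 0) else t).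
  move=> [|[|n]] t; [exact: is_derive_id|exact: is_derive_cst|exact: is_derive_cst].
have [_ ->] := partial_tower 0 k i x tid; move=> /= H.
rewrite (eq_bigr (fun j => jacobian (transition c1 c2) x i j * partial j (fun y => transition c2 c1 y 0 k) (transition c1 c2 x))).
  by rewrite -H; case: eqP.
move=> j _; congr (_ * _).
exact: (transition_jacobianE j k a2 a1 (transition_overlap ox)).
Qed.

Lemma field_mulmx1_unit n (A B : 'M[R]_n) : A *m B = 1%:M -> A \in unitmx.
Proof.
move=> h; have := congr1 determinant h; rewrite det_mulmx det1 unitmxE unitfE => {}h.
by apply/eqP => d0; move: h; rewrite d0 mul0r => /esym/eqP; rewrite oner_eq0.
Qed.

Lemma jacobian_unit c1 c2 x : atlas M c1 -> atlas M c2 -> overlap c1 c2 x ->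
  jacobian (transition c1 c2) x \in unitmx.
Proof.
by move=> a1 a2 ox; apply: field_mulmx1_unit (jacobian_mul a1 a2 ox). Qed.

Lemma metric_unit c x : atlas M c -> ccod c x -> metric M c x \in unitmx.
Proof.
move=> ac cx; rewrite -row_free_unit -kermx_eq0; apply/eqP/row_matrixP => i.
rewrite row0; apply/eqP; apply: contraT => v0.
have := metric_posdef ac cx v0; rewrite -row_mul mulmx_ker row0 mul0mx mxE.
by rewrite ltxx.
Qed.

Lemma smooth_det n (V : set E) (A : E -> 'M[R]_n) : open V ->
  (forall i j, smooth_on V (fun x => A x i j)) -> smooth_on V (fun x => \det (A x)).
Proof.
move=> oV sA; rewrite /determinant.
apply: (smooth_sum _ oV) => s _; apply: (smoothZ _ oV).
by apply: (smooth_prod _ oV) => i _; exact: sA.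
Qed.

Lemma smooth_invmx (V : set E) (A : E -> 'M[R]_d) i j : open V ->
  (forall i j, smooth_on V (fun x => A x i j)) -> (forall x, V x -> A x \in unitmx) ->
  smooth_on V (fun x => invmx (A x) i j).
Proof.
move=> oV sA uA.
have sd := smooth_det oV sA.
have d0 x : V x -> \det (A x) != 0 by move=> Vx; rewrite -unitfE; exact: uA.
apply: (@smooth_eq _ _ _ (fun x => (\det (A x))^-1 * cofactor (A x) j i) _ oV).
  by move=> x Vx; rewrite /invmx uA// !mxE.
apply: (smoothM oV (smooth_inv oV sd d0)).
rewrite /cofactor; apply: (smoothZ _ oV).
apply: (smooth_det oV) => k l.
apply: (smooth_eq oV _ (sA (lift j k) (lift i l))) => x _.
by rewrite !mxE.
Qed.

Lemma metric_inv_smooth c i j : atlas M c ->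
  smooth_on (ccod c) (fun x => invmx (metric M c x) i j).
Proof.
move=> ac; apply: smooth_invmx; [exact: open_ccod| |].
  by move=> k l; exact: metric_smooth.
by move=> x; exact: metric_unit.
Qed.

Lemma christoffel_smooth c k i l : atlas M c -> smooth_on (ccod c) (christoffel M c k i l).
Proof.
move=> ac; rewrite /christoffel; have oc := @open_ccod c.
apply: (smoothZ _ oc); apply: (smooth_sum _ oc) => m _.
apply: (smoothM oc (metric_inv_smooth l m ac)).
have sp a b e : smooth_on (ccod c) (partial a (fun y => metric M c y b e)).
  by apply: smooth_partial; exact: metric_smooth.
apply: (@smooth_eq _ _ _ (fun x => partial k (fun y => metric M c y m i) x
     + partial i (fun y => metric M c y m k) x
     + -1 * partial m (fun y => metric M c y k i) x)) => //.
  by move=> x _; rewrite mulN1r.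
exact: (smoothD oc (smoothD oc (sp _ _ _) (sp _ _ _)) (smoothZ (-1) oc (sp _ _ _))).
Qed.

End Charts.

Section ChristoffelTransformation.
Opaque smooth_on jacobian partial overlap.
Variables (c1 c2 : chart R U d) (x : E).
Hypotheses (a1 : atlas M c1) (a2 : atlas M c2) (ox : overlap c1 c2 x).
Local Notation phi := (transition c1 c2).
Let J y i a := partial i (fun y => phi y 0 a) y.

Let oo : open (overlap c1 c2) := @open_overlap c1 c2.

Let JE y i a : overlap c1 c2 y -> jacobian phi y i a = J y i a.
Proof. by move=> oy; exact: transition_jacobianE. Qed.

Let J_smooth i a : smooth_on (overlap c1 c2) (J ^~ i ^~ a).
Proof. by apply: smooth_partial; exact: transition_smooth. Qed.

Let metric_overlap y : overlap c1 c2 y -> forall m i, metric M c1 y m i =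
  \sum_a \sum_b J y m a * J y i b * metric M c2 (phi y) a b.
Proof.
move=> oy m i; have [cy dy] := (overlapP c1 c2 y).1 oy.
have [dc1 e1] := ccodP cy.
have := metric_change a1 a2 dc1 dy; rewrite e1 => ->.
have -> : cmap c2 (cinv c1 y) = phi y by [].
rewrite mxE exchange_big; apply: eq_bigr => b _; rewrite mxE mulr_suml.
by apply: eq_bigr => a _; rewrite (JE m a oy) [_^T _ _]mxE (JE i b oy) mulrAC.
Qed.

Let partial_metric k m i : partial k (fun y => metric M c1 y m i) x =
  \sum_a \sum_b (partial k (J ^~ m ^~ a) x * J x i b * metric M c2 (phi x) a b +
    J x m a * partial k (J ^~ i ^~ b) x * metric M c2 (phi x) a b +
    J x m a * J x i b * \sum_c J x k c * partial c (fun y => metric M c2 y a b) (phi x)).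
Proof.
have sG a b : smooth_on (overlap c2 c1) (fun y => metric M c2 y a b).
  exact: smooth_sub (@overlap_sub c2 c1) (metric_smooth a2 a b).
have sGphi a b : smooth_on (overlap c1 c2) (fun y => metric M c2 (phi y) a b).
  apply: (@smooth_comp _ _ _ _ (overlap c2 c1) (fun y => metric M c2 y a b) phi oo) => //.
  - exact: open_overlap.
  - by move=> j; exact: transition_smooth.
  - by move=> y; exact: transition_overlap.
have dJ i0 a0 := smooth_derivable (J_smooth i0 a0) ox.
have dG a b j : derivable (fun y => metric M c2 (phi y) a b) x (e_ j) := smooth_derivable (sGphi a b) ox.
have -> : partial k (fun y => metric M c1 y m i) x =
  partial k (fun y => \sum_a \sum_b J y m a * J y i b * metric M c2 (phi y) a b) x.
  by apply: partial_near; apply: near_open_eq oo ox _ => y oy; exact: metric_overlap.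
have sT a b : smooth_on (overlap c1 c2) (fun y => J y m a * J y i b * metric M c2 (phi y) a b).
  by apply: smoothM => //; apply: smoothM.
rewrite (partial_sum k oo ox); last by move=> a; apply: (smooth_sum _ oo) => b _; exact: sT.
apply: eq_bigr => a _.
rewrite (partial_sum k oo ox); last by move=> b; exact: sT.
apply: eq_bigr => b _.
have s1 := smoothM oo (J_smooth m a) (J_smooth i b).
apply: (etrans (partialM (smooth_derivable s1 ox) (dG a b k))).
have -> := partialM (dJ k m a) (dJ k i b).
have -> : partial k (fun y => metric M c2 (phi y) a b) x =
   \sum_c J x k c * partial c (fun y => metric M c2 y a b) (phi x).
  have := transition_chain k a1 a2 ox (sG a b).
  move=> H; apply: etrans H _; apply: eq_bigr => c _.
  by rewrite JE.
set S := \sum_(c < d) _.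
move: (J x m a) (J x i b) (metric M c2 (phi x) a b) (partial k (J ^~ m ^~ a) x) (partial k (J ^~ i ^~ b) x) S => u v w z t S.
by ring.
Qed.

(** Differentiating the change of the metric gives the data of [christoffel_change], with H the
    second derivatives of the transition map, symmetric by [schwarz]. *)
Lemma christoffel_transformation k i a :
  \sum_l christoffel M c1 k i l x * jacobian phi x l a =
  partial k (fun y => partial i (fun y => phi y 0 a) y) x +
  \sum_b \sum_c jacobian phi x k b * jacobian phi x i c * christoffel M c2 b c a (phi x).
Proof.
have [cx dx] := (overlapP c1 c2 x).1 ox.
have [cpx dpx] := (overlapP c2 c1 (phi x)).1 (transition_overlap ox).
pose JJ : 'M[R]_d := jacobian phi x.
have JJE u v : JJ u v = J x u v by rewrite JE.
pose G' := metric M c2 (phi x).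
pose H u v w := partial u (J ^~ v ^~ w) x.
pose D w u v := partial w (fun y => metric M c2 y u v) (phi x).
have Hsym u v w : H u v w = H v u w.
  by rewrite /J; apply: (schwarz _ _ oo (transition_smooth w a1 a2) ox).
have Gs y u v : ccod c2 y -> metric M c2 y u v = metric M c2 y v u.
  by move=> cy; rewrite -{1}(Defs.metric_sym a2 cy) mxE.
have Gsym u v : G' u v = G' v u by exact: Gs.
have uJ : JJ \in unitmx by exact: jacobian_unit.
have uG : G' \in unitmx by exact: metric_unit.
have := @christoffel_change _ _ JJ G' H D Hsym Gsym uJ uG k i a.
have -> : JJ *m G' *m JJ^T = metric M c1 x.
  have [dc1 e1] := ccodP cx; have := metric_change a1 a2 dc1 dx; rewrite e1.
  by move->.
have dGE u v w : \sum_a0 \sum_b (H u v a0 * JJ w b * G' a0 b + JJ v a0 * H u w b * G' a0 b +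
   JJ v a0 * JJ w b * \sum_c JJ u c * D c a0 b) = partial u (fun y => metric M c1 y v w) x.
  rewrite partial_metric; apply: eq_bigr => a0 _; apply: eq_bigr => b _.
  by rewrite !JJE; congr (_ + _ * _); apply: eq_bigr => c _; rewrite JJE.
move=> h0.
transitivity (2^-1 * (\sum_l (\sum_m invmx (metric M c1 x) l m *
     (partial k (fun y => metric M c1 y m i) x + partial i (fun y => metric M c1 y m k) x
     - partial m (fun y => metric M c1 y k i) x)) * JJ l a)).
  by rewrite mulr_sumr; apply: eq_bigr => l _; rewrite mulrA.
transitivity (2^-1 * (H k i a *+ 2 + \sum_b \sum_c JJ k b * JJ i c *
     (\sum_m invmx G' a m * (D b m c + D c m b - D m b c)))).
  congr (_ * _); rewrite -h0; apply: eq_bigr => l _; congr (_ * _).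
  by apply: eq_bigr => m _; rewrite !dGE.
rewrite mulrDr; congr (_ + _).
  have n2 : (2%:R : R) != 0 by rewrite pnatr_eq0.
  have h (y : R) : 2^-1 * (y *+ 2) = y by rewrite -[y *+ 2]mulr_natl mulKf.
  exact: h.
apply: (etrans (mulr_sumr _ _ _ _)); apply: eq_bigr => b _.
apply: (etrans (mulr_sumr _ _ _ _)); apply: eq_bigr => c _; exact: mulrCA.
Qed.

End ChristoffelTransformation.

Section CovariantDerivative.
Opaque smooth_on jacobian partial overlap christoffel.
Implicit Types (c : chart R U d) (V : set E) (I : seq 'I_d).

Lemma smooth_pull V (A : 'I_d -> 'I_d -> E -> R) I (S : seq 'I_d -> E -> R) : open V ->
  (forall i a, smooth_on V (A i a)) ->
  (forall J, size J = size I -> smooth_on V (S J)) ->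
  smooth_on V (fun x => pull (fun i a => A i a x) I (fun J => S J x)).
Proof.
move=> oV sA; elim: I S => [|i I IH] S sS; first exact: sS.
apply: (smooth_sum _ oV) => a _; apply: (smoothM oV (sA i a)).
by apply: IH => J sJ; apply: sS; rewrite /= sJ.
Qed.

Lemma partial_pull V (A : 'I_d -> 'I_d -> E -> R) k I (S : seq 'I_d -> E -> R) x :
  open V -> V x -> (forall i a, smooth_on V (A i a)) ->
  (forall J, size J = size I -> smooth_on V (S J)) ->
  partial k (fun x => pull (fun i a => A i a x) I (fun J => S J x)) x =
  dpull (fun i a => A i a x) (fun i a => partial k (A i a) x) I (fun J => S J x) +
  pull (fun i a => A i a x) I (fun J => partial k (S J) x).
Proof.
move=> oV Vx sA; elim: I S => [|i I IH] S sS; first by rewrite add0r.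
have sP a : smooth_on V (fun x => pull (fun i a => A i a x) I (fun J => S (a :: J) x)).
  by apply: (smooth_pull oV sA) => J sJ; apply: sS; rewrite /= sJ.
have sAP a := smoothM oV (sA i a) (sP a).
apply: (etrans (partial_sum k oV Vx sAP)).
rewrite /= -!big_split; apply: eq_bigr => a _ /=.
apply: (etrans (partialM (smooth_derivable (sA i a) Vx) (smooth_derivable (sP a) Vx))).
have sS' J : size J = size I -> smooth_on V (S (a :: J)).
  by move=> sJ; apply: sS; rewrite /= sJ.
have -> := IH (fun J => S (a :: J)) sS'.
set p1 := pull _ _ _; set p2 := pull _ _ _; set p3 := dpull _ _ _ _.
by move: (partial k (A i a) x) (A i a x) p1 p2 p3 => u v w z t; ring.
Qed.

Lemma smooth_corr V (G : 'I_d -> 'I_d -> E -> R) I (S : seq 'I_d -> E -> R) : open V ->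
  (forall i a, smooth_on V (G i a)) ->
  (forall J, size J = size I -> smooth_on V (S J)) ->
  smooth_on V (fun x => corr (fun i a => G i a x) I (fun J => S J x)).
Proof.
move=> oV sG; elim: I S => [|i I IH] S sS; first exact: smooth_cst.
apply: (smoothD oV); last first.
  by apply: IH => J sJ; apply: sS; rewrite /= sJ.
apply: (smooth_sum _ oV) => a _; apply: (smoothM oV (sG i a)).
exact: sS.
Qed.

Variable u : U -> R.
Hypothesis su : forall c, atlas M c -> smooth_on (ccod c) (u \o cinv c).

(** Classical covariant derivatives in one chart. The order is a separate argument that drives the
    recursion; only multi-indices of length n are meaningful. *)
Fixpoint cov c n : seq 'I_d -> E -> R :=
  if n is n'.+1 then fun I x =>
    if I is k :: I' then partial k (cov c n' I') x -
      corr (fun i l => christoffel M c k i l x) I' (fun J => cov c n' J x)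
    else 0
  else fun _ => u \o cinv c.

Lemma smooth_cov c n I : atlas M c -> smooth_on (ccod c) (cov c n I).
Proof.
move=> ac; have oc := @open_ccod c.
elim: n I => [|n IH] I; first exact: su.
case: I => [|k I]; first exact: smooth_cst.
have s1 := smooth_partial k (IH I).
have s2 : smooth_on (ccod c) (fun x => corr (fun i l => christoffel M c k i l x) I (fun J => cov c n J x)).
  by apply: (smooth_corr oc) => [i a|J _]; [exact: christoffel_smooth|exact: IH].
apply: (smooth_eq oc _ (smoothD oc s1 (smoothZ (-1) oc s2))) => x _.
by rewrite mulN1r.
Qed.

(** Induction on the order: differentiating the pulled-back tensor produces a derivative of the
    Jacobian, which the inhomogeneous term of the Christoffel symbols cancels. *)
Lemma cov_pull c1 c2 n I x : atlas M c1 -> atlas M c2 -> overlap c1 c2 x -> size I = n ->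
  cov c1 n I x = pull (fun i a => jacobian (transition c1 c2) x i a) I
    (fun J => cov c2 n J (transition c1 c2 x)).
Proof.
move=> a1 a2; elim: n I x => [|n IH] I x ox.
  move/size0nil => ->; have [cx dx] := (overlapP c1 c2 x).1 ox.
  by rewrite /= cmapK.
case: I => [//|k I] /succn_inj sI.
set phi := transition c1 c2.
pose A i a y := partial i (fun y => phi y 0 a) y.
have oo : open (overlap c1 c2) := @open_overlap c1 c2.
have AE y i a : overlap c1 c2 y -> jacobian phi y i a = A i a y.
  by move=> oy; exact: transition_jacobianE.
have sA i a : smooth_on (overlap c1 c2) (A i a).
  by apply: smooth_partial; exact: transition_smooth.
have s2 J : smooth_on (overlap c2 c1) (cov c2 n J).
  exact: smooth_sub (@overlap_sub c2 c1) (smooth_cov n J a2).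
have sS J : smooth_on (overlap c1 c2) (cov c2 n J \o phi).
  apply: smooth_comp => //.
  - exact: open_overlap.
  - by move=> j; exact: transition_smooth.
  - by move=> y; exact: transition_overlap.
have AJ y : overlap c1 c2 y -> (fun i a => jacobian phi y i a) = (fun i a => A i a y).
  by move=> oy; apply/funext => i; apply/funext => a; exact: AE.
have -> : cov c1 n.+1 (k :: I) x = partial k (cov c1 n I) x -
      corr (fun i l => christoffel M c1 k i l x) I (fun J => cov c1 n J x) by [].
have -> : partial k (cov c1 n I) x =
    partial k (fun y => pull (fun i a => A i a y) I (fun J => (cov c2 n J \o phi) y)) x.
  apply: partial_near; apply: near_open_eq oo ox _ => y oy.
  by rewrite (IH I y oy sI) AJ.
have -> : corr (fun i l => christoffel M c1 k i l x) I (fun J => cov c1 n J x) =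
   corr (fun i l => christoffel M c1 k i l x) I
     (fun J => pull (fun i a => A i a x) J (fun J => (cov c2 n J \o phi) x)).
  by apply: eq_corr => J sJ; rewrite (IH J x ox (etrans sJ sI)) AJ.
have -> := partial_pull k oo ox sA (fun J _ => sS J).
have h i a : \sum_l christoffel M c1 k i l x * A l a x =
     partial k (A i a) x + \sum_b \sum_c A k b x * A i c x * christoffel M c2 b c a (phi x).
  have := christoffel_transformation a1 a2 ox k i a.
  have -> : \sum_l christoffel M c1 k i l x * jacobian phi x l a = \sum_l christoffel M c1 k i l x * A l a x.
    by apply: eq_bigr => l _; rewrite AE.
  move=> ->; congr (_ + _); apply: eq_bigr => b _; apply: eq_bigr => c _.
  by rewrite (AE x k b ox) AE.
have -> := corr_pull I (fun J => (cov c2 n J \o phi) x) h.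
rewrite opprD addrACA subrr add0r.
have -> : pull (fun i a => A i a x) I (fun J => partial k (cov c2 n J \o phi) x) =
   \sum_b A k b x * pull (fun i a => A i a x) I (fun J => partial b (cov c2 n J) (phi x)).
  rewrite -pull_sum; apply: eq_pull => J sJ.
  have := transition_chain k a1 a2 ox (s2 J).
  move=> H; apply: (etrans H); apply: eq_bigr => b _.
  by rewrite AE.
rewrite -sumrB /= (AJ x ox); apply: eq_bigr => b _.
rewrite -mulrBr (AE x k b ox); congr (_ * _).
have pB S S' : pull (fun i a => A i a x) I S - pull (fun i a => A i a x) I S' =
    pull (fun i a => A i a x) I (fun J => S J - S' J).
  apply/eqP; rewrite subr_eq -pullD; apply/eqP; apply: eq_pull => J _.
  by rewrite subrK.
exact: pB.
Qed.

Definition cov_tensors : covariant_tensors R U d := fun c I => cov c (size I) I.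

(** Adding the Christoffel terms back leaves a plain partial derivative, so the weak identity is
    classical integration by parts. *)
Lemma weak_derivatives_cov : weak_derivatives M r u cov_tensors.
Proof.
split.
- move=> c1 c2 a1 a2 p p1 p2 j _ I.
  have ox : overlap c1 c2 (cmap c1 p) by apply/overlapP; rewrite cmapK//; split => //; exists p.
  have := cov_pull a1 a2 ox (size_tuple I); rewrite /transition cmapK// => h.
  rewrite /cov_tensors size_tuple; apply: (etrans h); rewrite pull_tuple; apply: eq_bigr => J _.
  by rewrite size_tuple.
- by move=> c ac p cp; rewrite /cov_tensors /= cmapK.
- move=> c ac I sI k.
  have oc := @open_ccod c.
  have sT := smooth_cov (size I) I ac.
  have -> : (fun x => cov_tensors c (k :: I) x + \sum_(m < size I) \sum_(l < d)
      christoffel M c k (nth k I m) l x * cov_tensors c (set_nth k I m l) x) =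
      partial k (cov c (size I) I).
    apply/funext => x; rewrite -(corr_nth k (fun i l => christoffel M c k i l x) I (fun J => cov_tensors c J x)).
    have -> : corr (fun i l => christoffel M c k i l x) I (fun J => cov_tensors c J x) =
       corr (fun i l => christoffel M c k i l x) I (fun J => cov c (size I) J x).
      by apply: eq_corr => J sJ; rewrite /cov_tensors sJ.
    exact: subrK.
  split.
  + by apply: continuous_locally_integrable oc _ => x cx; exact: smooth_continuous sT cx.
  + apply: continuous_locally_integrable oc _ => x cx.
    exact: (smooth_continuous (smooth_partial k sT) cx).
  + move=> psi tpsi; exact: rV_integration_by_parts.
Qed.

End CovariantDerivative.

(** * Volume and weak covariant derivatives *)

Section Patch.

Lemma metric_det_gt0 c x : atlas M c -> ccod c x -> 0 < \det (metric M c x).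
Proof.
move=> ac cx.
have [F uF ->] := cholesky (Defs.metric_sym ac cx) (metric_posdef ac cx).
by rewrite det_mulmx det_tr -expr2 exprn_even_gt0//= -unitfE.
Qed.

Lemma sqrt_det_continuous c x : atlas M c -> ccod c x ->
  {for x, continuous (fun x => Num.sqrt (\det (metric M c x)))}.
Proof.
move=> ac cx.
have s1 : smooth_on (ccod c) (fun x => \det (metric M c x)).
  by apply: smooth_det; [exact: open_ccod|move=> i j; exact: metric_smooth].
have := smooth_continuous s1 cx => h.
apply: continuous_comp => //.
exact: sqrt_continuous.
Qed.

Lemma cmap_measurable c (D : set (borel U)) : measurable D -> D `<=` cdom c ->
  measurable_fun D (cmap c : borel U -> borel E).
Proof.
move=> mD Dc; apply: (@measurable_funS _ _ _ _ (cdom c : set (borel U))) => //.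
  by apply: open_borel; exact: cdom_open.
by apply: borel_continuous; [exact: cdom_open|exact: cmap_continuous].
Qed.

Lemma cinv_measurable c (D : set (borel E)) : measurable D -> D `<=` ccod c ->
  measurable_fun D (cinv c : borel E -> borel U).
Proof.
move=> mD Dc; apply: (@measurable_funS _ _ _ _ (ccod c : set (borel E))) => //.
  by apply: open_borel; exact: open_ccod.
by apply: borel_continuous; [exact: open_ccod|exact: cinv_continuous].
Qed.

Variables (c : chart R U d) (a b : 'I_d -> R).
Hypotheses (ac : atlas M c) (Kc : closed_rect a b `<=` ccod c).

(** The preimage of an open rectangle whose closure lies in the range of the chart, so that smooth
    chart data are bounded on it. *)
Definition cpatch : set U := cdom c `&` cmap c @^-1` (open_rect a b : set E).

Lemma rect_ccod : (open_rect a b : set E) `<=` ccod c.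
Proof. by move=> x /open_rect_closed; exact: Kc. Qed.

Lemma open_patch : open cpatch.
Proof.
apply: continuous_open_preimage; [exact: cdom_open|exact: cmap_continuous|].
exact: open_open_rect.
Qed.

Lemma measurable_patch : measurable (cpatch : set (borel U)).
Proof. by apply: open_borel; exact: open_patch. Qed.

Lemma patch_cinv x : open_rect a b x -> cpatch (cinv c x).
Proof. by move=> Bx; have [h1 h2] := ccodP (rect_ccod Bx); split => //=; rewrite h2. Qed.

Lemma measurable_patch_cmap disp (T : measurableType disp) (f : borel E -> T) :
  measurable_fun (open_rect a b) f -> measurable_fun (cpatch : set (borel U)) (f \o cmap c).
Proof.
move=> mf; apply: (@measurable_comp _ _ _ _ _ _ (open_rect a b) f _ (cmap c : borel U -> borel E)) => //.
- exact: measurable_open_rect.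
- by move=> x [p [_ h] <-].
- by apply: cmap_measurable; [exact: measurable_patch|move=> p []].
Qed.

Lemma measurable_cinv_patch disp (T : measurableType disp) (f : borel U -> T) :
  measurable_fun (cpatch : set (borel U)) f -> measurable_fun (open_rect a b) (f \o cinv c).
Proof.
move=> mf; apply: (@measurable_comp _ _ _ _ _ _ (cpatch : set (borel U)) f _ (cinv c : borel E -> borel U)) => //.
- exact: measurable_patch.
- by move=> x [y By <-]; exact: patch_cinv.
- by apply: cinv_measurable; [exact: measurable_open_rect|exact: rect_ccod].
Qed.

Lemma patch_image (A : set U) :
  cmap c @` (cpatch `&` A) = open_rect a b `&` cinv c @^-1` A.
Proof.
apply/seteqP; split=> [x [p [[cp Bp] Ap] <-]|x [Bx Ax]]; first by split=> //=; rewrite cmapK.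
have [h1 h2] := ccodP (rect_ccod Bx).
by exists (cinv c x) => //; split => //; exact: patch_cinv.
Qed.

(** The density sqrt(det g) and its inverse are bounded on the compact closed rectangle. *)
Lemma vol_patch : exists2 C : R, 0 < C & forall A : set (borel U), measurable A ->
  (L (open_rect a b `&` cinv c @^-1` A) <= C%:E * vol (cpatch `&` A) /\
   vol (cpatch `&` A) <= C%:E * L (open_rect a b `&` cinv c @^-1` A))%E.
Proof.
have cK := @compact_closed_rect R d a b.
have [C1 C10 hC1] := compact_bound cK (fun x Kx => sqrt_det_continuous ac (Kc Kx)).
have [C2 C20 hC2] : exists2 C : R, 0 < C & forall x, closed_rect a b x ->
    `|(Num.sqrt (\det (metric M c x)))^-1| <= C.
  apply: (compact_bound cK) => x Kx; apply: continuousV.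
    by rewrite gt_eqF// sqrtr_gt0 metric_det_gt0//; exact: Kc.
  exact: (sqrt_det_continuous ac (Kc Kx)).
exists (C1 + C2) => [|A mA]; first exact: addr_gt0.
have mQ : measurable (open_rect a b `&` cinv c @^-1` A).
  by apply: cinv_measurable => //; [exact: measurable_open_rect|exact: rect_ccod|exact: measurable_open_rect].
have mpA : measurable (cpatch `&` A : set (borel U)) by apply: measurableI => //; exact: measurable_patch.
have subp : cpatch `&` A `<=` cdom c by move=> p [[]].
rewrite (volP ac mpA subp) patch_image.
set Q := open_rect a b `&` _.
have QK : Q `<=` closed_rect a b by move=> x [/open_rect_closed].
set f := fun x => (Num.sqrt (\det (metric M c x)))%:E.
have mf : measurable_fun Q f.
  apply/measurable_EFinP; apply: measurable_funS.
  - by apply: open_borel; exact: open_ccod.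
  - by move=> x /QK; exact: Kc.
  - apply: borel_real_continuous; first exact: open_ccod.
    by move=> x cx; exact: sqrt_det_continuous.
have C0 : 0 <= C1 + C2 by apply/ltW/addr_gt0.
have LQ : L Q = (\int[L]_(x in Q) 1)%E by rewrite integral_cst// mul1e.
split.
- rewrite LQ -ge0_integralZl//.
  apply: ge0_le_integral => //.
  + exact: measurable_funeM.
  + move=> x Qx; rewrite lee_fin.
    have h := hC2 x (QK x Qx).
    have s0 : 0 < Num.sqrt (\det (metric M c x)).
      by rewrite sqrtr_gt0 metric_det_gt0//; apply: Kc; exact: QK.
    rewrite -ler_pdivrMr// div1r; apply: le_trans (ler_norm _) _; apply: (le_trans h).
    by rewrite lerDr ltW.
- rewrite LQ -ge0_integralZl//.
  apply: ge0_le_integral => //.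
  + move=> x Qx; rewrite mule1; apply: le_trans (ler_norm _) _.
    by apply: (le_trans (hC1 x (QK x Qx))); rewrite lerDl ltW.
Qed.

Lemma patch_integral : exists2 C : R, 0 < C & forall F : borel U -> \bar R,
  measurable_fun (cpatch : set (borel U)) F -> (forall p, cpatch p -> 0 <= F p)%E ->
  (\int[L]_(x in open_rect a b) F (cinv c x) <= C%:E * \int[vol]_(p in cpatch) F p /\
   \int[vol]_(p in cpatch) F p <= C%:E * \int[L]_(x in open_rect a b) F (cinv c x))%E.
Proof.
have [C C0 hC] := vol_patch; exists C => // F mF F0.
have mB := @measurable_open_rect R d a b.
have mP := measurable_patch.
split.
- apply: (@transport_integral _ _ _ _ _ L vol (open_rect a b) (cpatch) (cinv c : borel E -> borel U) (point : borel U)) => //.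
  + by apply: cinv_measurable => //; exact: rect_ccod.
  + by move=> x; exact: patch_cinv.
  + exact: ltW.
  + move=> A mA; have [h _] := hC A mA; apply: (le_trans h).
    by rewrite lee_pmul2l// le_measure ?inE//; exact: measurableI.
- have -> : (\int[vol]_(p in cpatch) F p = \int[vol]_(p in cpatch) (F \o cinv c) (cmap c p))%E.
    by apply: eq_integral => p; rewrite inE => -[cp _] /=; rewrite cmapK.
  apply: (@transport_integral _ _ _ _ _ vol L (cpatch) (open_rect a b) (cmap c : borel U -> borel E) (0 : borel E) _ _ _ _ C (F \o cinv c)) => //.
  + by apply: cmap_measurable => // p [].
  + by move=> p [].
  + exact: ltW.
  + move=> A mA.
    have mpA : measurable (cpatch `&` cmap c @^-1` A : set (borel U)).
      by apply: cmap_measurable => // p [].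
    have [_] := hC _ mpA; rewrite setIA setIid => h; apply: (le_trans h).
    rewrite lee_pmul2l//; apply: le_measure; rewrite ?inE//.
      by apply: cinv_measurable => //; exact: rect_ccod.
    by move=> x [Bx [_]] /=; have [_ ->] := ccodP (rect_ccod Bx).
  + exact: measurable_cinv_patch.
  + by move=> x Bx /=; apply: F0; exact: patch_cinv.
Qed.

Lemma ae_cinv (P : U -> Prop) : {ae vol, forall p, P p} ->
  {ae L, forall x, open_rect a b x -> P (cinv c x)}.
Proof.
move=> [N [mN N0 hN]]; have [C C0 hC] := vol_patch; have [h _] := hC N mN.
exists (open_rect a b `&` cinv c @^-1` N); split.
- by apply: cinv_measurable => //; [exact: measurable_open_rect|exact: rect_ccod|exact: measurable_open_rect].
- apply/eqP; rewrite eq_le measure_ge0 andbT; apply: (le_trans h).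
  rewrite (_ : vol _ = 0%E) ?mule0//; apply/eqP; rewrite eq_le measure_ge0 andbT -N0.
  by apply: le_measure; rewrite ?inE//; apply: measurableI => //; exact: measurable_patch.
- move=> x /= /not_implyP[Bx nP]; split => //; exact: hN.
Qed.

Lemma ae_cmap (Q : E -> Prop) : {ae L, forall x, open_rect a b x -> Q x} ->
  {ae vol, forall p, cpatch p -> Q (cmap c p)}.
Proof.
move=> [N [mN N0 hN]]; have [C C0 hC] := vol_patch.
have mpN : measurable (cpatch `&` cmap c @^-1` N : set (borel U)).
  by apply: cmap_measurable => //; [exact: measurable_patch|move=> p []|exact: measurable_patch].
exists (cpatch `&` cmap c @^-1` N); split => //.
- have [_] := hC _ mpN; rewrite setIA setIid => h.
  apply/eqP; rewrite eq_le measure_ge0 andbT; apply: (le_trans h).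
  rewrite (_ : L _ = 0%E) ?mule0//; apply/eqP; rewrite eq_le measure_ge0 andbT -N0.
  apply: le_measure; rewrite ?inE//.
    by apply: cinv_measurable => //; [exact: measurable_open_rect|exact: rect_ccod|exact: measurable_open_rect].
  by move=> x [Bx [_]] /=; have [_ ->] := ccodP (rect_ccod Bx).
- move=> p /= /not_implyP[Pp nQ]; split => //; apply: hN => /= h; apply: nQ; apply: h.
  by case: Pp.
Qed.

End Patch.

Section Tensors.
Implicit Types (c : chart R U d) (T S : covariant_tensors R U d) (u v : U -> R).

Definition cdot c j T S (x : E) : R :=
  tform (invmx (metric M c x)) j (fun I => T c I x) (fun J => S c J x).

Lemma chart_atP p : atlas M (chart_at M p) /\ cdom (chart_at M p) p.
Proof. by rewrite /chart_at; case: cid2. Qed.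

Lemma tensor_dotE j T S p :
  tensor_dot M j T S p = cdot (chart_at M p) j T S (cmap (chart_at M p) p).
Proof. by rewrite /cdot -tform_tuple. Qed.

Lemma metric_inv_change c1 c2 x : atlas M c1 -> atlas M c2 -> overlap c1 c2 x ->
  let J := jacobian (transition c1 c2) x in
  J^T *m invmx (metric M c1 x) *m J = invmx (metric M c2 (transition c1 c2 x)).
Proof.
move=> a1 a2 ox J; have [cx dx] := (overlapP c1 c2 x).1 ox.
have [cpx _] := (overlapP c2 c1 (transition c1 c2 x)).1 (transition_overlap ox).
have [h1 h2] := ccodP cx.
have uJ : J \in unitmx := jacobian_unit a1 a2 ox.
have uJT : J^T \in unitmx by rewrite unitmx_tr.
have uG := metric_unit a2 cpx.
have := metric_change a1 a2 h1 dx; rewrite h2.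
have -> : cmap c2 (cinv c1 x) = transition c1 c2 x by [].
move: (metric M c2 _) uG => G uG ->.
have uW : J *m G *m J^T \in unitmx by rewrite !unitmx_mul uJ uG.
apply: (can_inj (mulKmx uG)); rewrite mulmxV//.
apply: (can_inj (mulKmx uJ)); rewrite mulmx1 !mulmxA mulmxV// mul1mx//.
Qed.

Lemma tensor_dot_chart j T S c p : (j <= r)%N -> tensorial M r T -> tensorial M r S ->
  atlas M c -> cdom c p -> tensor_dot M j T S p = cdot c j T S (cmap c p).
Proof.
move=> jr tT tS ac cp; rewrite tensor_dotE; have [a1 p1] := chart_atP p.
set c1 := chart_at M p in a1 p1 *; set x := cmap c1 p.
have ox : overlap c1 c x by apply/overlapP; rewrite cmapK//; split => //; exists p.
have xE : transition c1 c x = cmap c p by rewrite /transition cmapK.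
have pE W I : tensorial M r W -> size I = j -> W c1 I x =
    pull (fun i a => jacobian (transition c1 c) x i a) I (fun J => W c J (cmap c p)).
  move=> tW sI; have := tW c1 c a1 ac p p1 cp j jr (tcast sI (in_tuple I)).
  have := pull_tuple (fun i a => jacobian (transition c1 c) x i a) (tcast sI (in_tuple I))
    (fun J => W c J (cmap c p)).
  by rewrite val_tcast => h1 h2; apply: etrans h2 (esym h1).
rewrite /cdot; apply: (etrans (eq_tform _ (fun I sI => pE T I tT sI) (fun I sI => pE S I tS sI))).
rewrite tform_pull; congr (tform _ _ _ _).
by have := metric_inv_change a1 ac ox; rewrite xE.
Qed.

Lemma wd_tensorial u T : wd u T -> tensorial M r T. Proof. by case. Qed.

Lemma wd_lin k u v T S : wd u T -> wd v S ->
  wd (fun p => k * u p + v p) (fun c I x => k * T c I x + S c I x).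
Proof.
move=> [tT T0 hT] [tS S0 hS]; split.
- move=> c1 c2 a1 a2 p p1 p2 j jr I.
  rewrite (tT c1 c2 a1 a2 p p1 p2 j jr I) (tS c1 c2 a1 a2 p p1 p2 j jr I).
  rewrite mulr_sumr -big_split; apply: eq_bigr => J _ /=.
  by rewrite mulrDr mulrCA.
- by move=> c ac p cp; rewrite T0// S0.
- move=> c ac I sI i.
  have := weak_partial_lin k (@open_ccod c) (hT c ac I sI i) (hS c ac I sI i).
  congr (weak_partial _ _ _ _); apply/funext => x.
  rewrite mulrDr addrACA; congr (_ + _).
  rewrite mulr_sumr -big_split; apply: eq_bigr => m _ /=.
  rewrite mulr_sumr -big_split; apply: eq_bigr => l _ /=.
  by rewrite mulrDr mulrCA.
Qed.

(** [weak_partial] records the local integrability of T_(k I) plus Christoffel terms; these have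
    order [size I] and are subtracted by induction. *)
Lemma wd_locally_integrable u T c I : wd u T -> atlas M c -> (size I <= r)%N ->
  locally_integrable_on (ccod c) (T c I).
Proof.
move=> [_ _ hT] ac; have oc := @open_ccod c.
have [n] := ubnP (size I); elim: n I => [//|n IH] [|k I] sn sI.
  (* Order 0 occurs as the function that is differentiated once in some direction, hence 0 < r and 0
     < d. *)
  by have [] := hT c ac [::] r_gt0 (Ordinal d_gt0).
have [_ lw _] := hT c ac I sI k.
pose C x := \sum_(m < size I) \sum_(l < d)
  christoffel M c k (nth k I m) l x * T c (set_nth k I m l) x.
have lC : locally_integrable_on (ccod c) C.
  apply: locally_integrable_sum => m _; apply: locally_integrable_sum => l _.
  apply: locally_integrable_mul => //.
    by move=> x cx; exact: (smooth_continuous (christoffel_smooth k (nth k I m) l ac) cx).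
  have sm : size (set_nth k I m l) = size I by rewrite size_set_nth; apply/maxn_idPr.
  by apply: IH; rewrite sm//; exact: ltnW.
have := locally_integrable_lin (-1) lC lw.
by congr locally_integrable_on; apply/funext => x; rewrite mulN1r addrC addrK.
Qed.

(** Induction on the length: the Christoffel terms have lower order, so uniqueness of weak
    derivatives settles the new component up to a null set. *)
Lemma wd_unique u T T' c I : wd u T -> wd u T' -> atlas M c -> (size I <= r)%N ->
  {ae L, forall x, ccod c x -> T c I x = T' c I x}.
Proof.
move=> [_ T0 hT] [_ T0' hT'] ac; have oc := @open_ccod c.
have [n] := ubnP (size I); elim: n I => [//|n IH] [|k I] sn sI.
  apply: aeW => x cx; have [h1 h2] := ccodP cx.
  by have := T0 c ac _ h1; have := T0' c ac _ h1; rewrite h2 => -> ->.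
have sI' : (size I <= r)%N by exact: ltnW.
have h0 := IH I sn sI'.
have := weak_partial_unique oc (hT c ac I sI k) (hT' c ac I sI k) h0.
have hml (ml : 'I_(size I) * 'I_d) : {ae L, forall x, ccod c x ->
    T c (set_nth k I ml.1 ml.2) x = T' c (set_nth k I ml.1 ml.2) x}.
  have sm : size (set_nth k I ml.1 ml.2) = size I.
    by rewrite size_set_nth; apply/maxn_idPr.
  by apply: IH; rewrite sm.
have := ae_forall_fin hml; apply: filterS2 => x h1 h2 cx.
have := h2 cx; set A := \sum_(m < _) _; set B := \sum_(m < _) _.
have -> : A = B.
  by apply: eq_bigr => m _; apply: eq_bigr => l _; rewrite (h1 (m, l) cx).
by move/addIr.
Qed.

Lemma wd_measurable u T c a b I : wd u T -> atlas M c -> closed_rect a b `<=` ccod c ->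
  (size I <= r)%N -> measurable_fun (open_rect a b) (T c I : borel E -> R).
Proof.
move=> wT ac Kc sI; have cK := @compact_closed_rect R d a b.
have := wd_locally_integrable wT ac sI cK Kc => /measurable_int/measurable_EFinP.
apply: measurable_funS; first exact: compact_borel.
exact: open_rect_closed.
Qed.

Lemma metric_inv_measurable c a b i j : atlas M c -> closed_rect a b `<=` ccod c ->
  measurable_fun (open_rect a b) (fun x : borel E => invmx (metric M c x) i j).
Proof.
move=> ac Kc; apply: borel_real_continuous; first exact: open_open_rect.
move=> x /open_rect_closed/Kc cx.
exact: (smooth_continuous (metric_inv_smooth i j ac) cx).
Qed.

Lemma cdot_measurable u v T S c a b j : wd u T -> wd v S -> atlas M c ->
  closed_rect a b `<=` ccod c -> (j <= r)%N ->
  measurable_fun (open_rect a b) (cdot c j T S : borel E -> R).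
Proof.
move=> wT wS ac Kc jr; apply: measurable_tform.
- by move=> i k; exact: metric_inv_measurable.
- by move=> I sI; apply: (wd_measurable wT) => //; rewrite sI.
- by move=> I sI; apply: (wd_measurable wS) => //; rewrite sI.
Qed.

Lemma tensor_dot_measurable_patch u v T S c a b j : wd u T -> wd v S -> atlas M c ->
  closed_rect a b `<=` ccod c -> (j <= r)%N ->
  measurable_fun (cpatch c a b : set (borel U)) (tensor_dot M j T S).
Proof.
move=> wT wS ac Kc jr.
have := @measurable_patch_cmap c a b _ _ _ (cdot_measurable wT wS ac Kc jr).
apply: eq_measurable_fun => p; rewrite inE => -[cp _] /=.
by rewrite (tensor_dot_chart jr (wd_tensorial wT) (wd_tensorial wS) ac cp).
Qed.

Lemma invmx_gram n (F : 'M[R]_n) : F \in unitmx ->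
  invmx (F *m F^T) = (invmx F)^T *m invmx F.
Proof.
move=> uF; have uFT : F^T \in unitmx by rewrite unitmx_tr.
have uW : F *m F^T \in unitmx by rewrite unitmx_mul uF.
apply: (can_inj (mulKmx uW)); rewrite mulmxV// trmx_inv -mulmxA.
by rewrite (mulmxA F^T) mulmxV// mul1mx mulmxV.
Qed.

Lemma cdot_ge0 c j T x : atlas M c -> ccod c x -> 0 <= cdot c j T T x.
Proof.
move=> ac cx; have [F uF gE] := cholesky (Defs.metric_sym ac cx) (metric_posdef ac cx).
rewrite /cdot gE invmx_gram//.
exact: tform_gram_ge0.
Qed.

Lemma tensor_dot_ge0 j T p : 0 <= tensor_dot M j T T p.
Proof.
by rewrite tensor_dotE; have [ac cp] := chart_atP p; apply: cdot_ge0 => //; exact: ccod_cmap.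
Qed.

(** Pointwise this is [tform_gram_lower] in the Cholesky frame; (1 + B)^r dominates the products of
    diagonal entries for all orders up to r. *)
Lemma cdot_lower c a b : atlas M c -> closed_rect a b `<=` ccod c ->
  exists2 C : R, 0 < C & forall x, closed_rect a b x -> forall T I, (size I <= r)%N ->
    T c I x ^+ 2 <= C * cdot c (size I) T T x.
Proof.
move=> ac Kc; have cK := @compact_closed_rect R d a b.
have st : smooth_on (ccod c) (fun x => \sum_i metric M c x i i).
  by apply: smooth_sum => [|i _]; [exact: open_ccod|exact: metric_smooth].
have [B B0 hB] := compact_bound cK (fun x Kx => smooth_continuous st (Kc x Kx)).
exists ((1 + B) ^+ r); first by rewrite exprn_gt0// addr_gt0.
move=> x Kx T I sI; have cx := Kc x Kx.
have [F uF gE] := cholesky (Defs.metric_sym ac cx) (metric_posdef ac cx).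
have := tform_gram_lower I (fun I => T c I x) uF.
have -> : (invmx F)^T *m invmx F = invmx (metric M c x).
  by rewrite gE invmx_gram.
move=> h; apply: (le_trans h); rewrite -gE.
apply: ler_wpM2r; first exact: cdot_ge0.
have gi0 i : 0 <= metric M c x i i.
  by rewrite gE mxE; apply: sumr_ge0 => k _; rewrite mxE sqr_ge0.
have gii i : 0 <= metric M c x i i <= 1 + B.
  rewrite gi0/=; apply: (@le_trans _ _ B); last by rewrite lerDr.
  apply: le_trans (hB x Kx); apply: le_trans (ler_norm _).
  by rewrite (bigD1 i)//= lerDl; apply: sumr_ge0.
apply: (@le_trans _ _ ((1 + B) ^+ size I)).
  elim: I {sI h} => [|i I IH]; first by rewrite big_nil.
  rewrite big_cons exprS; have /andP[g0 g1] := gii i.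
  by apply: ler_pM => //; apply: prodr_ge0 => k _; have /andP[] := gii k.
by rewrite ler_weXn2l// lerDl ltW.
Qed.

Lemma wd_eq_dot u v T S T' S' c a b j : wd u T -> wd u T' -> wd v S -> wd v S' ->
  atlas M c -> closed_rect a b `<=` ccod c -> (j <= r)%N ->
  {ae L, forall x, open_rect a b x -> cdot c j T S x = cdot c j T' S' x}.
Proof.
move=> wT wT' wS wS' ac Kc jr.
have h1 (I : j.-tuple 'I_d) : {ae L, forall x, ccod c x -> T c I x = T' c I x}.
  by apply: (wd_unique wT wT' ac); rewrite size_tuple.
have h2 (I : j.-tuple 'I_d) : {ae L, forall x, ccod c x -> S c I x = S' c I x}.
  by apply: (wd_unique wS wS' ac); rewrite size_tuple.
have := ae_forall_fin h1; have := ae_forall_fin h2.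
apply: filterS2 => x hS hT /open_rect_closed/Kc cx.
apply: eq_tform => I sI; [have := hT (tcast sI (in_tuple I)) cx|have := hS (tcast sI (in_tuple I)) cx];
  by rewrite val_tcast.
Qed.

End Tensors.

(** * Iterated integration by parts for weak covariant derivatives *)

Section IteratedByParts.
Implicit Types (T : covariant_tensors R U d) (u : U -> R) (e : E -> R).
Variables (c : chart R U d) (B : set E).
Hypotheses (ac : atlas M c) (oB : open B) (BV : B `<=` ccod c).
Local Notation V := (ccod c).

(* The functional is a combination of integrals of components of T against e,
   with coefficients that depend neither on T nor on e. *)
Definition reducible (Lam : covariant_tensors R U d -> (E -> R) -> R) :=
  exists (K : finType) (J : K -> seq 'I_d) (b : K -> E -> R),
    (forall k, (size (J k) <= r)%N /\ test_function B (b k)) /\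
    forall u T e, wd u T -> smooth_on setT e ->
      Lam T e = \sum_k \int[L]_(x in V) (T c (J k) x * (b k x * e x)).

Lemma reducible_eq Lam Lam' : (forall u T e, wd u T -> smooth_on setT e -> Lam T e = Lam' T e) ->
  reducible Lam' -> reducible Lam.
Proof.
move=> h [K [J [b [h1 h2]]]]; exists K, J, b; split => // u T e wT se.
by rewrite (h u T e wT se); exact: h2 u T e wT se.
Qed.

Lemma reducible0 : reducible (fun _ _ => 0).
Proof.
exists void, (fun=> [::]), (fun _ _ => 0); split => [[]|u T e _ _].
by rewrite big1// => -[].
Qed.

Lemma reducibleD Lam Lam' : reducible Lam -> reducible Lam' ->
  reducible (fun T e => Lam T e + Lam' T e).
Proof.
move=> [K [J [b [h1 h2]]]] [K' [J' [b' [h1' h2']]]].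
exists (K + K')%type, (fun k => match k with inl k => J k | inr k => J' k end),
  (fun k => match k with inl k => b k | inr k => b' k end).
split => [[k|k]|u T e wT se]; [exact: h1|exact: h1'|].
by rewrite big_sumType (h2 u T e)// (h2' u T e).
Qed.

Lemma reducible_sum n (Lam : 'I_n -> covariant_tensors R U d -> (E -> R) -> R) :
  (forall i, reducible (Lam i)) -> reducible (fun T e => \sum_i Lam i T e).
Proof.
elim: n Lam => [|n IH] Lam h.
  by apply: (reducible_eq _ reducible0) => *; rewrite big_ord0.
apply: reducible_eq.
  by move=> *; rewrite big_ord_recl.
by apply: reducibleD => //; exact: IH.
Qed.

Let oV : open V := @open_ccod c.

Lemma wd_test_integrable u T I psi : wd u T -> (size I <= r)%N -> test_function B psi ->
  L.-integrable V (EFin \o (fun x => T c I x * psi x)).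
Proof.
move=> wT sI tpsi; apply: locally_integrable_test => //.
  exact: wd_locally_integrable wT ac sI.
exact: test_function_sub tpsi.
Qed.

Lemma test_mul_smooth psi e : test_function B psi -> smooth_on setT e ->
  test_function B (fun x => psi x * e x).
Proof.
move=> tp se; have := test_functionM oB (smooth_sub (@subsetT _ B) se) tp.
by have -> : (fun x => e x * psi x) = (fun x => psi x * e x) by apply/funext => x; rewrite mulrC.
Qed.

Lemma reducibleN Lam : reducible Lam -> reducible (fun T e => - Lam T e).
Proof.
move=> [K [J [b [h1 h2]]]]; exists K, J, (fun k x => -1 * b k x); split.
  by move=> k; have [s1 t1] := h1 k; split => //; exact: test_functionZ.
move=> u T e wT se; rewrite (h2 u T e)// -sumrN; apply: eq_bigr => k _.
have [s1 t1] := h1 k; have mV : measurable (V : set (borel E)) by exact: open_borel.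
have i1 := wd_test_integrable wT s1 (test_mul_smooth t1 se).
apply: (etrans (esym (mulN1r _))); apply: (etrans (esym (RintegralZl (-1) mV i1))).
by apply: eq_Rintegral => x _; ring.
Qed.

Lemma smooth_iter_partial i m e : smooth_on setT e -> smooth_on setT (iter m (partial i) e).
Proof. by move=> se; elim: m => [|m IH]; [exact: se|rewrite iterS; exact: smooth_partial]. Qed.

(** One integration by parts trades a derivative of e for a longer multi-index, Christoffel terms or
    a derivative of chi; [size I] plus the number of remaining derivatives never exceeds r. *)
Lemma iter_by_parts i m I chi : (size I + m <= r)%N -> test_function B chi ->
  reducible (fun T e => \int[L]_(x in V) (T c I x * (chi x * iter m (partial i) e x))).
Proof.
elim: m I chi => [|m IH] I chi sI tchi.
  rewrite addn0 in sI; exists unit, (fun=> I), (fun=> chi); split => // u T e wT se.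
  by rewrite (big_pred1 tt)// => -[].
have sI' : (size I + m <= r)%N by apply: leq_trans sI; rewrite leq_add2l.
have sIr : (size I < r)%N by apply: leq_trans sI; rewrite addnS ltnS leq_addr.
have IH1 := IH (i :: I) chi; have {}IH1 := IH1 (_ : (size (i :: I) + m <= r)%N) tchi.
have {}IH1 := IH1 (_ : _); rewrite /= addSnnS in IH1; have {}IH1 := IH1 sI.
have IH2 := IH I (partial i chi) sI' (test_function_partial i tchi).
have sset n l : (n < size I)%N -> size (set_nth i I n l) = size I.
  by move=> nI; rewrite size_set_nth; apply/maxn_idPr.
have tG (n : 'I_(size I)) l : test_function B (fun x => christoffel M c i (nth i I n) l x * chi x).
  by apply: test_functionM => //; apply: smooth_sub BV (christoffel_smooth _ _ _ ac).
have IH3 (n : 'I_(size I)) l : reducible (fun T e => \int[L]_(x in V) (T c (set_nth i I n l) x *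
    ((christoffel M c i (nth i I n) l x * chi x) * iter m (partial i) e x))).
  by apply: IH => //; rewrite sset.
have := reducibleN (reducibleD (reducibleD IH1 (reducible_sum (fun n => reducible_sum (IH3 n)))) IH2).
apply: reducible_eq => u T e wT se.
set e' := iter m (partial i) e.
have se' : smooth_on setT e' := smooth_iter_partial i m se.
have -> : iter m.+1 (partial i) e = partial i e' by [].
have [_ _ hT] := wT; have [lf lw hw] := hT c ac I sIr i.
have tce := test_mul_smooth tchi se'.
have mV : measurable (V : set (borel E)) by exact: open_borel.
have dchi x : partial i (fun x => chi x * e' x) x = chi x * partial i e' x + e' x * partial i chi x.
  have [schi _] := tchi.
  exact: (partialM (smooth_derivable schi Logic.I) (smooth_derivable se' Logic.I)).
have tpc := test_function_partial i tchi.
have i0 := wd_test_integrable wT (ltnW sIr) (test_mul_smooth tpc se').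
have i1 := wd_test_integrable wT (ltnW sIr) (test_function_partial i tce).
have := hw _ (test_function_sub BV tce); rewrite -/Rintegral => hw'.
have eL : \int[L]_(x in V) (T c I x * (chi x * partial i e' x)) =
   \int[L]_(x in V) (T c I x * partial i (fun x => chi x * e' x) x) -
   \int[L]_(x in V) (T c I x * (partial i chi x * e' x)).
  apply: etrans (RintegralB mV i1 i0); apply: eq_Rintegral => x _.
  by rewrite dchi; ring.
apply: (etrans eL).
have sr1 : (size (i :: I) <= r)%N by [].
have i2 := wd_test_integrable wT sr1 tce.
have i3 (n : 'I_(size I)) l : L.-integrable V (EFin \o (fun x => T c (set_nth i I n l) x *
    ((christoffel M c i (nth i I n) l x * chi x) * e' x))).
  by apply: wd_test_integrable wT _ (test_mul_smooth (tG n l) se'); rewrite sset// ltnW.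
have i4 (n : 'I_(size I)) := Rintegrable_sum (index_enum 'I_d) mV (fun l (_ : xpredT l) => i3 n l).
have i5 := Rintegrable_sum (index_enum 'I_(size I)) mV (fun n (_ : xpredT n) => i4 n).
rewrite opprD; congr (_ - _); apply: (etrans hw'); congr (- _).
have e6 : \sum_(n < size I) \sum_(l < d) \int[L]_(x in V) (T c (set_nth i I n l) x *
     ((christoffel M c i (nth i I n) l x * chi x) * e' x)) =
   \int[L]_(x in V) (\sum_(n < size I) \sum_(l < d) (T c (set_nth i I n l) x *
     ((christoffel M c i (nth i I n) l x * chi x) * e' x))).
  apply: esym; apply: (etrans (Rintegral_sum (index_enum 'I_(size I)) mV (fun n (_ : xpredT n) => i4 n))).
  by apply: eq_bigr => n _; exact: Rintegral_sum.
rewrite e6; apply: etrans (RintegralD mV i2 i5); apply: eq_Rintegral => x _.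
rewrite mulrDl; congr (_ + _); rewrite mulr_suml; apply: eq_bigr => n _.
by rewrite mulr_suml; apply: eq_bigr => l _; ring.
Qed.

End IteratedByParts.

(** * Patches and the Sobolev inner product *)

Section SobolevTensors.
Opaque smooth_on jacobian partial overlap christoffel.
Implicit Types (T S W : covariant_tensors R U d) (u v : U -> R) (p q : U).

Definition pchart p := chart_at M p.
Definition pcenter p : E := cmap (pchart p) p.

Lemma pchartP p : atlas M (pchart p) /\ cdom (pchart p) p.
Proof. exact: chart_atP. Qed.

Lemma pradius_subproof p : exists2 e : R, 0 < e &
  closed_rect (fun i => pcenter p 0 i - e) (fun i => pcenter p 0 i + e) `<=` ccod (pchart p).
Proof.
have [_ cp] := pchartP p.
have [e e0 he] := open_ball_sub (@open_ccod (pchart p)) (ccod_cmap cp).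
exists (e / 2); first by rewrite divr_gt0.
move=> x hx; apply: he; apply/rV_ballP => // i.
have := hx i; rewrite -ler_distlC => h; apply: (le_lt_trans h).
by rewrite ltr_pdivrMr// ltr_pMr// ltr1n.
Qed.

Definition pradius p : R := s2val (cid2 (pradius_subproof p)).

Lemma pradius_gt0 p : 0 < pradius p.
Proof. by rewrite /pradius; case: cid2. Qed.

(** The factor k selects concentric boxes: k = 1 for the Fourier series, k = 1/4 for the patches on
    which the cut-off is bounded below. *)
Definition plo k p (i : 'I_d) : R := pcenter p 0 i - k * pradius p.
Definition phi k p (i : 'I_d) : R := pcenter p 0 i + k * pradius p.
Definition ppatch k p : set U := cpatch (pchart p) (plo k p) (phi k p).

Lemma prect_sub k p : k <= 1 -> closed_rect (plo k p) (phi k p) `<=` ccod (pchart p).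
Proof.
move=> k1 x hx; have h := pradius_gt0 p; move: h; rewrite /pradius.
rewrite /plo /phi /pradius in hx; move: hx; case: cid2 => e /= _ he hx e0.
apply: he => i; have /andP[h1 h2] := hx i.
have ke : k * e <= e by rewrite ler_piMl// ltW.
by apply/andP; split; [apply: le_trans h1; rewrite lerD2l lerN2|apply: (le_trans h2); rewrite lerD2l].
Qed.

Lemma ppatch_center k p : 0 < k -> ppatch k p p.
Proof.
move=> k0; have [_ cp] := pchartP p; split => // i /=.
have kr : 0 < k * pradius p by rewrite mulr_gt0// pradius_gt0.
by rewrite in_itv /= ltrBlDr !ltrDl kr.
Qed.

Lemma open_ppatch k p : open (ppatch k p).
Proof. exact: open_patch. Qed.

Lemma finite_ppatch k : 0 < k -> exists s : seq U, forall q, exists2 p, p \in s & ppatch k p q.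
Proof.
move=> k0; apply: (compact_points compactU); first by move=> p; exact: open_ppatch.
by move=> p; exact: ppatch_center.
Qed.

(** By compactness finitely many patches cover the manifold, so null sets can be treated in
    charts. *)
Lemma ae_ppatch k (P : U -> Prop) : 0 < k ->
  (forall p, {ae vol, forall q, ppatch k p q -> P q}) -> {ae vol, forall q, P q}.
Proof.
move=> k0 hP; have [s hs] := finite_ppatch k0.
suff : {ae vol, forall q, (exists2 p, p \in s & ppatch k p q) -> P q}.
  by apply: ae_imp => q h; apply: h; exact: hs.
elim: s {hs} => [|p s IH]; first by apply: aeW => q [].
apply: ae_imp2 (hP p) IH => q h1 h2 [p']; rewrite inE => /orP[/eqP ->//|ps] pq.
by apply: h2; exists p'.
Qed.

Lemma measurable_ppatch k disp (T : measurableType disp) (f : borel U -> T) : 0 < k ->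
  (forall p, measurable_fun (ppatch k p : set (borel U)) f) -> measurable_fun setT f.
Proof.
move=> k0 mf; have [s hs] := finite_ppatch k0.
have -> : [set: borel U] = \big[setU/set0]_(p <- s) (ppatch k p).
  apply/seteqP; split => // q _; have [p ps pq] := hs q.
  by rewrite -bigcup_seq; exists p.
have mpp p : measurable (ppatch k p : set (borel U)) by apply: open_borel; exact: open_ppatch.
elim: s {hs} => [|p s IH]; first by rewrite big_nil; exact: measurable_fun_set0.
rewrite big_cons; apply/measurable_funU => //.
by apply: bigsetU_measurable => q _; exact: mpp.
Qed.

Lemma vol_lty : (vol setT < +oo)%E.
Proof.
have [s hs] := @finite_ppatch 1 ltr01.
have mpp p : measurable (ppatch 1 p : set (borel U)) by apply: open_borel; exact: open_ppatch.
have vpp p : (vol (ppatch 1 p) < +oo)%E.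
  have [ac _] := pchartP p; have [C C0 hC] := vol_patch ac (@prect_sub 1 p (lexx _)).
  have [_] := hC setT measurableT; rewrite setIT setIT => h; apply: (le_lt_trans h).
  by rewrite lte_mul_pinfty// ?ltW//; exact: open_rect_lty.
have -> : [set: borel U] = \big[setU/set0]_(p <- s) (ppatch 1 p).
  apply/seteqP; split => // q _; have [p ps pq] := hs q.
  by rewrite -bigcup_seq; exists p.
elim: s {hs} => [|p s IH]; first by rewrite big_nil measure0.
rewrite big_cons; apply: (le_lt_trans (measureU2 _ _ _)) => //.
  by apply: bigsetU_measurable => q _; exact: mpp.
by apply: lte_add_pinfty => //; exact: vpp.
Qed.

Lemma tensor_dot_measurable u v T S j : wd u T -> wd v S -> (j <= r)%N ->
  measurable_fun setT (tensor_dot M j T S : borel U -> R).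
Proof.
move=> wT wS jr; apply: measurable_ppatch => // p.
have [ac _] := pchartP p.
by apply: (tensor_dot_measurable_patch wT wS ac _ jr); exact: prect_sub.
Qed.

Lemma tensor_dot_ae u v T S T' S' j : wd u T -> wd u T' -> wd v S -> wd v S' -> (j <= r)%N ->
  {ae vol, forall p, tensor_dot M j T S p = tensor_dot M j T' S' p}.
Proof.
move=> wT wT' wS wS' jr; apply: ae_ppatch => // p.
have [ac _] := pchartP p; have Kc := @prect_sub 1 p (lexx _).
have := ae_cmap ac Kc (wd_eq_dot wT wT' wS wS' ac Kc jr).
apply: ae_imp => q h pq; have [cq _] := pq; have := h pq.
rewrite -(tensor_dot_chart jr (wd_tensorial wT) (wd_tensorial wS) ac cq).
by rewrite -(tensor_dot_chart jr (wd_tensorial wT') (wd_tensorial wS') ac cq).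
Qed.

Lemma tensor_dotC j T S p : tensor_dot M j T S p = tensor_dot M j S T p.
Proof.
rewrite !tensor_dotE; have [ac cp] := chart_atP p; apply: tformC.
by rewrite trmx_inv Defs.metric_sym//; exact: ccod_cmap.
Qed.

Lemma tensor_dot_lin j k T S W p :
  tensor_dot M j (fun c I x => k * T c I x + S c I x) W p =
  k * tensor_dot M j T W p + tensor_dot M j S W p.
Proof. by rewrite !tensor_dotE /cdot tform_linl. Qed.

Lemma tensor_dot_linr j k T S W p :
  tensor_dot M j W (fun c I x => k * T c I x + S c I x) p =
  k * tensor_dot M j W T p + tensor_dot M j W S p.
Proof. by rewrite tensor_dotC tensor_dot_lin !(tensor_dotC _ W). Qed.

Lemma tensor_dot_sq j k T S p :
  tensor_dot M j (fun c I x => k * T c I x + S c I x) (fun c I x => k * T c I x + S c I x) p =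
  k ^+ 2 * tensor_dot M j T T p + k * tensor_dot M j T S p *+ 2 + tensor_dot M j S S p.
Proof.
rewrite tensor_dot_lin !tensor_dot_linr tensor_dotC.
move: (tensor_dot M j T T p) (tensor_dot M j T S p) (tensor_dot M j S S p) => x y z; ring.
Qed.

Lemma tensor_dot_le j T S p :
  `|tensor_dot M j T S p| <= tensor_dot M j T T p + tensor_dot M j S S p.
Proof.
have h1 := tensor_dot_ge0 j (fun c I x => 1 * T c I x + S c I x) p.
have h2 := tensor_dot_ge0 j (fun c I x => -1 * T c I x + S c I x) p.
have h3 := tensor_dot_ge0 j T p; have h4 := tensor_dot_ge0 j S p.
move: h1 h2; rewrite !tensor_dot_sq => h1 h2.
rewrite ler_norml; apply/andP; move: h1 h2 h3 h4.
move: (tensor_dot M j T T p) (tensor_dot M j T S p) (tensor_dot M j S S p) => x y z.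
by move=> *; split; nra.
Qed.

Definition sob T := forall j, (j <= r)%N ->
  vol.-integrable setT (EFin \o tensor_dot M j T T).

Lemma tensor_dot_integrable u v T S j : wd u T -> wd v S -> sob T -> sob S -> (j <= r)%N ->
  vol.-integrable setT (EFin \o tensor_dot M j T S).
Proof.
move=> wT wS sT sS jr.
apply: (@le_integrable _ _ _ vol setT measurableT _
  (EFin \o (fun p => tensor_dot M j T T p + tensor_dot M j S S p))).
- by apply/measurable_EFinP; exact: tensor_dot_measurable wT wS jr.
- move=> p _ /=; rewrite lee_fin [leRHS]ger0_norm ?tensor_dot_le//.
  by apply: addr_ge0; exact: tensor_dot_ge0.
- by apply: RintegrableD => //; [exact: sT|exact: sS].
Qed.

Lemma sob_lin u v T S k : wd u T -> wd v S -> sob T -> sob S ->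
  sob (fun c I x => k * T c I x + S c I x).
Proof.
move=> wT wS sT sS j jr.
have -> : tensor_dot M j (fun c I x => k * T c I x + S c I x) (fun c I x => k * T c I x + S c I x)
  = fun p => k ^+ 2 * tensor_dot M j T T p + (k * 2 * tensor_dot M j T S p + tensor_dot M j S S p).
  by apply/funext => p; rewrite tensor_dot_sq; ring.
apply: RintegrableD => //; first by apply: RintegrableZ => //; exact: sT.
apply: RintegrableD => //; last exact: sS.
by apply: RintegrableZ => //; exact: tensor_dot_integrable wT wS sT sS jr.
Qed.

(** The inner product of explicit tensor fields; by [dotT_ae] any choice of weak derivatives
    computes [sobolev_dot]. *)
Definition dotT T S : R := \sum_(j < r.+1) \int[vol]_p tensor_dot M j T S p.

Lemma dotTC T S : dotT T S = dotT S T.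
Proof.
apply: eq_bigr => j _; apply: eq_Rintegral => p _; exact: tensor_dotC.
Qed.

Lemma dotT_lin u v w T S W k : wd u T -> wd v S -> wd w W -> sob T -> sob S -> sob W ->
  dotT (fun c I x => k * T c I x + S c I x) W = k * dotT T W + dotT S W.
Proof.
move=> wT wS wW sT sS sW; rewrite mulr_sumr -big_split; apply: eq_bigr => j _ /=.
have jr : (j <= r)%N by rewrite -ltnS.
have i1 := tensor_dot_integrable wT wW sT sW jr.
have i2 := tensor_dot_integrable wS wW sS sW jr.
by apply: (Rintegral_axpy measurableT i1 i2) => p; rewrite tensor_dot_lin.
Qed.

Lemma Rintegral_tensor_ge0 j T : 0 <= \int[vol]_p tensor_dot M j T T p.
Proof. by apply: Rintegral_ge0 => p _; exact: tensor_dot_ge0. Qed.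

Lemma dotT_ge0 T : 0 <= dotT T T.
Proof. by apply: sumr_ge0 => j _; exact: Rintegral_tensor_ge0. Qed.

Lemma dotT_ge j T : (j <= r)%N -> \int[vol]_p tensor_dot M j T T p <= dotT T T.
Proof.
move=> jr; rewrite /dotT (bigD1 (Ordinal (jr : (j < r.+1)%N)))//= lerDl.
by apply: sumr_ge0 => i _; exact: Rintegral_tensor_ge0.
Qed.

Lemma wd_nabla u T : wd u T -> wd u (nabla M r u).
Proof. by move=> wT; apply: xgetPex; exists T. Qed.

Lemma sob_ae u T T' : wd u T -> wd u T' -> sob T -> sob T'.
Proof.
move=> wT wT' sT j jr.
have mT := tensor_dot_measurable wT wT jr; have mT' := tensor_dot_measurable wT' wT' jr.
have /integrableP[_ fi] := sT j jr.
apply/integrableP; split; first exact/measurable_EFinP.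
rewrite (_ : (\int[vol]_p _ = \int[vol]_p `|(EFin \o tensor_dot M j T T) p|)%E)//.
apply: ge0_ae_eq_integral => //.
- by apply: measurableT_comp => //; exact/measurable_EFinP.
- by apply: measurableT_comp => //; exact/measurable_EFinP.
- by apply: ae_imp (tensor_dot_ae wT wT' wT wT' jr) => p /= ->.
Qed.

Lemma sobolevP u : sobolev M vol r u -> wd u (nabla M r u) /\ sob (nabla M r u).
Proof.
move=> [T wT sT]; have wn := wd_nabla wT; split => //; exact: sob_ae wT wn sT.
Qed.

Lemma dotT_ae u v T S T' S' : wd u T -> wd u T' -> wd v S -> wd v S' -> dotT T S = dotT T' S'.
Proof.
move=> wT wT' wS wS'; apply: eq_bigr => j _; congr fine.
have jr : (j <= r)%N by rewrite -ltnS.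
apply: ae_eq_integral => //.
- by apply/measurable_EFinP; exact: tensor_dot_measurable wT wS jr.
- by apply/measurable_EFinP; exact: tensor_dot_measurable wT' wS' jr.
- by apply: ae_imp (tensor_dot_ae wT wT' wS wS' jr) => p /= ->.
Qed.

Lemma sobolev_dotE u v T S : wd u T -> wd v S -> sobolev_dot M vol r u v = dotT T S.
Proof. by move=> wT wS; apply: dotT_ae (wd_nabla wT) wT (wd_nabla wS) wS. Qed.

Lemma sobolev_lin k u v : sobolev M vol r u -> sobolev M vol r v ->
  sobolev M vol r (fun p => k * u p + v p).
Proof.
move=> /sobolevP[wu su] /sobolevP[wv sv]; exists (fun c I x => k * nabla M r u c I x + nabla M r v c I x).
  exact: wd_lin.
exact: sob_lin wu wv su sv.
Qed.

Lemma sobolev_dot_lin k u v w : sobolev M vol r u -> sobolev M vol r v -> sobolev M vol r w ->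
  sobolev_dot M vol r (fun p => k * u p + v p) w =
  k * sobolev_dot M vol r u w + sobolev_dot M vol r v w.
Proof.
move=> /sobolevP[wu su] /sobolevP[wv sv] /sobolevP[ww sw].
rewrite (sobolev_dotE (wd_lin k wu wv) ww).
exact: dotT_lin wu wv ww su sv sw.
Qed.

Lemma sobolev_dotC u v : sobolev M vol r u -> sobolev M vol r v ->
  sobolev_dot M vol r u v = sobolev_dot M vol r v u.
Proof.
move=> /sobolevP[wu su] /sobolevP[wv sv].
by rewrite (sobolev_dotE wv wu) dotTC.
Qed.

Lemma sobolev_dot_ge0 u : sobolev M vol r u -> 0 <= sobolev_dot M vol r u u.
Proof. by move=> /sobolevP[wu _]; rewrite dotT_ge0. Qed.

Lemma tensor_dot0 u T p : wd u T -> tensor_dot M 0 T T p = u p ^+ 2.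
Proof.
move=> [_ h _]; rewrite tensor_dotE /cdot /=; have [ac cp] := chart_atP p.
by rewrite h.
Qed.

Lemma sobolev_sq_integrable u : sobolev M vol r u ->
  measurable_fun setT (fun p : borel U => u p ^+ 2) /\
  vol.-integrable setT (EFin \o (fun p => u p ^+ 2)) /\
  \int[vol]_p (u p ^+ 2) <= sobolev_dot M vol r u u.
Proof.
move=> /sobolevP[wu su].
have e : tensor_dot M 0 (nabla M r u) (nabla M r u) = (fun p => u p ^+ 2).
  by apply/funext => p; exact: tensor_dot0.
split; first by rewrite -e; exact: (tensor_dot_measurable wu wu (leq0n _)).
split; first by rewrite -e; exact: su.
by rewrite -e; exact: dotT_ge.
Qed.

Lemma ae_continuous_zero (f : U -> R) : continuous f -> {ae vol, forall p, f p = 0} ->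
  f = fun=> 0.
Proof.
move=> cf h; apply/funext => p; have [ac cp] := pchartP p.
have Kc := @prect_sub 1 p (lexx _).
have h1 := ae_cinv ac Kc h.
have oB := @open_open_rect R d (plo 1 p) (phi 1 p).
have Bp : (open_rect (plo 1 p) (phi 1 p) : set E) (pcenter p) by have [] := @ppatch_center 1 p ltr01.
have cg x : (open_rect (plo 1 p) (phi 1 p) : set E) x -> {for x, continuous (f \o cinv (pchart p))}.
  move=> /open_rect_closed/Kc cx; apply: continuous_comp; first exact: cinv_continuous.
  exact: cf.
have := ae_continuous_eq0 oB cg h1 Bp.
by rewrite /= cmapK.
Qed.

Lemma sobolev_dot_eq0 u : sobolev_continuous M vol r u -> sobolev_dot M vol r u u = 0 ->
  u = fun=> 0.
Proof.
move=> [su cu] h; apply: ae_continuous_zero => //.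
have [mu [iu hu]] := sobolev_sq_integrable su; rewrite h in hu.
have i0 : \int[vol]_p (u p ^+ 2) = 0.
  by apply/eqP; rewrite eq_le hu; apply: Rintegral_ge0 => p _; exact: sqr_ge0.
have : (\int[vol]_p `|(u p ^+ 2)%:E| = 0)%E.
  have -> : (\int[vol]_p `|(u p ^+ 2)%:E| = \int[vol]_p (u p ^+ 2)%:E)%E.
    by apply: eq_integral => p _; rewrite gee0_abs// lee_fin sqr_ge0.
  by rewrite -(fineK (integrable_fin_num measurableT iu)); congr EFin.
have mE : measurable_fun setT (fun p : borel U => (u p ^+ 2)%:E) by apply/measurable_EFinP.
move/(ae_eq_integral_abs vol measurableT mE); apply: ae_imp => p /(_ I) /= [].
by move/eqP; rewrite sqrf_eq0 => /eqP.
Qed.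

Lemma sobolev_L2_rect c a b : atlas M c -> closed_rect a b `<=` ccod c ->
  exists2 C : R, 0 < C & forall u T, wd u T -> sob T -> forall I, (size I <= r)%N ->
   sqint L (open_rect a b) (T c I) /\
   \int[L]_(x in open_rect a b) (T c I x ^+ 2) <= C * dotT T T.
Proof.
move=> ac Kc; set B := open_rect _ _.
have mB : measurable B := @measurable_open_rect R d _ _.
have [C1 C10 h1] := cdot_lower ac Kc.
have [C2 C20 h2] := patch_integral ac Kc.
exists (C1 * C2); first exact: mulr_gt0.
move=> u T wT sT I sI.
have mT := wd_measurable wT ac Kc sI.
have mtd := tensor_dot_measurable wT wT sI.
set F := fun q => (tensor_dot M (size I) T T q)%:E.
have mF : measurable_fun (cpatch c a b : set (borel U)) F.
  by apply/measurable_EFinP; exact: measurable_funTS.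
have F0 q : (0 <= F q)%E by rewrite lee_fin tensor_dot_ge0.
have [h3 _] := h2 F mF (fun q _ => F0 q).
have mpp : measurable (cpatch c a b : set (borel U)) by apply: open_borel; exact: open_patch.
have h4 : (\int[vol]_(q in cpatch c a b) F q <= (dotT T T)%:E)%E.
  apply: (@le_trans _ _ (\int[vol]_q F q)%E).
    by apply: ge0_subset_integral => //; apply/measurable_EFinP.
  have := dotT_ge T sI; rewrite -lee_fin; apply: le_trans.
  by rewrite -(fineK (integrable_fin_num measurableT (sT _ sI))).
have h5 : (\int[L]_(x in B) (T c I x ^+ 2)%:E <= (C1 * C2 * dotT T T)%:E)%E.
  apply: (@le_trans _ _ (\int[L]_(x in B) (C1%:E * F (cinv c x)))%E).
    apply: ge0_le_integral => //.
    - by move=> x _; rewrite lee_fin sqr_ge0.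
    - by apply/measurable_EFinP; apply: measurable_funX.
    - apply: measurable_funeM; exact: measurable_cinv_patch.
    - move=> x Bx; rewrite lee_fin; have cx := Kc x (open_rect_closed Bx).
      have [d1 d2] := ccodP cx.
      rewrite (tensor_dot_chart sI (wd_tensorial wT) (wd_tensorial wT) ac d1) d2.
      by apply: h1 => //; exact: open_rect_closed.
  rewrite ge0_integralZl//; last 2 first.
    - exact: (measurable_cinv_patch Kc mF).
    - by rewrite ltW.
  rewrite -mulrA EFinM lee_pmul2l//; apply: (le_trans h3).
  by rewrite EFinM lee_pmul2l.
have iT : L.-integrable B (EFin \o (fun x => T c I x ^+ 2)).
  apply/integrableP; split; first by apply/measurable_EFinP; apply: measurable_funX.
  apply: le_lt_trans (ltry (C1 * C2 * dotT T T)); apply: le_trans h5.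
  by apply: le_of_eq; apply: eq_integral => x _; rewrite /= ger0_norm// sqr_ge0.
split; first by split.
by rewrite -lee_fin; apply: le_trans h5; rewrite fineK//; exact: integrable_fin_num.
Qed.

Lemma sobolev_L2 p : exists2 C : R, 0 < C & forall u T, wd u T -> sob T ->
  forall I, (size I <= r)%N ->
   sqint L (open_rect (plo 1 p) (phi 1 p)) (T (pchart p) I) /\
   \int[L]_(x in open_rect (plo 1 p) (phi 1 p)) (T (pchart p) I x ^+ 2) <= C * dotT T T.
Proof. by have [ac _] := pchartP p; apply: sobolev_L2_rect => //; exact: prect_sub. Qed.

End SobolevTensors.

(** * Fourier coefficients in a chart and the Sobolev embedding *)

Section PatchEstimate.
Implicit Types (T : covariant_tensors R U d) (u : U -> R).
Variable p : U.
Let c := pchart p.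
Let rho := pradius p.
Let a := plo 1 p.
Local Notation box := (box rho a).
Let ac : atlas M c. Proof. by have [] := pchartP p. Qed.
Let rho0 : 0 < rho. Proof. exact: pradius_gt0. Qed.

Let boxE : box = open_rect (plo 1 p) (phi 1 p).
Proof. by congr open_rect; apply/funext => i; rewrite /a /plo /phi -/rho; ring. Qed.

Let boxV : (box : set E) `<=` ccod c.
Proof. by rewrite boxE => x /open_rect_closed; exact: prect_sub. Qed.

Let open_box : open (box : set E). Proof. exact: open_open_rect. Qed.

(** The cut-off vanishes outside the inner box, the region on which [trig_unique] recovers a
    function. *)
Definition pchi : E -> R :=
  rect_bump 1 (fun i => a i + rho / 2) (fun i => a i + rho / 2 + rho).

Let tchi : test_function (box : set E) pchi.
Proof.
apply: rect_bump_test => // x hx i; have /andP[h1 h2] := hx i.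
have aux (y b t : R) : 0 < t -> b + t / 2 <= y -> y <= b + t / 2 + t -> b < y < b + t *+ 2.
  by move=> *; apply/andP; split; lra.
by rewrite /=; exact: aux.
Qed.

Definition pcut u (x : E) : R := pchi x * u (cinv c x).

Definition pcoef u (k : {ffun 'I_d -> nat}) : R :=
  \int[L]_(x in box) (pcut u x * etrig rho a (fun=> 0) k x).

Let mB := @measurable_box R d rho a.

Let pchi_measurable : measurable_fun setT (pchi : borel E -> R).
Proof. exact: test_function_measurable tchi. Qed.

Let pchi01 x : 0 <= pchi x <= 1.
Proof. by rewrite rect_bump_ge0 rect_bump_le1. Qed.

Lemma patch_sqint u T : wd u T -> sob T -> forall I, (size I <= r)%N -> sqint L box (T c I).
Proof.
move=> wT sT I sI; have [C _ h] := sobolev_L2 p.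
by rewrite boxE; have [] := h u T wT sT I sI.
Qed.

Lemma wd0 u T x : wd u T -> ccod c x -> T c [::] x = u (cinv c x).
Proof.
by move=> [_ h _] cx; have [h1 h2] := ccodP cx; have := h c ac _ h1; rewrite h2.
Qed.

Lemma pcut_sqint : exists2 C : R, 0 < C & forall u T, wd u T -> sob T ->
  sqint L box (pcut u) /\ \int[L]_(x in box) (pcut u x ^+ 2) <= C * dotT T T.
Proof.
have [C C0 h] := sobolev_L2 p.
exists C => // u T wT sT; rewrite boxE; have [s1 l1] := h u T wT sT [::] (leq0n _).
have s2 : sqint L (open_rect (plo 1 p) (phi 1 p)) (u \o cinv c).
  have e x : (open_rect (plo 1 p) (phi 1 p) : set E) x -> T c [::] x = u (cinv c x).
    by move=> hx; apply: wd0 wT _; apply: boxV; rewrite boxE.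
  have [m1 i1] := s1; split.
    by apply: eq_measurable_fun m1 => x; rewrite inE; exact: e.
  apply: eq_integrable i1; first exact: measurable_open_rect.
  by move=> x; rewrite inE => hx /=; rewrite e.
have := @sqint_bounded_mul _ _ _ L _ (@measurable_open_rect R d _ _) (u \o cinv c) pchi 1
  (measurable_funTS pchi_measurable) _ s2.
have hb x : open_rect (plo 1 p) (phi 1 p) x -> `|pchi x| <= 1.
  by move=> _; have /andP[h0 h1] := pchi01 x; rewrite ger0_norm.
move=> /(_ hb) [s3 l3]; split => //; apply: (le_trans l3).
rewrite expr1n mul1r; apply: le_trans l1; apply: le_of_eq.
congr fine; apply: eq_integral => x; rewrite inE => hx; congr EFin.
by rewrite (wd0 wT)//; apply: boxV; rewrite boxE.
Qed.

(** The r-th power of the frequency times a coefficient of the cut-off function is a coefficient of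
    one combination F of tensor components, in the system of phase tau. Bessel's inequality for F
    finishes. *)
Lemma pcoef_direction i : exists2 C : R, 0 < C & forall u T, wd u T -> sob T ->
  forall s : seq {ffun 'I_d -> nat}, uniq s ->
   \sum_(k <- s) ((uphalf (k i))%:R * freq rho) ^+ (2 * r) * pcoef u k ^+ 2 <= C * dotT T T.
Proof.
have [K [J [b [hJ hred]]]] := iter_by_parts ac open_box boxV i
  (I := [::]) (m := r) (leqnn r) tchi.
have [C C0 hC] := sobolev_L2 p.
have /choice[bd hbd] : forall k, exists B : R, 0 <= B /\ forall x, `|b k x| <= B.
  by move=> k; have [_ tb] := hJ k; have [B B0 hB] := test_function_bounded tb; exists B.
pose A k := bd k ^+ 2 * C.
have A0 k : 0 <= A k by rewrite mulr_ge0 ?sqr_ge0// ltW.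
exists (rho ^+ d * (#|K|%:R * \sum_k A k) + 1).
  by rewrite ltr_wpDl// !mulr_ge0 ?exprn_ge0 ?(ltW rho0)//; apply: sumr_ge0.
move=> u T wT sT s us.
have D0 := dotT_ge0 T.
pose F x := \sum_k b k x * T c (J k) x.
have [sF lF] : sqint L box F /\ \int[L]_(x in box) (F x ^+ 2) <= #|K|%:R * (\sum_k A k) * dotT T T.
  apply: sqint_sum => // k; have [sJ tb] := hJ k.
  have [s1 l1] := hC u T wT sT (J k) sJ; rewrite -boxE in s1 l1.
  have [s2 l2] := sqint_bounded_mul mB (measurable_funTS (test_function_measurable tb)) (fun x _ => (hbd k).2 x) s1.
  split => //; apply: (le_trans l2); rewrite /A -mulrA ler_wpM2l ?sqr_ge0//.
(* With this phase, r derivatives in direction i lead to the system used in [pcoef]. *)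
pose tau (j : 'I_d) : R := if j == i then - (r%:R * (pi / 2)) else 0.
have key (k : {ffun 'I_d -> nat}) : ((uphalf (k i))%:R * freq rho) ^+ r * pcoef u k =
    \int[L]_(x in box) (F x * etrig rho a tau k x).
  have se := etrig_smooth rho a tau k.
  have := hred u T (etrig rho a tau k) wT se.
  rewrite iter_partial_etrig.
  set w := _ ^+ r; set e0 := etrig rho a _ k => h.
  have i1 : L.-integrable box (EFin \o (fun x => pcut u x * e0 x)).
    have [C' _ h'] := pcut_sqint; have [sv _] := h' u T wT sT.
    exact: (sqintM mB sv (etrig_sqint rho a _ k)).
  have e1 : w * pcoef u k = \int[L]_(x in ccod c) (T c [::] x * (pchi x * (w * e0 x))).
    apply: (etrans (esym (RintegralZl w mB i1))).
    rewrite (Rint_supp (C := box) (D := (ccod c : set (borel E))))//; last first.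
      by move=> x nx; rewrite /pchi rect_bump_out// ?mul0r ?mulr0// => hx; apply: nx; exact: inner_box_sub.
    congr fine; apply: eq_integral => x; rewrite inE => xB; congr EFin.
    by rewrite (wd0 wT) ?/pcut; [ring|exact: boxV].
  rewrite e1; apply: (etrans h).
  have i2 j : L.-integrable box (EFin \o (fun x => (b j x * T c (J j) x) * etrig rho a tau k x)).
    have [sJ tb] := hJ j; have s1 := patch_sqint wT sT sJ.
    have [s2 _] := sqint_bounded_mul mB (measurable_funTS (test_function_measurable tb)) (fun x _ => (hbd j).2 x) s1.
    exact: (sqintM mB s2 (etrig_sqint rho a tau k)).
  have eF : (fun x => F x * etrig rho a tau k x) = (fun x => \sum_j (b j x * T c (J j) x) * etrig rho a tau k x).
    by apply/funext => x; rewrite mulr_suml.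
  rewrite eF; apply: (etrans _ (esym (Rintegral_sum (index_enum K) mB (fun j (_ : xpredT j) => i2 j)))).
  apply: eq_bigr => j _; have [_ [_ [Cj [_ CB bj0]]]] := hJ j.
  rewrite (Rint_supp (C := box) (D := (ccod c : set (borel E))))//; last first.
    by move=> x nx; rewrite bj0 ?mul0r ?mulr0// => /CB.
  by apply: eq_Rintegral => x _; ring.
have r0d : 0 < rho ^+ d by rewrite exprn_gt0.
have := @bessel _ _ _ L box _ (fun k : {ffun 'I_d -> nat} => etrig rho a tau k) (rho ^+ d) mB r0d
  (fun k => etrig_sqint rho a tau k) (fun k l => etrig_orth a rho0 tau k l) F s us sF.
have -> : \sum_(k <- s) (\int[L]_(x in box) (F x * etrig rho a tau k x)) ^+ 2 =
   \sum_(k <- s) ((uphalf (k i))%:R * freq rho) ^+ (2 * r) * pcoef u k ^+ 2.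
  by apply: eq_bigr => k _; rewrite -key exprMn -exprM mulnC.
move=> h; apply: (le_trans h); rewrite mulrDl mul1r.
apply: (@le_trans _ _ (rho ^+ d * (#|K|%:R * (\sum_k A k)) * dotT T T)); last by rewrite lerDl.
by rewrite -mulrA ler_pM2l.
Qed.

Lemma pcoef_weighted : exists2 C : R, 0 < C & forall u T, wd u T -> sob T ->
  forall s : seq {ffun 'I_d -> nat}, uniq s ->
   \sum_(k <- s) weight r (freq rho) k * pcoef u k ^+ 2 <= C * dotT T T.
Proof.
have [C C0 hC] := pcut_sqint.
have /choice[D hD] : forall i, exists C : R, 0 < C /\ forall u T, wd u T -> sob T ->
  forall s : seq {ffun 'I_d -> nat}, uniq s ->
   \sum_(k <- s) ((uphalf (k i))%:R * freq rho) ^+ (2 * r) * pcoef u k ^+ 2 <= C * dotT T T.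
  by move=> i; have [C' C'0 h] := pcoef_direction i; exists C'.
exists (rho ^+ d * C + \sum_i D i).
  rewrite ltr_pwDl ?mulr_gt0 ?exprn_gt0//; apply: sumr_ge0 => i _; have [D0 _] := hD i; exact: ltW.
move=> u T wT sT s us; have [sv lv] := hC u T wT sT.
have -> : \sum_(k <- s) weight r (freq rho) k * pcoef u k ^+ 2 = \sum_(k <- s) pcoef u k ^+ 2 +
    \sum_i \sum_(k <- s) ((uphalf (k i))%:R * freq rho) ^+ (2 * r) * pcoef u k ^+ 2.
  rewrite exchange_big -big_split; apply: eq_bigr => k _ /=.
  by rewrite mulrDl mul1r mulr_suml.
rewrite mulrDl; apply: lerD.
  have r0d : 0 < rho ^+ d by rewrite exprn_gt0.
  have := @bessel _ _ _ L box _ (fun k : {ffun 'I_d -> nat} => etrig rho a (fun=> 0) k) (rho ^+ d) mB r0d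
    (fun k => etrig_sqint rho a _ k) (fun k l => etrig_orth a rho0 _ k l) (pcut u) s us sv.
  by move=> h; apply: (le_trans h); rewrite -mulrA ler_pM2l.
by rewrite mulr_suml; apply: ler_sum => i _; have [_ h] := hD i; exact: h.
Qed.

Definition box_index N (k : {ffun 'I_d -> 'I_N.+1}) : {ffun 'I_d -> nat} :=
  [ffun i => k i : nat].

(** Indices with some k_i > N have weight at least l (N+1)^(2r), which gives the remainder. The
    three summands of C serve the sup bound, the low frequencies and the remainder. *)
Lemma pcut_series : exists2 C : R, 0 < C & forall u T, wd u T -> sob T ->
  exists g : E -> R, [/\ continuous g, forall x, `|g x| <= C * Num.sqrt (dotT T T),
    {ae L, forall x, inner_box rho a x -> pcut u x = g x} &
    forall N, \int[L]_(x in box) (pcut u x ^+ 2) <=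
      C * (\sum_(k : {ffun 'I_d -> 'I_N.+1}) pcoef u (box_index k) ^+ 2 +
           dotT T T / N.+1%:R ^+ (2 * r))].
Proof.
have w0 := freq_gt0 rho0.
have [A A0 hA] := pcoef_weighted.
have [S S0 hS] := weight_summable d_gt0 rd w0.
have [l l0 hl] := @weight_lower R d r _ w0.
have r0d : 0 < (rho ^+ d)^-1 by rewrite invr_gt0 exprn_gt0.
pose C := (rho ^+ d)^-1 * (Num.sqrt (A * S) + 1 + A / l).
have C0 : 0 < C.
  by rewrite mulr_gt0// -addrA ltr_wpDl ?sqrtr_ge0// ltr_pwDl// divr_ge0// ltW.
exists C => // u T wT sT; have D0 := dotT_ge0 T.
have [C' _ hC'] := pcut_sqint; have [sv _] := hC' u T wT sT.
have v0 x : ~ inner_box rho a x -> pcut u x = 0.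
  by move=> nx; rewrite /pcut /pchi rect_bump_out ?mul0r.
have W0 (k : {ffun 'I_d -> nat}) : 0 < weight r (freq rho) k.
  by apply: lt_le_trans ltr01 _; exact: weight_ge1.
have [g [cg gb gv gp]] := trig_series rho0 sv v0 W0 (hA u T wT sT) hS.
exists g; split => //.
  move=> x; apply: (le_trans (gb x)); rewrite /C -[leRHS]mulrA ler_pM2l// mulrAC sqrtrM ?mulr_ge0 ?(ltW A0) ?(ltW S0)//.
  by rewrite ler_wpM2r ?sqrtr_ge0// -addrA lerDl addr_ge0// divr_ge0// ltW.
move=> N; set Sg := \sum_(k : _) _.
have Sg0 : 0 <= Sg by apply: sumr_ge0 => k _; exact: sqr_ge0.
apply: (@le_trans _ _ ((rho ^+ d)^-1 * (Sg + A / l * (dotT T T / N.+1%:R ^+ (2 * r))))); last first.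
  rewrite /C -[leRHS]mulrA ler_pM2l//.
  have := sqrtr_ge0 (A * S); have : 0 <= A / l by rewrite divr_ge0// ltW.
  have : 0 <= dotT T T / N.+1%:R ^+ (2 * r) by rewrite divr_ge0// ltW.
  move: (A / l) (Num.sqrt _) (dotT T T / _) Sg0 => x y z; move: Sg => t *; nra.
apply: gp => s us.
rewrite (bigID (fun k : {ffun 'I_d -> nat} => [forall i, (k i < N.+1)%N])); apply: lerD.
  rewrite -big_filter; set s1 := seq.filter _ s.
  have us1 : uniq s1 by exact: filter_uniq.
  have hs1 k i : k \in s1 -> (k i < N.+1)%N by rewrite mem_filter => /andP[/forallP/(_ i)].
  pose t (k : {ffun 'I_d -> nat}) : {ffun 'I_d -> 'I_N.+1} := [ffun i => inord (k i)].
  have tK k : k \in s1 -> box_index (t k) = k.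
    by move=> ks; apply/ffunP => i; rewrite !ffunE inordK//; exact: hs1.
  have ut : uniq (map t s1).
    by rewrite map_inj_in_uniq// => k l' ks ls tkl; rewrite -(tK k ks) tkl tK.
  have -> : \sum_(k <- s1) pcoef u k ^+ 2 = \sum_(k <- map t s1) pcoef u (box_index k) ^+ 2.
    by rewrite big_map big_seq [RHS]big_seq; apply: eq_bigr => k ks; rewrite tK.
  rewrite big_uniq//= [leRHS](bigID (mem (map t s1)))/= lerDl.
  by apply: sumr_ge0 => k _; exact: sqr_ge0.
rewrite -big_filter; set s2 := seq.filter _ s.
have us2 : uniq s2 by exact: filter_uniq.
have := hA u T wT sT s2 us2 => h2.
apply: (@le_trans _ _ (\sum_(k <- s2) (l * N.+1%:R ^+ (2 * r))^-1 * (weight r (freq rho) k * pcoef u k ^+ 2))).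
  rewrite big_seq [leRHS]big_seq; apply: ler_sum => k; rewrite mem_filter => /andP[+ _].
  rewrite negb_forall => /existsP[i]; rewrite -leqNgt => hi.
  rewrite mulrA -[leLHS]mul1r ler_wpM2r ?sqr_ge0// mulrC ler_pdivlMr ?mulr_gt0// mul1r.
  apply: le_trans (hl k i); rewrite ler_pM2l// lerXn2r ?nnegrE// ler_nat.
  exact: leq_trans.
rewrite -mulr_sumr invfM.
apply: (@le_trans _ _ (l^-1 * (N.+1%:R ^+ (2 * r))^-1 * (A * dotT T T))).
  by rewrite ler_wpM2l// mulr_ge0 ?invr_ge0 ?ltW.
by apply: le_of_eq; ring.
Qed.

End PatchEstimate.

Section Embedding.
Implicit Types (T : covariant_tensors R U d) (u v : U -> R) (p q : U).
Local Notation sobolev := (sobolev M vol r).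
Local Notation Q p := (ppatch 4^-1 p).
Local Notation pbox p := (box (pradius p) (plo 1 p)).

Lemma sdotE u : sobolev u -> sdot u u = dotT (nabla M r u) (nabla M r u).
Proof.
move=> /(sobolevP)[wu _].
exact: sobolev_dotE.
Qed.

Let quarter_inner p : closed_rect (plo 4^-1 p) (phi 4^-1 p) `<=`
  (open_rect (fun i => plo 1 p i + pradius p / 2)
     (fun i => plo 1 p i + pradius p / 2 + pradius p) : set E).
Proof.
move=> x hx i; have := hx i; have := pradius_gt0 p; rewrite /= in_itv /plo /phi /=.
move: (pradius p) (pcenter p 0 i) (x 0 i) => t b y t0 /andP[h1 h2].
by apply/andP; split; lra.
Qed.

Lemma pchi_lower p : exists2 de : R, 0 < de &
  forall x, closed_rect (plo 4^-1 p) (phi 4^-1 p) x -> de <= pchi p x.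
Proof.
have cK := @compact_closed_rect R d (plo 4^-1 p) (phi 4^-1 p).
have pos x : closed_rect (plo 4^-1 p) (phi 4^-1 p) x -> 0 < pchi p x.
  by move=> hx; apply: rect_bump_gt0 => //; exact: quarter_inner.
have [C C0 hC] : exists2 C : R, 0 < C & forall x,
    closed_rect (plo 4^-1 p) (phi 4^-1 p) x -> `|(pchi p x)^-1| <= C.
  apply: (compact_bound cK) => x Kx; apply: continuousV; first by rewrite gt_eqF// pos.
  exact: (smooth_continuous (rect_bump_smooth 1 _ _) Logic.I).
exists C^-1; first by rewrite invr_gt0.
move=> x Kx; have := hC x Kx; have p0 := pos x Kx.
rewrite ger0_norm ?invr_ge0 ?(ltW p0)// => h.
by rewrite -[leRHS]invrK lef_pV2// posrE invr_gt0.
Qed.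

Let Q_sub p : closed_rect (plo 4^-1 p) (phi 4^-1 p) `<=` ccod (pchart p).
Proof. by apply: prect_sub; rewrite invf_le1// ler1n. Qed.

Let rect_quarter p : open_rect (plo 4^-1 p) (phi 4^-1 p) `<=` pbox p.
Proof. by move=> x /open_rect_closed/quarter_inner; exact: inner_box_sub. Qed.

(** On the quarter patch the cut-off is at least de, so u is almost everywhere the sum of the
    trigonometric series divided by the cut-off. *)
Lemma local_representative p : exists2 C : R, 0 < C & forall u, sobolev u ->
  exists G : U -> R, [/\ forall q, Q p q -> {for q, continuous G},
    forall q, Q p q -> `|G q| <= C * Num.sqrt (sdot u u) &
    {ae vol, forall q, Q p q -> u q = G q}].
Proof.
have [C C0 hC] := pcut_series p.
have [de de0 hde] := pchi_lower p.
have [ac _] := pchartP p; set c := pchart p in ac *.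
exists (C / de); first by rewrite divr_gt0.
move=> u su; have [wu sbu] := sobolevP su.
have [g [cg gb gv _]] := hC u _ wu sbu.
have Qx q : Q p q -> closed_rect (plo 4^-1 p) (phi 4^-1 p) (cmap c q).
  by move=> [_ /open_rect_closed].
exists (fun q => g (cmap c q) / pchi p (cmap c q)); split.
- move=> q pq; have [cq _] := pq; have hx := Qx q pq.
  have cm := cmap_continuous cq.
  apply: (@continuous_comp _ _ _ (cmap c) (fun x => g x / pchi p x)) => //.
  apply: continuousM; first exact: cg.
  apply: continuousV; first by rewrite gt_eqF// (lt_le_trans de0)// hde.
  exact: (smooth_continuous (rect_bump_smooth 1 _ _) Logic.I).
- move=> q pq; have hx := Qx q pq; have h1 := hde _ hx.
  have p0 : 0 < pchi p (cmap c q) by exact: lt_le_trans h1.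
  rewrite normrM [`|_^-1|]ger0_norm ?invr_ge0 ?(ltW p0)// [leRHS]mulrAC.
  by apply: ler_pM; rewrite ?invr_ge0 ?(ltW p0)// lef_pV2.
- have h : {ae L, forall x, open_rect (plo 4^-1 p) (phi 4^-1 p) x ->
      u (cinv c x) = g x / pchi p x}.
    apply: ae_imp gv => x hx xB; have hK := open_rect_closed xB.
    have := hx (quarter_inner hK); rewrite /pcut => <-.
    by rewrite mulrC mulKf// gt_eqF// (lt_le_trans de0)// hde.
  apply: ae_imp (ae_cmap ac (@Q_sub p) h) => q hq pq.
  by have := hq pq; have [cq _] := pq; rewrite cmapK.
Qed.

Lemma local_approx p : exists2 C : R, 0 < C & forall u N, sobolev u ->
  \int[vol]_(q in Q p) (u q ^+ 2) <=
   C * (\sum_(k : {ffun 'I_d -> 'I_N.+1}) pcoef p u (box_index k) ^+ 2 +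
        sdot u u / N.+1%:R ^+ (2 * r)).
Proof.
have [C C0 hC] := pcut_series p.
have [de de0 hde] := pchi_lower p.
have [ac _] := pchartP p; set c := pchart p in ac *.
have [C2 C20 h2] := patch_integral ac (@Q_sub p).
have [C3 _ h3] := pcut_sqint p.
exists (C2 * (de ^- 2 * C)); first by rewrite !mulr_gt0// invr_gt0 exprn_gt0.
move=> u N su; have [wu sbu] := sobolevP su.
have [g [_ _ _ gN]] := hC u _ wu sbu; have := gN N; rewrite -sdotE//.
set X := C * _ => hX.
have [sv _] := h3 u _ wu sbu.
have [mu2 [iu2 _]] := sobolev_sq_integrable su.
have mQ : measurable (Q p : set (borel U)) by apply: open_borel; exact: open_ppatch.
have mF : measurable_fun (Q p : set (borel U)) (fun q : borel U => (u q ^+ 2)%:E).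
  by apply/measurable_EFinP; exact: measurable_funTS.
have F0 q : (0 <= (u q ^+ 2)%:E)%E by rewrite lee_fin sqr_ge0.
have [_ h4] := h2 _ mF (fun q _ => F0 q).
have mB := @measurable_box R d (pradius p) (plo 1 p).
have mr := @measurable_open_rect R d (plo 4^-1 p) (phi 4^-1 p).
have de2 : 0 <= de ^- 2 by rewrite invr_ge0 exprn_ge0// ltW.
have h5 : (\int[L]_(x in open_rect (plo 4^-1 p) (phi 4^-1 p)) (u (cinv c x) ^+ 2)%:E <=
   (de ^- 2 * X)%:E)%E.
  apply: (@le_trans _ _ (\int[L]_(x in pbox p) ((de ^- 2 * pcut p u x ^+ 2)%:E))%E).
    apply: (@le_trans _ _ (\int[L]_(x in open_rect (plo 4^-1 p) (phi 4^-1 p)) ((de ^- 2 * pcut p u x ^+ 2)%:E))%E).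
      apply: ge0_le_integral => //.
      - exact: (measurable_cinv_patch (@Q_sub p) mF).
      - apply/measurable_EFinP; apply: measurable_funM => //; apply: measurable_funX.
        by apply: measurable_funS sv.1 => //; exact: rect_quarter.
      - move=> x xB; rewrite lee_fin exprMn mulrA.
        have h := hde x (open_rect_closed xB).
        rewrite -[leLHS]mul1r ler_wpM2r ?sqr_ge0// mulrC ler_pdivlMr ?exprn_gt0// mul1r.
        by rewrite lerXn2r ?nnegrE ?(ltW de0)// (le_trans (ltW de0)).
    apply: ge0_subset_integral => //.
    - by apply/measurable_EFinP; apply: measurable_funM => //; apply: measurable_funX; exact: sv.1.
    - by move=> x _; rewrite lee_fin mulr_ge0// sqr_ge0.
  have iv := RintegrableZ (de ^- 2) mB sv.2.
  rewrite -[X in (X <= _)%E](fineK (integrable_fin_num mB iv)).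
  have e1 := RintegralZl (de ^- 2) mB sv.2.
  apply: (@le_trans _ _ (de ^- 2 * \int[L]_(x in pbox p) (pcut p u x ^+ 2))); first by rewrite -e1.
  by rewrite ler_wpM2l.
have iQ : vol.-integrable (Q p) (EFin \o (fun q => u q ^+ 2)).
  exact: integrableS iu2.
rewrite -lee_fin; apply: (@le_trans _ _ (\int[vol]_(q in Q p) (u q ^+ 2)%:E)%E).
  by have := fineK (integrable_fin_num mQ iQ) => /= <-.
apply: (le_trans h4); rewrite -!mulrA EFinM lee_pmul2l//.
Qed.

Lemma pcoef_bound p : exists2 C : R, 0 < C & forall u k, sobolev u ->
  pcoef p u k ^+ 2 <= C * sdot u u.
Proof.
have [C C0 hC] := pcoef_weighted p.
exists C => // u k su; have [wu sbu] := sobolevP su.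
have := hC u _ wu sbu [:: k] isT; rewrite big_seq1 => h; apply: le_trans h.
rewrite -[leLHS]mul1r ler_wpM2r ?sqr_ge0//; apply: weight_ge1.
exact: freq_gt0 (pradius_gt0 p).
Qed.

Lemma pcoef_lin p k s u v : sobolev u -> sobolev v ->
  pcoef p (fun q => s * u q + v q) k = s * pcoef p u k + pcoef p v k.
Proof.
move=> su sv; have [wu sbu] := sobolevP su.
have [wv sbv] := sobolevP sv.
have [C3 _ h3] := pcut_sqint p.
have [iu _] := h3 u _ wu sbu; have [iv _] := h3 v _ wv sbv.
have mB := @measurable_box R d (pradius p) (plo 1 p).
have se := etrig_sqint (pradius p) (plo 1 p) (fun=> 0) k.
have i1 := sqintM mB iu se; have i2 := sqintM mB iv se.
by apply: (Rintegral_axpy mB i1 i2) => x; rewrite /pcut; ring.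
Qed.

Lemma vol_open_pos (W : set U) p : open W -> W p -> forall P : U -> Prop,
  {ae vol, forall q, P q} -> exists2 q, W q & P q.
Proof.
move=> oW Wp P hP; have [ac cp] := pchartP p; set c := pchart p in ac cp *.
have Kc := @prect_sub 1 p (lexx _).
have h1 := ae_cinv ac Kc hP.
have oO : open (ppatch 1 p `&` W) by apply: openI => //; exact: open_ppatch.
have oB : open ((open_rect (plo 1 p) (phi 1 p) : set E) `&` cinv c @^-1` W).
  apply: continuous_open_preimage => //; first exact: open_open_rect.
  by move=> x /open_rect_closed/Kc cx; exact: cinv_continuous.
have Bp : ((open_rect (plo 1 p) (phi 1 p) : set E) `&` cinv c @^-1` W) (pcenter p).
  split; first by have [] := @ppatch_center 1 p ltr01.
  by rewrite /= cmapK.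
have [x [xB xW] hx] := ae_open_nonempty h1 oB Bp.
by exists (cinv c x) => //; exact: hx.
Qed.

Lemma ae_continuous_eq (G H : U -> R) p : {for p, continuous G} -> {for p, continuous H} ->
  forall W, open W -> W p -> {ae vol, forall q, W q -> G q = H q} -> G p = H p.
Proof.
move=> cG cH W oW Wp h; apply/eqP; rewrite -subr_eq0; apply: contraT => n0.
have e0 : 0 < `|G p - H p| by rewrite normr_gt0.
have cD : {for p, continuous (fun q => G q - H q)} by exact: continuousB.
have h1 : \forall q \near p, `|(G p - H p) - (G q - H q)| < `|G p - H p|.
  by move/cvgrPdist_lt : cD => /(_ _ e0).
have h2 : \forall q \near p, W q by exact: open_nbhs_nbhs.
have FF : Filter (nbhs p) := nbhs_filter p.
have h3 : nbhs p ([set q | `|(G p - H p) - (G q - H q)| < `|G p - H p|] `&` W) := @filterI _ _ FF _ _ h1 h2.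
move: h3; rewrite nbhsE => -[B]; rewrite /= => -[oB Bp] sB.
have [q Bq hq] := vol_open_pos oB Bp h.
have [l Wq] := sB _ Bq; move: l; by rewrite /= (hq Wq) subrr subr0 ltxx.
Qed.

End Embedding.

(** * From patches to the whole manifold *)

Section Gluing.
Implicit Types (T : covariant_tensors R U d) (u v : U -> R) (p q : U).
Local Notation sobolev := (sobolev M vol r).
Local Notation Q p := (ppatch 4^-1 p).

Let k0 : 0 < 4^-1 :> R. Proof. by rewrite invr_gt0. Qed.

(** The local representatives agree on overlaps, being continuous and almost everywhere equal to u;
    the diagonal [G q q] then glues them. *)
Lemma continuous_representative u : sobolev u ->
  exists! f : U -> R, continuous f /\ {ae vol, forall p, u p = f p}.
Proof.
move=> su.
have /choice[G hG] : forall p, exists G : U -> R, (forall q, Q p q -> {for q, continuous G}) /\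
    {ae vol, forall q, Q p q -> u q = G q}.
  by move=> p; have [C _ /(_ u su)[G [h1 _ h2]]] := local_representative p; exists G.
have cen p : Q p p by exact: ppatch_center.
have glue p q : Q p q -> G q q = G p q.
  move=> pq; have [cp ap] := hG p; have [cq aq] := hG q.
  have oW : open (Q p `&` Q q) by apply: openI; exact: open_ppatch.
  apply: (ae_continuous_eq (cq _ (cen q)) (cp _ pq) oW) => //.
  by apply: ae_imp2 ap aq => x h1 h2 [/h1 <- /h2 <-].
exists (fun q => G q q); split; first split.
- move=> p; have [cp _] := hG p.
  have e : \forall q \near p, G p q = G q q.
    have : \forall q \near p, Q p q by apply: open_nbhs_nbhs; split => //; exact: open_ppatch.
    by apply: filterS => q /glue.
  have h : G p q @[q --> p] --> G p p := cp p (cen p).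
  exact: cvg_trans (near_eq_cvg e) h.
- apply: (ae_ppatch k0) => p; have [_ ap] := hG p.
  by apply: ae_imp ap => q hq pq; rewrite (glue p q pq); exact: hq.
- move=> f [cf af]; apply/funext => q; have [cq aq] := hG q.
  apply: (ae_continuous_eq (cq _ (cen q)) (cf q) (open_ppatch 4^-1 q)) => //.
  by apply: ae_imp2 aq af => x h1 h2 /h1 <-.
Qed.

Lemma sup_bound : exists2 C : R, 0 < C & forall f, sobolevC f ->
  forall q, `|f q| <= C * Num.sqrt (sdot f f).
Proof.
have /choice[C hC] : forall p, exists C : R, 0 < C /\ forall f, sobolevC f ->
    forall q, Q p q -> `|f q| <= C * Num.sqrt (sdot f f).
  move=> p; have [C C0 h] := local_representative p.
  exists C; split => // f [sf cf] q pq; have [G [cG bG aG]] := h f sf.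
  rewrite (_ : f q = G q); first exact: bG.
  exact: (ae_continuous_eq (cf q) (cG _ pq) (open_ppatch 4^-1 p)).
have [s hs] := finite_ppatch k0.
pose t := tnth (in_tuple s).
exists (1 + \sum_i C (t i)).
  by rewrite ltr_pwDl// sumr_ge0// => i _; have [/ltW] := hC (t i).
move=> f sf q; have [p /seq_tnthP[i ->] pq] := hs q; have [C0 h] := hC (t i).
apply: (le_trans (h f sf q pq)); rewrite ler_wpM2r ?sqrtr_ge0//.
rewrite (bigD1 i)//= addrCA lerDl addr_ge0// sumr_ge0// => j _.
by have [/ltW] := hC (t j).
Qed.

Lemma sobolev_approx : exists (I : finType) (l : I -> forall N, {ffun 'I_d -> 'I_N.+1} -> (U -> R) -> R) (C : R), [/\ 0 < C,
  forall i N k s u v, sobolev u -> sobolev v ->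
    l i N k (fun q => s * u q + v q) = s * l i N k u + l i N k v,
  forall i N k, exists C' : R, forall u, sobolev u -> l i N k u ^+ 2 <= C' * sdot u u &
  forall u N, sobolev u -> \int[vol]_q (u q ^+ 2) <=
   C * (\sum_i \sum_k l i N k u ^+ 2 + sdot u u / N.+1%:R ^+ (2 * r))].
Proof.
have /choice[C hC] : forall p, exists C : R, 0 < C /\ forall u N, sobolev u ->
  \int[vol]_(q in Q p) (u q ^+ 2) <=
   C * (\sum_(k : {ffun 'I_d -> 'I_N.+1}) pcoef p u (box_index k) ^+ 2 +
        sdot u u / N.+1%:R ^+ (2 * r)).
  by move=> p; have [C C0 h] := local_approx p; exists C.
have [s hs] := finite_ppatch k0.
pose t := tnth (in_tuple s).
have ht q : exists i, Q (t i) q.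
  by have [p /seq_tnthP[i ->] pq] := hs q; exists i.
exists 'I_(size s), (fun i N k u => pcoef (t i) u (box_index k)), (1 + \sum_i C (t i)); split.
- by rewrite ltr_pwDl// sumr_ge0// => i _; have [/ltW] := hC (t i).
- by move=> i N k a u v su sv; exact: (pcoef_lin).
- move=> i N k; have [C' _ h] := pcoef_bound (t i).
  by exists C' => u su; exact: h.
- move=> u N su; set D := sdot u u / _.
  have D0 : 0 <= D by rewrite divr_ge0 ?exprn_ge0// sobolev_dot_ge0.
  have [mu2 [iu2 _]] := sobolev_sq_integrable su.
  have mQ p : measurable (Q p : set (borel U)) by apply: open_borel; exact: open_ppatch.
  have iQ p : vol.-integrable (Q p) (EFin \o (fun q => u q ^+ 2)).
    exact: integrableS iu2.
  have i0 : \int[vol]_q (u q ^+ 2) <= \sum_i \int[vol]_(q in Q (t i)) (u q ^+ 2).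
    have mT := @measurableT _ (borel U).
    have e1 : (\int[vol]_q (u q ^+ 2)%:E <= \sum_i \int[vol]_(q in Q (t i)) (u q ^+ 2)%:E)%E.
      apply: integral_cover => //.
      - by move=> q; rewrite lee_fin sqr_ge0.
      - exact/measurable_EFinP.
      - by move=> i; apply/measurable_EFinP; exact: measurable_funTS.
    have e2 : (\int[vol]_q (u q ^+ 2)%:E = (\int[vol]_q (u q ^+ 2))%:E)%E.
      by rewrite -(fineK (integrable_fin_num mT iu2)).
    have e3 i : (\int[vol]_(q in Q (t i)) (u q ^+ 2)%:E = (\int[vol]_(q in Q (t i)) (u q ^+ 2))%:E)%E.
      by rewrite -(fineK (integrable_fin_num (mQ (t i)) (iQ (t i)))).
    by move: e1; rewrite e2 (eq_bigr _ (fun i _ => e3 i)) sumEFin.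
  apply: (le_trans i0); rewrite mulrDl mul1r ler_wpDl//.
    by rewrite addr_ge0// sumr_ge0// => i _; apply: sumr_ge0 => k _; exact: sqr_ge0.
  rewrite mulr_suml; apply: ler_sum => i _; have [C0 h] := hC (t i).
  apply: (le_trans (h u N su)); rewrite ler_pM2l// lerD2r (bigD1 i)//= lerDl.
  by apply: sumr_ge0 => j _; apply: sumr_ge0 => k _; exact: sqr_ge0.
Qed.

End Gluing.

(** * Completeness *)

Section Completeness.
Implicit Types (T W N : covariant_tensors R U d) (u v : U -> R) (p q : U) (c : chart R U d).

(** Finitely many rectangles cover K, and Cauchy-Schwarz on each turns the L^2 bound into an L^1
    bound, the input for dominated convergence in charts. *)
Lemma sobolev_L1 c (K : set E) : atlas M c -> compact K -> K `<=` ccod c ->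
  exists C : R, forall u T, wd u T -> sob T -> forall I, (size I <= r)%N ->
    (\int[L]_(x in K) `|T c I x|%:E <= (C * Num.sqrt (dotT T T))%:E)%E.
Proof.
move=> ac cK KV; have [n [a [b [sV hK]]]] := compact_rects cK (@open_ccod c) KV.
have /choice[C hC] : forall i, exists C : R, 0 < C /\ forall u T, wd u T -> sob T ->
    forall I, (size I <= r)%N -> sqint L (open_rect (a i) (b i)) (T c I) /\
   \int[L]_(x in open_rect (a i) (b i)) (T c I x ^+ 2) <= C * dotT T T.
  move=> i; have [C C0 h] := sobolev_L2_rect ac (sV i).
  by exists C.
pose l i := fine (L (open_rect (a i) (b i))).
exists (\sum_i Num.sqrt (l i * C i)) => u T wT sT I sI.
have mR i : measurable (open_rect (a i) (b i)) by exact: measurable_open_rect.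
have lR i : (L (open_rect (a i) (b i)) < +oo)%E.
  apply: le_lt_trans (compact_lty (@compact_closed_rect R d (a i) (b i))).
  apply: le_measure; rewrite ?inE//; last exact: open_rect_closed.
  by apply: compact_borel; exact: compact_closed_rect.
have mT i : measurable_fun (open_rect (a i) (b i)) (fun x => `|T c I x|).
  by have [_ /(_ u T wT sT I sI)[[h _] _]] := hC i; exact: measurableT_comp.
have lT := wd_locally_integrable wT ac sI.
have mTK : measurable_fun (K : set (borel E)) (fun x => `|T c I x|%:E).
  by apply/measurable_EFinP; apply: measurableT_comp; have := lT K cK KV => /measurable_int/measurable_EFinP.
apply: (le_trans (integral_cover L (compact_borel cK) mR _ mTK _ hK)).
- by move=> x; rewrite lee_fin.
- by move=> i; apply/measurable_EFinP.
rewrite mulr_suml -sumEFin; apply: lee_sum => i _.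
have [C0 /(_ u T wT sT I sI)[sq bq]] := hC i.
have s1 : sqint L (open_rect (a i) (b i)) (cst 1).
  split; first exact: measurable_cst.
  apply: (eq_integrable _ (cst 1%E)) => //; first by move=> x _ /=; rewrite expr1n.
  apply/integrableP; split; first exact: measurable_cst.
  by under eq_integral do rewrite abse1; rewrite integral_cst// mul1e; exact: lR.
have sa : sqint L (open_rect (a i) (b i)) (fun x => `|T c I x|).
  by split => //; apply: eq_integrable sq.2 => // x _ /=; rewrite -normrX ger0_norm// sqr_ge0.
have cs := cauchy_schwarz_int (mR i) s1 sa.
have e1 : \int[L]_(x in open_rect (a i) (b i)) ((cst 1 x) ^+ 2) = l i.
  rewrite /l; congr fine; under eq_integral do rewrite expr1n.
  by rewrite integral_cst// mul1e.
have e2 : \int[L]_(x in open_rect (a i) (b i)) (`|T c I x| ^+ 2) = \int[L]_(x in open_rect (a i) (b i)) (T c I x ^+ 2).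
  by apply: eq_Rintegral => x _; rewrite -normrX ger0_norm// sqr_ge0.
have iT := sqintM (mR i) s1 sa.
have e3 : (\int[L]_(x in open_rect (a i) (b i)) `|T c I x|%:E =
    (\int[L]_(x in open_rect (a i) (b i)) ((cst 1 x) * `|T c I x|))%:E)%E.
  apply: (etrans _ (esym (fineK (integrable_fin_num (mR i) iT)))).
  by apply: eq_integral => x _ /=; rewrite mul1r.
rewrite e3.
have l0 : 0 <= l i by rewrite fine_ge0.
rewrite -sqrtrM ?mulr_ge0 ?(ltW C0)//; apply: (le_trans (ler_norm _)).
rewrite -sqrtr_sqr; apply: ler_wsqrtr; apply: (le_trans cs).
by rewrite e1 e2 -mulrA; exact: ler_wpM2l.
Qed.

(** The density of the squared Sobolev norm, so that Fatou's lemma is applied to all orders at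
    once. *)
Definition sqnorm T p := \sum_(j < r.+1) tensor_dot M j T T p.

Lemma sqnorm_ge0 T p : 0 <= sqnorm T p.
Proof. by apply: sumr_ge0 => j _; exact: tensor_dot_ge0. Qed.

Lemma sqnorm_measurable u T : wd u T -> measurable_fun setT (sqnorm T : borel U -> R).
Proof.
move=> wT; apply: measurable_sum => j.
by apply: (tensor_dot_measurable wT wT); rewrite -ltnS.
Qed.

Lemma sqnorm_int T : sob T -> (\int[vol]_p (sqnorm T p)%:E = (dotT T T)%:E)%E.
Proof.
move=> sT; have iT (j : 'I_r.+1) : vol.-integrable setT (EFin \o tensor_dot M j T T).
  by apply: sT; rewrite -ltnS.
have jE (j : 'I_r.+1) := fineK (integrable_fin_num measurableT (iT j)).
rewrite -sumEFin -(eq_bigr _ (fun j _ => esym (jE j))).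
rewrite -ge0_integral_sum//.
- by apply: eq_integral => p _; rewrite sumEFin.
- by move=> j; exact: measurable_int.
- by move=> j p _; rewrite lee_fin tensor_dot_ge0.
Qed.

Lemma sqnorm_sob u T e : wd u T -> (\int[vol]_p (sqnorm T p)%:E <= e%:E)%E ->
  sob T /\ dotT T T <= e.
Proof.
move=> wT h.
have sT : sob T.
  move=> j jr; have mT := tensor_dot_measurable wT wT jr.
  apply/integrableP; split; first exact/measurable_EFinP.
  apply: (le_lt_trans _ (ltry e)); apply: le_trans h.
  apply: ge0_le_integral => //.
  - by apply/measurable_EFinP; exact: measurableT_comp.
  - by apply/measurable_EFinP; exact: sqnorm_measurable wT.
  - move=> p _; rewrite lee_fin ger0_norm ?tensor_dot_ge0//.
    have jr' : (j < r.+1)%N by [].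
    rewrite /sqnorm (bigD1 (Ordinal jr'))//= lerDl.
    by apply: sumr_ge0 => k _; exact: tensor_dot_ge0.
by split => //; rewrite -lee_fin -sqnorm_int.
Qed.

Section Limit.
Variables (S : nat -> covariant_tensors R U d) (u_ : nat -> U -> R) (f : U -> R).
Hypothesis wS : forall n, wd (u_ n) (S n).
Hypothesis sS : forall n, sob (S n).
Definition step n : covariant_tensors R U d := fun c I x => - 1 * S n c I x + S n.+1 c I x.
Hypothesis fast : forall n, dotT (step n) (step n) <= 4^-1 ^+ n.
Hypothesis cvgf : forall p, u_ n p @[n --> \oo] --> f p.

Let wstep n : wd (fun p => - 1 * u_ n p + u_ n.+1 p) (step n).
Proof. exact: wd_lin. Qed.

Let sstep n : sob (step n).
Proof. exact: sob_lin. Qed.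

Definition step_size n c (x : E) := \sum_(j < r.+1) \sum_(I : j.-tuple 'I_d) `|step n c I x|.
(** All components up to order r enter at once, so that a linear change of components preserves the
    bound: regularity does not depend on the chart. *)
Definition regular c (x : E) := exists B, forall n, \sum_(i < n) step_size i c x <= B.
(** Order 0 is f at every point, as [weak_derivatives] demands. In higher orders the default 0 at
    irregular points is compatible with the tensor law, which has to hold everywhere. *)
Definition limit_tensors : covariant_tensors R U d := fun c I x =>
  if nilp I then f (cinv c x)
  else if `[<regular c x>] then limn (fun n => S n c I x) else 0.
Local Notation T := limit_tensors.

Lemma step_size_ge n c x I : (size I <= r)%N -> `|step n c I x| <= step_size n c x.
Proof.
move=> sI; rewrite /step_size; have jr : (size I < r.+1)%N by [].
rewrite (bigD1 (Ordinal jr))//= (bigD1 (in_tuple I))//= -addrA lerDl.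
by rewrite addr_ge0 ?sumr_ge0// => j _; exact: sumr_ge0.
Qed.

Lemma step_telescope n c I x : S n c I x = S 0 c I x + \sum_(i < n) step i c I x.
Proof.
elim: n => [|n IH]; first by rewrite big_ord0 addr0.
by rewrite big_ord_recr addrA -IH /step; ring.
Qed.

Lemma limit_tensors_cvg c p I : atlas M c -> cdom c p -> regular c (cmap c p) -> (size I <= r)%N ->
  S n c I (cmap c p) @[n --> \oo] --> T c I (cmap c p).
Proof.
move=> ac cp rp sI; rewrite /limit_tensors; case: nilP => [->|_].
  rewrite cmapK// (_ : (fun n => _) = u_ ^~ p); first exact: cvgf.
  by apply/funext => n; have [_ h _] := wS n; exact: h.
rewrite (asboolT rp); set x := cmap c p.
have [B hB] := rp.
have -> : (fun n => S n c I x) = (fun n => S 0 c I x + \sum_(i < n) step i c I x).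
  by apply/funext => n; exact: step_telescope.
apply: is_cvgD; first exact: is_cvg_cst.
have h n : \sum_(i < n) `|step i c I x| <= B.
  by apply: le_trans (hB n); apply: ler_sum => i _; exact: step_size_ge.
exact: (@bounded_series_cvg _ (fun i => step i c I x) B h).
Qed.

Lemma regular_change c1 c2 p : atlas M c1 -> atlas M c2 -> cdom c1 p -> cdom c2 p ->
  regular c1 (cmap c1 p) -> regular c2 (cmap c2 p).
Proof.
move=> a1 a2 p1 p2 [B hB].
pose P (j : nat) (I J : j.-tuple 'I_d) := \prod_(m < j) jacobian (transition c2 c1) (cmap c2 p) (tnth I m) (tnth J m).
pose C := \sum_(j < r.+1) \sum_(I : j.-tuple 'I_d) \sum_(J : j.-tuple 'I_d) `|P j I J|.
have C0 : 0 <= C by do 3!(apply: sumr_ge0 => ? _).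
exists (C * B) => n; apply: (@le_trans _ _ (\sum_(i < n) C * step_size i c1 (cmap c1 p))); last first.
  by rewrite -mulr_sumr ler_wpM2l.
apply: ler_sum => i _; rewrite mulr_suml; apply: ler_sum => j _.
rewrite mulr_suml; apply: ler_sum => I _; rewrite mulr_suml.
have jr : (j <= r)%N by rewrite -ltnS.
rewrite (wd_tensorial (wstep i) a2 a1 p2 p1 jr I); apply: (le_trans (ler_norm_sum _ _ _)).
apply: ler_sum => J _; rewrite normrM ler_wpM2l//; apply: step_size_ge.
by rewrite size_tuple.
Qed.

Lemma limit_tensors_tensorial : tensorial M r T.
Proof.
move=> c1 c2 a1 a2 p p1 p2 j jr I.
have [rp|nrp] := pselect (regular c1 (cmap c1 p)).
  have rp2 := regular_change a1 a2 p1 p2 rp.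
  have sz (J : j.-tuple 'I_d) : (size J <= r)%N by rewrite size_tuple.
  have h1 := limit_tensors_cvg a1 p1 rp (sz I).
  apply: (cvg_unique (@Rhausdorff R) h1).
  have -> : (fun n => S n c1 I (cmap c1 p)) = (fun n => \sum_(J : j.-tuple 'I_d)
      (\prod_(m < j) jacobian (transition c1 c2) (cmap c1 p)
                       (tnth I m) (tnth J m)) * S n c2 J (cmap c2 p)).
    by apply/funext => n; exact: wd_tensorial.
  apply: cvgn_sum => J; apply: cvgM; first exact: cvg_cst.
  exact: limit_tensors_cvg.
have nrp2 : ~ regular c2 (cmap c2 p) by move=> h; apply: nrp; exact: regular_change h.
case: j jr I => [|j] jr I.
  rewrite (bigD1 [tuple])//= [X in _ + X]big1 ?addr0; last by move=> J h; case/eqP: h; exact: tuple0.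
  by rewrite big_ord0 mul1r !tuple0 /limit_tensors !cmapK.
rewrite /limit_tensors; case: nilP => [h|_]; first by have := size_tuple I; rewrite h.
rewrite (asboolF nrp) big1// => J _; case: nilP => [h|_]; first by have := size_tuple J; rewrite h.
by rewrite (asboolF nrp2) mulr0.
Qed.

Lemma measurable_comp_tensors (K : set E) n c I : atlas M c -> compact K -> K `<=` ccod c ->
  (size I <= r)%N -> measurable_fun (K : set (borel E)) (S n c I : borel E -> R).
Proof.
move=> ac cK KV sI.
by have := wd_locally_integrable (wS n) ac sI cK KV => /measurable_int/measurable_EFinP.
Qed.

Lemma measurable_step_size (K : set E) n c : atlas M c -> compact K -> K `<=` ccod c ->
  measurable_fun (K : set (borel E)) (step_size n c : borel E -> R).
Proof.
move=> ac cK KV; apply: measurable_sum => j; apply: measurable_sum => I.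
have jr : (size I <= r)%N by rewrite size_tuple -ltnS.
apply: measurableT_comp => //.
by have := wd_locally_integrable (wstep n) ac jr cK KV => /measurable_int/measurable_EFinP.
Qed.

Lemma step_L1 c (K : set E) : atlas M c -> compact K -> K `<=` ccod c ->
  exists C : R, forall I n, (size I <= r)%N ->
    (\int[L]_(x in K) `|step n c I x|%:E <= (C * 2^-1 ^+ n)%:E)%E.
Proof.
move=> ac cK KV; have [C hC] := sobolev_L1 ac cK KV; exists `|C| => I n sI.
apply: (le_trans (hC _ _ (wstep n) (sstep n) I sI)); rewrite lee_fin.
apply: (le_trans (ler_wpM2r (sqrtr_ge0 _) (ler_norm C))); rewrite ler_wpM2l//.
apply: (le_trans (ler_wsqrtr (fast n))).
have -> : 4^-1 = 2^-1 ^+ 2 :> R by rewrite exprVn; congr (_^-1); ring.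
by rewrite exprAC sqrtr_sqr ger0_norm.
Qed.

(** The L^1 norms of the steps decay like 2^-n, so the sum of the step sizes is finite almost
    everywhere. *)
Lemma ae_regular c (K : set E) : atlas M c -> compact K -> K `<=` ccod c ->
  {ae L, forall x, K x -> regular c x}.
Proof.
move=> ac cK KV; have mK := compact_borel cK; have [C hC] := step_L1 ac cK KV.
pose D := \sum_(j < r.+1) \sum_(I : j.-tuple 'I_d) C.
have ms n := measurable_step_size n ac cK KV.
have b n : (\int[L]_(x in K) `|step_size n c x|%:E <= (D * 2^-1 ^+ n)%:E)%E.
  rewrite (_ : (\int[L]_(x in K) _)%E = (\sum_(j < r.+1) \sum_(I : j.-tuple 'I_d) \int[L]_(x in K) `|step n c I x|%:E)%E).
    rewrite mulr_suml -sumEFin; apply: lee_sum => j _; rewrite mulr_suml -sumEFin.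
    by apply: lee_sum => I _; apply: hC; rewrite size_tuple -ltnS.
  have mst (j : 'I_r.+1) (I : j.-tuple 'I_d) : measurable_fun (K : set (borel E)) (fun x => `|step n c I x|%:E).
    apply/measurable_EFinP; apply: measurableT_comp => //.
    have jr : (size I <= r)%N by rewrite size_tuple -ltnS.
    by have := wd_locally_integrable (wstep n) ac jr cK KV => /measurable_int/measurable_EFinP.
  transitivity (\int[L]_(x in K) \sum_(j < r.+1) \sum_(I : j.-tuple 'I_d) `|step n c I x|%:E)%E.
    apply: eq_integral => x _; rewrite ger0_norm; last by apply: sumr_ge0 => j _; exact: sumr_ge0.
    by rewrite -sumEFin; apply: eq_bigr => j _; rewrite sumEFin.
  rewrite ge0_integral_sum//; last 2 first.
  - by move=> j; apply: emeasurable_sum => I; exact: mst.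
  - by move=> j x _; apply: sume_ge0.
  by apply: eq_bigr => j _; rewrite ge0_integral_sum.
have [g _ hg] := summable_dom mK ms b.
apply: ae_imp hg => x hx Kx; exists (g x) => n; apply: le_trans (hx Kx n).
by apply: ler_sum => i _; exact: ler_norm.
Qed.

Lemma measurable_limit_tensors (K : set E) c I : atlas M c -> compact K -> K `<=` ccod c ->
  (size I <= r)%N -> measurable_fun (K : set (borel E)) (T c I : borel E -> R).
Proof.
move=> ac cK KV sI; have mK := compact_borel cK.
have mS n := measurable_comp_tensors n ac cK KV sI.
have ms n := measurable_step_size n ac cK KV.
have [nI|nI] := boolP (nilp I).
  apply: (measurable_fun_cvg mS) => x /KV/ccodP[cx xE].
  rewrite (nilP nI) (_ : (fun n => _) = u_ ^~ (cinv c x)); first exact: cvgf.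
  by apply/funext => n; have [_ h _] := wS n; rewrite -(h c ac _ cx) xE.
have mA := measurable_bounded_sum mK ms; set A := [set x | _] in mA.
apply: (@measurable_fun_cvg _ (borel E) R K (fun n x => S n c I x * \1_A x)).
  by move=> n; apply: measurable_funM => //; apply: measurable_funTS; exact: measurable_indic.
move=> x Kx; have [cx xE] := ccodP (KV x Kx).
have [rx|nrx] := pselect (regular c x).
  rewrite indicE mem_set//; under eq_fun do rewrite mulr1.
  by have := @limit_tensors_cvg c (cinv c x) I ac cx; rewrite xE; exact.
rewrite indicE memNset; last by move=> [_ h]; exact: nrx.
rewrite /limit_tensors (negPf nI) (asboolF nrx); under eq_fun do rewrite mulr0.
exact: cvg_cst.
Qed.

Lemma limit_tensors_dcvg c I : atlas M c -> (size I <= r)%N ->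
  dcvg (ccod c) (fun n => S n c I) (T c I).
Proof.
move=> ac sI; rewrite (_ : (fun n => S n c I) = fun n x => S 0 c I x + \sum_(i < n) step i c I x); last first.
  by apply/funext => n; apply/funext => x; exact: step_telescope.
apply: (@dcvg_series _ _ (ccod c) (S 0 c I) (fun n => step n c I)); first exact: open_ccod.
- exact: wd_locally_integrable.
- by move=> n; exact: wd_locally_integrable.
- by move=> K cK KV; have [C hC] := step_L1 ac cK KV; exists C => n; exact: hC.
- by move=> K cK KV; exact: measurable_limit_tensors.
- move=> K cK KV; apply: ae_imp (ae_regular ac cK KV) => x hx Kx.
  have [cx xE] := ccodP (KV x Kx).
  rewrite (_ : (fun n => _) = fun n => S n c I x); last by apply/funext => n; rewrite -step_telescope.
  have := @limit_tensors_cvg c (cinv c x) I ac cx; rewrite xE; apply => //; exact: hx.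
Qed.

Lemma wd_limit_tensors : wd f T.
Proof.
split; first exact: limit_tensors_tensorial.
  by move=> c ac p cp; rewrite /limit_tensors cmapK.
move=> c ac I sI k; have oc := @open_ccod c.
have hw n : weak_partial (ccod c) k (S n c I) (fun x => S n c (k :: I) x +
    \sum_(m < size I) \sum_(l < d) christoffel M c k (nth k I m) l x * S n c (set_nth k I m l) x).
  by have [_ _ h] := wS n; exact: h.
apply: (weak_partial_lim oc hw).
  by apply: limit_tensors_dcvg => //; exact: ltnW.
apply: dcvg_add; first exact: limit_tensors_dcvg.
apply: dcvg_sum => m; apply: dcvg_sum => l; apply: dcvg_mul => //.
  by move=> x cx; exact: (smooth_continuous (christoffel_smooth k (nth k I m) l ac) cx).
apply: limit_tensors_dcvg => //.
rewrite size_set_nth; apply: leq_trans (ltnW sI).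
by rewrite geq_max leqnn andbT.
Qed.

Lemma tensor_dot_limit_cvg N : {ae vol, forall p, forall j, (j <= r)%N ->
  tensor_dot M j (fun c I x => - 1 * S n c I x + N c I x) (fun c I x => - 1 * S n c I x + N c I x) p @[n --> \oo] -->
  tensor_dot M j (fun c I x => - 1 * T c I x + N c I x) (fun c I x => - 1 * T c I x + N c I x) p}.
Proof.
apply: (ae_ppatch ltr01) => p.
have [ac cp] := pchartP p; have Kc := @prect_sub 1 p (lexx _).
have h := ae_regular ac (@compact_closed_rect R d _ _) Kc.
have h' : {ae L, forall x, open_rect (plo 1 p) (phi 1 p) x -> regular (pchart p) x}.
  by apply: ae_imp h => x hx /open_rect_closed.
apply: ae_imp (ae_cmap ac Kc h') => q hq pq j jr.
have [aq cq] := chart_atP q; have [cpq _] := pq.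
have rq := regular_change ac aq cpq cq (hq pq).
apply: cvgn_sum => I; apply: cvgn_sum => J.
have sz (I' : j.-tuple 'I_d) : (size I' <= r)%N by rewrite size_tuple.
have c0 (I' : j.-tuple 'I_d) := limit_tensors_cvg aq cq rq (sz I').
have c1 (I' : j.-tuple 'I_d) := cvgD (cvgM (cvg_cst (-1 : R)) (c0 I')) (cvg_cst (N (chart_at M q) I' (cmap (chart_at M q) q))).
apply: cvgM; last exact: c1.
apply: cvgM; first exact: cvg_cst.
exact: c1.
Qed.

(** Fatou's lemma for the differences with one fixed field N, for which almost everywhere
    convergence is known; the shift by n0 discards the terms without a bound. *)
Lemma limit_tensors_fatou v N n0 e : wd v N -> sob N ->
  (forall n, (n0 <= n)%N -> let W := fun c I x => - 1 * S n c I x + N c I x in dotT W W <= e) ->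
  let W := fun c I x => - 1 * T c I x + N c I x in sob W /\ dotT W W <= e.
Proof.
move=> wN sN hn W; pose W_ n c I x := - 1 * S (n + n0)%N c I x + N c I x.
have wW : wd (fun p => - 1 * f p + v p) W := wd_lin (-1) wd_limit_tensors wN.
have wW_ n : wd (fun p => - 1 * u_ (n + n0)%N p + v p) (W_ n) := wd_lin (-1) (wS _) wN.
have sW_ n : sob (W_ n) := sob_lin (-1) (wS _) wN (sS _) sN.
apply: (sqnorm_sob wW).
pose g n (p : borel U) := (sqnorm (W_ n) p)%:E.
have mg n : measurable_fun setT (g n).
  by apply/measurable_EFinP; exact: sqnorm_measurable.
have g0 n p : (0 <= g n p)%E by rewrite lee_fin; exact: sqnorm_ge0.
have h := fatou vol measurableT mg (fun n p _ => g0 n p).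
have mlim : measurable_fun setT (fun p : borel U => limn_einf (g ^~ p)).
  apply: emeasurable_fun_cvg; first exact: measurable_fun_einfs.
  by move=> p _; rewrite limn_einf_lim; exact: is_cvg_einfs.
have mW : measurable_fun setT (fun p : borel U => (sqnorm W p)%:E).
  by apply/measurable_EFinP; exact: sqnorm_measurable wW.
have e1 : (\int[vol]_p (sqnorm W p)%:E = \int[vol]_p limn_einf (g ^~ p))%E.
  apply: (@ae_eq_integral _ _ _ vol setT (fun p => limn_einf (g ^~ p)) (fun p => (sqnorm W p)%:E) measurableT mW mlim).
  apply: ae_imp (tensor_dot_limit_cvg N) => p hp _.
  have c1 : g n p @[n --> \oo] --> (sqnorm W p)%:E.
    apply: cvg_EFin; first exact: nearW.
    apply: cvgn_sum => j; have jr : (j <= r)%N by rewrite -ltnS.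
    by have := hp j jr; rewrite -(cvg_shiftn n0).
  by have [-> _] := cvg_limn_einf_sup c1.
rewrite e1; apply: (le_trans h); rewrite limn_einf_lim; apply: lime_le; first exact: is_cvg_einfs.
apply: nearW => n; apply: le_trans.
  by apply: ereal_inf_lbound; exists n => /=.
by rewrite (sqnorm_int (sW_ n)); apply: hn; rewrite leq_addl.
Qed.

End Limit.

Local Notation sobolev := (sobolev M vol r).

Lemma sobolev_sub u v : sobolev u -> sobolev v -> sobolev (fun p => u p - v p).
Proof.
move=> su sv; have := sobolev_lin (-1) sv su.
by congr sobolev; apply/funext => p; ring.
Qed.

Lemma sobolev_continuous_sub u v : sobolevC u -> sobolevC v -> sobolevC (fun p => u p - v p).
Proof.
move=> [su cu] [sv cv]; split; first exact: sobolev_sub.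
by move=> p; apply: continuousB; [exact: cu|exact: cv].
Qed.

Lemma sobolev_distE u v T N : wd u T -> wd v N ->
  rkhs_dist sdot u v = Num.sqrt (dotT (fun c I x => - 1 * N c I x + T c I x)
    (fun c I x => - 1 * N c I x + T c I x)).
Proof.
move=> wT wN; rewrite /rkhs_dist; congr Num.sqrt.
have w : wd (fun p => u p - v p) (fun c I x => - 1 * N c I x + T c I x).
  have -> : (fun p => u p - v p) = (fun p => - 1 * v p + u p) by apply/funext => p; ring.
  exact: wd_lin.
exact: sobolev_dotE.
Qed.

Theorem sobolev_complete : is_complete sobolevC sdot.
Proof.
move=> f_ Hf cau.
have [C C0 hC] := sup_bound.
have sup m n p : `|f_ m p - f_ n p| <= C * rkhs_dist sdot (f_ m) (f_ n).
  exact: hC (sobolev_continuous_sub (Hf m) (Hf n)) p.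
have /choice[Ne hN] : forall e : R, exists N0 : nat, 0 < e -> forall m n,
    (N0 <= m)%N -> (N0 <= n)%N -> rkhs_dist sdot (f_ m) (f_ n) < e.
  move=> e; have [e0|e0] := ltP 0 e; last by exists 0%N.
  by have [N0 hN] := cau e e0; exists N0.
have unif e p m n : 0 < e -> (Ne (e / C) <= m)%N -> (Ne (e / C) <= n)%N -> `|f_ m p - f_ n p| <= e.
  move=> e0 hm hn; apply: (le_trans (sup m n p)).
  by rewrite mulrC -ler_pdivlMr// ltW// hN// divr_gt0.
have cv p : cvgn (f_ ^~ p).
  apply: cauchy_cvg; apply: cauchy_exP => e e0.
  exists (f_ (Ne (e / 2 / C)) p).
  have e2 : 0 < e / 2 by rewrite divr_gt0.
  exists (Ne (e / 2 / C)) => // n /= hn; rewrite /ball /=.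
  apply: (le_lt_trans (unif _ p _ n e2 (leqnn _) hn)).
  by rewrite ltr_pdivrMr// ltr_pMr// ltr1n.
pose f p := limn (f_ ^~ p).
have cf p : f_ n p @[n --> \oo] --> f p := cv p.
have uniff e p n : 0 < e -> (Ne (e / C) <= n)%N -> `|f_ n p - f p| <= e.
  move=> e0 hn.
  have h : `|f_ n p - f_ m p| @[m --> \oo] --> `|f_ n p - f p|.
    by apply: cvg_norm; apply: cvgB; [exact: cvg_cst|exact: cf].
  apply: (cvgr_to_le h); near=> m; apply: unif => //.
  by near: m; exact: nbhs_infty_ge.
have contf : continuous f.
  move=> p.
  apply/cvgrPdist_lt => e e0; pose n := Ne (e / 4 / C).
  have e4 : 0 < e / 4 by rewrite divr_gt0.
  have [_ cn] := Hf n.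
  have := cn p => /cvgrPdist_lt/(_ _ e4); apply: filterS => q hq.
  have h1 := uniff _ p n e4 (leqnn _); have h2 := uniff _ q n e4 (leqnn _).
  have -> : f p - f q = - (f_ n p - f p) + (f_ n p - f_ n q) + (f_ n q - f q) by ring.
  apply: (le_lt_trans (ler_normD _ _)); apply: (@le_lt_trans _ _ (`|f_ n p - f p| + `|f_ n p - f_ n q| + e / 4)).
    by apply: lerD => //; apply: (le_trans (ler_normD _ _)); rewrite normrN.
  by move: h1 hq; move: (`|_|) (`|_|) => x y; lra.
(* The subsequence increases, is at least k, and lies beyond the index after which distances are
   below 2^-k; squared distances of successive terms are then at most 4^-k. *)
pose phi k := (k + \sum_(i < k.+1) Ne (2^-1 ^+ i))%N.
have phi_mono k : (phi k <= phi k.+1)%N.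
  by rewrite /phi (big_ord_recr k.+1) /=; lia.
have phi_ge k : (Ne (2^-1 ^+ k) <= phi k)%N by rewrite /phi big_ord_recr /=; lia.
have phi_id k : (k <= phi k)%N by rewrite leq_addr.
pose S k := nabla M r (f_ (phi k)).
have sS n : sob (nabla M r (f_ n)) by have [h _] := Hf n; have [] := sobolevP h.
have wS n : wd (f_ n) (nabla M r (f_ n)) by have [h _] := Hf n; have [] := sobolevP h.
have fast n : dotT (step S n) (step S n) <= 4^-1 ^+ n.
  have D0 := dotT_ge0 (step S n).
  have e0 : 0 < 2^-1 ^+ n :> R by rewrite exprn_gt0.
  have := hN _ e0 (phi n.+1) (phi n) (leq_trans (phi_ge n) (phi_mono n)) (phi_ge n).
  rewrite (sobolev_distE (wS _) (wS _)) => h.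
  have -> : 4^-1 = 2^-1 ^+ 2 :> R by rewrite exprVn; congr (_^-1); ring.
  rewrite exprAC -(sqr_sqrtr D0).
  by rewrite lerXn2r ?nnegrE ?(ltW e0)// ltW.
have cphi p : f_ (phi k) p @[k --> \oo] --> f p.
  apply/cvgrPdist_le => e e0; near=> k; rewrite distrC; apply: uniff => //.
  by apply: leq_trans (phi_id k); near: k; exact: nbhs_infty_ge.
pose T := limit_tensors S f.
have wT : wd f T := wd_limit_tensors (fun k => wS (phi k)) (fun k => sS (phi k)) fast cphi.
(* Fatou's lemma against the fixed term f_n bounds its distance to the limit, for the whole sequence
   and not only along phi. *)
have fat n e : 0 < e -> (Ne e <= n)%N ->
   let W := fun c I x => - 1 * T c I x + nabla M r (f_ n) c I x in sob W /\ dotT W W <= e ^+ 2.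
  move=> e0 hn.
  apply: (@limit_tensors_fatou S _ f (fun k => wS (phi k)) (fun k => sS (phi k)) fast cphi (f_ n) _ (Ne e)) => //.
  move=> m hm /=; set W := (X in dotT X _); have D0 := dotT_ge0 W.
  have := hN e e0 n (phi m) hn (leq_trans hm (phi_id m)).
  rewrite (sobolev_distE (wS _) (wS _)) => h.
  rewrite -(sqr_sqrtr D0).
  by rewrite lerXn2r ?nnegrE ?(ltW e0)// ltW.
(* T is one term of the sequence minus a difference that [fat] shows to be square integrable. *)
have sT : sob T.
  have [sW _] := fat _ 1 ltr01 (leqnn _).
  have := sob_lin (-1) (wd_lin (-1) wT (wS (Ne 1))) (wS (Ne 1)) sW (sS (Ne 1)).
  congr sob; apply/funext => c; apply/funext => I; apply/funext => x; ring.
exists f; first by split => //; exists T.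
apply/cvgrPdist_le => e e0; near=> n.
rewrite sub0r normrN ger0_norm (sobolev_distE (wS _) wT).
have hn : (Ne e <= n)%N by near: n; exact: nbhs_infty_ge.
have [_ h] := fat n e e0 hn.
by apply: (le_trans (ler_wsqrtr h)); rewrite sqrtr_sqr ger0_norm// ltW.
Unshelve. all: by end_near.
Qed.

End Completeness.

(** * Functions supported in one chart *)

Section Extension.
Implicit Types (p q : U) (c : chart R U d).

Lemma cov_zero (u : U -> R) c (W : set E) n I : open W -> (forall x, W x -> u (cinv c x) = 0) ->
  forall x, W x -> cov u c n I x = 0.
Proof.
move=> oW u0; elim: n I => [|n IH] I x Wx; first exact: u0.
case: I => [//|k I].
have -> : cov u c n.+1 (k :: I) x = partial k (cov u c n I) x -
      corr (fun i l => christoffel M c k i l x) I (fun J => cov u c n J x) by [].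
have -> : partial k (cov u c n I) x = 0.
  rewrite (_ : 0 = partial k (fun=> 0) x); last by rewrite partial_cst.
  by apply: partial_near; apply: near_open_eq oW Wx _ => y; exact: IH.
rewrite (_ : corr _ _ _ = 0) ?subr0//.
have : forall J, cov u c n J x = 0 by move=> J; exact: IH.
move: (cov u c n) => S S0; elim: I S S0 => [//|i I IHI] S S0 /=.
rewrite big1 ?add0r; last by move=> l _; rewrite S0 mulr0.
by apply: (IHI (fun J => S (i :: J))) => J; exact: S0.
Qed.

(** Each covariant derivative costs one factor la, the Christoffel symbols being the same for the
    whole family. *)
Lemma cov_bfam (J : Type) (la : J -> R) c (K : set E) (u : J -> U -> R) :
  (forall j, 1 <= la j) -> K `<=` ccod c -> compact K -> atlas M c ->
  (forall n, bfam la (ccod c) K n 0 (fun j => u j \o cinv c)) ->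
  forall m n I, bfam la (ccod c) K n m (fun j => cov (u j) c m I).
Proof.
move=> la1 KV cK ac hu; have oc := @open_ccod c.
elim=> [|m IH] n I; first exact: hu.
case: I => [|k I]; first exact: bfam0.
have h1 : bfam la (ccod c) K n m.+1 (fun j => partial k (cov (u j) c m I)).
  by have [_ _] := IH n.+1 I; exact.
have h2 : bfam la (ccod c) K n m.+1 (fun j x => corr (fun i l => christoffel M c k i l x) I (fun J => cov (u j) c m J x)).
  apply: bfam_weaken => //; apply: bfam_corr => //.
  by move=> i a; exact: christoffel_smooth.
have h3 := bfamM oc KV (bfam_fixed la1 KV cK n (smooth_cst (-1) oc)) h2.
rewrite add0n in h3.
apply: bfam_eq (bfamD oc KV h1 h3) => // j x _ /=.
by rewrite mulN1r.
Qed.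

Section OneChart.
Variables (c : chart R U d) (a b : 'I_d -> R).
Hypotheses (ac : atlas M c) (abc : closed_rect a b `<=` ccod c).

Definition extend (phi : E -> R) : U -> R := fun q => if `[<cdom c q>] then phi (cmap c q) else 0.

Lemma extend_cinv phi x : ccod c x -> extend phi (cinv c x) = phi x.
Proof. by move=> /ccodP[h1 h2]; rewrite /extend (asboolT h1) h2. Qed.

(** Compact in a Hausdorff space, hence closed: on its open complement the extension by 0 vanishes,
    which makes it smooth in every chart and not only in c. *)
Let Kc : set U := cinv c @` closed_rect a b.

Let closed_Kc : closed Kc.
Proof.
apply: compact_closed; first exact: manifold_hausdorff M.
apply: continuous_compact; last exact: compact_closed_rect.
apply: continuous_in_subspaceT => x; rewrite inE => /abc cx.
exact: cinv_continuous.
Qed.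

Let Kc_cdom q : Kc q -> cdom c q /\ closed_rect a b (cmap c q).
Proof. by move=> [x xab <-]; have [h1 h2] := ccodP (abc xab); rewrite h2. Qed.

Section Supported.
Variables (phi : E -> R) (a' b' : 'I_d -> R).
Hypotheses (sphi : smooth_on setT phi) (ab' : closed_rect a' b' `<=` closed_rect a b).
Hypothesis phi0 : forall x, ~ closed_rect a' b' x -> phi x = 0.
Local Notation u := (extend phi).

Lemma extend_out q : ~ Kc q -> u q = 0.
Proof.
move=> nq; rewrite /extend; case: asboolP => // cq; apply: phi0 => h; apply: nq.
by exists (cmap c q); [exact: ab'|rewrite cmapK].
Qed.

Let off c' : set E := ccod c' `&` cinv c' @^-1` (~` Kc).

Let open_off c' : open (off c').
Proof.
apply: continuous_open_preimage; first exact: open_ccod.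
  by move=> x cx; exact: cinv_continuous.
exact: closed_openC.
Qed.

Lemma extend_smooth c' : atlas M c' -> smooth_on (ccod c') (u \o cinv c').
Proof.
move=> ac'; apply: (@smooth_sub _ _ (overlap c' c `|` off c')).
  move=> x cx; have [h|h] := pselect (Kc (cinv c' x)); last by right.
  by left; apply/overlapP; split; have [] := Kc_cdom h.
apply: smooth_union.
  have oo : open (overlap c' c) := @open_overlap c' c.
  have s1 : smooth_on (overlap c' c) (phi \o transition c' c).
    apply: (@smooth_comp _ _ _ _ setT phi (transition c' c) oo) => //; first exact: openT.
    by move=> j; exact: transition_smooth.
  apply: smooth_eq oo _ s1 => x /overlapP[_ cx].
  by rewrite /= /extend asboolT.
have s0 := smooth_cst 0 (@open_off c').
apply: (smooth_eq (@open_off c') _ s0) => x [_ h].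
by rewrite /= extend_out.
Qed.

Lemma wd_extend : wd u (cov_tensors u).
Proof. apply: weak_derivatives_cov; exact: extend_smooth. Qed.

Lemma cov_extend_off c' q I : cdom c' q -> ~ Kc q -> cov_tensors u c' I (cmap c' q) = 0.
Proof.
move=> cq nq; rewrite /cov_tensors; apply: (cov_zero (c := c') (W := off c') (size I) I (@open_off c')); first by move=> x [_ h]; exact: extend_out.
by split; [exact: ccod_cmap|rewrite /= cmapK].
Qed.

Lemma cov_extend_out I x : ccod c x -> ~ closed_rect a' b' x -> cov_tensors u c I x = 0.
Proof.
move=> cx nx; apply: (@cov_zero _ _ (ccod c `&` ~` closed_rect a' b')) => //.
  apply: openI; first exact: open_ccod.
  by apply: closed_openC; apply: compact_closed; [exact: rV_hausdorff|exact: compact_closed_rect].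
by move=> y [cy ny]; rewrite extend_cinv//; exact: phi0.
Qed.

Lemma extend_continuous : continuous u.
Proof.
move=> q; have [aq cq] := chart_atP q; set c' := chart_at M q in aq cq.
have cd : {for q, continuous ((u \o cinv c') \o cmap c')}.
  apply: continuous_comp; first exact: cmap_continuous.
  exact: smooth_continuous (extend_smooth aq) (ccod_cmap cq).
have e : \forall p \near q, ((u \o cinv c') \o cmap c') p = u p.
  have : \forall p \near q, cdom c' p by apply: open_nbhs_nbhs; split => //; exact: cdom_open.
  by apply: filterS => p cp; rewrite /= cmapK.
have h := nbhs_singleton e.
suff : u @ q --> u q by [].
by rewrite -h; exact: cvg_trans (near_eq_cvg e) cd.
Qed.

Lemma tensor_dot_extend_off j S q : ~ Kc q -> tensor_dot M j (cov_tensors u) S q = 0.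
Proof.
move=> nq; have [aq cq] := chart_atP q.
rewrite /tensor_dot big1// => I _; rewrite big1// => J _.
by rewrite cov_extend_off// mulr0 mul0r.
Qed.

Lemma tensor_dot_extend_out j S q : (j <= r)%N -> tensorial M r S -> cdom c q ->
  ~ closed_rect a' b' (cmap c q) -> tensor_dot M j (cov_tensors u) S q = 0.
Proof.
move=> jr tS cq nq; rewrite (tensor_dot_chart jr (wd_tensorial wd_extend) tS ac cq).
rewrite /cdot -tform_tuple big1// => I _; rewrite big1// => J _.
by rewrite cov_extend_out ?mulr0 ?mul0r//; exact: ccod_cmap.
Qed.

End Supported.

Section Families.
Variables (J : Type) (la : J -> R) (phi : J -> E -> R) (a' b' : J -> 'I_d -> R).
Hypothesis la1 : forall j, 1 <= la j.
Hypothesis sphi : forall j, smooth_on setT (phi j).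
Hypothesis ab' : forall j, closed_rect (a' j) (b' j) `<=` closed_rect a b.
Hypothesis phi0 : forall j x, ~ closed_rect (a' j) (b' j) x -> phi j x = 0.
Hypothesis bphi : forall n, bfam la (ccod c) (closed_rect a b) n 0 phi.
Local Notation u j := (extend (phi j)).

(** The components of order i are O(la^i), so the inner product is O(la^(2i)) with i <= r and la >=
    1; outside [Kc] it vanishes. *)
Lemma tensor_dot_family : exists2 C : R, 0 <= C & forall j i q, (i <= r)%N ->
  tensor_dot M i (cov_tensors (u j)) (cov_tensors (u j)) q <= C * la j ^+ (2 * r).
Proof.
have cK := @compact_closed_rect R d a b.
have bu n : bfam la (ccod c) (closed_rect a b) n 0 (fun j => u j \o cinv c).
  by apply: bfam_eq (bphi n) => //; [exact: open_ccod|move=> j x cx; rewrite /= extend_cinv].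
have /choice[C hC] : forall I : seq 'I_d, exists C : R, forall j x, closed_rect a b x ->
    `|cov_tensors (u j) c I x| <= C * la j ^+ size I.
  by move=> I; have [] := cov_bfam la1 abc cK ac bu (size I) 0 I.
have [B B0 hB] : exists2 B : R, 0 <= B & forall x, closed_rect a b x -> forall i k,
    `|invmx (metric M c x) i k| <= B.
  have /choice[B hB] : forall ik : 'I_d * 'I_d, exists B : R, 0 < B /\ forall x, closed_rect a b x ->
      `|invmx (metric M c x) ik.1 ik.2| <= B.
    move=> [i k]; have [B B0 hB] := compact_bound cK (fun x Kx =>
      smooth_continuous (metric_inv_smooth i k ac) (abc Kx)).
    by exists B.
  exists (\sum_ik B ik); first by apply: sumr_ge0 => ik _; have [/ltW] := hB ik.
  move=> x Kx i k; have [_ /(_ x Kx)/= h] := hB (i, k); apply: (le_trans h).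
  by rewrite (bigD1 (i, k))//= lerDl sumr_ge0// => ik _; have [/ltW] := hB ik.
pose D i := \sum_(I : i.-tuple 'I_d) `|C I|.
pose G i := (d%:R ^+ 2 * B) ^+ i * (D i * D i).
have D0 i : 0 <= D i by exact: sumr_ge0.
have G0 i : 0 <= G i by rewrite mulr_ge0 ?exprn_ge0 ?mulr_ge0.
exists (\sum_(i < r.+1) G i); first by apply: sumr_ge0 => i _; exact: G0.
move=> j i q ir; have la0 : 0 <= la j by apply: le_trans (la1 j).
have X0 : 0 <= \sum_(i < r.+1) G i by apply: sumr_ge0 => k _; exact: G0.
have [h|nq] := pselect (Kc q); last first.
  rewrite (_ : tensor_dot _ _ _ _ _ = 0); first by rewrite mulr_ge0// exprn_ge0.
  apply: tensor_dot_extend_off => // x; exact: phi0.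
have [cq xab] := Kc_cdom h.
have tw := wd_tensorial (wd_extend (sphi j) (@ab' j) (@phi0 j)).
rewrite (tensor_dot_chart ir tw tw ac cq).
have hT I : size I = i -> `|cov_tensors (u j) c I (cmap c q)| <= D i * la j ^+ i.
  move=> sI; have := hC I j _ xab; rewrite sI => h1; apply: (le_trans h1).
  rewrite ler_wpM2r ?exprn_ge0//; apply: (le_trans (ler_norm _)).
  have sI' : size I == i by apply/eqP.
  by rewrite /D (bigD1 (Tuple sI'))//= lerDl sumr_ge0.
have := tform_le B0 (hB _ xab) hT hT => h1.
apply: (le_trans (ler_norm _)); apply: (le_trans h1).
rewrite mulrACA -exprD mulrA -/(G i).
have ir' : (i < r.+1)%N by [].
apply: ler_pM => //; first by rewrite exprn_ge0.
  by rewrite (bigD1 (Ordinal ir'))//= lerDl sumr_ge0.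
by rewrite ler_weXn2l//; lia.
Qed.

Lemma sob_extend j : sob (cov_tensors (u j)).
Proof.
have [C C0 hC] := tensor_dot_family => i ir.
have w := wd_extend (sphi j) (@ab' j) (@phi0 j).
have mt := tensor_dot_measurable w w ir.
apply/integrableP; split; first exact/measurable_EFinP.
have vl := vol_lty.
apply: (@le_lt_trans _ _ (\int[vol]_p (C * la j ^+ (2 * r))%:E)%E).
  apply: ge0_le_integral => //.
  - by apply/measurable_EFinP; exact: measurableT_comp.
  - by move=> p _; rewrite lee_fin ger0_norm ?tensor_dot_ge0//; exact: hC.
by rewrite integral_cst// lte_mul_pinfty// lee_fin mulr_ge0// exprn_ge0// (le_trans _ (la1 j)).
Qed.

Lemma sobolev_extend j : sobolev_continuous M vol r (u j).
Proof.
split; last exact: extend_continuous (sphi j) (@ab' j) (@phi0 j).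
exists (cov_tensors (u j)); first exact: wd_extend (sphi j) (@ab' j) (@phi0 j).
exact: sob_extend.
Qed.

End Families.

End OneChart.
End Extension.

(** * Density of the Sobolev space in L^2 *)

Section Density.

Lemma extend_bump_sobolev c a b n : atlas M c -> closed_rect a b `<=` ccod c -> 0 <= n ->
  sobolevC (extend c (rect_bump n a b)).
Proof.
move=> ac abc n0.
apply: (@sobolev_extend c a b ac abc unit (fun=> 1)
  (fun=> rect_bump n a b) (fun=> a) (fun=> b)) => //.
- by move=> _; exact: rect_bump_smooth.
- by move=> _ x.
- by move=> _ x nx; apply: rect_bump_out => // /open_rect_closed.
- move=> m; apply: bfam_fixed => //; first exact: compact_closed_rect.
  exact: smooth_sub (rect_bump_smooth n a b).
Qed.

Lemma sqint_finite (g : borel U -> R) : sqint vol setT g -> vol.-integrable setT (EFin \o g).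
Proof.
move=> sg; have vl := vol_lty.
have s1 : sqint vol setT (cst 1).
  split; first exact: measurable_cst.
  apply: (eq_integrable _ (cst 1%E)) => //; first by move=> x _ /=; rewrite expr1n.
  apply/integrableP; split; first exact: measurable_cst.
  by under eq_integral do rewrite abse1; rewrite integral_cst// mul1e.
by apply: eq_integrable (sqintM measurableT sg s1) => // x _ /=; rewrite mulr1.
Qed.

Variable g : borel U -> R.
Hypothesis sg : sqint vol setT g.
Hypothesis g_orth : forall h, sobolevC h -> \int[vol]_p (g p * h p) = 0.

Let ig : vol.-integrable setT (EFin \o g).
Proof. exact: sqint_finite. Qed.

Let mg : measurable_fun setT g.
Proof. by case: sg. Qed.

(** Extended bumps converge boundedly to the indicator of the patch, and g is orthogonal to each of
    them. *)
Lemma orth_patch c a b : atlas M c -> closed_rect a b `<=` ccod c ->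
  (\int[vol]_(p in cpatch c a b) (g p)%:E = 0)%E.
Proof.
move=> ac abc; have mp : measurable (cpatch c a b : set (borel U)) by apply: open_borel; exact: open_patch.
pose h n : borel U -> R := extend c (rect_bump n.+1%:R a b).
have Hh n : sobolevC (h n) by exact: extend_bump_sobolev.
have mh n : measurable_fun setT (h n).
  by have [_ ch] := Hh n; apply: borel_real_continuous => [|x _]; [exact: openT|exact: ch].
have h01 n p : `|h n p| <= 1.
  rewrite /h /extend; case: asboolP => _; last by rewrite normr0.
  by rewrite ger0_norm ?rect_bump_ge0// rect_bump_le1.
have hc p : h n p @[n --> \oo] --> (\1_(cpatch c a b) p : R).
  rewrite /h /extend indicE; case: asboolP => cp; last first.
    by rewrite memNset; [exact: cvg_cst|move=> []].
  have := @rect_bump_cvg R d a b (cmap c p); rewrite indicE.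
  have -> // : (cmap c p \in (open_rect a b : set E)) = (p \in cpatch c a b).
  by apply/idP/idP; rewrite !inE => // -[].
have [|||||_ _ cv] := @dominated_convergence _ _ _ vol setT measurableT (fun n p => (g p * h n p)%:E)
   (fun p => (g p * \1_(cpatch c a b) p)%:E) (fun p => `|(g p)%:E|%E).
- by move=> n; apply/measurable_EFinP; exact: measurable_funM.
- by apply/measurable_EFinP; apply: measurable_funM => //; exact: measurable_indic.
- apply: aeW => p _; apply: cvg_EFin; first exact: nearW.
  by apply: cvgM; [exact: cvg_cst|exact: hc].
- exact: integrable_abse.
- by apply: aeW => p n _; rewrite lee_fin normrM ler_piMr.
have z n : (\int[vol]_p (g p * h n p)%:E = 0)%E.
  have i1 : vol.-integrable setT (EFin \o (fun p => g p * h n p)).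
    have := @integrable_bounded_mul _ _ _ vol setT g (h n) 1 measurableT (mh n) (fun x _ => h01 n x) ig.
    by apply: eq_integrable => // x _ /=; rewrite mulrC.
  apply: (etrans (esym (fineK (integrable_fin_num measurableT i1)))).
  by congr (_%:E); exact: g_orth.
move: cv; under eq_fun do rewrite z.
move=> /cvg_lim; rewrite lim_cst// => /(_ (@ereal_hausdorff R)) ->.
rewrite [LHS]integral_mkcond; apply: eq_integral => p _; rewrite patchE indicE.
by case: ifP => _; rewrite ?mulr1 ?mulr0.
Qed.

(** Rectangles generate the Borel sets of a chart; the Dynkin argument extends [orth_patch] from
    rectangles to all Borel sets of a patch. *)
Lemma orth_ae0 : {ae vol, forall p, g p = 0}.
Proof.
apply: (ae_ppatch ltr01) => p.
have [ac cp] := pchartP p; have Kc := @prect_sub 1 p (lexx _).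
set c := pchart p in ac cp Kc *; set a := plo 1 p in Kc *; set b := phi 1 p in Kc *.
rewrite -[ppatch 1 p]/(cpatch c a b).
have mp : measurable (cpatch c a b : set (borel U)) by apply: open_borel; exact: open_patch.
pose P (B : set (borel E)) := (\int[vol]_(p in cpatch c a b `&` cmap c @^-1` B) (g p)%:E = 0)%E.
have mcm : measurable_fun (cpatch c a b : set (borel U)) (cmap c : borel U -> borel E).
  by apply: cmap_measurable => // q [].
have mpre (B : set (borel E)) : measurable B -> measurable (cpatch c a b `&` cmap c @^-1` B : set (borel U)).
  by move=> mB; exact: mcm.
have igS A : measurable A -> vol.-integrable A (EFin \o g).
  by move=> mA; exact: integrableS ig.
have PA B : measurable B -> P B.
  rewrite borel_rV_open_rect; apply: dynkin_induction.
  - exact: borel_rV_open_rect.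
  - move=> _ _ [a1 [b1 ->]] [a2 [b2 ->]]; rewrite open_rectI.
    by eexists; eexists.
  - by rewrite /P setIT; exact: orth_patch.
  - move=> _ [a' [b' ->]]; rewrite /P -setIA -preimage_setI open_rectI.
    apply: orth_patch => // x hx; apply: Kc => i; have := hx i.
    by rewrite ge_max le_min => /andP[/andP[-> _] /andP[-> _]].
  - move=> S mS PS; have := orth_patch ac Kc; rewrite -{1}(setIT (cpatch c a b)) -(preimage_setT (cmap c)).
    rewrite -(setUv S) preimage_setU setIUr integral_setU//=.
    + by rewrite PS add0e.
    + exact: mpre.
    + by apply: mpre; exact: measurableC.
    + by apply: measurable_funTS; exact/measurable_EFinP.
    + by rewrite disj_set2E -setIACA setICr setI0.
  - move=> F mF tF PF; rewrite /P setI_bigcupr integral_bigcup.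
    + by apply: eseries0 => i _ _; exact: PF.
    + apply/trivIsetP => i j _ _ ij; rewrite setIACA -preimage_setI.
      by have /trivIsetP/(_ i j Logic.I Logic.I ij) -> := tF; rewrite setI0.
    + by move=> k; exact: mpre.
    + by apply: igS; apply: bigcup_measurable => i _; exact: mpre.
have PU (A : set (borel U)) : measurable A -> (\int[vol]_(p in cpatch c a b `&` A) (g p)%:E = 0)%E.
  move=> mA; have mr := @measurable_open_rect R d a b.
  have mci : measurable_fun (open_rect a b) (cinv c : borel E -> borel U).
    by apply: cinv_measurable => // x /open_rect_closed /Kc.
  have := PA _ (mci mr A mA); congr (integral _ _ _ = _).
  apply/seteqP; split => q [cpq].
    by move=> [_ /=]; rewrite cmapK; have [] := cpq.
  by move=> Aq; split; split; have [c1 c2] := cpq => //; rewrite /= cmapK.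
have := @integral_ae_eq _ (borel U) R vol (cpatch c a b) mp (cst 0)%E (EFin \o g) (igS _ mp)
  (measurable_cst _) (fun A AD mA => etrans (etrans (congr1 (fun D => integral vol D (EFin \o g)) (esym (setIidr AD))) (PU A mA)) (esym (integral0 _ _))).
by apply: ae_imp => q hq cq; have := hq cq => /= -[].
Qed.

End Density.

(** * Disjoint bumps on a grid in one chart *)

Section Grid.

Let p : U := point.
Let c := pchart p.
Let rho := pradius p.
Let a := plo 1 p.
Let b := phi 1 p.

(** All grid sizes form one family, so that the constant of [tensor_dot_family] does not depend on
    N. *)
Definition cell := {N : nat & {ffun 'I_d -> 'I_N.+1}}.
Implicit Types (j k l : cell).
Definition cell_scale j : R := (projT1 j).+1%:R.
Local Notation la := cell_scale.

(** The point at relative position t of the cell along axis i; cells have width 2 rho / (N + 1).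
    Bumps live between 1/4 and 3/4, so those of distinct cells of one grid are separated. *)
Definition cell_at (t : R) j (i : 'I_d) : R := a i + (projT2 j i)%:R * (2 * rho / la j) + t * (2 * rho / la j).
Local Notation lo := (cell_at 4^-1).
Local Notation hi := (cell_at (3 / 4)).
Definition cell_bump j : U -> R := extend c (rect_bump (la j) (lo j) (hi j)).
Local Notation u := cell_bump.

Let rho0 : 0 < rho := pradius_gt0 p.
Let ac : atlas M c. Proof. by have [] := pchartP p. Qed.
Let abc : closed_rect a b `<=` ccod c. Proof. exact: prect_sub. Qed.
Let la1 j : 1 <= la j. Proof. by rewrite ler1n. Qed.
Let la0 j : 0 < la j. Proof. exact: lt_le_trans. Qed.
Let h0 j : 0 < 2 * rho / la j. Proof. by rewrite divr_gt0// mulr_gt0. Qed.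

Lemma cell_at_bounds j i t : 0 < t -> t < 1 -> a i < cell_at t j i /\ cell_at t j i < b i.
Proof.
move=> t0 t1; have hj := h0 j; rewrite /cell_at.
have k1 : (projT2 j i)%:R + 1 <= la j by rewrite -[leRHS]natr1 lerD2r ler_nat -ltnS.
have bE : b i = a i + la j * (2 * rho / la j).
  by rewrite [la j * _]mulrC divfK ?gt_eqF// /b /a /plo /phi /rho; ring.
rewrite bE; move: (2 * rho / la j) hj => h hj; move: (la j) k1 => m k1.
have k0 : 0 <= (projT2 j i)%:R :> R by [].
move: (a i) (projT2 j i)%:R k1 k0 => x y k1 k0; split; nra.
Qed.

Let loU j : closed_rect (lo j) (hi j) `<=` open_rect a b.
Proof.
move=> x hx i; have /andP[h1 h2] := hx i; rewrite /= in_itv/=.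
have q0 : 0 < 4^-1 :> R by rewrite invr_gt0.
have q1 : 4^-1 < 1 :> R by rewrite invf_lt1// ltr1n.
have q2 : 0 < 3 / 4 :> R by rewrite divr_gt0.
have q3 : 3 / 4 < 1 :> R by rewrite ltr_pdivrMr// mul1r ltr_nat.
have [l1 _] := cell_at_bounds j i q0 q1; have [_ l2] := cell_at_bounds j i q2 q3.
by rewrite (lt_le_trans l1 h1) (le_lt_trans h2 l2).
Qed.

Let loS j : closed_rect (lo j) (hi j) `<=` closed_rect a b.
Proof. by move=> x /loU/open_rect_closed. Qed.

Let sbump j : smooth_on setT (rect_bump (la j) (lo j) (hi j)).
Proof. exact: rect_bump_smooth. Qed.

Let bump0 j x : ~ closed_rect (lo j) (hi j) x -> rect_bump (la j) (lo j) (hi j) x = 0.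
Proof. by move=> nx; apply: rect_bump_out => [|/open_rect_closed]; [exact: ltW|]. Qed.

Let bbump n : bfam la (ccod c) (closed_rect a b) n 0 (fun j => rect_bump (la j) (lo j) (hi j)).
Proof.
have oc := @open_ccod c.
apply: (bfam_prod la1 oc abc (@compact_closed_rect R d a b)) => i.
have h1 : bfam la (ccod c) (closed_rect a b) n 0 (fun j x => flat_tower 0 (la j * x 0 i + - (la j * lo j i))).
  by apply: (bfam_flat la1 oc abc (@compact_closed_rect R d a b)) => j; rewrite ger0_norm.
have h2 : bfam la (ccod c) (closed_rect a b) n 0 (fun j x => flat_tower 0 (- la j * x 0 i + la j * hi j i)).
  by apply: (bfam_flat la1 oc abc (@compact_closed_rect R d a b)) => j; rewrite normrN ger0_norm.
exact: (bfamM oc abc h1 h2).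
Qed.

Lemma cell_bump_sobolev j : sobolevC (u j).
Proof. exact: (sobolev_extend ac abc la1 sbump loS bump0 bbump). Qed.

Let wu j : weak_derivatives M r (u j) (cov_tensors (u j)).
Proof. exact: (wd_extend ac abc (sbump j) (@loS j) (@bump0 j)). Qed.

Let inside j q := cdom c q /\ closed_rect (lo j) (hi j) (cmap c q).

Lemma cell_bump_out j q : ~ inside j q -> u j q = 0.
Proof.
move=> nq; rewrite /cell_bump /extend; case: asboolP => // cq; apply: bump0 => h.
exact: nq.
Qed.

Lemma cell_tensor_out j S q i : (i <= r)%N -> tensorial M r S -> ~ inside j q ->
  tensor_dot M i (cov_tensors (u j)) S q = 0.
Proof.
move=> ir tS nq; have [cq|ncq] := pselect (cdom c q).
  apply: (tensor_dot_extend_out ac abc (sbump j) (@loS j) (@bump0 j) ir tS cq).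
  by move=> h; apply: nq.
apply: (@tensor_dot_extend_off c a b abc _ (lo j) (hi j) (@loS j) (@bump0 j)).
by move=> [x /abc/ccodP[h _] xq]; apply: ncq; rewrite -xq.
Qed.

Lemma cell_disjoint j k q : projT1 j = projT1 k -> j <> k -> inside j q -> ~ inside k q.
Proof.
case: j k => N x [N' y] /= e; subst N' => xy [_ h1] [_ h2]; apply: xy; congr existT.
apply/ffunP => i; apply: val_inj; have := h1 i; have := h2 i; rewrite /cell_at.
have h0' : 0 < 2 * rho / N.+1%:R by rewrite divr_gt0// mulr_gt0.
move: (2 * rho / _) h0' (a i) => h hh ai /andP[u1 u2] /andP[v1 v2].
apply/eqP; rewrite eqn_leq; apply/andP; split; rewrite leqNgt; apply/negP => lt.
  have : (y i)%:R + 1 <= (x i)%:R :> R by rewrite natr1 ler_nat.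
  move: u1 u2 v1 v2; move: ((x i)%:R) ((y i)%:R) => s t u1 u2 v1 v2 st.
  have : (t + 1) * h <= s * h by rewrite ler_pM2r.
  nra.
have : (x i)%:R + 1 <= (y i)%:R :> R by rewrite natr1 ler_nat.
move: u1 u2 v1 v2; move: ((x i)%:R) ((y i)%:R) => s t u1 u2 v1 v2 st.
have : (s + 1) * h <= t * h by rewrite ler_pM2r.
nra.
Qed.

Lemma cell_bump_orth j k : projT1 j = projT1 k -> j <> k ->
  sdot (u j) (u k) = 0 /\ forall q, u j q * u k q = 0.
Proof.
move=> e jk; split.
  rewrite (sobolev_dotE (wu j) (wu k)) /dotT big1// => i _.
  have ir : (i <= r)%N by rewrite -ltnS.
  apply: (@congr1 _ _ fine _ 0%E); rewrite -[RHS](integral0 vol setT); apply: eq_integral => q _; congr EFin.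
  have [h|h] := pselect (inside j q).
    rewrite tensor_dotC; apply: (cell_tensor_out ir (wd_tensorial (wu j))).
    exact: cell_disjoint h.
  exact: (cell_tensor_out ir (wd_tensorial (wu k))).
move=> q; have [h|h] := pselect (inside j q).
  by rewrite (@cell_bump_out k) ?mulr0//; exact: cell_disjoint h.
by rewrite cell_bump_out ?mul0r.
Qed.

Let measure_cell s t j : s < t -> (L (closed_rect (cell_at s j) (cell_at t j)) =
   (((t - s) * (2 * rho / la j)) ^+ d)%:E)%E.
Proof.
move=> st.
have -> : closed_rect (cell_at s j) (cell_at t j) = rect (fun i => `[cell_at s j i, cell_at t j i]%classic).
  by apply/seteqP; split => x hx i; have := hx i; rewrite /=.
rewrite -[L _]/(lebesgue_rV (rect (fun i => `[cell_at s j i, cell_at t j i]%classic))).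
rewrite lebesgue_rV_rect; last by move=> i; exact: measurable_itv.
transitivity (\prod_(i < d) ((t - s) * (2 * rho / la j))%:E)%E; last first.
  by rewrite prodEFin prodr_const card_ord.
apply: eq_bigr => i _; rewrite lebesgue_measure_itv/= lte_fin /cell_at ifT; last by rewrite ltrD2l ltr_pM2r.
by rewrite -EFinB; congr (_%:E); ring.
Qed.

(** Both squared norms scale with the volume of the cell, of order la^-d, which cancels in the
    quotient; the derivatives cost la^(2r). *)
Lemma cell_bump_quotient : exists2 C : R, 0 < C & forall j, 0 < \int[vol]_q (u j q ^+ 2) /\
  sdot (u j) (u j) <= C * la j ^+ (2 * r) * \int[vol]_q (u j q ^+ 2).
Proof.
have [C2 C20 h2] := patch_integral ac abc.
have [C C0 hC] := tensor_dot_family ac abc la1 sbump loS bump0 bbump.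
(* Between the relative positions 3/8 and 5/8 the arguments of the flat functions are at least la
   (1/8) (2 rho / la) = rho/4, so each of the 2d factors of the bump is at least eta there. *)
pose eta : R := flat_tower 0 (rho / 4).
have eta0 : 0 < eta by apply: flat_tower_gt0; rewrite divr_gt0.
pose D := (eta ^+ 2) ^+ d.
have D0 : 0 < D by rewrite !exprn_gt0.
have mp : measurable (cpatch c a b : set (borel U)) by apply: open_borel; exact: open_patch.
have mr := @measurable_open_rect R d a b.
have mcr s t j : measurable (closed_rect (cell_at s j) (cell_at t j) : set (borel E)).
  by apply: compact_borel; exact: compact_closed_rect.
have low j : (D ^+ 2 * (rho / (2 * la j)) ^+ d) <= C2 * \int[vol]_q (u j q ^+ 2).
  have [su _] := cell_bump_sobolev j.
  have [mu2 [iu2 _]] := sobolev_sq_integrable su.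
  have mF : measurable_fun (cpatch c a b : set (borel U)) (fun q : borel U => (u j q ^+ 2)%:E).
    by apply/measurable_EFinP; exact: measurable_funTS.
  have F0 q : (0 <= (u j q ^+ 2)%:E)%E by rewrite lee_fin sqr_ge0.
  have [h3 _] := h2 _ mF (fun q _ => F0 q).
  pose B := closed_rect (cell_at (3 / 8) j) (cell_at (5 / 8) j) : set (borel E).
  have s38 : 3 / 8 < 5 / 8 :> R by rewrite ltr_pM2r ?invr_gt0// ltr_nat.
  have LB := measure_cell j s38.
  have q0 : 0 < 3 / 8 :> R by rewrite divr_gt0.
  have q1 : 5 / 8 < 1 :> R by rewrite ltr_pdivrMr// mul1r ltr_nat.
  have Bab : B `<=` (open_rect a b : set E).
    move=> x hx i; have /andP[x1 x2] := hx i; rewrite /= in_itv/=.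
    have [l1 _] := cell_at_bounds j i q0 (lt_trans s38 q1).
    have [_ l2] := cell_at_bounds j i (lt_trans q0 s38) q1.
    by rewrite (lt_le_trans l1 x1) (le_lt_trans x2 l2).
  rewrite -lee_fin; apply: (@le_trans _ _ (C2%:E * \int[vol]_(q in cpatch c a b) (u j q ^+ 2)%:E)%E); last first.
    rewrite EFinM lee_pmul2l// ?lte_fin//.
    apply: (@le_trans _ _ (\int[vol]_q (u j q ^+ 2)%:E)%E).
      by apply: ge0_subset_integral => //; exact/measurable_EFinP.
    by have := fineK (integrable_fin_num measurableT iu2) => /= <-.
  apply: le_trans h3; apply: (@le_trans _ _ (\int[L]_(x in B) (u j (cinv c x) ^+ 2)%:E)%E); last first.
    by apply: ge0_subset_integral => //; [exact: mcr|exact: (measurable_cinv_patch abc mF)].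
  apply: (@le_trans _ _ (\int[L]_(x in B) (D ^+ 2)%:E)%E).
    rewrite integral_cst; last exact: mcr.
    rewrite /B [X in (_ * X)%E]LB -EFinM lee_fin ler_wpM2l ?sqr_ge0//.
    apply: le_of_eq; congr (_ ^+ _).
    have := gt_eqF (la0 j); move: (la j) => m m0; field.
    by rewrite m0.
  apply: ge0_le_integral => //.
  - exact: mcr.
  - by move=> x _; rewrite lee_fin exprn_ge0// ltW.
  - by apply: measurable_funS (measurable_cinv_patch abc mF).
  - move=> x Bx; rewrite lee_fin /cell_bump extend_cinv; last by apply: abc; exact: open_rect_closed (Bab _ Bx).
    rewrite lerXn2r ?nnegrE ?(ltW D0) ?rect_bump_ge0//.
    rewrite /D /rect_bump -[X in _ ^+ X](card_ord d) -prodr_const; apply: ler_prod => i _.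
    rewrite exprn_ge0 ?(ltW eta0)//= expr2.
    have /andP[x1 x2] := Bx i.
    have key (y m w k : R) : 0 < m -> 0 < w -> k + (3 / 8) * (2 * w / m) <= y -> 
        w / 4 <= m * y + - (m * (k + 4^-1 * (2 * w / m))).
      move=> m0 w0 h; have : m * (k + 3 / 8 * (2 * w / m)) <= m * y by rewrite ler_pM2l.
      have -> : m * (k + 3 / 8 * (2 * w / m)) = m * k + 3 / 4 * w by field; rewrite gt_eqF.
      have -> : m * (k + 4^-1 * (2 * w / m)) = m * k + w / 2 by field; rewrite gt_eqF.
      lra.
    have key2 (y m w k : R) : 0 < m -> 0 < w -> y <= k + (5 / 8) * (2 * w / m) -> 
        w / 4 <= - m * y + m * (k + 3 / 4 * (2 * w / m)).
      move=> m0 w0 h; have : m * y <= m * (k + 5 / 8 * (2 * w / m)) by rewrite ler_pM2l.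
      have -> : m * (k + 5 / 8 * (2 * w / m)) = m * k + 5 / 4 * w by field; rewrite gt_eqF.
      have -> : m * (k + 3 / 4 * (2 * w / m)) = m * k + 3 / 2 * w by field; rewrite gt_eqF.
      lra.
    by apply: ler_pM; rewrite ?(ltW eta0)//; apply: flat_tower_mono; [exact: key|exact: key2].
have up j : sdot (u j) (u j) <= r.+1%:R * (C2 * (C * la j ^+ (2 * r) * (rho / la j) ^+ d)).
  rewrite (sobolev_dotE (wu j) (wu j)) /dotT.
  rewrite mulr_natl -[X in _ *+ X](card_ord r.+1) -sumr_const; apply: ler_sum => i _.
  have ir : (i <= r)%N by rewrite -ltnS.
  have mt := tensor_dot_measurable (wu j) (wu j) ir.
  pose F (q : borel U) := (tensor_dot M i (cov_tensors (u j)) (cov_tensors (u j)) q)%:E.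
  have mF : measurable_fun (cpatch c a b : set (borel U)) F.
    by apply/measurable_EFinP; exact: measurable_funTS.
  have F0 q : (0 <= F q)%E by rewrite lee_fin tensor_dot_ge0.
  have [_ h3] := h2 _ mF (fun q _ => F0 q).
  have it := sob_extend ac abc la1 sbump loS bump0 bbump j ir.
  rewrite -lee_fin; apply: (@le_trans _ _ (\int[vol]_q F q)%E).
    by have := fineK (integrable_fin_num measurableT it) => /= <-.
  have -> : (\int[vol]_q F q = \int[vol]_(q in cpatch c a b) F q)%E.
    rewrite [RHS]integral_mkcond; apply: eq_integral => q _; rewrite patchE; case: ifPn => // nq.
    rewrite /F (cell_tensor_out ir (wd_tensorial (wu j)))// => -[cq h].
    by move/negP: nq; apply; rewrite inE; split => //; exact: loU h.
  apply: (le_trans h3); rewrite EFinM lee_pmul2l// ?lte_fin//.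
  have s14 : 4^-1 < 3 / 4 :> R by rewrite ltr_pdivlMr// mulVf// ltr1n.
  pose B := closed_rect (lo j) (hi j) : set (borel E).
  have LB := measure_cell j s14.
  have la2 : 0 <= C * la j ^+ (2 * r) by rewrite mulr_ge0// exprn_ge0// ltW.
  apply: (@le_trans _ _ (\int[L]_(x in B) (C * la j ^+ (2 * r))%:E)%E); last first.
    rewrite integral_cst; last exact: mcr.
    rewrite /B [X in (_ * X)%E]LB -EFinM lee_fin; apply: le_of_eq.
    congr (_ * _ ^+ _); have := gt_eqF (la0 j); move: (la j) => m m0; field.
    by rewrite m0.
  rewrite integral_mkcond [leRHS]integral_mkcond; apply: ge0_le_integral => //.
  - by move=> x _; apply: erestrict_ge0.
  - by apply/(measurable_restrictT _ mr); exact: (measurable_cinv_patch abc mF).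
  - by apply/(measurable_restrictT _ (mcr _ _ _)); exact: measurable_cst.
  - move=> x _; rewrite !patchE; case: ifPn => [|_]; last by case: ifP => _ //; rewrite lee_fin.
    rewrite inE => xr; have cx := abc (open_rect_closed xr).
    case: ifPn => [_|nx]; first by rewrite /F lee_fin; exact: hC.
    rewrite /F (cell_tensor_out ir (wd_tensorial (wu j)))// => -[_].
    by have [_ ->] := ccodP cx => h; move/negP: nx; apply; rewrite inE.
have rl j : 0 < rho / la j by rewrite divr_gt0.
exists (r.+1%:R * C2 * (C + 1) * 2 ^+ d * C2 / D ^+ 2).
  by rewrite divr_gt0 ?exprn_gt0// !mulr_gt0// ?exprn_gt0// ltr_wpDl.
move=> j; have := low j; have -> : rho / (2 * la j) = rho / la j / 2.
  by have := gt_eqF (la0 j); move: (la j) => m m0; field; rewrite m0.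
rewrite exprMn => lj.
have I0 : 0 < \int[vol]_q (u j q ^+ 2).
  rewrite -(pmulr_rgt0 _ C20); apply: lt_le_trans lj.
  by rewrite !mulr_gt0 ?exprn_gt0.
split => //; apply: (le_trans (up j)).
have X0 : 0 < la j ^+ (2 * r) by rewrite exprn_gt0.
have Y0 : 0 < (rho / la j) ^+ d by rewrite exprn_gt0.
have lj' : (rho / la j) ^+ d <= 2 ^+ d * C2 / D ^+ 2 * \int[vol]_q (u j q ^+ 2).
  rewrite mulrAC ler_pdivlMr ?exprn_gt0// -mulrA -ler_pdivrMl ?exprn_gt0//.
  apply: le_trans lj; rewrite exprVn; apply: le_of_eq.
  move: ((rho / la j) ^+ d) (2 ^- d) (D ^+ 2) => x y z; ring.
have r0 : 0 <= r.+1%:R * C2 * (C + 1) * la j ^+ (2 * r) by rewrite !mulr_ge0// ?(ltW X0) ?(ltW C20)// addr_ge0.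
apply: (@le_trans _ _ (r.+1%:R * C2 * (C + 1) * la j ^+ (2 * r) * (rho / la j) ^+ d)).
  rewrite -!mulrA ler_pM2l// ler_pM2l// mulrA [leRHS]mulrA ler_pM2r//.
  by rewrite ler_pM2r// lerDl.
apply: (le_trans (ler_wpM2l r0 lj')).
apply: le_of_eq.
move: (2 ^+ d) (D ^+ 2)^-1 (la j ^+ _) (\int[vol]_q _) => x y z t; ring.
Qed.

End Grid.

(** * The kernel and its eigenvalues *)

Section Spectrum.

Definition L2dot (f g : U -> R) : R := \int[vol]_p (f p * g p).

Lemma sobolev_lin_continuous k f g : sobolevC f -> sobolevC g -> sobolevC (fun p => k * f p + g p).
Proof.
move=> [sf cf] [sg cg]; split; first exact: sobolev_lin.
move=> p; have h : {for p, continuous (fun q => k * f q)}.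
  by apply: continuousM; [exact: cst_continuous|exact: cf].
exact: continuousD h (cg p).
Qed.

Lemma sobolev_zero : sobolevC (fun=> 0).
Proof.
have [j _] : exists j : cell, True by exists (existT _ 0%N [ffun=> ord0]).
have h := cell_bump_sobolev j.
have := sobolev_continuous_sub h h.
by congr sobolevC; apply/funext => p; rewrite subrr.
Qed.

Lemma sobolev_inner_product : is_inner_product_space sobolevC sdot.
Proof.
split.
- exact: sobolev_zero.
- exact: sobolev_lin_continuous.
- by move=> f g [sf _] [sg _]; exact: sobolev_dotC.
- by move=> k f g h [sf _] [sg _] [sh _]; exact: sobolev_dot_lin.
- move=> f sf; have [sf1 _] := sf; split; first exact: sobolev_dot_ge0.
  exact: sobolev_dot_eq0.
Qed.

Lemma sobolev_rkhs : is_rkhs sobolevC sdot.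
Proof.
split; [exact: sobolev_inner_product|exact: sobolev_complete|].
move=> x; have [C C0 hC] := sup_bound.
by exists C => f sf; exact: hC.
Qed.

Lemma sobolev_sqint f : sobolevC f -> sqint vol setT (f : borel U -> R).
Proof.
move=> [sf cf]; have [_ [h _]] := sobolev_sq_integrable sf; split => //.
by apply: borel_real_continuous => [|x _]; [exact: openT|exact: cf].
Qed.

Lemma L2dot_lin k f g h : sqint vol setT (f : borel U -> R) -> sqint vol setT (g : borel U -> R) ->
  sqint vol setT (h : borel U -> R) -> L2dot (fun p => k * f p + g p) h = k * L2dot f h + L2dot g h.
Proof.
move=> sf sg sh; have i1 := sqintM measurableT sf sh; have i2 := sqintM measurableT sg sh.
by apply: (Rintegral_axpy measurableT i1 i2) => x; rewrite mulrDl mulrA.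
Qed.

Lemma L2dotC f g : L2dot f g = L2dot g f.
Proof. by apply: eq_Rintegral => x _; rewrite mulrC. Qed.

Lemma L2dot_sqE f : L2dot f f = \int[vol]_p (f p ^+ 2).
Proof. by apply: eq_Rintegral => x _; rewrite expr2. Qed.

Local Notation V := (U -> R^o).

Let sH : linear_subspace (sobolevC : set V).
Proof. by split; [exact: sobolev_zero|move=> k f g; exact: sobolev_lin_continuous]. Qed.

Let fdot : psd_form (sobolevC : set V) (sdot : V -> V -> R).
Proof.
have [_ _ h1 h2 h3] := sobolev_inner_product; split; [exact: h1|exact: h2|].
by move=> f /h3[].
Qed.

Let fb : psd_form (sobolevC : set V) (L2dot : V -> V -> R).
Proof.
split.
- by move=> f g _ _; exact: L2dotC.
- by move=> k f g h sf sg sh; apply: L2dot_lin; exact: sobolev_sqint.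
- by move=> f _; rewrite L2dot_sqE; apply: Rintegral_ge0 => x _; exact: sqr_ge0.
Qed.

Let dot_eq0 (f : V) : sobolevC f -> sdot f f = 0 -> f = 0.
Proof. by move=> sf h; have [_ _ _ _ /(_ f sf)[_ /(_ h)]] := sobolev_inner_product. Qed.

Let b_le (f : V) : sobolevC f -> L2dot f f <= 1 * sdot f f.
Proof.
move=> [sf _]; rewrite mul1r.
by have [_ [_]] := sobolev_sq_integrable sf.
Qed.

Let b_eq0 (f : V) : sobolevC f -> L2dot f f = 0 -> f = 0.
Proof.
move=> sf; rewrite L2dot_sqE => h; have [mf fi] := sobolev_sqint sf.
apply: (ae_continuous_zero (proj2 sf)).
have h0 : (\int[vol]_p (f p ^+ 2)%:E = 0)%E.
  apply: (etrans (esym (fineK (integrable_fin_num measurableT fi)))).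
  by congr (_%:E).
have mE : measurable_fun setT (EFin \o (fun p : borel U => f p ^+ 2)).
  by apply/measurable_EFinP; exact: measurable_funX.
have h1 : (\int[vol]_p `|(f p ^+ 2)%:E| = 0)%E.
  by rewrite -h0; apply: eq_integral => x _; rewrite gee0_abs// lee_fin sqr_ge0.
move/(ae_eq_integral_abs vol measurableT mE) : h1; apply: ae_imp => p /(_ Logic.I) /= [/eqP].
by rewrite sqrf_eq0 => /eqP.
Qed.

Let complete_dot (f_ : nat -> V) : (forall n, sobolevC (f_ n)) ->
  (forall e : R, 0 < e -> exists N, forall m n, (N <= m)%N -> (N <= n)%N ->
     sdot (f_ m - f_ n) (f_ m - f_ n) <= e) ->
  exists2 f : V, sobolevC f & forall e : R, 0 < e -> exists N, forall n, (N <= n)%N ->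
     sdot (f_ n - f) (f_ n - f) <= e.
Proof.
move=> Hf cau.
have [|f Hf' cf] := @sobolev_complete f_ Hf.
  move=> e e0; have e2 : 0 < (e / 2) ^+ 2 by rewrite exprn_gt0// divr_gt0.
  have [N hN] := cau _ e2; exists N => m n hm hn.
  have h := hN m n hm hn; apply: le_lt_trans.
    by apply: (le_trans (ler_wsqrtr h)); rewrite sqrtr_sqr ger0_norm// divr_ge0// ltW.
  by rewrite ltr_pdivrMr// ltr_pMr// ltr1n.
exists f => // e e0; have se : 0 < Num.sqrt e by rewrite sqrtr_gt0.
have := cf => /cvgrPdist_le/(_ _ se)[N _ hN]; exists N => n hn.
have := hN n hn; rewrite sub0r normrN ger0_norm ?sqrtr_ge0// => h.
have d0 : 0 <= sdot (f_ n - f) (f_ n - f) by apply: (form_ge0 fdot); exact: subspaceB.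
by rewrite ler_sqrt in h; [exact: h|exact: ltW].
Qed.

Let approx (e : R) : 0 < e -> exists (n : nat) (l : 'I_n -> V -> R) (C : R),
  [/\ 0 <= C, forall i, bounded_functional (sobolevC : set V) (sdot : V -> V -> R) (l i) &
      forall f : V, sobolevC f -> L2dot f f <= C * \sum_i l i f ^+ 2 + e * sdot f f].
Proof.
have [I [l [C [C0 lL lb hl]]]] := sobolev_approx.
(* N + 1 > C / e and (N + 1)^(2r) >= N + 1, so the remainder is at most e. *)
move=> e0; pose N := Num.truncn (C / e); pose K : finType := (I * {ffun 'I_d -> 'I_N.+1})%type.
exists #|K|, (fun i f => l (enum_val i).1 N (enum_val i).2 f), C; split.
- exact: ltW.
- move=> i; split; first by move=> k f g [sf _] [sg _]; exact: lL.
  by have [C' hC'] := lb (enum_val i).1 N (enum_val i).2; exists C' => f [sf _]; exact: hC'.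
- move=> f [sf cf]; rewrite L2dot_sqE; apply: (le_trans (hl f N sf)).
  rewrite mulrDr; apply: lerD.
    rewrite pair_big; apply: le_of_eq.
    by rewrite (reindex (@enum_val K predT))//=; exists enum_rank => x _; [exact: enum_valK|exact: enum_rankK].
  rewrite mulrCA mulrC ler_wpM2r//; first exact: (sobolev_dot_ge0).
  rewrite ler_pdivrMr ?exprn_gt0// -ler_pdivrMl//.
  have h1 : C / e <= N.+1%:R by rewrite ltW// truncnS_gt.
  rewrite mulrC; apply: (le_trans h1); rewrite -{1}[N.+1%:R]expr1 ler_weXn2l ?ler1n//.
  by rewrite muln_gt0.
Qed.

Let card_cells N : #|{ffun 'I_d -> 'I_N.+1}| = (N.+1 ^ d)%N.
Proof. by rewrite card_ffun !card_ord. Qed.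

Let bump N (k : {ffun 'I_d -> 'I_N.+1}) : V := cell_bump (existT _ N k).

Let bump_in N (k : {ffun 'I_d -> 'I_N.+1}) : sobolevC (bump k).
Proof. exact: (cell_bump_sobolev). Qed.

Let bump_neq N (k l : {ffun 'I_d -> 'I_N.+1}) : k != l ->
  existT (fun N => {ffun 'I_d -> 'I_N.+1}) N k <> existT _ N l.
Proof. by move=> /eqP kl h; apply: kl; exact: eq_from_Tagged h. Qed.

Let bump_orth N (k l : {ffun 'I_d -> 'I_N.+1}) : k != l ->
  sdot (bump k) (bump l) = 0 /\ L2dot (bump k) (bump l) = 0.
Proof.
move=> kl; have [h1 h2] := @cell_bump_orth
  (existT _ N k) (existT _ N l) erefl (bump_neq kl).
split => //; rewrite /L2dot; apply: (@congr1 _ _ fine _ 0%E); rewrite -[RHS](integral0 vol setT).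
by apply: eq_integral => p _; rewrite h2.
Qed.

Let bump_norm N (k : {ffun 'I_d -> 'I_N.+1}) : 0 < sdot (bump k) (bump k).
Proof.
have [C C0 hC] := cell_bump_quotient.
have [h _] := hC (existT _ N k); have [sk _] := bump_in k.
apply: lt_le_trans h _; by have [_ [_]] := sobolev_sq_integrable sk.
Qed.

Let infinite_dim (n : nat) : exists u : 'I_n -> V, [/\ forall i, sobolevC (u i),
  forall i k, i != k -> sdot (u i) (u k) = 0 & forall i, 0 < sdot (u i) (u i)].
Proof.
have nN : (n <= #|{ffun 'I_d -> 'I_n.+1}|)%N.
  by rewrite card_cells (leq_trans (leqnSn n))// -{1}[n.+1]expn1 leq_pexp2l.
exists (fun i => bump (enum_val (widen_ord nN i))); split.
- by move=> i; exact: bump_in.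
- move=> i k ik; have [] := @bump_orth _ (enum_val (widen_ord nN i)) (enum_val (widen_ord nN k)) => //.
  by apply: contra_neq ik => /enum_val_inj/(congr1 val) h; exact: val_inj.
- by move=> i; exact: bump_norm.
Qed.

Definition sobolev_eigenvalue (k : nat) : R :=
  @eigenvalue_of R V sobolevC sdot L2dot k.
Local Notation tau := sobolev_eigenvalue.

Lemma sobolev_eigenvalue_mono k n : (k <= n)%N -> tau n <= tau k.
Proof. exact: (tau_mono sH fdot dot_eq0 complete_dot fb b_le b_eq0 approx infinite_dim). Qed.

Lemma sobolev_eigenvalue_upper : exists m (C : R), [/\ (0 < m)%N, 0 < C &
  forall N, tau (m * N.+1 ^ d) <= C / N.+1%:R ^+ (2 * r)].
Proof.
have [I [l [C [C0 lL lb hl]]]] := sobolev_approx.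
(* The successor keeps m positive, as [floor_root] requires; monotonicity absorbs it. *)
exists #|I|.+1, C; split => // N; set D := C / _.
apply: (@le_trans _ _ (tau (#|I| * N.+1 ^ d))).
  by apply: sobolev_eigenvalue_mono; rewrite leq_mul2r leqnSn orbT.
have := @tau_upper _ _ _ _ sH fdot dot_eq0 complete_dot _ _ fb b_le b_eq0 approx infinite_dim
  (I * {ffun 'I_d -> 'I_N.+1})%type (fun i f => l i.1 N i.2 f) C D.
rewrite card_prod card_cells; apply.
  by move=> i k f g [sf _] [sg _]; exact: lL.
move=> f [sf cf]; rewrite L2dot_sqE; apply: (le_trans (hl f N sf)).
rewrite mulrDr; apply: lerD; first by rewrite pair_big.
by rewrite mulrCA mulrC.
Qed.

Lemma sobolev_eigenvalue_lower : exists2 c : R, 0 < c &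
  forall N k, (k < N.+1 ^ d)%N -> c / N.+1%:R ^+ (2 * r) <= tau k.
Proof.
have [C C0 hC] := cell_bump_quotient.
exists C^-1; first by rewrite invr_gt0.
move=> N k kN.
apply: (@tau_lower _ _ _ _ sH fdot dot_eq0 complete_dot _ _ fb b_le b_eq0 approx infinite_dim
  k {ffun 'I_d -> 'I_N.+1} (@bump N)); first by rewrite card_cells.
- by move=> i; exact: bump_in.
- by move=> i l /bump_orth[].
- by move=> i l /bump_orth[].
- by move=> i; exact: bump_norm.
- move=> i; have [_ h] := hC (existT _ N i); rewrite L2dot_sqE.
  rewrite -invfM mulrC ler_pdivrMr ?mulr_gt0 ?exprn_gt0//.
  by rewrite mulrC.
Qed.

(** Both bounds are known along the grid sizes N^d or m N^d; passing from k to a neighbouring grid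
    size changes k by a bounded factor, hence also its power 2r/d. *)
Lemma sobolev_eigenvalue_asymp : asymp tau (fun k => k.+1%:R `^ (- (2 * r)%:R / d%:R)).
Proof.
have [m [C [m0 C0 up]]] := sobolev_eigenvalue_upper.
have [c c0 low] := sobolev_eigenvalue_lower.
pose be : R := (2 * r)%:R / d%:R.
have be0 : 0 <= be by rewrite divr_ge0.
pose B k : R := k.+1%:R `^ (- (2 * r)%:R / d%:R).
have BE k : B k = (k.+1%:R `^ be)^-1 by rewrite /B mulNr powRN.
have B0 k : 0 < k.+1%:R `^ be by rewrite powR_gt0.
have pow N : (N%:R ^+ d) `^ be = N%:R ^+ (2 * r).
  rewrite -powR_mulrn// -powRrM mulrCA divff ?mulr1 ?powR_mulrn//.
  by rewrite pnatr_eq0 -lt0n.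
have mono (x y : R) : 0 <= x -> x <= y -> x `^ be <= y `^ be.
  by move=> x0 xy; apply: ge0_ler_powR => //; rewrite nnegrE// (le_trans x0).
pose D : R := (m * 2 ^ d)%:R `^ be.
exists (c / 2 ^+ (2 * r)), (C * D).
split; first by rewrite divr_gt0.
exists m => // k /= mk; rewrite -/(B k) BE invrK; apply/andP; split.
(* After the case split (N + 1)^d <= k + 1 < (N + 2)^d, so the lower bound is used with N + 2 cells
   per axis, and N + 2 <= 2 (N + 1). *)
- have [N /andP[h1 h2]] := floor_root k.+1 (ltn0Sn 0) d_gt0; rewrite !mul1n in h1 h2.
  case: N h1 h2 => [|N] h1 h2.
    by move: h2; rewrite exp1n.
  have kN : (k < N.+2 ^ d)%N by exact: ltnW.
  have h3 := low _ _ kN.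
  have h4 : N.+2%:R ^+ (2 * r) <= 2 ^+ (2 * r) * k.+1%:R `^ be.
    apply: (@le_trans _ _ ((2 * N.+1%:R) ^+ (2 * r))).
      by rewrite lerXn2r ?nnegrE ?mulr_ge0// -natrM ler_nat; lia.
    rewrite exprMn ler_pM2l ?exprn_gt0// -pow; apply: mono; first by rewrite exprn_ge0.
    by rewrite -natrX ler_nat.
  rewrite -ler_pdivrMr ?B0//; apply: le_trans h3.
  rewrite -mulrA -invfM ler_pM2l// lef_pV2 ?posrE ?exprn_gt0//.
(* The root 0 is excluded by k >= m; after the case split m (N + 1)^d <= k < m (N + 2)^d. *)
- have [N /andP[h1 h2]] := floor_root k m0 d_gt0.
  case: N h1 h2 => [|N] h1 h2.
    by move: h2; rewrite exp1n muln1 ltnNge mk.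
  have h3 : tau k <= C / N.+1%:R ^+ (2 * r).
    apply: le_trans (up N).
    exact: sobolev_eigenvalue_mono.
  rewrite -ler_pdivlMr ?B0//; apply: (le_trans h3).
  rewrite -mulrA ler_pM2l// -[leLHS]mul1r ler_pdivrMr ?exprn_gt0// mulrAC ler_pdivlMr// mul1r.
  rewrite -pow -powRM ?exprn_ge0//; apply: mono => //.
  rewrite -natrX -natrM ler_nat; apply: (leq_trans h2).
  rewrite -mulnA leq_mul2l; apply/orP; right; rewrite -expnMn leq_exp2r; lia.
Qed.

Lemma sobolev_reproducing_kernel : exists K, is_reproducing_kernel sobolevC sdot K.
Proof.
have [C C0 hC] := sup_bound.
have /choice[k hk] : forall s : U, exists g : V, sobolevC g /\ forall f : V, sobolevC f -> sdot f g = f s.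
  move=> s; have C2 : 0 <= C ^+ 2 by exact: sqr_ge0.
  have [||g Hg hg] := @riesz R V sobolevC sdot sH fdot complete_dot (fun f => f s) (C ^+ 2) C2.
  - by [].
  - move=> f sf; have h := hC f sf s; have d0 := form_ge0 fdot sf.
    rewrite -real_normK ?num_real// -(sqr_sqrtr d0) -exprMn lerXn2r ?nnegrE ?mulr_ge0 ?sqrtr_ge0//.
    exact: ltW.
  - by exists g.
by exists (fun x s => k s x) => s.
Qed.

Section Operator.
Variable K : U -> U -> R.
Hypothesis KP : is_reproducing_kernel sobolevC sdot K.
Local Notation e k := (@eigenvector R V sobolevC sdot L2dot k).

Let e_in k : sobolevC (e k).
Proof. exact: (eigenvector_in sH fdot dot_eq0 complete_dot fb b_le b_eq0 approx infinite_dim). Qed.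

Lemma kernel_sym x s : K x s = K s x.
Proof.
have [hs rs] := KP s; have [hx rx] := KP x; have := rx _ hs; have := rs _ hx => <- <-.
exact: (form_sym fdot).
Qed.

(* The integral operator is the adjoint of the inclusion into L^2. *)
Lemma integral_operator_riesz (f : borel U -> R) : sqint vol setT f ->
  exists g : V, [/\ sobolevC g, forall h : V, sobolevC h -> sdot h g = L2dot h f &
    forall x, integral_operator vol K f x = g x].
Proof.
move=> sf.
have C0 : 0 <= \int[vol]_p (f p ^+ 2) by apply: Rintegral_ge0 => x _; exact: sqr_ge0.
have [||g Hg hg] := @riesz R V sobolevC sdot sH fdot complete_dot (fun h => L2dot h f) _ C0.
- move=> k h1 h2 s1 s2; apply: L2dot_lin => //; exact: sobolev_sqint.
- move=> h sh; apply: (le_trans (cauchy_schwarz_int measurableT (sobolev_sqint sh) sf)).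
  by rewrite mulrC ler_wpM2l// -[leRHS]mul1r; exact: b_le.
exists g; split => // x; have [hx rx] := KP x.
rewrite -(rx _ Hg) (form_sym fdot Hg hx) (hg _ hx).
apply: (@congr1 _ _ fine); apply: eq_integral => s _.
by rewrite kernel_sym.
Qed.

Lemma eigenspaceP (la : R) (f : borel U -> R) : Defs.eigenspace vol K la f <->
  sqint vol setT f /\ {ae vol, forall x, integral_operator vol K f x = la * f x}.
Proof. by rewrite /=; split=> -[/Lfun2P]. Qed.

(** By the eigenvector relation, the image of e_k and [tau k] times e_k represent the same
    functional on the Sobolev space. *)
Lemma eigenvector_eigenspace k : Defs.eigenspace vol K (tau k) (e k : borel U -> R).
Proof.
apply/eigenspaceP; have sk := sobolev_sqint (e_in k); split => //.
have [g [Hg hg Tg]] := integral_operator_riesz sk.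
suff gE : g = tau k *: e k by apply: aeW => x; rewrite Tg gE.
have Hk := subspaceZ sH (tau k) (e_in k); have Hd := subspaceB sH Hg Hk.
suff d0 : sdot (g - tau k *: e k) (g - tau k *: e k) = 0 by apply/eqP; rewrite -subr_eq0; apply/eqP/dot_eq0.
rewrite (form_subr sH fdot Hg Hk Hd) (hg _ Hd) L2dotC.
rewrite (eigen_relation sH fdot dot_eq0 complete_dot fb b_le b_eq0 approx infinite_dim k Hd).
rewrite (form_scaler sH fdot (tau k) (e_in k) Hd) (form_sym fdot Hd (e_in k)).
exact: subrr.
Qed.

Lemma sum_continuous_in n (a : 'I_n -> R) (u : 'I_n -> V) : (forall i, sobolevC (u i)) ->
  {ae vol, forall x, \sum_i a i * u i x = 0} -> \sum_i a i *: u i = 0.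
Proof.
move=> Hu h; have [_ cS] := subspace_sum sH (index_enum _) a Hu.
apply: (ae_continuous_zero cS); move: h; apply: ae_imp => x <-.
by rewrite fct_sumE.
Qed.

Lemma eigenvectors_multiplicity la n (k_ : 'I_n -> nat) : injective k_ -> (forall i, tau (k_ i) = la) ->
  multiplicity_ge vol K la n.
Proof.
move=> ik hk; exists (fun i => e (k_ i)) => [i|a]; first by rewrite -(hk i); exact: eigenvector_eigenspace.
have Hu i : sobolevC (e (k_ i)) := e_in (k_ i).
move=> /(sum_continuous_in Hu) h j.
have := form_zerol sH fdot (Hu j); rewrite -h (form_suml sH fdot _ _ Hu (Hu j)) (bigD1 j)//= big1.
  rewrite (eigenvector_norm sH fdot dot_eq0 complete_dot fb b_le b_eq0 approx infinite_dim).
  by rewrite mulr1 addr0.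
move=> i ij; rewrite (eigenvector_orth sH fdot dot_eq0 complete_dot fb b_le b_eq0 approx infinite_dim) ?mulr0//.
by apply: contra ij => /eqP/ik ->.
Qed.

(** An L^2 eigenfunction f_i is replaced by its image g_i, a continuous Sobolev function equal to la
    f_i almost everywhere, to which [eigen_multiplicity] applies. *)
Lemma multiplicity_eigenvectors la n : multiplicity_ge vol K la n ->
  exists2 k_ : 'I_n -> nat, injective k_ & forall i, tau (k_ i) = la.
Proof.
case: n => [_|n [f ef free]]; first by exists (fun=> 0%N); case.
have sf i : sqint vol setT (f i) by have /eigenspaceP[] := ef i.
have fE i : {ae vol, forall x, integral_operator vol K (f i) x = la * f i x} by have /eigenspaceP[] := ef i.
have gex i : exists t : V, [/\ sobolevC t, forall h : V, sobolevC h -> sdot h t = L2dot h (f i) &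
    {ae vol, forall x, t x = la * f i x}].
  have [t [Ht ht Tt]] := integral_operator_riesz (sf i); exists t; split => //.
  by apply: ae_imp (fE i) => x <-.
pose g i := sval (cid (gex i)); have hg i := svalP (cid (gex i)); rewrite -/(g _) in hg.
have Hg i : sobolevC (g i) by case: (hg i).
(* A zero image would make f_i orthogonal to the Sobolev space, hence 0 by density; this excludes la
   = 0. *)
have g_neq0 i : g i <> 0.
  move=> g0; have [_ hi _] := hg i.
  have f0 : {ae vol, forall x, f i x = 0}.
    apply: (orth_ae0 (sf i)) => h sh.
    by rewrite -[LHS]/(L2dot (f i) h) L2dotC -(hi _ sh) -/(g i) g0 (form_sym fdot sh (subspace0 sH)) (form_zerol sH fdot sh).
  have := free (fun j => (j == i)%:R); have h1 : {ae vol, forall x, \sum_j (j == i)%:R * f j x = 0}.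
    apply: ae_imp f0 => x fx; rewrite (bigD1 i)//= fx mulr0 add0r big1// => j /negPf ->.
    by rewrite mul0r.
  by move=> /(_ h1 i)/eqP; rewrite eqxx oner_eq0.
have bg i (h : V) : sobolevC h -> L2dot (g i) h = la * sdot (g i) h.
  move=> sh; have [_ hi gi] := hg i; have sh2 := sobolev_sqint sh.
  rewrite (form_sym fdot (Hg i) sh) (hi _ sh) [L2dot h _]L2dotC.
  apply: (etrans _ (RintegralZl la measurableT (sqintM measurableT (sf i) sh2))).
  apply: (@congr1 _ _ fine); apply: ae_eq_integral => //.
  + by apply/measurable_EFinP; apply: measurable_funM; [case: (sobolev_sqint (Hg i))|case: sh2].
  + apply/measurable_EFinP; apply: measurable_funM => //; apply: measurable_funM; [by case: (sf i)|by case: sh2].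
  + by apply: ae_imp gi => x gx _; rewrite /g gx mulrA.
have la0 : 0 < la.
  have p0 i : 0 < sdot (g i) (g i).
    rewrite lt_neqAle (form_ge0 fdot (Hg i)) andbT eq_sym; apply/eqP => /(dot_eq0 (Hg i)); exact: g_neq0.
  have q0 : 0 < L2dot (g ord0) (g ord0).
    rewrite lt_neqAle (form_ge0 fb (Hg _)) andbT eq_sym; apply/eqP => /(b_eq0 (Hg _)); exact: g_neq0.
  by move: q0; rewrite (bg _ _ (Hg _)) pmulr_lgt0.
apply: (eigen_multiplicity sH fdot dot_eq0 complete_dot fb b_le b_eq0 approx infinite_dim la0 Hg bg).
move=> a ag0; apply: free.
have gE : {ae vol, forall x, forall i, g i x = la * f i x} by apply: ae_forall_fin => i; case: (hg i).
apply: ae_imp gE => x gx; have := congr1 (fun t : V => t x) ag0; rewrite fct_sumE => h.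
apply: (mulfI (lt0r_neq0 la0)); rewrite mulr0 -[RHS]h mulr_sumr; apply: eq_bigr => i _.
by rewrite -[RHS]/(a i * g i x) gx mulrCA.
Qed.

Lemma sobolev_eigenvalue_sequence : is_eigenvalue_sequence vol K tau.
Proof.
split=> [k|la n]; first exact: sobolev_eigenvalue_mono.
split; first exact: multiplicity_eigenvectors.
by move=> [k_ ik hk]; exact: eigenvectors_multiplicity ik hk.
Qed.

End Operator.

End Spectrum.

End RiemannianSobolev.

(* [tau] is indexed from 0, so that [tau k] is the eigenvalue of index k + 1. *)
Theorem theorem4p4 (R : realType) (d r : nat) (U : ptopologicalType)
    (M : riemannian_manifold R U d)
    (vol : {measure set (borel U) -> \bar R})
    (d_gt0 : (0 < d)%N)
    (compactU : compact [set: U])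
    (volP : is_riemannian_volume M vol)
    (r_gt : (d < 2 * r)%N) :
  [/\ forall u, sobolev M vol r u ->
        exists! f : U -> R, continuous f /\ {ae vol, forall p, u p = f p},
      is_rkhs (sobolev_continuous M vol r) (sobolev_dot M vol r) &
      exists2 K : U -> U -> R,
        is_reproducing_kernel (sobolev_continuous M vol r)
          (sobolev_dot M vol r) K &
        exists2 tau : nat -> R,
          is_eigenvalue_sequence vol K tau &
          asymp tau (fun k => k.+1%:R `^ (- (2 * r)%:R / d%:R))].
Proof.
have r_gt0 : (0 < r)%N by case: r r_gt => //; rewrite muln0.
split; first exact: continuous_representative.
  exact: sobolev_rkhs.
have [K KP] := sobolev_reproducing_kernel d_gt0 r_gt0 r_gt compactU volP.
exists K => //; exists (sobolev_eigenvalue M vol r).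
  exact: sobolev_eigenvalue_sequence.
exact: sobolev_eigenvalue_asymp.
Qed.
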